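(* Let $0<\sigma_1\le\sigma_2$ and $\mathcal{E}=\{(x_1,x_2)\in\mathbb{R}^2;\ \sigma_1x_1^2+\sigma_2x_2^2=1\}$. Let $\Phi=(\phi_1,\phi_2):\mathbb{D}\to\mathbb{R}^2$ be a possibly branched free boundary minimal immersion into $\mathcal{E}$ such that $\phi_1$ is a first Steklov eigenfunction and $\phi_2$ is either a first or a second Steklov eigenfunction with respect to the weight $e^v=\frac{|\partial_r\Phi|}{(\sigma_1^2\phi_1^2+\sigma_2^2\phi_2^2)^{1/2}}$ on $\mathbb{S}^1$. Then $\Phi$ is a diffeomorphism (onto the convex hull of $\mathcal{E}$).
   Context: $\mathbb{D}$ is the unit disk of $\mathbb{R}^2$, $\mathbb{S}^1=\partial\mathbb{D}$, and $\partial_r$ is the radial derivative. A possibly branched free boundary minimal immersion $\Phi:\mathbb{D}\to\mathbb{R}^2$ into $\mathcal{E}$ is a non-constant map, smooth up to the boundary, which is harmonic and weakly conformal ($|\Phi_x|=|\Phi_y|$, $\Phi_x\cdot\Phi_y=0$) in $\mathbb{D}$, with $\Phi(\mathbb{S}^1)\subset\mathcal{E}$ and $\partial_r\Phi\perp T_\Phi\mathcal{E}$ on $\mathbb{S}^1$. Its coordinates then satisfy $\Delta\phi_i=0$ in $\mathbb{D}$ and $\partial_r\phi_i=\sigma_ie^v\phi_i$ on $\mathbb{S}^1$. For a weight $e^v$ on $\mathbb{S}^1$, Steklov eigenvalues are the numbers $\lambda$ for which there is a nonzero $\varphi$ with $\Delta\varphi=0$ in $\mathbb{D}$ and $\partial_r\varphi=\lambda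 e^v\varphi$ on $\mathbb{S}^1$, listed with multiplicity as $\lambda_0=0<\lambda_1\le\lambda_2\le\cdots$; first (resp. second) eigenfunctions are those associated to $\lambda_1$ (resp. $\lambda_2$). *)

(* Defs.v *)
From Stdlib Require Import Reals List.
From Coquelicot Require Import Coquelicot.
Open Scope R_scope.

(** Maps on a subset [K] of the plane are total functions on [R * R]; every
    definition below only depends on their values on [K]. *)

Definition dot (u v : R * R) : R := fst u * fst v + snd u * snd v.
Definition enorm (u : R * R) : R := sqrt (dot u u).

Definition open_disk (p : R * R) : Prop := dot p p < 1.
Definition closed_disk (p : R * R) : Prop := dot p p <= 1.
Definition circle (p : R * R) : Prop := dot p p = 1.

Definition ellipse (s1 s2 : R) (q : R * R) : Prop :=
  s1 * fst q ^ 2 + s2 * snd q ^ 2 = 1.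

Definition interior (K : R * R -> Prop) (p : R * R) : Prop := locally p K.

Definition convex (C : R * R -> Prop) : Prop :=
  forall (p q : R * R) (t : R), C p -> C q -> 0 <= t <= 1 ->
    C ((1 - t) * fst p + t * fst q, (1 - t) * snd p + t * snd q).

Definition convex_hull (A : R * R -> Prop) (p : R * R) : Prop :=
  forall C : R * R -> Prop, convex C -> (forall q, A q -> C q) -> C p.

Inductive axis := AxisX | AxisY.

(** Restriction of [f] to the line through [p] parallel to an axis, and the
    coordinate of [p] on that line. *)
Definition along (a : axis) (f : R * R -> R) (p : R * R) : R -> R :=
  match a with
  | AxisX => fun t => f (t, snd p)
  | AxisY => fun t => f (fst p, t)
  end.

Definition coord (a : axis) (p : R * R) : R :=
  match a with AxisX => fst p | AxisY => snd p end.

Definition ex_partial (a : axis) (f : R * R -> R) (p : R * R) : Prop :=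
  ex_derive (along a f p) (coord a p).

Definition partial (a : axis) (f : R * R -> R) (p : R * R) : R :=
  Derive (along a f p) (coord a p).

Definition partials (w : list axis) (f : R * R -> R) : R * R -> R :=
  fold_right partial f w.

(** [f] is of class C^n on [K], which is meant to be contained in the closure of
    its interior: the partial derivatives of order at most [n] exist in the
    interior and extend continuously to [K].  Continuity of the extensions is
    automatic, since they are limits from the interior at each point of [K].
    For open [K] this is the usual C^n; for the closed disk it is "C^n up to
    the boundary". *)
Definition Ck_on (n : nat) (K : R * R -> Prop) (f : R * R -> R) : Prop :=
  (forall (w : list axis) (a : axis) (p : R * R),
      (length w < n)%nat -> interior K p -> ex_partial a (partials w f) p) /\
  (forall (w : list axis) (p : R * R),
      (length w <= n)%nat -> K p ->
      exists l : R,
        filterlim (partials w f) (within (interior K) (locally p)) (locally l)) /\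
  (forall p : R * R, K p ->
      filterlim f (within K (locally p)) (locally (f p))).

Definition smooth_on (K : R * R -> Prop) (f : R * R -> R) : Prop :=
  forall n : nat, Ck_on n K f.

Definition smooth_map_on (K : R * R -> Prop) (F : R * R -> R * R) : Prop :=
  smooth_on K (fun p => fst (F p)) /\ smooth_on K (fun p => snd (F p)).

Definition diffeomorphism (K L : R * R -> Prop) (F : R * R -> R * R) : Prop :=
  smooth_map_on K F /\
  (forall p, K p -> L (F p)) /\
  exists G : R * R -> R * R,
    smooth_map_on L G /\
    (forall q, L q -> K (G q)) /\
    (forall p, K p -> G (F p) = p) /\
    (forall q, L q -> F (G q) = q).

Definition laplacian (f : R * R -> R) (p : R * R) : R :=
  partial AxisX (partial AxisX f) p + partial AxisY (partial AxisY f) p.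

Definition harmonic (f : R * R -> R) : Prop :=
  Ck_on 2 open_disk f /\ forall p, open_disk p -> laplacian f p = 0.

(** Derivative at [p] on the unit circle in the outer normal direction,
    computed from inside the disk. *)
Definition is_radial_derive (f : R * R -> R) (p : R * R) (l : R) : Prop :=
  filterlim (fun t => (f (t * fst p, t * snd p) - f p) / (t - 1))
    (at_left 1) (locally l).

Definition radial_derive (f : R * R -> R) (p : R * R) : R :=
  iota (is_radial_derive f p).

Definition dx (F : R * R -> R * R) (p : R * R) : R * R :=
  (partial AxisX (fun q => fst (F q)) p, partial AxisX (fun q => snd (F q)) p).

Definition dy (F : R * R -> R * R) (p : R * R) : R * R :=
  (partial AxisY (fun q => fst (F q)) p, partial AxisY (fun q => snd (F q)) p).

Definition dr (F : R * R -> R * R) (p : R * R) : R * R :=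
  (radial_derive (fun q => fst (F q)) p, radial_derive (fun q => snd (F q)) p).

(** Tangent vectors of [E] at [q], as velocities of curves in [E]. *)
Definition tangent (E : R * R -> Prop) (q v : R * R) : Prop :=
  exists gamma : R -> R * R,
    (forall t, E (gamma t)) /\ gamma 0 = q /\ is_derive gamma 0 v.

Record fb_minimal_immersion (E : R * R -> Prop) (Phi : R * R -> R * R) : Prop := {
  fbmi_smooth : smooth_map_on closed_disk Phi;
  fbmi_nonconstant :
    exists p q, closed_disk p /\ closed_disk q /\ Phi p <> Phi q;
  fbmi_harmonic1 : harmonic (fun p => fst (Phi p));
  fbmi_harmonic2 : harmonic (fun p => snd (Phi p));
  fbmi_conformal : forall p, open_disk p ->
    enorm (dx Phi p) = enorm (dy Phi p) /\ dot (dx Phi p) (dy Phi p) = 0;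
  fbmi_boundary : forall p, circle p -> E (Phi p);
  fbmi_orthogonal : forall p v, circle p ->
    tangent E (Phi p) v -> dot (dr Phi p) v = 0
}.

(** The eigenspace of [lambda], made of classical solutions: C^2 in the disk
    and C^1 up to the boundary. *)
Definition steklov_solution (w : R * R -> R) (lambda : R) (f : R * R -> R)
  : Prop :=
  harmonic f /\ Ck_on 1 closed_disk f /\
  forall p, circle p -> radial_derive f p = lambda * w p * f p.

Definition steklov_eigenfunction (w : R * R -> R) (lambda : R) (f : R * R -> R)
  : Prop :=
  steklov_solution w lambda f /\ exists p, closed_disk p /\ f p <> 0.

(** The eigenspace of [lambda], as a space of functions on the closed disk, has
    dimension [d]: it has a basis [e 1, ..., e d]. *)
Definition steklov_multiplicity (w : R * R -> R) (lambda : R) (d : nat) : Prop :=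
  exists e : nat -> R * R -> R,
    (forall i, (1 <= i <= d)%nat -> steklov_solution w lambda (e i)) /\
    (forall c : nat -> R,
        (forall p, closed_disk p -> sum_n_m (fun i => c i * e i p) 1 d = 0) ->
        forall i, (1 <= i <= d)%nat -> c i = 0) /\
    (forall f, steklov_solution w lambda f ->
        exists c : nat -> R, forall p, closed_disk p ->
          f p = sum_n_m (fun i => c i * e i p) 1 d).

(** [lam] lists the Steklov eigenvalues with multiplicity: every real [mu] has
    as many indices [k] with [lam k = mu] as the dimension of its eigenspace
    (zero if [mu] is not an eigenvalue). *)
Definition steklov_spectrum (w : R * R -> R) (lam : nat -> R) : Prop :=
  lam 0%nat = 0 /\ 0 < lam 1%nat /\
  (forall k : nat, lam k <= lam (S k)) /\
  forall mu : R, exists ks : list nat,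
    NoDup ks /\ (forall k, In k ks <-> lam k = mu) /\
    steklov_multiplicity w mu (length ks).

Definition ellipse_weight (s1 s2 : R) (Phi : R * R -> R * R) (p : R * R) : R :=
  enorm (dr Phi p) /
  sqrt (s1 ^ 2 * fst (Phi p) ^ 2 + s2 ^ 2 * snd (Phi p) ^ 2).

(* Main.v *)
(** Let F = phi_1 + i sg phi_2.  Conformality and the free boundary condition
    give, on the circle, d_r Phi = w N and d_theta Phi = sg w J N, with N the
    normal (s1 phi_1, s2 phi_2), a constant sign sg and w > 0 by the Hopf lemma;
    so F is holomorphic up to the boundary, and the lift tau of
    (sqrt s1 phi_1, sg sqrt s2 phi_2) satisfies tau' = sqrt (s1 s2) w > 0.  It
    remains to see that F has boundary degree d = 1.

    If d >= 2, the function u = p cos (tau / d) + q sin (tau / d) and its harmonic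
    conjugate v, with (p, q) and a constant chosen so that u is w-orthogonal to 1
    and v to 1 and phi_1, have the same Dirichlet energy D and, by Cauchy-Schwarz,
    D^2 <= (s1 s2 / d^2) M(u) M(v) for the weighted boundary masses M
    (Hersch-Payne-Schiffer).  So D < s1 M(u) or D < s2 M(v).  A Galerkin
    minimisation turns this into an eigenvalue in (0, s1), or one in (0, s2) with
    an eigenfunction w-orthogonal to phi_1; both contradict s1 = lambda_1,
    s2 <= lambda_2.

    If d = 1 and q is inside the ellipse, then F - q has argument t + A(t) at
    e^(it), with A periodic.  Let H be holomorphic with Im H = A on the circle.
    If F omits q, then z e^H / (F - q) is positive on the circle and vanishes at
    0, against the mean value property; if F - q = (z - a)(z - b) F2, the same
    holds for z F2 e^(-H) / ((1 - conj a z)(1 - conj b z)).  So F is bijective with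
    nonvanishing derivative, and all derivatives of its inverse extend to the
    closed region. *)
Require Import Defs.
From Stdlib Require Import Reals List.
From Coquelicot Require Import Coquelicot.
From Stdlib Require Import Lra Lia Psatz ZArith Classical ClassicalEpsilon FunctionalExtensionality.
Open Scope R_scope.

(** The hypotheses give the spectrum only as a list of eigenvalues of classical solutions, with no
    variational characterisation. A test function of small Rayleigh quotient must therefore be
    converted into an eigenfunction smooth up to the circle, and this shapes the analytic part.
    Everything is transferred to boundary Fourier coefficients, where the radial derivative of a
    harmonic extension is multiplication by the frequency: finite-dimensional minimisers then have
    decay bounds independent of the dimension, and their limit is an actual solution. Orthogonality
    to 1 and to phi_1 is imposed by penalties rather than constraints, so that trigonometric
    polynomials remain admissible; testing the limit equation with 1 and phi_1 shows that the
    penalty terms vanish. The same coefficients present F as a power series smooth on the closed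
    disk. Holomorphy is used only as a second-order Taylor bound there, so that products, quotients
    and exponentials need no path integrals, and the vanishing first variation of circle means
    yields the mean value property that counts zeros. *)

Ltac toR :=
  repeat match goal with
  | |- context [@plus ?G ?a ?b] => change (@plus G a b) with (Rplus a b)
  | |- context [@minus ?G ?a ?b] => change (@minus G a b) with (Rminus a b)
  | |- context [@opp ?G ?a] => change (@opp G a) with (Ropp a)
  | |- context [@mult ?G ?a ?b] => change (@mult G a b) with (Rmult a b)
  | |- context [@scal ?G ?V ?a ?b] => change (@scal G V a b) with (Rmult a b)
  end;
  try match goal with |- @eq _ ?a ?b => change (@eq R a b) end.
Ltac ballR := match goal with |- ball ?x ?e ?y => change (Rabs (y - x) < e) end.
Ltac nz := repeat split; intro; lra.

(** * Continuous and smooth functions of one real variable *)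

Definition cont (f : R -> R) : Prop := forall x : R, continuous f x.

(** The derivatives are existential witnesses, so that closure properties are proved by exhibiting
    them instead of computing [Derive]. *)
Fixpoint Cn (n : nat) (f : R -> R) : Prop :=
  match n with
  | O => cont f
  | S m => exists f' : R -> R, (forall x : R, is_derive f x (f' x)) /\ Cn m f'
  end.

Definition smooth (f : R -> R) : Prop := forall n, Cn n f.

Lemma cont_derive (f f' : R -> R) : (forall x : R, is_derive f x (f' x)) -> cont f.
Proof. intros H x. apply (ex_derive_continuous f x). exists (f' x). apply H. Qed.

Lemma cont_ext (f g : R -> R) : (forall x, f x = g x) -> cont f -> cont g.
Proof. intros H Hf. replace g with f; auto. apply functional_extensionality, H. Qed.

Lemma Cn_cont n f : Cn n f -> cont f.
Proof. destruct n; simpl; auto. intros [f' [H _]]. now apply cont_derive with f'. Qed.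

Lemma Cn_ext n (f g : R -> R) : (forall x, f x = g x) -> Cn n f -> Cn n g.
Proof. intros H. now replace g with f by (apply functional_extensionality, H). Qed.

Lemma Cn_S n f : Cn (S n) f -> Cn n f.
Proof.
  revert f; induction n as [|n IH]; intros f [f' [H H']].
  - now apply cont_derive with f'.
  - exists f'; split; auto.
Qed.

Lemma cont_const c : cont (fun _ => c).
Proof. intros x. apply continuous_const. Qed.
Lemma cont_id : cont (fun x => x).
Proof. intros x. apply continuous_id. Qed.
Lemma cont_plus f g : cont f -> cont g -> cont (fun x => f x + g x).
Proof. intros H K x. apply (continuous_plus f g); auto. Qed.
Lemma cont_minus f g : cont f -> cont g -> cont (fun x => f x - g x).
Proof. intros H K x. apply (continuous_minus f g); auto. Qed.
Lemma cont_opp f : cont f -> cont (fun x => - f x).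
Proof. intros H x. apply (continuous_opp f); auto. Qed.
Lemma cont_mult f g : cont f -> cont g -> cont (fun x => f x * g x).
Proof. intros H K x. apply (continuous_mult f g); auto. Qed.
Lemma cont_comp f g : cont f -> cont g -> cont (fun x => f (g x)).
Proof. intros H K x. apply (continuous_comp g f); auto. Qed.
Lemma cont_abs f : cont f -> cont (fun x => Rabs (f x)).
Proof. intros H x. apply (continuous_comp f Rabs); auto. apply continuous_Rabs. Qed.
Lemma cont_cos : cont cos.
Proof. intros x; apply continuous_cos. Qed.
Lemma cont_sin : cont sin.
Proof. intros x; apply continuous_sin. Qed.
Lemma cont_pow f n : cont f -> cont (fun x => f x ^ n).
Proof.
  intros H. induction n; simpl.
  - apply cont_const.
  - now apply cont_mult.
Qed.
Lemma cont_div f c : cont f -> cont (fun x => f x / c).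
Proof. intros H. apply cont_mult; auto. apply cont_const. Qed.

Create HintDb cont.
#[export] Hint Resolve cont_const cont_id cont_cos cont_sin : cont.
#[export] Hint Resolve cont_plus cont_minus cont_opp cont_mult cont_pow cont_abs cont_div : cont.
#[export] Hint Extern 5 (cont (fun x => cos _)) => apply (cont_comp cos); [apply cont_cos|] : cont.
#[export] Hint Extern 5 (cont (fun x => sin _)) => apply (cont_comp sin); [apply cont_sin|] : cont.
#[export] Hint Extern 1 (continuous ?f ?x) => apply (fun H : cont f => H x) : cont.

Lemma Cn_const n c : Cn n (fun _ => c).
Proof.
  revert c; induction n; intros c; simpl.
  - apply cont_const.
  - exists (fun _ => 0); split; auto. intros x. auto_derive; auto.
Qed.
Lemma Cn_id n : Cn n (fun x => x).
Proof.
  destruct n; simpl; auto with cont.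
  exists (fun _ => 1); split.
  - intros x; auto_derive; auto.
  - apply Cn_const.
Qed.
Lemma Cn_plus n f g : Cn n f -> Cn n g -> Cn n (fun x => f x + g x).
Proof.
  revert f g; induction n; intros f g; simpl; auto with cont.
  intros [f' [Hf Hf']] [g' [Hg Hg']].
  exists (fun x => f' x + g' x); split; auto.
  intros x. apply (is_derive_plus f g); auto.
Qed.
Lemma Cn_mult n f g : Cn n f -> Cn n g -> Cn n (fun x => f x * g x).
Proof.
  revert f g; induction n; intros f g; [simpl; auto with cont|].
  intros Hf0 Hg0. pose proof (Cn_S _ _ Hf0) as Hf1. pose proof (Cn_S _ _ Hg0) as Hg1.
  destruct Hf0 as [f' [Hf Hf']]. destruct Hg0 as [g' [Hg Hg']].
  exists (fun x => f' x * g x + f x * g' x); split; auto using Cn_plus.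
  intros x. apply (is_derive_mult f g); auto. intros; apply Rmult_comm.
Qed.
Lemma Cn_opp n f : Cn n f -> Cn n (fun x => - f x).
Proof.
  intros H. apply Cn_ext with (fun x => (-1) * f x).
  - intros; ring.
  - apply Cn_mult; auto using Cn_const.
Qed.
Lemma Cn_minus n f g : Cn n f -> Cn n g -> Cn n (fun x => f x - g x).
Proof. intros; apply Cn_plus; auto using Cn_opp. Qed.
Lemma Cn_sincos n f : Cn n f -> Cn n (fun x => sin (f x)) /\ Cn n (fun x => cos (f x)).
Proof.
  revert f; induction n; intros f Hf0.
  - simpl in *. auto with cont.
  - pose proof (Cn_S _ _ Hf0) as Hf1. destruct Hf0 as [f' [Hf Hf']].
    destruct (IHn f Hf1) as [A B].
    split.
    + exists (fun x => f' x * cos (f x)); split; auto using Cn_mult.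
      intros x. apply (is_derive_comp sin f); auto. apply is_derive_sin.
    + exists (fun x => f' x * - sin (f x)); split; auto using Cn_mult, Cn_opp.
      intros x. apply (is_derive_comp cos f); auto. apply is_derive_cos.
Qed.
Lemma Cn_inv n f : (forall x, f x <> 0) -> Cn n f -> Cn n (fun x => / f x).
Proof.
  intros Hnz. induction n; intros Hf0.
  - intros x. apply (continuous_comp f Rinv); auto. now apply continuous_Rinv.
  - pose proof (Cn_S _ _ Hf0) as Hf1. destruct Hf0 as [f' [Hf Hf']].
    exists (fun x => - f' x * (/ f x * / f x)); split.
    + intros x. assert (E : - f' x / f x ^ 2 = - f' x * (/ f x * / f x)) by (field; auto).
      rewrite <- E. now apply is_derive_inv.
    + apply Cn_mult; auto using Cn_opp, Cn_mult.
Qed.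
Lemma Cn_atan n f : Cn n f -> Cn n (fun x => atan (f x)).
Proof.
  destruct n; intros Hf0.
  - intros x. apply (continuous_comp f atan); auto. apply continuous_atan.
  - pose proof (Cn_S _ _ Hf0) as Hf1. destruct Hf0 as [f' [Hf Hf']].
    exists (fun x => f' x * / (1 + f x * f x)); split.
    + intros x. change (f x * f x) with (Rsqr (f x)).
      apply (is_derive_comp atan f); auto. apply is_derive_atan.
    + apply Cn_mult; auto. apply Cn_inv.
      * intros x. nra.
      * apply Cn_plus; auto using Cn_const, Cn_mult.
Qed.

Lemma smooth_cont f : smooth f -> cont f.
Proof. intros H. apply (H O). Qed.
Lemma smooth_const c : smooth (fun _ => c). Proof. intros n; apply Cn_const. Qed.
Lemma smooth_id : smooth (fun x => x). Proof. intros n; apply Cn_id. Qed.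
Lemma smooth_plus f g : smooth f -> smooth g -> smooth (fun x => f x + g x).
Proof. intros H K n; apply Cn_plus; auto. Qed.
Lemma smooth_minus f g : smooth f -> smooth g -> smooth (fun x => f x - g x).
Proof. intros H K n; apply Cn_minus; auto. Qed.
Lemma smooth_mult f g : smooth f -> smooth g -> smooth (fun x => f x * g x).
Proof. intros H K n; apply Cn_mult; auto. Qed.
Lemma smooth_opp f : smooth f -> smooth (fun x => - f x).
Proof. intros H n; apply Cn_opp; auto. Qed.
Lemma smooth_sin f : smooth f -> smooth (fun x => sin (f x)).
Proof. intros H n; apply Cn_sincos; auto. Qed.
Lemma smooth_cos f : smooth f -> smooth (fun x => cos (f x)).
Proof. intros H n; apply Cn_sincos; auto. Qed.
Lemma smooth_inv f : (forall x, f x <> 0) -> smooth f -> smooth (fun x => / f x).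
Proof. intros H K n; apply Cn_inv; auto. Qed.
Lemma smooth_atan f : smooth f -> smooth (fun x => atan (f x)).
Proof. intros H n; apply Cn_atan; auto. Qed.
Lemma smooth_div f c : smooth f -> smooth (fun x => f x / c).
Proof. intros H. apply smooth_mult; auto. apply smooth_const. Qed.
Lemma smooth_primitive f f' : (forall x : R, is_derive f x (f' x)) -> smooth f' -> smooth f.
Proof.
  intros H K [|n].
  - now apply cont_derive with f'.
  - exists f'; auto.
Qed.
#[export] Hint Resolve smooth_const smooth_id smooth_plus smooth_minus smooth_mult smooth_opp
  smooth_sin smooth_cos smooth_atan smooth_div : cont.
#[export] Hint Resolve smooth_cont : cont.

(** * Integration over a period *)

Definition I (f : R -> R) : R := RInt f 0 (2 * PI).
Definition periodic (f : R -> R) : Prop := forall x, f (x + 2 * PI) = f x.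

Lemma two_PI_pos : 0 < 2 * PI.
Proof. pose proof PI_RGT_0; lra. Qed.

Lemma cont_ex_RInt f a b : cont f -> ex_RInt f a b.
Proof. intros H. apply (ex_RInt_continuous (V := R_CompleteNormedModule)). auto. Qed.
#[export] Hint Resolve cont_ex_RInt : cont.

Lemma I_ext f g : (forall x, f x = g x) -> I f = I g.
Proof. intros H. f_equal. apply functional_extensionality, H. Qed.
Lemma I_plus f g : cont f -> cont g -> I (fun x => f x + g x) = I f + I g.
Proof. intros H K. apply (RInt_plus f g); auto with cont. Qed.
Lemma I_minus f g : cont f -> cont g -> I (fun x => f x - g x) = I f - I g.
Proof. intros H K. apply (RInt_minus f g); auto with cont. Qed.
Lemma I_scal c f : cont f -> I (fun x => c * f x) = c * I f.
Proof. intros H. apply (RInt_scal f); auto with cont. Qed.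
Lemma I_const c : I (fun _ => c) = 2 * PI * c.
Proof. unfold I. rewrite RInt_const. unfold scal; simpl; unfold mult; simpl. ring. Qed.
Lemma I_le f g : cont f -> cont g -> (forall x, f x <= g x) -> I f <= I g.
Proof.
  intros H K L. pose proof two_PI_pos. apply RInt_le; auto with cont; lra.
Qed.
Lemma I_ge0 f : cont f -> (forall x, 0 <= f x) -> 0 <= I f.
Proof.
  intros H K. pose proof two_PI_pos. apply RInt_ge_0; auto with cont; lra.
Qed.
Lemma I_abs f : cont f -> Rabs (I f) <= I (fun x => Rabs (f x)).
Proof. intros H. pose proof two_PI_pos. apply abs_RInt_le; auto with cont; lra. Qed.
Lemma I_abs_le f g : cont f -> cont g -> (forall x, Rabs (f x) <= g x) -> Rabs (I f) <= I g.
Proof.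
  intros H K L. eapply Rle_trans. apply I_abs; auto. apply I_le; auto with cont.
Qed.
Lemma I_bound f B : cont f -> (forall x, Rabs (f x) <= B) -> Rabs (I f) <= 2 * PI * B.
Proof. intros H L. rewrite <- I_const. apply I_abs_le; auto with cont. Qed.

Lemma I_derive f f' : (forall x : R, is_derive f x (f' x)) -> cont f' -> I f' = f (2 * PI) - f 0.
Proof.
  intros H K. apply is_RInt_unique. apply (is_RInt_derive f f'); intros; auto.
Qed.
Lemma I_derive_periodic f f' :
  periodic f -> (forall x : R, is_derive f x (f' x)) -> cont f' -> I f' = 0.
Proof.
  intros P H K. rewrite (I_derive f); auto. specialize (P 0). rewrite Rplus_0_l in P. lra.
Qed.
Lemma I_by_parts f f' g g' : periodic f -> periodic g ->
  (forall x : R, is_derive f x (f' x)) -> (forall x : R, is_derive g x (g' x)) ->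
  cont f' -> cont g' -> I (fun x => f' x * g x) = - I (fun x => f x * g' x).
Proof.
  intros Pf Pg Hf Hg Kf Kg.
  assert (Cf := cont_derive _ _ Hf). assert (Cg := cont_derive _ _ Hg).
  enough (I (fun x => f' x * g x + f x * g' x) = 0) by (rewrite I_plus in H; auto with cont; lra).
  apply I_derive_periodic with (fun x => f x * g x); auto with cont.
  - intros x. now rewrite Pf, Pg.
  - intros x. apply (is_derive_mult f g); auto. intros; apply Rmult_comm.
Qed.

Lemma subinterval_I f a b : cont f -> (forall x, 0 <= f x) -> 0 <= a -> a <= b -> b <= 2 * PI ->
  RInt f a b <= I f.
Proof.
  intros H K Ha Hab Hb. unfold I.
  rewrite <- (RInt_Chasles f 0 a (2*PI)), <- (RInt_Chasles f a b (2*PI)); auto with cont.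
  unfold plus; simpl.
  assert (0 <= RInt f 0 a) by (apply RInt_ge_0; auto with cont).
  assert (0 <= RInt f b (2*PI)) by (apply RInt_ge_0; auto with cont).
  lra.
Qed.

Lemma cont_near f x eps : cont f -> 0 < eps ->
  exists d, 0 < d /\ forall y, Rabs (y - x) < d -> Rabs (f y - f x) < eps.
Proof.
  intros H He. destruct (proj1 (filterlim_locally _ _) (H x) (mkposreal _ He)) as [d Hd].
  exists d. split. apply cond_pos. intros y Hy. apply Hd, Hy.
Qed.

Lemma periodic_Z f : periodic f -> forall (k : Z) x, f (x + IZR k * (2 * PI)) = f x.
Proof.
  intros P. assert (N : forall (k : nat) x, f (x + INR k * (2*PI)) = f x).
  { induction k; intros x. simpl. f_equal; ring. rewrite S_INR.
    rewrite <- (IHk x), <- (P (x + INR k * (2*PI))). f_equal; ring. }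
  intros k x. destruct (Z_le_dec 0 k) as [H|H].
  - rewrite <- (Z2Nat.id k) by auto. rewrite <- INR_IZR_INZ. apply N.
  - rewrite <- (N (Z.to_nat (-k))). f_equal. rewrite INR_IZR_INZ, Z2Nat.id by lia.
    rewrite opp_IZR. ring.
Qed.

Lemma angle_reduce x : exists k : Z, 0 <= x + IZR k * (2 * PI) < 2 * PI.
Proof.
  pose proof two_PI_pos. exists (- (Int_part (x / (2*PI))))%Z.
  destruct (base_Int_part (x / (2*PI))) as [A B]. rewrite opp_IZR.
  set (m := IZR (Int_part _)) in *. assert (x = x / (2*PI) * (2*PI)) by (field; nz).
  set (y := x / (2*PI)) in *. split; nra.
Qed.

Lemma periodic_eq_on f g : periodic f -> periodic g ->
  (forall x, 0 <= x < 2*PI -> f x = g x) -> forall x, f x = g x.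
Proof.
  intros Pf Pg H x. destruct (angle_reduce x) as [k Hk].
  rewrite <- (periodic_Z f Pf k), <- (periodic_Z g Pg k). auto.
Qed.

Lemma periodic_bounded f : cont f -> periodic f -> exists B, 0 <= B /\ forall x, Rabs (f x) <= B.
Proof.
  intros H P. pose proof two_PI_pos as Hpi.
  destruct (continuity_ab_maj (fun x => Rabs (f x)) 0 (2*PI)) as [M [HM _]]; [lra| |].
  { intros c _. apply continuity_pt_filterlim. apply (cont_abs f H). }
  exists (Rabs (f M)). split. apply Rabs_pos. intros x.
  destruct (angle_reduce x) as [k Hk]. rewrite <- (periodic_Z f P k). apply HM. lra.
Qed.

Lemma I_pos_point f x0 : cont f -> periodic f -> (forall x, 0 <= f x) -> 0 < f x0 -> 0 < I f.
Proof.
  intros H P K L. pose proof two_PI_pos as Hpi.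
  (* The given point may reduce to the endpoint 0 of the period; it is first moved inside by
     continuity. *)
  assert (exists x1, 0 < x1 < 2 * PI /\ 0 < f x1) as [x1 [Hx1 L1]].
  { destruct (angle_reduce x0) as [k Hk].
    rewrite <- (periodic_Z f P k) in L. set (y := x0 + _) in *.
    destruct (cont_near f y (f y) H L) as [d [Hd Hy]].
    exists (y + Rmin (d/2) ((2*PI-y)/2)).
    assert (0 < Rmin (d/2) ((2*PI-y)/2)) by (apply Rmin_glb_lt; lra).
    assert (Rmin (d/2) ((2*PI-y)/2) <= d/2) by apply Rmin_l.
    assert (Rmin (d/2) ((2*PI-y)/2) <= (2*PI-y)/2) by apply Rmin_r.
    split. lra.
    match goal with |- 0 < f ?z => specialize (Hy z) end.
    apply Rabs_def2 in Hy. lra. rewrite Rabs_pos_eq; lra. }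
  destruct (cont_near f x1 (f x1 / 2) H) as [d [Hd Hy]]; [lra|].
  set (r := Rmin (d/2) (Rmin (x1/2) ((2*PI-x1)/2))).
  assert (0 < r) by (repeat apply Rmin_glb_lt; lra).
  assert (r <= d/2) by apply Rmin_l.
  assert (r <= x1/2) by (eapply Rle_trans; [apply Rmin_r|apply Rmin_l]).
  assert (r <= (2*PI-x1)/2) by (eapply Rle_trans; [apply Rmin_r|apply Rmin_r]).
  apply Rlt_le_trans with (RInt f (x1 - r) (x1 + r)).
  - apply RInt_gt_0; auto; try lra. intros x Hx.
    specialize (Hy x). apply Rabs_def2 in Hy. lra. apply Rabs_def1; lra.
  - apply subinterval_I; auto; lra.
Qed.

(** Evaluation at the critical point [- b / a]. The sign of [a] is not given: [a < 0] is refuted at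
    two large opposite points, and [a = 0] leaves an affine function, nonnegative only if
    [b = 0]. *)
Lemma nonneg_quadratic a b c : (forall t, 0 <= a * t * t + 2 * b * t + c) -> b * b <= a * c.
Proof.
  intros H. pose proof (H 0) as H0. pose proof (H 1) as H1. pose proof (H (-1)) as H2.
  destruct (Req_dec a 0) as [->|Ha].
  - destruct (Req_dec b 0) as [->|Hb]; [lra|].
    specialize (H (- (c + 1) / (2 * b))). exfalso.
    replace (0 * (- (c + 1) / (2 * b)) * (- (c + 1) / (2 * b)) + 2 * b * (- (c + 1) / (2 * b)) + c)
      with (-1) in H by (field; auto). lra.
  - assert (0 < a).
    { destruct (Rtotal_order a 0) as [L|[L|L]]; auto; [|lra].
      exfalso. set (t := (c + 1) / (- a) + 1).
      assert (a * t = - (c + 1) + a) by (unfold t; field; nz).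
      assert (1 <= t). { unfold t. assert (0 <= (c + 1) / (- a)); [|lra].
        apply Rmult_le_pos; [lra|]. left; apply Rinv_0_lt_compat; lra. }
      pose proof (H t). pose proof (H (- t)). nra. }
    specialize (H (- b / a)).
    replace (a * (- b / a) * (- b / a) + 2 * b * (- b / a) + c) with ((a * c - b * b) / a) in H
      by (field; auto).
    assert (H4 : 0 <= (a * c - b * b) / a * a) by (apply Rmult_le_pos; lra).
    replace ((a * c - b * b) / a * a) with (a * c - b * b) in H4 by (field; auto). lra.
Qed.

Lemma Cauchy_Schwarz_I w f g : cont w -> cont f -> cont g -> (forall x, 0 <= w x) ->
  I (fun x => w x * f x * g x) * I (fun x => w x * f x * g x) <=
  I (fun x => w x * f x * f x) * I (fun x => w x * g x * g x).
Proof.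
  intros Hw Hf Hg Pw. apply nonneg_quadratic. intros t.
  replace (I (fun x => w x * f x * f x) * t * t + 2 * I (fun x => w x * f x * g x) * t + I (fun x => w x * g x * g x))
    with (I (fun x => w x * ((t * f x + g x) * (t * f x + g x)))).
  - apply I_ge0; auto 12 with cont. intros x. apply Rmult_le_pos; auto. apply Rle_0_sqr.
  - rewrite (I_ext _ (fun x => t * t * (w x * f x * f x) + 2 * t * (w x * f x * g x) + w x * g x * g x))
      by (intros; ring).
    rewrite !I_plus, !I_scal; auto 12 with cont. ring.
Qed.

(** * The trigonometric system and its orthogonality *)

Definition freq (n : nat) : R := INR (Nat.div2 n).
(** [e (2 k)] is [cos (k t)] and [e (2 k + 1)] is [sin (k t)]; in particular
    [e 1] vanishes identically. *)
Definition e (n : nat) (t : R) : R :=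
  if Nat.odd n then sin (freq n * t) else cos (freq n * t).
(** The squared norms of the [e n]; the value at 1, where [e 1] is zero, is conventional. *)
Definition nu (n : nat) : R := match n with O => 2 * PI | _ => PI end.
Definition fc (g : R -> R) (n : nat) : R := I (fun t => g t * e n t) / nu n.

Definition summable (x : nat -> R) : Prop := ex_series (fun n => Rabs (x n)).
Definition norm1 (x : nat -> R) : R := Series (fun n => Rabs (x n)).
Definition rapid (x : nat -> R) : Prop :=
  forall q : nat, exists C, forall n, Rabs (x n) * (1 + INR n) ^ q <= C.
Definition T (x : nat -> R) (t : R) : R := Series (fun n => x n * e n t).

Lemma nu_pos n : 0 < nu n.
Proof. pose proof PI_RGT_0. destruct n; simpl; lra. Qed.

Lemma freq_even k : freq (2 * k) = INR k.
Proof. unfold freq. now rewrite Nat.div2_double. Qed.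
Lemma freq_odd k : freq (2 * k + 1) = INR k.
Proof. unfold freq. now rewrite Nat.add_1_r, Nat.div2_succ_double. Qed.
Lemma e_even k t : e (2 * k) t = cos (INR k * t).
Proof. unfold e. now rewrite freq_even, Nat.odd_even. Qed.
Lemma e_odd k t : e (2 * k + 1) t = sin (INR k * t).
Proof. unfold e. now rewrite freq_odd, Nat.odd_odd. Qed.
Lemma nat_parity n : exists k, n = (2 * k)%nat \/ n = (2 * k + 1)%nat.
Proof.
  exists (Nat.div2 n). destruct (Nat.Even_or_Odd n) as [H|H].
  - left. now apply Nat.Even_double in H as E; rewrite E at 1; unfold Nat.double; lia.
  - right. apply Nat.Odd_double in H as E; rewrite E at 1; unfold Nat.double; lia.
Qed.
Lemma freq_bound n : freq n <= INR n /\ 1 + INR n <= 2 * (1 + freq n).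
Proof.
  destruct (nat_parity n) as [k [-> | ->]].
  - rewrite freq_even, mult_INR. simpl. pose proof (pos_INR k). lra.
  - rewrite freq_odd, plus_INR, mult_INR. simpl. pose proof (pos_INR k). lra.
Qed.
Lemma freq_ge0 n : 0 <= freq n.
Proof. apply pos_INR. Qed.

Lemma cont_e n : cont (e n).
Proof. unfold e. destruct (Nat.odd n); auto with cont. Qed.
#[export] Hint Resolve cont_e : cont.
Lemma e_le1 n t : Rabs (e n t) <= 1.
Proof.
  unfold e. destruct (Nat.odd n); apply Rabs_le.
  - pose proof (SIN_bound (freq n * t)); lra.
  - pose proof (COS_bound (freq n * t)); lra.
Qed.
Lemma sin_Z (z : Z) x : sin (x + IZR z * (2 * PI)) = sin x.
Proof. apply (periodic_Z sin). intros y. rewrite sin_plus, sin_2PI, cos_2PI. ring. Qed.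
Lemma cos_Z (z : Z) x : cos (x + IZR z * (2 * PI)) = cos x.
Proof. apply (periodic_Z cos). intros y. rewrite cos_plus, sin_2PI, cos_2PI. ring. Qed.
Lemma periodic_e n : periodic (e n).
Proof.
  intros t. unfold e, freq.
  replace (INR (Nat.div2 n) * (t + 2 * PI)) with
    (INR (Nat.div2 n) * t + IZR (Z.of_nat (Nat.div2 n)) * (2 * PI))
    by (rewrite <- INR_IZR_INZ; ring).
  now rewrite sin_Z, cos_Z.
Qed.
Lemma e0 t : e 0 t = 1.
Proof. unfold e, freq; simpl. now rewrite Rmult_0_l, cos_0. Qed.
Lemma e1 t : e 1 t = 0.
Proof. unfold e, freq; simpl. now rewrite Rmult_0_l, sin_0. Qed.

Lemma I_cos_Z (z : Z) : z <> 0%Z -> I (fun t => cos (IZR z * t)) = 0.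
Proof.
  intros Hz. assert (IZR z <> 0) by (apply not_0_IZR; auto).
  apply I_derive_periodic with (fun t => sin (IZR z * t) / IZR z); auto with cont.
  - intros t. replace (IZR z * (t + 2 * PI)) with (IZR z * t + IZR z * (2*PI)) by ring.
    now rewrite sin_Z.
  - intros t. auto_derive; auto. field; auto.
Qed.
Lemma I_sin_Z (z : Z) : I (fun t => sin (IZR z * t)) = 0.
Proof.
  destruct (Z.eq_dec z 0) as [->|Hz].
  { rewrite (I_ext _ (fun _ => 0)). rewrite I_const; ring. intros; rewrite Rmult_0_l; apply sin_0. }
  assert (IZR z <> 0) by (apply not_0_IZR; auto).
  apply I_derive_periodic with (fun t => - cos (IZR z * t) / IZR z); auto with cont.
  - intros t. replace (IZR z * (t + 2 * PI)) with (IZR z * t + IZR z * (2*PI)) by ring.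
    now rewrite cos_Z.
  - intros t. auto_derive; auto. field; auto.
Qed.

Lemma cos_cos a b : cos a * cos b = (cos (a - b) + cos (a + b)) / 2.
Proof. rewrite cos_minus, cos_plus. field. Qed.
Lemma sin_sin a b : sin a * sin b = (cos (a - b) - cos (a + b)) / 2.
Proof. rewrite cos_minus, cos_plus. field. Qed.
Lemma sin_cos_prod a b : sin a * cos b = (sin (a - b) + sin (a + b)) / 2.
Proof. rewrite sin_minus, sin_plus. field. Qed.

Lemma INR_sub_IZR a b : INR a - INR b = IZR (Z.of_nat a - Z.of_nat b).
Proof. now rewrite minus_IZR, !INR_IZR_INZ. Qed.
Lemma INR_add_IZR a b : INR a + INR b = IZR (Z.of_nat a + Z.of_nat b).
Proof. now rewrite plus_IZR, !INR_IZR_INZ. Qed.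

Lemma I_cos_diff a b : I (fun t => cos ((INR a - INR b) * t)) = if Nat.eq_dec a b then 2 * PI else 0.
Proof.
  destruct (Nat.eq_dec a b) as [->|H].
  - rewrite (I_ext _ (fun _ => 1)). rewrite I_const; ring.
    intros; rewrite Rminus_diag, Rmult_0_l; apply cos_0.
  - rewrite INR_sub_IZR. apply I_cos_Z. lia.
Qed.
Lemma I_cos_add a b : I (fun t => cos ((INR a + INR b) * t)) = if Nat.eq_dec (a + b) 0 then 2 * PI else 0.
Proof.
  destruct (Nat.eq_dec (a + b) 0) as [H|H].
  - assert (a = O) by lia. assert (b = O) by lia. subst.
    rewrite (I_ext _ (fun _ => 1)). rewrite I_const; ring.
    intros; simpl; rewrite Rplus_0_l, Rmult_0_l; apply cos_0.
  - rewrite INR_add_IZR. apply I_cos_Z. lia.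
Qed.

Lemma e_orth m n : n <> 1%nat ->
  I (fun t => e m t * e n t) = if Nat.eq_dec m n then nu n else 0.
Proof.
  intros Hn1.
  destruct (nat_parity m) as [a [-> | ->]], (nat_parity n) as [b [-> | ->]].
  - rewrite (I_ext _ (fun t => /2 * (cos ((INR a - INR b) * t) + cos ((INR a + INR b) * t)))).
    2:{ intros t. rewrite !e_even, cos_cos.
        rewrite <- Rmult_minus_distr_r, <- Rmult_plus_distr_r. field. }
    rewrite I_scal, I_plus, I_cos_diff, I_cos_add; auto with cont.
    destruct (Nat.eq_dec a b) as [->|H].
    + destruct (Nat.eq_dec (2 * b) (2 * b)) as [_|?]; [|lia].
      destruct (Nat.eq_dec (b + b) 0) as [H0|H0].
      * assert (b = O) by lia. subst. simpl. field.
      * destruct b; [lia|]. simpl. field.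
    + destruct (Nat.eq_dec (2 * a) (2 * b)); [lia|].
      destruct (Nat.eq_dec (a + b) 0); [lia|]. ring.
  - destruct (Nat.eq_dec (2 * a) (2 * b + 1)); [lia|].
    rewrite (I_ext _ (fun t => /2 * (sin (IZR (Z.of_nat b - Z.of_nat a) * t) + sin (IZR (Z.of_nat b + Z.of_nat a) * t)))).
    2:{ intros t. rewrite e_even, e_odd, Rmult_comm, sin_cos_prod, <- INR_sub_IZR, <- INR_add_IZR.
        rewrite <- Rmult_minus_distr_r, <- Rmult_plus_distr_r. field. }
    rewrite I_scal, I_plus, !I_sin_Z; auto with cont. ring.
  - destruct (Nat.eq_dec (2 * a + 1) (2 * b)); [lia|].
    rewrite (I_ext _ (fun t => /2 * (sin (IZR (Z.of_nat a - Z.of_nat b) * t) + sin (IZR (Z.of_nat a + Z.of_nat b) * t)))).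
    2:{ intros t. rewrite e_even, e_odd, sin_cos_prod, <- INR_sub_IZR, <- INR_add_IZR.
        rewrite <- Rmult_minus_distr_r, <- Rmult_plus_distr_r. field. }
    rewrite I_scal, I_plus, !I_sin_Z; auto with cont. ring.
  - rewrite (I_ext _ (fun t => /2 * (cos ((INR a - INR b) * t) - cos ((INR a + INR b) * t)))).
    2:{ intros t. rewrite !e_odd, sin_sin.
        rewrite <- Rmult_minus_distr_r, <- Rmult_plus_distr_r. field. }
    rewrite I_scal, I_minus, I_cos_diff, I_cos_add; auto with cont.
    assert (b <> O) by lia.
    destruct (Nat.eq_dec (a + b) 0); [lia|].
    destruct (Nat.eq_dec a b) as [->|H'].
    + destruct (Nat.eq_dec (2 * b + 1) (2 * b + 1)) as [_|?]; [|lia].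
      destruct b; [lia|]. simpl. field.
    + destruct (Nat.eq_dec (2 * a + 1) (2 * b + 1)); [lia|]. ring.
Qed.

(** * Absolutely convergent trigonometric series *)

Lemma summable_ex x : summable x -> ex_series x.
Proof. apply ex_series_Rabs. Qed.
Lemma summable_le x y : summable y -> (forall n, Rabs (x n) <= Rabs (y n)) -> summable x.
Proof.
  intros H K. apply (ex_series_le (V := R_CompleteNormedModule) _ (fun n => Rabs (y n))); auto.
  intros n. unfold norm; simpl. unfold abs; simpl. rewrite Rabs_Rabsolu. auto.
Qed.
Lemma summable_mult x c B : summable x -> (forall n, Rabs (c n) <= B) -> summable (fun n => x n * c n).
Proof.
  intros H K. apply summable_le with (fun n => B * Rabs (x n)).
  - unfold summable. apply ex_series_ext with (fun n => Rabs B * Rabs (x n)).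
    + intros n. now rewrite Rabs_mult, Rabs_Rabsolu.
    + apply (ex_series_scal (Rabs B) (fun n => Rabs (x n))). exact H.
  - intros n. rewrite !Rabs_mult, Rabs_Rabsolu.
    rewrite Rmult_comm. apply Rmult_le_compat_r. apply Rabs_pos.
    eapply Rle_trans; [apply K|apply RRle_abs].
Qed.
Lemma summable_scal c x : summable x -> summable (fun n => c * x n).
Proof.
  intros H. unfold summable. apply ex_series_ext with (fun n => Rabs c * Rabs (x n)).
  - intros n. now rewrite Rabs_mult.
  - apply (ex_series_scal (Rabs c) (fun n => Rabs (x n))). exact H.
Qed.
Lemma summable_plus x y : summable x -> summable y -> summable (fun n => x n + y n).
Proof.
  intros H K.
  apply (ex_series_le (V := R_CompleteNormedModule) _ (fun n => Rabs (x n) + Rabs (y n))).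
  - intros n. unfold norm; simpl. unfold abs; simpl. rewrite Rabs_Rabsolu. apply Rabs_triang.
  - apply (ex_series_plus (fun n => Rabs (x n)) (fun n => Rabs (y n))); auto.
Qed.
Lemma summable_minus x y : summable x -> summable y -> summable (fun n => x n - y n).
Proof.
  intros H K. apply summable_le with (fun n => x n + (-1) * y n).
  - apply summable_plus; auto using summable_scal.
  - intros n. right. f_equal. ring.
Qed.
Lemma Series_abs_le x y : summable y -> (forall n, Rabs (x n) <= Rabs (y n)) ->
  Rabs (Series x) <= norm1 y.
Proof.
  intros H K. eapply Rle_trans. apply Series_Rabs.
  - apply summable_le with y; auto.
  - apply Series_le; auto. intros n; split; auto. apply Rabs_pos.
Qed.
Lemma norm1_ge0 x : summable x -> 0 <= norm1 x.
Proof. intros H. eapply Rle_trans. 2: apply (Series_abs_le x x); auto with real. apply Rabs_pos. Qed.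

Lemma summable_e x t : summable x -> summable (fun n => x n * e n t).
Proof. intros H. apply summable_mult with 1; auto. intros n; apply e_le1. Qed.

Lemma T_abs x t : summable x -> Rabs (T x t) <= norm1 x.
Proof.
  intros H. apply Series_abs_le; auto. intros n. rewrite Rabs_mult.
  pose proof (e_le1 n t). pose proof (Rabs_pos (x n)). nra.
Qed.
Lemma T_plus x y t : summable x -> summable y -> T (fun n => x n + y n) t = T x t + T y t.
Proof.
  intros H K. unfold T. rewrite <- Series_plus; try (apply summable_ex, summable_e; auto).
  apply Series_ext. intros; ring.
Qed.
Lemma T_scal c x t : T (fun n => c * x n) t = c * T x t.
Proof. unfold T. rewrite <- Series_scal_l. apply Series_ext. intros; ring. Qed.
Lemma T_minus x y t : summable x -> summable y -> T (fun n => x n - y n) t = T x t - T y t.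
Proof.
  intros H K. unfold T. rewrite <- Series_minus; try (apply summable_ex, summable_e; auto).
  apply Series_ext. intros; ring.
Qed.
Lemma periodic_T x : periodic (T x).
Proof. intros t. apply Series_ext. intros n. now rewrite periodic_e. Qed.

Definition trunc (N : nat) (x : nat -> R) (n : nat) : R := if Nat.leb n N then x n else 0.

Lemma trunc_le N x n : Rabs (trunc N x n) <= Rabs (x n).
Proof. unfold trunc. destruct (Nat.leb n N). lra. rewrite Rabs_R0. apply Rabs_pos. Qed.
Lemma summable_trunc N x : summable x -> summable (trunc N x).
Proof. intros H. apply summable_le with x; auto. apply trunc_le. Qed.

Lemma is_series_finite x N : (forall n, (N < n)%nat -> x n = 0) -> is_series x (sum_n x N).
Proof.
  intros H. unfold is_series. apply filterlim_ext_loc with (fun _ => sum_n x N).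
  - exists N. intros n Hn. induction Hn as [|n Hn IH]; auto.
    rewrite sum_Sn, <- IH, H by lia. toR. now rewrite Rplus_0_r.
  - apply filterlim_const.
Qed.
Lemma summable_finite x N : (forall n, (N < n)%nat -> x n = 0) -> summable x.
Proof.
  intros H. eexists. apply (is_series_finite _ N). intros n Hn. rewrite H by auto. apply Rabs_R0.
Qed.
Lemma T_finite x N t : (forall n, (N < n)%nat -> x n = 0) -> T x t = sum_n (fun n => x n * e n t) N.
Proof.
  intros H. apply is_series_unique. apply (is_series_finite _ N).
  intros n Hn. rewrite H by auto. ring.
Qed.

Lemma tail_small x eps : summable x -> 0 < eps ->
  exists N0, forall N, (N0 <= N)%nat -> norm1 (fun n => x n - trunc N x n) < eps.
Proof.
  intros H He.
  assert (Hc := Series_correct _ H). unfold is_series in Hc.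
  destruct (proj1 (filterlim_locally _ _) Hc (mkposreal _ He)) as [N0 HN].
  exists N0. intros N HN0. specialize (HN N HN0).
  replace (norm1 (fun n => x n - trunc N x n)) with (norm1 x - sum_n (fun n => Rabs (x n)) N).
  - change (Rabs (sum_n (fun n => Rabs (x n)) N - norm1 x) < eps) in HN. apply Rabs_def2 in HN.
    set (s := sum_n _ N : R) in *. lra.
  - unfold norm1.
    rewrite <- (is_series_unique (fun n => Rabs (trunc N x n)) (sum_n (fun n => Rabs (x n)) N)).
    + rewrite <- Series_minus; auto.
      * apply Series_ext. intros n. unfold trunc. destruct (Nat.leb n N).
        rewrite !Rminus_diag, Rabs_R0; auto. now rewrite Rabs_R0, !Rminus_0_r.
      * apply (summable_trunc N x H).
    + rewrite (sum_n_ext_loc (fun n => Rabs (x n)) (fun n => Rabs (trunc N x n)) N).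
      apply is_series_finite.
      * intros n Hn. unfold trunc. replace (Nat.leb n N) with false. apply Rabs_R0.
        symmetry. apply Nat.leb_gt. lia.
      * intros n Hn. unfold trunc. replace (Nat.leb n N) with true; auto.
        symmetry. apply Nat.leb_le. lia.
Qed.

Lemma cont_sum_n (f : nat -> R -> R) N : (forall n, cont (f n)) -> cont (fun t => sum_n (fun n => f n t) N).
Proof.
  intros H. induction N.
  - apply cont_ext with (f O); auto. intros; now rewrite sum_O.
  - apply cont_ext with (fun t => sum_n (fun n => f n t) N + f (S N) t).
    + intros t. now rewrite sum_Sn.
    + auto with cont.
Qed.
Lemma I_sum_n (f : nat -> R -> R) N : (forall n, cont (f n)) ->
  I (fun t => sum_n (fun n => f n t) N) = sum_n (fun n => I (f n)) N.
Proof.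
  intros H. induction N.
  - rewrite sum_O. apply I_ext. intros; now rewrite sum_O.
  - rewrite sum_Sn, <- IHN. unfold plus; simpl. rewrite <- I_plus; auto using cont_sum_n.
    apply I_ext. intros t. now rewrite sum_Sn.
Qed.
Lemma trunc_out N x n : (N < n)%nat -> trunc N x n = 0.
Proof. intros Hn. unfold trunc. replace (Nat.leb n N) with false; auto. symmetry. apply Nat.leb_gt. lia. Qed.
Lemma trunc_in N x n : (n <= N)%nat -> trunc N x n = x n.
Proof. intros Hn. unfold trunc. replace (Nat.leb n N) with true; auto. symmetry. apply Nat.leb_le. lia. Qed.

Lemma cont_T x : summable x -> cont (T x).
Proof.
  intros H t. apply filterlim_locally. intros eps.
  destruct (tail_small x (eps/3)) as [N HN]; auto. destruct eps; simpl; lra.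
  specialize (HN N (Nat.le_refl N)).
  assert (K : cont (T (trunc N x))).
  { apply cont_ext with (fun t => sum_n (fun n => trunc N x n * e n t) N).
    - intros s. rewrite (T_finite _ N); auto. intros n Hn; now apply trunc_out.
    - apply (cont_sum_n (fun n t => trunc N x n * e n t)). auto with cont. }
  destruct (cont_near _ t (eps/3) K) as [d [Hd Hy]]. destruct eps; simpl; lra.
  exists (mkposreal _ Hd). intros s Hs. specialize (Hy s Hs).
  ballR.
  assert (L : forall s, Rabs (T x s - T (trunc N x) s) < eps/3).
  { intros r. rewrite <- T_minus; auto using summable_trunc.
    eapply Rle_lt_trans; [apply T_abs|exact HN]. apply summable_minus; auto using summable_trunc. }
  pose proof (L s) as L1. pose proof (L t) as L2.
  apply Rabs_def2 in L1, L2, Hy. apply Rabs_def1; lra.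
Qed.
#[export] Hint Resolve cont_T : cont.

(** Termwise integration: the truncations of [T x] converge uniformly, with error at most the
    [norm1] of the tail. *)
Lemma I_T x g : summable x -> cont g ->
  is_series (fun n => x n * I (fun t => e n t * g t)) (I (fun t => T x t * g t)).
Proof.
  intros H Hg. apply filterlim_locally. intros eps.
  set (B := I (fun t => Rabs (g t))).
  assert (HB : 0 <= B) by (apply I_ge0; auto with cont; intros; apply Rabs_pos).
  destruct (tail_small x (eps/(B+1))) as [N0 HN]; auto.
  { apply Rdiv_lt_0_compat. apply cond_pos. lra. }
  exists N0. intros N HN0. specialize (HN N HN0).
  assert (E : sum_n (fun n => x n * I (fun t => e n t * g t)) N = I (fun t => T (trunc N x) t * g t)).
  { rewrite (I_ext _ (fun t => sum_n (fun n => (x n * (e n t * g t))) N)).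
    - rewrite (I_sum_n (fun n t => x n * (e n t * g t))); auto with cont.
      apply sum_n_ext. intros n. rewrite I_scal; auto with cont.
    - intros t. rewrite (T_finite _ N) by (intros; now apply trunc_out).
      rewrite Rmult_comm, <- (sum_n_mult_l (K := R_Ring) (g t)). apply sum_n_ext_loc. intros n Hn.
      rewrite trunc_in; auto. toR; ring. }
  ballR. change R_AbelianMonoid with (NormedModule.AbelianMonoid R_AbsRing R_NormedModule) in E. rewrite E.
  assert (St := summable_trunc N x H).
  rewrite <- I_minus; auto with cont.
  rewrite (I_ext _ (fun t => (- 1) * (T (fun n => x n - trunc N x n) t * g t))).
  2:{ intros t. rewrite T_minus; auto. ring. }
  assert (Sd : summable (fun n => x n - trunc N x n)) by (apply summable_minus; auto).
  rewrite I_scal by auto with cont. rewrite Rabs_mult, Rabs_m1, Rmult_1_l.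
  eapply Rle_lt_trans. apply (I_abs_le _ (fun t => norm1 (fun n => x n - trunc N x n) * Rabs (g t))); auto with cont.
  - intros t. rewrite Rabs_mult. apply Rmult_le_compat_r. apply Rabs_pos. now apply T_abs.
  - rewrite I_scal by auto with cont. fold B.
    assert (0 <= norm1 (fun n => x n - trunc N x n)) by now apply norm1_ge0.
    assert (eps / (B + 1) * (B + 1) = eps) by (field; nz).
    pose proof (cond_pos eps).
    apply Rle_lt_trans with (norm1 (fun n => x n - trunc N x n) * (B + 1)); [nra|].
    rewrite <- H1. apply Rmult_lt_compat_r; lra.
Qed.

Lemma I_T_e x n : summable x -> n <> 1%nat -> I (fun t => T x t * e n t) = x n * nu n.
Proof.
  intros H Hn.
  rewrite <- (is_series_unique _ _ (I_T x (e n) H (cont_e n))).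
  rewrite (Series_ext _ (fun m => if Nat.eq_dec m n then x n * nu n else 0)).
  2:{ intros m. rewrite e_orth by auto. destruct (Nat.eq_dec m n) as [->|]; auto. ring. }
  apply is_series_unique. evar_last.
  apply (is_series_finite _ n). intros m Hm. destruct (Nat.eq_dec m n); auto; lia.
  clear. enough (forall N, sum_n (fun m => if Nat.eq_dec m n then x n * nu n else 0) N =
     if le_dec n N then x n * nu n else 0).
  { rewrite H. destruct (le_dec n n); auto; lia. }
  induction N.
  - rewrite sum_O. destruct (Nat.eq_dec 0 n), (le_dec n 0); auto; lia.
  - rewrite sum_Sn, IHN. toR.
    destruct (Nat.eq_dec (S N) n), (le_dec n N), (le_dec n (S N)); try (exfalso; lia); ring.
Qed.

Lemma one_INR_pos n : 1 <= 1 + INR n.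
Proof. pose proof (pos_INR n); lra. Qed.
Lemma weight_pos n q : 0 < (1 + INR n) ^ q.
Proof. apply pow_lt. pose proof (one_INR_pos n); lra. Qed.

(** Domination by the telescoping series of [2 (1 / (1 + n) - 1 / (2 + n))]. *)
Lemma summable_inv_sq : summable (fun n => / (1 + INR n) ^ 2).
Proof.
  apply (ex_series_le (V := R_CompleteNormedModule) _ (fun n => 2 * (/ (1 + INR n) - / (1 + INR (S n))))).
  - intros n. unfold norm; simpl; unfold abs; simpl. rewrite Rabs_Rabsolu.
    change (match n with O => 1 | S _ => INR n + 1 end) with (INR (S n)). rewrite S_INR.
    pose proof (pos_INR n). rewrite Rabs_pos_eq.
    + rewrite Rmult_1_r.
      replace (/ (1 + INR n) - / (1 + (INR n + 1))) with (/ ((1 + INR n) * (2 + INR n))) by (field; nz).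
      rewrite !Rinv_mult.
      assert (0 < / (1 + INR n)) by (apply Rinv_0_lt_compat; lra).
      assert (/ (1 + INR n) <= 2 * / (2 + INR n)).
      { replace (2 * / (2 + INR n)) with (/ ((2 + INR n) / 2)) by (field; nz).
        apply Rinv_le_contravar; lra. }
      nra.
    + left. apply Rinv_0_lt_compat. nra.
  - exists (2 * (1 - 0)).
    apply (is_series_scal 2 (fun n => / (1 + INR n) - / (1 + INR (S n)))).
    unfold is_series.
    apply (filterlim_ext (fun N => 1 - / (1 + INR (S N)))).
    + induction x; [rewrite sum_O|rewrite sum_Sn, <- IHx]; toR.
      * simpl. field.
      * rewrite !S_INR. pose proof (pos_INR x). field. nz.
    + apply (is_lim_seq_minus' (fun _ => 1) (fun N => / (1 + INR (S N))) 1 0).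
      * apply is_lim_seq_const.
      * apply (is_lim_seq_incr_1 (fun n => / (1 + INR n))).
        apply (is_lim_seq_inv (fun n => 1 + INR n) p_infty); [|discriminate].
        eapply is_lim_seq_plus. apply is_lim_seq_const. apply is_lim_seq_INR. reflexivity.
Qed.

Lemma rapid_nonneg_const x q : rapid x -> exists C, 0 <= C /\ forall n, Rabs (x n) * (1 + INR n) ^ q <= C.
Proof.
  intros H. destruct (H q) as [C HC]. exists C; split; auto.
  eapply Rle_trans; [|apply (HC O)]. apply Rmult_le_pos. apply Rabs_pos. left; apply weight_pos.
Qed.

Lemma rapid_weight x q : rapid x -> summable (fun n => x n * (1 + INR n) ^ q).
Proof.
  intros H. destruct (rapid_nonneg_const x (q + 2) H) as [C [C0 HC]].
  apply summable_le with (fun n => C * / (1 + INR n) ^ 2).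
  - apply summable_scal, summable_inv_sq.
  - intros n. specialize (HC n). rewrite pow_add in HC.
    pose proof (weight_pos n 2). pose proof (weight_pos n q).
    rewrite !Rabs_mult, (Rabs_pos_eq C), (Rabs_pos_eq (_ ^ q)), (Rabs_pos_eq (/ _)) by
      (try (left; apply Rinv_0_lt_compat); lra).
    apply Rmult_le_reg_r with ((1 + INR n) ^ 2); auto.
    rewrite (Rmult_assoc C), Rinv_l; nra.
Qed.
Lemma rapid_summable x : rapid x -> summable x.
Proof.
  intros H. apply summable_le with (fun n => x n * (1 + INR n) ^ 0); auto using rapid_weight.
  intros n. simpl. right; f_equal; ring.
Qed.
Lemma rapid_poly x y B p : rapid x -> (forall n, Rabs (y n) <= B * Rabs (x n) * (1 + INR n) ^ p) -> rapid y.
Proof.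
  intros H K q. destruct (rapid_nonneg_const x (p + q) H) as [C [C0 HC]].
  exists (Rabs B * C). intros n. specialize (K n). specialize (HC n). rewrite pow_add in HC.
  pose proof (weight_pos n p). pose proof (weight_pos n q). pose proof (Rabs_pos (x n)).
  pose proof (RRle_abs B).
  apply Rle_trans with (Rabs B * (Rabs (x n) * ((1 + INR n) ^ p * (1 + INR n) ^ q))).
  - apply Rle_trans with (B * Rabs (x n) * (1 + INR n) ^ p * (1 + INR n) ^ q).
    + apply Rmult_le_compat_r; lra.
    + rewrite <- !Rmult_assoc. repeat (apply Rmult_le_compat_r; [nra|]). lra.
  - apply Rmult_le_compat_l; auto. apply Rabs_pos.
Qed.
Lemma rapid_plus x y : rapid x -> rapid y -> rapid (fun n => x n + y n).
Proof.
  intros H K q. destruct (H q) as [C HC], (K q) as [D HD].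
  exists (C + D). intros n. specialize (HC n). specialize (HD n).
  pose proof (weight_pos n q). pose proof (Rabs_triang (x n) (y n)). nra.
Qed.
Lemma rapid_scal c x : rapid x -> rapid (fun n => c * x n).
Proof.
  intros H. apply rapid_poly with x (Rabs c) O; auto. intros n. rewrite Rabs_mult. simpl. lra.
Qed.
Lemma rapid_finite x N : (forall n, (N < n)%nat -> x n = 0) -> rapid x.
Proof.
  intros H q. exists (sum_n (fun n => Rabs (x n) * (1 + INR n) ^ q) N). intros n.
  destruct (le_lt_dec n N) as [L|L].
  - clear H. induction N.
    + replace n with O by lia. rewrite sum_O. lra.
    + rewrite sum_Sn. toR.
      assert (0 <= Rabs (x (S N)) * (1 + INR (S N)) ^ q).
      { apply Rmult_le_pos. apply Rabs_pos. left; apply weight_pos. }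
      assert (0 <= sum_n (fun n => Rabs (x n) * (1 + INR n) ^ q) N).
      { rewrite sum_n_Reals. apply cond_pos_sum. intros k. apply Rmult_le_pos. apply Rabs_pos. left; apply weight_pos. }
      destruct (le_lt_dec n N).
      * eapply Rle_trans. apply IHN; auto. rewrite <- (Rplus_0_r (sum_n _ N)) at 1.
        apply Rplus_le_compat_l; auto.
      * replace n with (S N) by lia. rewrite <- (Rplus_0_l (Rabs _ * _)) at 1.
        apply Rplus_le_compat_r; auto.
  - rewrite H by auto. rewrite Rabs_R0, Rmult_0_l. rewrite sum_n_Reals. apply cond_pos_sum.
    intros k. apply Rmult_le_pos. apply Rabs_pos. left; apply weight_pos.
Qed.
Lemma rapid_freq x : rapid x -> rapid (fun n => freq n * x n).
Proof.
  intros H. apply rapid_poly with x 1 1%nat; auto. intros n.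
  rewrite Rabs_mult, (Rabs_pos_eq _ (freq_ge0 n)). destruct (freq_bound n) as [A _].
  pose proof (Rabs_pos (x n)). simpl. nra.
Qed.

(** * Completeness of the trigonometric system *)

Lemma e_ortho_Z g : cont g -> (forall n, I (fun t => g t * e n t) = 0) ->
  forall z : Z, I (fun t => g t * cos (IZR z * t)) = 0 /\ I (fun t => g t * sin (IZR z * t)) = 0.
Proof.
  intros Hg H.
  assert (N : forall k : nat, I (fun t => g t * cos (INR k * t)) = 0 /\ I (fun t => g t * sin (INR k * t)) = 0).
  { intros k. split.
    - rewrite <- (H (2 * k)%nat). apply I_ext. intros t. now rewrite e_even.
    - rewrite <- (H (2 * k + 1)%nat). apply I_ext. intros t. now rewrite e_odd. }
  intros z. destruct (Z_le_dec 0 z) as [L|L].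
  - specialize (N (Z.to_nat z)). rewrite INR_IZR_INZ, Z2Nat.id in N by auto. auto.
  - specialize (N (Z.to_nat (- z))). rewrite INR_IZR_INZ, Z2Nat.id in N by lia.
    rewrite opp_IZR in N. destruct N as [A B]. split.
    + rewrite <- A. apply I_ext. intros t. rewrite Ropp_mult_distr_l_reverse, cos_neg. auto.
    + rewrite <- (Rmult_0_r (-1)), <- B, <- I_scal; auto with cont. apply I_ext.
      intros t. rewrite Ropp_mult_distr_l_reverse, sin_neg. ring.
Qed.

(** Multiplication by [a + b cos t + c sin t] shifts frequencies by at most one, so orthogonality to
    all modes passes to each power. Frequencies range over [Z] so that the downward shift stays in
    range. *)
Lemma trig_power_orth g a b c : cont g -> (forall n, I (fun t => g t * e n t) = 0) ->
  forall n, forall z : Z,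
   I (fun t => g t * (a + b * cos t + c * sin t) ^ n * cos (IZR z * t)) = 0 /\
   I (fun t => g t * (a + b * cos t + c * sin t) ^ n * sin (IZR z * t)) = 0.
Proof.
  intros Hg H n. induction n; intros z.
  - destruct (e_ortho_Z g Hg H z) as [A B]. rewrite <- A at 1. rewrite <- B at 1.
    split; apply I_ext; intros t; simpl; ring.
  - set (P := fun t => g t * (a + b * cos t + c * sin t) ^ n).
    assert (IH : forall z : Z, I (fun t => P t * cos (IZR z * t)) = 0 /\ I (fun t => P t * sin (IZR z * t)) = 0)
      by exact IHn.
    destruct (IH z) as [A B], (IH (z+1)%Z) as [A1 B1], (IH (z-1)%Z) as [A2 B2].
    assert (HP : cont P) by (unfold P; auto 12 with cont).
    assert (forall t, IZR (z + 1) * t = IZR z * t + t) as E1 by (intros; rewrite plus_IZR; ring).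
    assert (forall t, IZR (z - 1) * t = IZR z * t - t) as E2 by (intros; rewrite minus_IZR; ring).
    split.
    + rewrite (I_ext _ (fun t => a * (P t * cos (IZR z * t)) +
        (b / 2 * (P t * cos (IZR (z+1) * t)) + (b / 2 * (P t * cos (IZR (z-1) * t)) +
        (c / 2 * (P t * sin (IZR (z+1) * t)) - c / 2 * (P t * sin (IZR (z-1) * t))))))).
      rewrite !I_plus, I_minus, !I_scal; auto 12 with cont.
      rewrite A, A1, A2, B1, B2; ring.
      intros t. unfold P. rewrite E1, E2, cos_plus, cos_minus, sin_plus, sin_minus. simpl. field.
    + rewrite (I_ext _ (fun t => a * (P t * sin (IZR z * t)) +
        (b / 2 * (P t * sin (IZR (z+1) * t)) + (b / 2 * (P t * sin (IZR (z-1) * t)) +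
        (c / 2 * (P t * cos (IZR (z-1) * t)) - c / 2 * (P t * cos (IZR (z+1) * t))))))).
      rewrite !I_plus, I_minus, !I_scal; auto 12 with cont.
      rewrite B, A1, A2, B1, B2; ring.
      intros t. unfold P. rewrite E1, E2, cos_plus, cos_minus, sin_plus, sin_minus. simpl. field.
Qed.

(** Powers of a kernel peaked at [t0] are combinations of modes, hence orthogonal to [g]; yet if
    [g t0 > 0], their integrals against [g] would grow geometrically. *)
Lemma completeness_pos g t0 : cont g -> (forall n, I (fun t => g t * e n t) = 0) ->
  periodic g -> 0 < t0 < 2 * PI -> 0 < g t0 -> False.
Proof.
  intros Hg H P Ht0 Hpos. pose proof two_PI_pos as Hpi.
  destruct (cont_near g t0 (g t0 / 2) Hg) as [d0 [Hd0 Hnear]]; [lra|].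
  set (d := Rmin (d0 / 2) (Rmin (t0/2) (Rmin ((2*PI - t0)/2) 1))).
  assert (0 < d) by (repeat apply Rmin_glb_lt; lra).
  assert (d <= d0 / 2) by apply Rmin_l.
  assert (d <= t0/2) by (eapply Rle_trans; [apply Rmin_r|apply Rmin_l]).
  assert (d <= (2*PI-t0)/2) by (do 2 (eapply Rle_trans; [apply Rmin_r|]); apply Rmin_l).
  assert (d <= 1) by (do 2 (eapply Rle_trans; [apply Rmin_r|]); apply Rmin_r).
  pose proof PI2_1.
  assert (Hcd : cos d < cos (d/2)) by (apply cos_decreasing_1; lra).
  assert (Hcd0 : 0 < cos d) by (apply cos_gt_0; lra).
  (* At least [q > 1] within [d / 2] of [t0], and of modulus at most 1 at distance [d] or more, so
     that the powers concentrate at [t0]. *)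
  set (Tn := fun t => 1 + cos (t - t0) - cos d).
  destruct (periodic_bounded g Hg P) as [B [HB0 HB]].
  set (q := 1 + cos (d/2) - cos d).
  assert (Hq : 1 < q) by (unfold q; lra).
  assert (HT : cont Tn) by (unfold Tn; auto with cont).
  assert (Z : forall n, I (fun t => g t * Tn t ^ n) = 0).
  { intros n. destruct (trig_power_orth g (1 - cos d) (cos t0) (sin t0) Hg H n 0) as [A _].
    rewrite <- A. apply I_ext. intros t. rewrite Rmult_0_l, cos_0, Rmult_1_r. f_equal. f_equal.
    unfold Tn. rewrite cos_minus. ring. }
  (* Away from [t0] the kernel has modulus at most 1; near it both factors are nonnegative. Adding
     [B] thus makes the integrand nonnegative over the whole period. *)
  assert (Low : forall n t, 0 <= t <= 2 * PI -> 0 <= g t * Tn t ^ n + B).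
  { intros n t Ht. destruct (Rle_lt_dec d (Rabs (t - t0))) as [L|L].
    - assert (cos (t - t0) <= cos d).
      { assert (cos (t - t0) = cos (Rabs (t - t0))) as ->.
        { unfold Rabs. destruct (Rcase_abs _); auto. now rewrite cos_neg. }
        assert (Rabs (t - t0) <= 2 * PI - d) by (apply Rabs_le; lra).
        set (y := Rabs (t - t0)) in *.
        destruct (Rle_lt_dec y PI).
        - apply cos_decr_1; lra.
        - replace (cos y) with (cos (2 * PI - y)). apply cos_decr_1; lra.
          rewrite cos_minus, cos_2PI, sin_2PI. ring. }
      assert (Rabs (Tn t) <= 1).
      { pose proof (COS_bound (t - t0)). pose proof (COS_bound d). unfold Tn.
        apply Rabs_le. lra. }
      assert (Rabs (g t * Tn t ^ n) <= B).
      { rewrite Rabs_mult, <- RPow_abs. specialize (HB t).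
        assert (0 <= Rabs (Tn t) ^ n <= 1).
        { split. apply pow_le, Rabs_pos. rewrite <- (pow1 n). apply pow_incr. split; auto. apply Rabs_pos. }
        pose proof (Rabs_pos (g t)). nra. }
      apply Rabs_le_between in H8. lra.
    - assert (0 <= g t). { assert (Rabs (t - t0) < d0) as K by lra. apply Hnear in K. apply Rabs_def2 in K. lra. }
      assert (cos d <= cos (t - t0)).
      { assert (cos (t - t0) = cos (Rabs (t - t0))) as ->.
        { unfold Rabs. destruct (Rcase_abs _); auto. now rewrite cos_neg. }
        pose proof (Rabs_pos (t - t0)). apply cos_decr_1; lra. }
      assert (0 <= Tn t ^ n) by (apply pow_le; unfold Tn; lra). nra. }
  (* The full integral of the shifted integrand is [2 PI B] for every [n], whereas its part over an
     interval of length [d] about [t0] is at least a multiple of [q ^ n]. *)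
  assert (Key : forall n, d * (g t0 / 2 * q ^ n) <= 2 * PI * B).
  { intros n.
    assert (CP : cont (fun t => g t * Tn t ^ n + B)) by auto with cont.
    assert (EI : I (fun t => g t * Tn t ^ n + B) = 2 * PI * B).
    { rewrite I_plus, Z, I_const; auto with cont. ring. }
    rewrite <- EI.
    apply Rle_trans with (RInt (fun t => g t * Tn t ^ n + B) (t0 - d/2) (t0 + d/2)).
    - replace (d * (g t0 / 2 * q ^ n)) with (RInt (fun _ => g t0 / 2 * q ^ n) (t0 - d/2) (t0 + d/2)).
      2:{ rewrite RInt_const. toR. field. }
      apply RInt_le; auto with cont; [lra|]. intros t Ht.
      assert (Rabs (t - t0) <= d/2) by (apply Rabs_le; lra).
      assert (g t0 / 2 <= g t). { assert (Rabs (t - t0) < d0) as K by lra. apply Hnear in K. apply Rabs_def2 in K. lra. }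
      assert (cos (d/2) <= cos (t - t0)).
      { assert (cos (t - t0) = cos (Rabs (t - t0))) as ->.
        { unfold Rabs. destruct (Rcase_abs _); auto. now rewrite cos_neg. }
        pose proof (Rabs_pos (t - t0)). apply cos_decr_1; lra. }
      assert (q ^ n <= Tn t ^ n) by (apply pow_incr; unfold Tn, q; lra).
      assert (0 <= q ^ n) by (apply pow_le; lra). nra.
    - set (h := fun t => g t * Tn t ^ n + B) in *.
      unfold I. rewrite <- (RInt_Chasles h 0 (t0 - d/2) (2*PI)), <- (RInt_Chasles h (t0-d/2) (t0+d/2) (2*PI)) by auto with cont.
      toR.
      assert (0 <= RInt h 0 (t0 - d/2)) by (apply RInt_ge_0; auto with cont; [lra|]; intros; apply Low; lra).
      assert (0 <= RInt h (t0 + d/2) (2*PI)) by (apply RInt_ge_0; auto with cont; [lra|]; intros; apply Low; lra).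
      lra. }
  destruct (Pow_x_infinity q) with (b := 2 * PI * B / (d * (g t0 / 2)) + 1) as [N HN].
  { rewrite Rabs_pos_eq; lra. }
  specialize (HN N (Nat.le_refl N)). rewrite Rabs_pos_eq in HN by (apply pow_le; lra).
  specialize (Key N).
  assert (0 < d * (g t0 / 2)) by nra.
  assert (2 * PI * B / (d * (g t0 / 2)) * (d * (g t0 / 2)) = 2 * PI * B) by (field; nz).
  nra.
Qed.

Lemma fourier_complete g : cont g -> periodic g -> (forall n, I (fun t => g t * e n t) = 0) ->
  forall t, g t = 0.
Proof.
  intros Hg P H.
  assert (Hm : forall n, I (fun t => - g t * e n t) = 0).
  { intros n. rewrite (I_ext _ (fun t => (-1) * (g t * e n t))) by (intros; ring).
    rewrite I_scal, H by auto with cont. ring. }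
  assert (K : forall t, 0 < t < 2 * PI -> g t = 0).
  { intros t Ht. destruct (Rtotal_order (g t) 0) as [L|[L|L]]; auto; exfalso.
    - apply (completeness_pos (fun t => - g t) t); auto with cont; try lra.
      intros x; now rewrite P.
    - apply (completeness_pos g t); auto. }
  pose proof two_PI_pos as Hpi.
  (* The argument above needs an interior point; the endpoint of the period follows by
     continuity. *)
  assert (K0 : g 0 = 0).
  { apply NNPP. intros Hn. assert (0 < Rabs (g 0)) as Hp by now apply Rabs_pos_lt.
    destruct (cont_near g 0 (Rabs (g 0)) Hg Hp) as [d [Hd Hnear]].
    set (y := Rmin (d/2) PI). pose proof PI_RGT_0.
    assert (0 < y) by (apply Rmin_glb_lt; lra).
    assert (y <= d/2) by apply Rmin_l. assert (y <= PI) by apply Rmin_r.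
    specialize (Hnear y). rewrite (K y) in Hnear by lra.
    rewrite !Rminus_0_r, Rminus_0_l, Rabs_Ropp in Hnear.
    rewrite (Rabs_pos_eq y) in Hnear by lra. specialize (Hnear ltac:(lra)). lra. }
  apply (periodic_eq_on g (fun _ => 0)); auto. intros x; auto.
  intros x Hx. destruct (Req_dec x 0) as [->|]; auto. apply K; lra.
Qed.

(** * Decay of Fourier coefficients and Fourier series of smooth functions *)

Lemma derive_periodic f f' : periodic f -> (forall x : R, is_derive f x (f' x)) -> periodic f'.
Proof.
  intros P H x. rewrite <- (is_derive_unique _ _ _ (H x)), <- (is_derive_unique _ _ _ (H (x + 2*PI))).
  transitivity (Derive (fun x => f (x + 2*PI)) x).
  - symmetry. apply is_derive_unique.
    assert (D := H (x + 2*PI)).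
    assert (is_derive (fun x => f (x + 2*PI)) x (1 * f' (x + 2 * PI))).
    { apply (is_derive_comp f (fun x => x + 2*PI)); auto. auto_derive; auto. }
    rewrite Rmult_1_l in H0. now rewrite (is_derive_unique _ _ _ D).
  - apply Derive_ext. auto.
Qed.

Lemma is_derive_cos_lin c x : is_derive (fun t => cos (c * t)) x (- c * sin (c * x)).
Proof. auto_derive; auto. ring. Qed.
Lemma is_derive_sin_lin c x : is_derive (fun t => sin (c * t)) x (c * cos (c * x)).
Proof. auto_derive; auto. ring. Qed.

Lemma periodic_cos_nat k : periodic (fun t => cos (INR k * t)).
Proof. intros t. rewrite <- !e_even. apply periodic_e. Qed.
Lemma periodic_sin_nat k : periodic (fun t => sin (INR k * t)).
Proof. intros t. rewrite <- !e_odd. apply periodic_e. Qed.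

Lemma fourier_by_parts g g' k : periodic g -> (forall x : R, is_derive g x (g' x)) -> cont g' ->
  I (fun t => g t * cos (INR k * t)) * INR k = - I (fun t => g' t * sin (INR k * t)) /\
  I (fun t => g t * sin (INR k * t)) * INR k = I (fun t => g' t * cos (INR k * t)).
Proof.
  intros P H H'. pose proof (cont_derive _ _ H) as Hg.
  rewrite (I_by_parts g g' (fun t => sin (INR k * t)) (fun t => INR k * cos (INR k * t)));
    auto using periodic_sin_nat, is_derive_sin_lin with cont.
  rewrite (I_by_parts g g' (fun t => cos (INR k * t)) (fun t => - INR k * sin (INR k * t)));
    auto using periodic_cos_nat, is_derive_cos_lin with cont.
  split.
  - rewrite Ropp_involutive, Rmult_comm, <- I_scal by auto with cont. apply I_ext; intros; ring.
  - rewrite Rmult_comm, <- I_scal by auto with cont.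
    rewrite (I_ext (fun x => g x * (- INR k * sin (INR k * x))) (fun t => (-1) * (INR k * (g t * sin (INR k * t))))) by (intros; ring).
    rewrite (I_scal (-1)) by auto with cont. ring.
Qed.

(** Each derivative buys one power of [k], by an integration by parts whose boundary terms cancel by
    periodicity. *)
Lemma fourier_decay q : forall g, Cn q g -> periodic g -> exists C, 0 <= C /\ forall k,
  Rabs (I (fun t => g t * cos (INR k * t))) * INR k ^ q <= C /\
  Rabs (I (fun t => g t * sin (INR k * t))) * INR k ^ q <= C.
Proof.
  induction q; intros g Hg P.
  - destruct (periodic_bounded g Hg P) as [B [HB0 HB]].
    exists (2 * PI * B). split. pose proof two_PI_pos; nra.
    intros k. simpl. rewrite !Rmult_1_r. split; (apply I_bound; auto with cont; intros t;
      rewrite Rabs_mult; specialize (HB t); pose proof (Rabs_pos (g t))).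
    + pose proof (e_le1 (2 * k) t) as E. rewrite e_even in E. nra.
    + pose proof (e_le1 (2 * k + 1) t) as E. rewrite e_odd in E. nra.
  - destruct Hg as [g' [Hd Hg']].
    destruct (IHq g' Hg' (derive_periodic _ _ P Hd)) as [C [C0 HC]].
    exists C. split; auto. intros k. destruct (HC k) as [A B].
    destruct (fourier_by_parts g g' k P Hd (Cn_cont _ _ Hg')) as [E1 E2].
    assert (Hk := pos_INR k). simpl.
    assert (Ex : forall J, Rabs J * (INR k * INR k ^ q) = Rabs (J * INR k) * INR k ^ q).
    { intros J. rewrite Rabs_mult, (Rabs_pos_eq _ Hk). ring. }
    now rewrite !Ex, E1, E2, Rabs_Ropp.
Qed.

Lemma fc_rapid g : smooth g -> periodic g -> rapid (fc g).
Proof.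
  intros Hg P q. destruct (fourier_decay q g (Hg q) P) as [C [C0 HC]].
  (* The factor [4 ^ q] comes from [1 + n <= 2 (1 + freq n) <= 4 freq n], valid once [freq n >= 1];
     the coefficients 0 and 1 have frequency 0 and are bounded apart. *)
  exists (C / PI * 4 ^ q + Rabs (fc g 0) + Rabs (fc g 1) * 2 ^ q).
  pose proof PI_RGT_0.
  assert (Cq : 0 <= C / PI * 4 ^ q).
  { apply Rmult_le_pos. apply Rmult_le_pos; auto. left; apply Rinv_0_lt_compat; auto. apply pow_le; lra. }
  assert (0 <= Rabs (fc g 1) * 2 ^ q) by (apply Rmult_le_pos; [apply Rabs_pos|apply pow_le; lra]).
  pose proof (Rabs_pos (fc g 0)).
  intros [|[|n]].
  - simpl INR. rewrite Rplus_0_r, pow1. lra.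
  - simpl INR. replace (1 + 1) with 2 by ring. lra.
  - set (m := S (S n)).
    assert (Hm : Rabs (I (fun t => g t * e m t)) * freq m ^ q <= C).
    { destruct (nat_parity m) as [k [E|E]]; rewrite E.
      - rewrite freq_even. rewrite (I_ext _ (fun t => g t * cos (INR k * t))) by (intros; now rewrite e_even). exact (proj1 (HC k)).
      - rewrite freq_odd. rewrite (I_ext _ (fun t => g t * sin (INR k * t))) by (intros; now rewrite e_odd). exact (proj2 (HC k)). }
    assert (Hf : 1 <= freq m).
    { unfold freq, m. simpl Nat.div2. rewrite S_INR. pose proof (pos_INR (Nat.div2 n)); lra. }
    destruct (freq_bound m) as [_ F].
    assert (Hw : (1 + INR m) ^ q <= 4 ^ q * freq m ^ q).
    { rewrite <- Rpow_mult_distr. apply pow_incr. split. pose proof (one_INR_pos m); lra. lra. }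
    unfold fc at 1. change (nu m) with PI. unfold Rdiv at 1. rewrite Rabs_mult, (Rabs_pos_eq (/ PI)).
    2: left; apply Rinv_0_lt_compat; auto.
    assert (Hi : 0 < / PI) by now apply Rinv_0_lt_compat.
    assert (0 < 4 ^ q) by (apply pow_lt; lra).
    apply Rle_trans with (C / PI * 4 ^ q); [|lra].
    set (J := Rabs (I _)) in *. assert (0 <= J) by apply Rabs_pos.
    apply Rle_trans with (J * / PI * (4 ^ q * freq m ^ q)).
    + apply Rmult_le_compat_l; auto. nra.
    + replace (J * / PI * (4 ^ q * freq m ^ q)) with ((J * freq m ^ q) * (/ PI * 4 ^ q)) by ring.
      replace (C / PI * 4 ^ q) with (C * (/ PI * 4 ^ q)) by (unfold Rdiv; ring).
      apply Rmult_le_compat_r; auto. nra.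
Qed.

Lemma I_mult_e1 g : I (fun t => g t * e 1 t) = 0.
Proof. rewrite (I_ext _ (fun _ => 0)). rewrite I_const; ring. intros; rewrite e1; ring. Qed.

(** Index 1 is exempt because [e 1] is the zero function, so that [x 1] does not affect [T x]. *)
Lemma T_unique g x : cont g -> periodic g -> summable x ->
  (forall n, n <> 1%nat -> I (fun t => g t * e n t) = x n * nu n) -> forall t, g t = T x t.
Proof.
  intros Hg P Hx H t. apply Rminus_diag_uniq. revert t.
  apply (fourier_complete (fun t => g t - T x t)); auto with cont.
  - intros t. now rewrite P, periodic_T.
  - intros n. destruct (Nat.eq_dec n 1) as [->|Hn]; [apply I_mult_e1|].
    rewrite (I_ext _ (fun t => g t * e n t - T x t * e n t)) by (intros; ring).
    rewrite I_minus, I_T_e, H by auto with cont. ring.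
Qed.

Lemma fourier_eq g : smooth g -> periodic g -> forall t, g t = T (fc g) t.
Proof.
  intros Hg P. apply T_unique; auto with cont.
  - apply rapid_summable, fc_rapid; auto.
  - intros n Hn. unfold fc. field. pose proof (nu_pos n). lra.
Qed.

(** * Complex power series with rapidly decreasing coefficients *)

Lemma C_eq (a b : C) : fst a = fst b -> snd a = snd b -> a = b.
Proof. destruct a, b; simpl; intros; subst; auto. Qed.
Lemma fst_le_Cmod z : Rabs (fst z) <= Cmod z.
Proof. eapply Rle_trans; [|apply Rmax_Cmod]. apply Rmax_l. Qed.
Lemma snd_le_Cmod z : Rabs (snd z) <= Cmod z.
Proof. eapply Rle_trans; [|apply Rmax_Cmod]. apply Rmax_r. Qed.
Lemma Cmod_sqr z : Cmod z ^ 2 = fst z ^ 2 + snd z ^ 2.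
Proof. unfold Cmod. rewrite <- Rsqr_pow2, Rsqr_sqrt; nra. Qed.
Lemma Cmod_le_abs z : Cmod z <= Rabs (fst z) + Rabs (snd z).
Proof.
  pose proof (Rabs_pos (fst z)). pose proof (Rabs_pos (snd z)).
  apply Rsqr_incr_0_var; [|lra]. rewrite Rsqr_pow2, Cmod_sqr. unfold Rsqr.
  rewrite <- (pow2_abs (fst z)), <- (pow2_abs (snd z)). nra.
Qed.
Lemma Cmod_minus_sym a b : Cmod (a - b)%C = Cmod (b - a)%C.
Proof. rewrite <- (Cmod_opp (a - b)%C). f_equal. ring. Qed.
Lemma Cmod_triangle3 a b c : Cmod (a + b + c)%C <= Cmod a + Cmod b + Cmod c.
Proof. eapply Rle_trans. apply Cmod_triangle. pose proof (Cmod_triangle a b). lra. Qed.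
Lemma Cmod_minus_le a b : Cmod (a - b)%C <= Cmod a + Cmod b.
Proof. unfold Cminus. eapply Rle_trans. apply Cmod_triangle. now rewrite Cmod_opp; right. Qed.

Definition csum (t : nat -> C) : Prop := summable (fun n => Cmod (t n)).
Definition CS (t : nat -> C) : C := (Series (fun n => fst (t n)), Series (fun n => snd (t n))).

Lemma csum_le t s B : csum s -> (forall n, Cmod (t n) <= B * Cmod (s n)) -> csum t.
Proof.
  intros H K. apply summable_le with (fun n => B * Cmod (s n)). now apply summable_scal.
  intros n. rewrite Rabs_pos_eq by apply Cmod_ge_0. eapply Rle_trans; [apply K|apply RRle_abs].
Qed.
Lemma csum_fst t : csum t -> summable (fun n => fst (t n)).
Proof.
  intros H. apply summable_le with (fun n => Cmod (t n)); auto.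
  intros n. rewrite (Rabs_pos_eq (Cmod _)) by apply Cmod_ge_0. apply fst_le_Cmod.
Qed.
Lemma csum_snd t : csum t -> summable (fun n => snd (t n)).
Proof.
  intros H. apply summable_le with (fun n => Cmod (t n)); auto.
  intros n. rewrite (Rabs_pos_eq (Cmod _)) by apply Cmod_ge_0. apply snd_le_Cmod.
Qed.
Lemma csum_scal c t : csum t -> csum (fun n => c * t n)%C.
Proof. intros H. apply csum_le with t (Cmod c); auto. intros n. rewrite Cmod_mult; lra. Qed.
Lemma csum_plus s t : csum s -> csum t -> csum (fun n => s n + t n)%C.
Proof.
  intros H K. apply summable_le with (fun n => Cmod (s n) + Cmod (t n)). now apply summable_plus.
  intros n. rewrite !Rabs_pos_eq. apply Cmod_triangle.
  pose proof (Cmod_ge_0 (s n)). pose proof (Cmod_ge_0 (t n)). lra. apply Cmod_ge_0.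
Qed.
Lemma csum_minus s t : csum s -> csum t -> csum (fun n => s n - t n)%C.
Proof.
  intros H K. apply csum_le with (fun n => s n + (-1) * t n)%C 1.
  - apply csum_plus; auto using csum_scal.
  - intros n. right. rewrite Rmult_1_l. f_equal. ring.
Qed.
Lemma csum_S' t : csum (fun n => t (S n)) -> csum t.
Proof. intros H. apply (ex_series_incr_1 (fun n => Rabs (Cmod (t n)))). exact H. Qed.

Lemma CS_ext s t : (forall n, s n = t n) -> CS s = CS t.
Proof. intros H. unfold CS. f_equal; apply Series_ext; intros; now rewrite H. Qed.
Lemma CS_plus s t : csum s -> csum t -> CS (fun n => s n + t n)%C = (CS s + CS t)%C.
Proof.
  intros H K. apply C_eq; simpl; apply Series_plus; apply summable_ex; auto using csum_fst, csum_snd.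
Qed.
Lemma CS_minus s t : csum s -> csum t -> CS (fun n => s n - t n)%C = (CS s - CS t)%C.
Proof.
  intros H K. apply C_eq; simpl; apply Series_minus; apply summable_ex; auto using csum_fst, csum_snd.
Qed.
Lemma CS_scal c t : csum t -> CS (fun n => c * t n)%C = (c * CS t)%C.
Proof.
  intros H. assert (Hf := summable_ex _ (csum_fst _ H)). assert (Hs := summable_ex _ (csum_snd _ H)).
  destruct c as [a b]. apply C_eq; simpl.
  - rewrite <- !Series_scal_l, <- Series_minus; auto.
    + apply (ex_series_scal a (fun n => fst (t n))); auto.
    + apply (ex_series_scal b (fun n => snd (t n))); auto.
  - rewrite <- !Series_scal_l, <- Series_plus; auto.
    + apply (ex_series_scal a (fun n => snd (t n))); auto.
    + apply (ex_series_scal b (fun n => fst (t n))); auto.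
Qed.
Lemma CS_incr t : csum t -> CS t = (t O + CS (fun n => t (S n)))%C.
Proof.
  intros H. apply C_eq; simpl; apply Series_incr_1; apply summable_ex; auto using csum_fst, csum_snd.
Qed.
Lemma CS_bound t (b : nat -> R) : summable b -> (forall n, Cmod (t n) <= b n) -> Cmod (CS t) <= 2 * norm1 b.
Proof.
  intros H K. eapply Rle_trans. apply Cmod_le_abs. simpl.
  assert (A : Rabs (Series (fun n => fst (t n))) <= norm1 b).
  { apply Series_abs_le; auto. intros n. eapply Rle_trans. apply fst_le_Cmod.
    eapply Rle_trans. apply K. apply RRle_abs. }
  assert (Rabs (Series (fun n => snd (t n))) <= norm1 b).
  { apply Series_abs_le; auto. intros n. eapply Rle_trans. apply snd_le_Cmod.
    eapply Rle_trans. apply K. apply RRle_abs. }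
  lra.
Qed.

Definition rapidC (c : nat -> C) : Prop := rapid (fun n => Cmod (c n)).
Definition ps (c : nat -> C) (z : C) : C := CS (fun n => c n * z ^ n)%C.
Definition dc (c : nat -> C) (n : nat) : C := (RtoC (INR (S n)) * c (S n))%C.

Lemma Cmod_pow_le1 z n : Cmod z <= 1 -> Cmod (z ^ n)%C <= 1.
Proof.
  intros H. rewrite Cmod_pow. rewrite <- (pow1 n). apply pow_incr. split; auto. apply Cmod_ge_0.
Qed.
Lemma rapidC_csum c : rapidC c -> csum c.
Proof. intros H. now apply rapid_summable. Qed.
Lemma csum_ps c z : rapidC c -> Cmod z <= 1 -> csum (fun n => c n * z ^ n)%C.
Proof.
  intros H Hz. apply csum_le with c 1. now apply rapidC_csum.
  intros n. rewrite Cmod_mult. pose proof (Cmod_pow_le1 z n Hz). pose proof (Cmod_ge_0 (c n)). nra.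
Qed.
Lemma rapid_shift x : rapid x -> rapid (fun n => x (S n)).
Proof.
  intros H q. destruct (H q) as [C HC]. exists C. intros n. eapply Rle_trans; [|apply (HC (S n))].
  apply Rmult_le_compat_l. apply Rabs_pos. apply pow_incr. rewrite S_INR. pose proof (pos_INR n). lra.
Qed.
Lemma rapidC_dc c : rapidC c -> rapidC (dc c).
Proof.
  intros H. apply rapid_poly with (fun n => Cmod (c (S n))) 1 1%nat.
  - now apply (rapid_shift (fun n => Cmod (c n))).
  - intros n. unfold dc. rewrite Cmod_mult, Cmod_R, !Rabs_mult, Rabs_Rabsolu.
    rewrite (Rabs_pos_eq (INR (S n))) by apply pos_INR. rewrite S_INR. right. ring.
Qed.

Lemma Cpow_diff n z z0 : Cmod z <= 1 -> Cmod z0 <= 1 ->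
  Cmod (z ^ n - z0 ^ n)%C <= INR n * Cmod (z - z0)%C.
Proof.
  intros Hz Hz0. induction n.
  - simpl. replace (1 - 1)%C with (RtoC 0) by ring. rewrite Cmod_0; lra.
  - rewrite !Cpow_S, S_INR.
    replace (z * z ^ n - z0 * z0 ^ n)%C with (z * (z ^ n - z0 ^ n) + (z - z0) * z0 ^ n)%C by ring.
    eapply Rle_trans. apply Cmod_triangle. rewrite !Cmod_mult.
    pose proof (Cmod_pow_le1 z0 n Hz0). pose proof (Cmod_ge_0 (z - z0)%C).
    pose proof (Cmod_ge_0 (z ^ n - z0 ^ n)%C). nra.
Qed.
(** The derivative of [z ^ n], by cases so that the exponent [n - 1] never occurs at 0. *)
Definition dpow (n : nat) (z : C) : C := match n with O => RtoC 0 | S m => (RtoC (INR (S m)) * z ^ m)%C end.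
Lemma dpow_S n z : dpow (S n) z = (z * dpow n z + z ^ n)%C.
Proof.
  destruct n. simpl. ring. unfold dpow. rewrite (S_INR (S n)), RtoC_plus, Cpow_S. ring.
Qed.
(** The remainder for [n + 1] is [z0] times the one for [n] plus a product of two first-order
    differences, which adds at most [n |z - z0|^2]. The crude constant [n ^ 2] is enough against
    rapidly decreasing coefficients. *)
Lemma Cpow_taylor n z z0 : Cmod z <= 1 -> Cmod z0 <= 1 ->
  Cmod (z ^ n - z0 ^ n - dpow n z0 * (z - z0))%C <= INR n ^ 2 * Cmod (z - z0)%C ^ 2.
Proof.
  intros Hz Hz0. induction n.
  - simpl. replace (1 - 1 - 0 * (z - z0))%C with (RtoC 0) by ring. rewrite Cmod_0; lra.
  - rewrite !Cpow_S, dpow_S.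
    replace (z * z ^ n - z0 * z0 ^ n - (z0 * dpow n z0 + z0 ^ n) * (z - z0))%C with
      (z0 * (z ^ n - z0 ^ n - dpow n z0 * (z - z0)) + (z - z0) * (z ^ n - z0 ^ n))%C by ring.
    eapply Rle_trans. apply Cmod_triangle. rewrite !Cmod_mult.
    pose proof (Cpow_diff n z z0 Hz Hz0). pose proof (Cmod_ge_0 (z - z0)%C).
    pose proof (Cmod_ge_0 (z ^ n - z0 ^ n - dpow n z0 * (z - z0))%C).
    rewrite S_INR. pose proof (pos_INR n). set (h := Cmod (z - z0)) in *.
    assert (h * Cmod (z ^ n - z0 ^ n) <= INR n * h ^ 2) by nra.
    assert (0 <= h ^ 2) by nra.
    set (K := Cmod (z ^ n - z0 ^ n - dpow n z0 * (z - z0))) in *.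
    assert (Cmod z0 * K <= K) by nra. nra.
Qed.

(** The quadratic Taylor estimate on the closed disk makes [f] holomorphic
    inside and one-sidedly differentiable up to the circle. *)
Definition hol1 (f f' : C -> C) : Prop :=
  exists B, forall z z0, Cmod z <= 1 -> Cmod z0 <= 1 ->
    Cmod (f z) <= B /\ Cmod (f' z) <= B /\
    Cmod (f z - f z0 - f' z0 * (z - z0))%C <= B * Cmod (z - z0)%C ^ 2.

Lemma ps_dc c z : rapidC c -> Cmod z <= 1 ->
  csum (fun n => c n * dpow n z)%C /\ ps (dc c) z = CS (fun n => c n * dpow n z)%C.
Proof.
  intros H Hz. pose proof (rapidC_dc c H) as H'.
  assert (K : csum (fun n => c n * dpow n z)%C).
  { apply csum_S'. apply csum_le with (fun n => dc c n * z ^ n)%C 1.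
    now apply csum_ps. intros n. right. rewrite Rmult_1_l. f_equal. unfold dc, dpow. ring. }
  split; auto. rewrite (CS_incr _ K). change (dpow O z) with (RtoC 0). replace (c O * 0)%C with (RtoC 0) by ring.
  rewrite Cplus_0_l. apply CS_ext. intros n. unfold dc, dpow. ring.
Qed.

(** The Taylor estimates of the monomials are summed; the weights [n ^ 2] are absorbed by the decay
    of [c], uniformly up to the circle. *)
Lemma ps_hol1 c : rapidC c -> hol1 (ps c) (ps (dc c)).
Proof.
  intros H. pose proof (rapidC_dc c H) as H'.
  assert (W : summable (fun n => Cmod (c n) * (1 + INR n) ^ 2)) by now apply (rapid_weight (fun n => Cmod (c n))).
  set (N0 := norm1 (fun n => Cmod (c n))). set (N1 := norm1 (fun n => Cmod (dc c n))).
  set (N2 := norm1 (fun n => Cmod (c n) * (1 + INR n) ^ 2)).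
  assert (P0 : 0 <= N0) by now apply norm1_ge0, rapidC_csum.
  assert (P1 : 0 <= N1) by now apply norm1_ge0, rapidC_csum.
  assert (P2 : 0 <= N2) by now apply norm1_ge0.
  exists (2 * N0 + 2 * N1 + 2 * N2). intros z z0 Hz Hz0. repeat split.
  - apply Rle_trans with (2 * N0); [|lra]. apply CS_bound. now apply rapidC_csum.
    intros n. rewrite Cmod_mult. pose proof (Cmod_pow_le1 z n Hz). pose proof (Cmod_ge_0 (c n)). nra.
  - apply Rle_trans with (2 * N1); [|lra]. apply CS_bound. now apply rapidC_csum.
    intros n. rewrite Cmod_mult. pose proof (Cmod_pow_le1 z n Hz). pose proof (Cmod_ge_0 (dc c n)). nra.
  - destruct (ps_dc c z0 H Hz0) as [K D].
    assert (E : (ps c z - ps c z0 - ps (dc c) z0 * (z - z0))%C =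
       CS (fun n => c n * (z ^ n - z0 ^ n - dpow n z0 * (z - z0)))%C).
    { rewrite D, (Cmult_comm (CS _)). rewrite <- CS_scal by auto.
      unfold ps. rewrite <- !CS_minus; auto using csum_ps, csum_minus, csum_scal.
      apply CS_ext. intros n. ring. }
    rewrite E. set (h := Cmod (z - z0)).
    assert (0 <= h) by apply Cmod_ge_0.
    apply Rle_trans with (2 * norm1 (fun n => h ^ 2 * (Cmod (c n) * (1 + INR n) ^ 2))).
    + apply CS_bound. now apply summable_scal.
      intros n. rewrite Cmod_mult.
      pose proof (Cpow_taylor n z z0 Hz Hz0) as Q. fold h in Q. pose proof (Cmod_ge_0 (c n)).
      assert (INR n ^ 2 <= (1 + INR n) ^ 2) by (apply pow_incr; pose proof (pos_INR n); lra).
      assert (0 <= h ^ 2) by (apply pow_le; auto).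
      apply Rle_trans with (Cmod (c n) * (INR n ^ 2 * h ^ 2)). now apply Rmult_le_compat_l.
      replace (h ^ 2 * (Cmod (c n) * (1 + INR n) ^ 2)) with (Cmod (c n) * ((1 + INR n) ^ 2 * h ^ 2)) by ring.
      apply Rmult_le_compat_l; auto. apply Rmult_le_compat_r; auto.
    + assert (0 <= h ^ 2) by (apply pow_le; auto).
      unfold norm1. rewrite (Series_ext _ (fun n => h ^ 2 * Rabs (Cmod (c n) * (1 + INR n) ^ 2))).
      2:{ intros n. rewrite Rabs_mult, (Rabs_pos_eq (h ^ 2)); auto. }
      rewrite Series_scal_l. fold (norm1 (fun n => Cmod (c n) * (1 + INR n) ^ 2)). fold N2.
      rewrite <- Rmult_assoc, (Rmult_comm 2), Rmult_assoc, Rmult_comm.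
      apply Rmult_le_compat_r; auto. lra.
Qed.

Lemma hol1_bound f f' : hol1 f f' -> exists B, 0 <= B /\ forall z z0, Cmod z <= 1 -> Cmod z0 <= 1 ->
    Cmod (f z) <= B /\ Cmod (f' z) <= B /\ Cmod (f z - f z0)%C <= B * Cmod (z - z0)%C /\
    Cmod (f z - f z0 - f' z0 * (z - z0))%C <= B * Cmod (z - z0)%C ^ 2.
Proof.
  intros [B HB]. assert (B0 : 0 <= B).
  { destruct (HB 0 0) as [A _]; try (rewrite Cmod_0; lra). pose proof (Cmod_ge_0 (f 0)). lra. }
  (* Since [|z - z0| <= 2], the quadratic remainder is at most [2 B |z - z0|]; with the linear term
     this gives the Lipschitz constant [3 B]. *)
  exists (3 * B). split; [lra|]. intros z z0 Hz Hz0. destruct (HB z z0 Hz Hz0) as [A1 [A2 A3]].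
  destruct (HB z0 z Hz0 Hz) as [_ [A4 _]].
  set (h := Cmod (z - z0)) in *. assert (0 <= h) by apply Cmod_ge_0.
  assert (h <= 2). { unfold h. eapply Rle_trans. apply Cmod_minus_le. lra. }
  assert (0 <= B * h) by now apply Rmult_le_pos.
  assert (B * h ^ 2 <= 2 * (B * h)) by nra.
  assert (0 <= B * h ^ 2) by nra.
  repeat split; try lra.
  replace (f z - f z0)%C with ((f z - f z0 - f' z0 * (z - z0)) + f' z0 * (z - z0))%C by ring.
  eapply Rle_trans. apply Cmod_triangle. rewrite Cmod_mult. fold h. nra.
Qed.

Lemma hol1_ext f g f' g' : (forall z, Cmod z <= 1 -> f z = g z) -> (forall z, Cmod z <= 1 -> f' z = g' z) ->
  hol1 f f' -> hol1 g g'.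
Proof.
  intros H K [B HB]. exists B. intros z z0 Hz Hz0. rewrite <- !H, <- !K by auto. apply HB; auto.
Qed.
Lemma hol1_const c : hol1 (fun _ => c) (fun _ => 0).
Proof.
  exists (Cmod c). intros z z0 _ _. rewrite Cmod_0. pose proof (Cmod_ge_0 c).
  replace (c - c - 0 * (z - z0))%C with (RtoC 0) by ring. rewrite Cmod_0.
  assert (0 <= Cmod (z - z0) ^ 2) by (apply pow_le, Cmod_ge_0). nra.
Qed.
Lemma hol1_id : hol1 (fun z => z) (fun _ => 1).
Proof.
  exists 1. intros z z0 Hz _. rewrite Cmod_1.
  replace (z - z0 - 1 * (z - z0))%C with (RtoC 0) by ring. rewrite Cmod_0.
  assert (0 <= Cmod (z - z0) ^ 2) by (apply pow_le, Cmod_ge_0). lra.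
Qed.
Lemma hol1_plus f f' g g' : hol1 f f' -> hol1 g g' ->
  hol1 (fun z => f z + g z)%C (fun z => f' z + g' z)%C.
Proof.
  intros [A HA] [B HB]. exists (A + B). intros z z0 Hz Hz0.
  destruct (HA z z0 Hz Hz0) as [A1 [A2 A3]], (HB z z0 Hz Hz0) as [B1 [B2 B3]].
  repeat split; try (eapply Rle_trans; [apply Cmod_triangle|lra]).
  replace (f z + g z - (f z0 + g z0) - (f' z0 + g' z0) * (z - z0))%C with
    ((f z - f z0 - f' z0 * (z - z0)) + (g z - g z0 - g' z0 * (z - z0)))%C by ring.
  eapply Rle_trans; [apply Cmod_triangle|lra].
Qed.
Lemma mult_le_compat4 a b x y : 0 <= a -> 0 <= b -> a <= x -> b <= y -> a * b <= x * y.
Proof. intros. apply Rmult_le_compat; auto. Qed.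

Lemma hol1_mult f f' g g' : hol1 f f' -> hol1 g g' ->
  hol1 (fun z => f z * g z)%C (fun z => f' z * g z + f z * g' z)%C.
Proof.
  intros Hf Hg. destruct (hol1_bound _ _ Hf) as [A [A0 HA]]. destruct (hol1_bound _ _ Hg) as [B [B0 HB]].
  assert (AB : 0 <= A * B) by now apply Rmult_le_pos.
  exists (3 * (A * B)). intros z z0 Hz Hz0.
  destruct (HA z z0 Hz Hz0) as [A1 [A2 [A3 A4]]], (HB z z0 Hz Hz0) as [B1 [B2 [B3 B4]]].
  destruct (HA z0 z Hz0 Hz) as [C1 [C2 _]].
  repeat split.
  - rewrite Cmod_mult. assert (Cmod (f z) * Cmod (g z) <= A * B) by (apply mult_le_compat4; auto using Cmod_ge_0). lra.
  - eapply Rle_trans; [apply Cmod_triangle|]. rewrite !Cmod_mult.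
    assert (Cmod (f' z) * Cmod (g z) <= A * B) by (apply mult_le_compat4; auto using Cmod_ge_0).
    assert (Cmod (f z) * Cmod (g' z) <= A * B) by (apply mult_le_compat4; auto using Cmod_ge_0). lra.
  - replace (f z * g z - f z0 * g z0 - (f' z0 * g z0 + f z0 * g' z0) * (z - z0))%C with
     ((f z - f z0 - f' z0 * (z - z0)) * g z + f' z0 * (z - z0) * (g z - g z0)
      + f z0 * (g z - g z0 - g' z0 * (z - z0)))%C by ring.
    eapply Rle_trans; [apply Cmod_triangle3|]. rewrite !Cmod_mult.
    set (h := Cmod (z - z0)) in *. assert (0 <= h) by apply Cmod_ge_0.
    assert (H1 : Cmod (f z - f z0 - f' z0 * (z - z0)) * Cmod (g z) <= (A * h ^ 2) * B)
      by (apply mult_le_compat4; auto using Cmod_ge_0).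
    assert (H2 : (Cmod (f' z0) * h) * Cmod (g z - g z0) <= (A * h) * (B * h)).
    { apply mult_le_compat4; auto using Cmod_ge_0. apply Rmult_le_pos; auto using Cmod_ge_0. apply Rmult_le_compat_r; auto. }
    assert (H3 : Cmod (f z0) * Cmod (g z - g z0 - g' z0 * (z - z0)) <= A * (B * h ^ 2))
      by (apply mult_le_compat4; auto using Cmod_ge_0).
    replace (3 * (A * B) * h ^ 2) with (A * h ^ 2 * B + A * h * (B * h) + A * (B * h ^ 2)) by ring. lra.
Qed.
Lemma hol1_inv g g' c : 0 < c -> (forall z, Cmod z <= 1 -> c <= Cmod (g z)) -> hol1 g g' ->
  hol1 (fun z => / g z)%C (fun z => - g' z / (g z * g z))%C.
Proof.
  intros Hc Hlow Hg. destruct (hol1_bound _ _ Hg) as [B [B0 HB]].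
  assert (NZ : forall z, Cmod z <= 1 -> g z <> 0).
  { intros z Hz E. specialize (Hlow z Hz). rewrite E, Cmod_0 in Hlow. lra. }
  assert (Hi : 0 < / c) by now apply Rinv_0_lt_compat.
  assert (LI : forall z, Cmod z <= 1 -> Cmod (/ g z) <= / c).
  { intros z Hz. rewrite Cmod_inv by auto. apply Rinv_le_contravar; auto. }
  set (M := / c + B * (/ c * / c) + (B * B + B * B) * (/ c * (/ c * / c))).
  assert (I2 : 0 <= / c * / c) by nra.
  assert (I3 : 0 <= / c * (/ c * / c)) by (apply Rmult_le_pos; lra).
  assert (0 <= B * (/ c * / c)) by (apply Rmult_le_pos; lra).
  assert (0 <= (B * B + B * B) * (/ c * (/ c * / c))) by (apply Rmult_le_pos; nra).
  exists M. intros z z0 Hz Hz0.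
  destruct (HB z z0 Hz Hz0) as [B1 [B2 [B3 B4]]].
  destruct (HB z0 z Hz0 Hz) as [D1 [D2 _]].
  repeat split.
  - specialize (LI z Hz). unfold M; lra.
  - replace (- g' z / (g z * g z))%C with ((- g' z) * (/ g z * / g z))%C by (field; auto).
    rewrite !Cmod_mult, Cmod_opp.
    assert (Cmod (g' z) * (Cmod (/ g z) * Cmod (/ g z)) <= B * (/ c * / c)).
    { apply mult_le_compat4; auto using Cmod_ge_0. apply Rmult_le_pos; apply Cmod_ge_0.
      apply mult_le_compat4; auto using Cmod_ge_0. }
    unfold M; lra.
  - replace (/ g z - / g z0 - - g' z0 / (g z0 * g z0) * (z - z0))%C with
     ((g' z0 * (z - z0) * (g z - g z0) + (- g z0) * (g z - g z0 - g' z0 * (z - z0))) *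
      (/ g z * (/ g z0 * / g z0)))%C by (field; auto).
    rewrite !Cmod_mult.
    set (h := Cmod (z - z0)) in *. assert (0 <= h) by apply Cmod_ge_0.
    apply Rle_trans with (((B * B + B * B) * h ^ 2) * (/ c * (/ c * / c))).
    + apply mult_le_compat4.
      * apply Cmod_ge_0.
      * repeat apply Rmult_le_pos; apply Cmod_ge_0.
      * eapply Rle_trans; [apply Cmod_triangle|]. rewrite !Cmod_mult, Cmod_opp. fold h.
        assert (H2 : (Cmod (g' z0) * h) * Cmod (g z - g z0) <= (B * h) * (B * h)).
        { apply mult_le_compat4; auto using Cmod_ge_0. apply Rmult_le_pos; auto using Cmod_ge_0. apply Rmult_le_compat_r; auto. }
        assert (H3 : Cmod (g z0) * Cmod (g z - g z0 - g' z0 * (z - z0)) <= B * (B * h ^ 2))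
          by (apply mult_le_compat4; auto using Cmod_ge_0).
        replace ((B * B + B * B) * h ^ 2) with ((B * h) * (B * h) + B * (B * h ^ 2)) by ring. lra.
      * apply mult_le_compat4; auto using Cmod_ge_0. apply Rmult_le_pos; apply Cmod_ge_0.
        apply mult_le_compat4; auto using Cmod_ge_0.
    + assert (0 <= h ^ 2) by nra. unfold M.
      replace ((B * B + B * B) * h ^ 2 * (/ c * (/ c * / c))) with ((B * B + B * B) * (/ c * (/ c * / c)) * h ^ 2) by ring.
      apply Rmult_le_compat_r; auto. lra.
Qed.

Lemma derive_of_quadratic (g : R -> R) (t l K : R) :
  locally t (fun s : R => Rabs (g s - g t - l * (s - t)) <= K * (s - t) ^ 2) -> is_derive g t l.
Proof.
  intros [d Hd]. apply is_derive_Reals. intros eps He.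
  assert (HK : 0 < Rabs K + 1) by (pose proof (Rabs_pos K); lra).
  assert (Hm : 0 < Rmin d (eps / (Rabs K + 1))).
  { apply Rmin_glb_lt. apply cond_pos. now apply Rdiv_lt_0_compat. }
  exists (mkposreal _ Hm). intros h Hh0 Hh. simpl in Hh.
  assert (Hhd : Rabs h < d) by (eapply Rlt_le_trans; [exact Hh|apply Rmin_l]).
  assert (Hhe : Rabs h < eps / (Rabs K + 1)) by (eapply Rlt_le_trans; [exact Hh|apply Rmin_r]).
  assert (B : Rabs (g (t + h) - g t - l * h) <= K * h ^ 2).
  { specialize (Hd (t + h)). replace (t + h - t) with h in Hd by ring. apply Hd.
    ballR. replace (t + h - t) with h by ring. auto. }
  replace ((g (t + h) - g t) / h - l) with ((g (t + h) - g t - l * h) / h) by (field; auto).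
  unfold Rdiv. rewrite Rabs_mult, Rabs_inv.
  assert (0 < Rabs h) by now apply Rabs_pos_lt.
  apply Rmult_lt_reg_r with (Rabs h); auto.
  rewrite Rmult_assoc, Rinv_l, Rmult_1_r by lra.
  eapply Rle_lt_trans. exact B. rewrite <- (pow2_abs h).
  assert (K <= Rabs K) by apply RRle_abs.
  assert (Rabs h * (Rabs K + 1) < eps).
  { replace eps with (eps / (Rabs K + 1) * (Rabs K + 1)) by (field; nz). apply Rmult_lt_compat_r; auto. }
  simpl. nra.
Qed.

Lemma derive_lin_bound (g : R -> R) (t l : R) : is_derive g t l ->
  locally t (fun s : R => Rabs (g s - g t) <= (Rabs l + 1) * Rabs (s - t)).
Proof.
  intros H. apply is_derive_Reals in H. destruct (H 1) as [d Hd]; [lra|].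
  exists d. refine (fun (s : R) (Hs : Rabs (s - t) < d) => _).
  destruct (Req_dec s t) as [->|Hn]. { rewrite !Rminus_diag, Rabs_R0. lra. }
  assert (Hn' : s - t <> 0) by lra.
  specialize (Hd (s - t) Hn' Hs). replace (t + (s - t)) with s in Hd by ring.
  replace (g s - g t) with ((g s - g t) / (s - t) * (s - t)) by (field; auto).
  rewrite Rabs_mult. apply Rmult_le_compat_r. apply Rabs_pos.
  apply Rabs_def2 in Hd. pose proof (Rabs_pos l). unfold Rabs at 1.
  pose proof (RRle_abs l). pose proof (Rle_abs (- l)). rewrite Rabs_Ropp in H2.
  destruct (Rcase_abs _); lra.
Qed.

(** The shape of one component of the Taylor formula along a curve: the remainder [r], a constant,
    and a linear form in the two coordinates [p] and [q]. *)
Lemma affine_derive (r p q : R -> R) (t r' p' q' a b c d x : R) :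
  is_derive r t r' -> is_derive p t p' -> is_derive q t q' -> x = r' + (a * p' + b * q') ->
  is_derive (fun s => r s + (c + (a * (p s - p t) + b * (q s - d)))) t x.
Proof.
  intros Hr Hp Hq ->. auto_derive.
  - repeat split; eexists; eauto.
  - rewrite (is_derive_unique (fun s : R => r s) _ _ Hr), (is_derive_unique (fun s : R => p s) _ _ Hp),
      (is_derive_unique (fun s : R => q s) _ _ Hq). ring.
Qed.

(** The remainder of the Taylor formula is quadratic in the displacement, hence has derivative zero
    along the curve. The curve only has to stay in the closed disk, so the chain rule also covers
    motion along the circle. *)
Lemma hol1_curve f f' (g : R -> C) (t : R) (g' : C) : hol1 f f' ->
  locally t (fun s => Cmod (g s) <= 1) ->
  is_derive (fun s => fst (g s)) t (fst g') -> is_derive (fun s => snd (g s)) t (snd g') ->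
  is_derive (fun s => fst (f (g s))) t (fst (f' (g t) * g')%C) /\
  is_derive (fun s => snd (f (g s))) t (snd (f' (g t) * g')%C).
Proof.
  intros Hf Hin Hx Hy.
  destruct Hf as [B HB].
  assert (Ht : Cmod (g t) <= 1) by now apply locally_singleton in Hin.
  assert (B0 : 0 <= B). { destruct (HB _ _ Ht Ht) as [A _]. pose proof (Cmod_ge_0 (f (g t))). lra. }
  set (r := fun s => (f (g s) - f (g t) - f' (g t) * (g s - g t))%C).
  set (a := Rabs (fst g') + 1). set (b := Rabs (snd g') + 1).
  assert (Hr : locally t (fun s => Cmod (r s) <= B * (a ^ 2 + b ^ 2) * (s - t) ^ 2)).
  { pose proof (derive_lin_bound _ _ _ Hx) as L1. pose proof (derive_lin_bound _ _ _ Hy) as L2.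
    generalize (filter_and _ _ Hin (filter_and _ _ L1 L2)). apply filter_imp. intros s [A1 [A2 A3]].
    destruct (HB _ _ A1 Ht) as [_ [_ Q]]. eapply Rle_trans. exact Q.
    rewrite Rmult_assoc. apply Rmult_le_compat_l; auto. rewrite Cmod_sqr. simpl fst. simpl snd.
    rewrite <- (pow2_abs (fst (g s) + _)), <- (pow2_abs (snd (g s) + _)), <- (pow2_abs (s - t)).
    fold a in A2. fold b in A3.
    assert (forall x y, 0 <= x -> x <= y -> x ^ 2 <= y ^ 2) as Sq by (intros; apply pow_incr; auto).
    rewrite Rmult_plus_distr_r, <- !Rpow_mult_distr.
    apply Rplus_le_compat; apply Sq; auto using Rabs_pos. }
  set (l := f' (g t)) in *.
  assert (Z : forall (p : C -> R), (forall z, Rabs (p z) <= Cmod z) -> is_derive (fun s => p (r s)) t 0).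
  { intros p Hp. apply derive_of_quadratic with (B * (a ^ 2 + b ^ 2)).
    revert Hr. apply filter_imp. intros s Hs.
    assert (p (r t) = 0).
    { assert (E : Cmod (r t) = 0). { unfold r. rewrite <- Cmod_0. f_equal. fold l. ring. }
      specialize (Hp (r t)). rewrite E in Hp. pose proof (Rabs_pos (p (r t))).
      apply Rabs_eq_0. lra. }
    rewrite H, Rmult_0_l, !Rminus_0_r. eapply Rle_trans; eauto. }
  assert (Z1 := Z fst fst_le_Cmod). assert (Z2 := Z snd snd_le_Cmod).
  split.
  - apply is_derive_ext with (fun s => fst (r s) + (fst (f (g t)) + (fst l * (fst (g s) - fst (g t)) + (- snd l) * (snd (g s) - snd (g t))))).
    { intros s. unfold r. simpl. fold l. ring. }
    eapply (affine_derive (fun s => fst (r s)) (fun s => fst (g s)) (fun s => snd (g s))); eauto. simpl. ring.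
  - apply is_derive_ext with (fun s => snd (r s) + (snd (f (g t)) + (snd l * (fst (g s) - fst (g t)) + fst l * (snd (g s) - snd (g t))))).
    { intros s. unfold r. simpl. fold l. ring. }
    eapply (affine_derive (fun s => snd (r s)) (fun s => fst (g s)) (fun s => snd (g s))); eauto. simpl. ring.
Qed.

(** * Circles and the mean value property *)

Definition cis (t : R) : C := (cos t, sin t).
Lemma Cmod_cis t : Cmod (cis t) = 1.
Proof.
  unfold Cmod, cis; simpl fst; simpl snd. rewrite <- sqrt_1. f_equal.
  pose proof (sin2_cos2 t) as H. unfold Rsqr in H. simpl. lra.
Qed.
Lemma cis_plus a b : cis (a + b) = (cis a * cis b)%C.
Proof. unfold cis. rewrite cos_plus, sin_plus. apply C_eq; simpl; ring. Qed.
Lemma cis_pow t n : (cis t ^ n)%C = cis (INR n * t).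
Proof.
  induction n.
  - simpl. unfold cis. now rewrite Rmult_0_l, cos_0, sin_0.
  - rewrite Cpow_S, IHn, S_INR, <- cis_plus. f_equal. ring.
Qed.
Lemma Cmod_scal_cis r t : 0 <= r <= 1 -> Cmod (r * cis t)%C <= 1.
Proof. intros H. rewrite Cmod_mult, Cmod_R, Cmod_cis, Rabs_pos_eq; lra. Qed.

Lemma hol1_circle f f' r (t : R) : hol1 f f' -> 0 <= r <= 1 ->
  is_derive (fun s => fst (f (r * cis s)%C)) t (fst (f' (r * cis t) * (r * (Ci * cis t)))%C) /\
  is_derive (fun s => snd (f (r * cis s)%C)) t (snd (f' (r * cis t) * (r * (Ci * cis t)))%C).
Proof.
  intros H Hr. apply (hol1_curve f f' (fun s => (r * cis s)%C)); auto.
  - apply filter_forall. intros s. now apply Cmod_scal_cis.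
  - simpl. auto_derive; auto; ring.
  - simpl. auto_derive; auto; ring.
Qed.

(** Over [n] equal steps the total variation is at most [n] times [K / n ^ 2], which tends to
    zero. *)
Lemma quadratic_const (J : R -> R) K :
  (forall r r0, 0 <= r <= 1 -> 0 <= r0 <= 1 -> Rabs (J r - J r0) <= K * (r - r0) ^ 2) -> J 1 = J 0.
Proof.
  intros H.
  assert (K0 : 0 <= K).
  { pose proof (H 1 0). pose proof (Rabs_pos (J 1 - J 0)). assert (Rabs (J 1 - J 0) <= K * (1 - 0) ^ 2) by (apply H; lra). lra. }
  assert (S : forall n, (0 < n)%nat -> forall k, (k <= n)%nat -> Rabs (J (INR k / INR n) - J 0) <= INR k * (K / (INR n) ^ 2)).
  { intros n Hn. assert (Pn : 0 < INR n) by now apply lt_0_INR.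
    induction k; intros Hk.
    - simpl. unfold Rdiv. rewrite !Rmult_0_l, Rminus_diag, Rabs_R0. lra.
    - specialize (IHk ltac:(lia)).
      assert (0 <= INR k / INR n <= 1).
      { split. apply Rmult_le_pos. apply pos_INR. left; now apply Rinv_0_lt_compat.
        apply Rmult_le_reg_r with (INR n); auto. unfold Rdiv. rewrite Rmult_assoc, Rinv_l, Rmult_1_l, Rmult_1_r by lra.
        apply le_INR; lia. }
      assert (0 <= INR (S k) / INR n <= 1).
      { split. apply Rmult_le_pos. apply pos_INR. left; now apply Rinv_0_lt_compat.
        apply Rmult_le_reg_r with (INR n); auto. unfold Rdiv. rewrite Rmult_assoc, Rinv_l, Rmult_1_l, Rmult_1_r by lra.
        apply le_INR; lia. }
      pose proof (H _ _ H1 H0) as Q.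
      replace (K * (INR (S k) / INR n - INR k / INR n) ^ 2) with (K / INR n ^ 2) in Q
        by (rewrite S_INR; field; nz).
      replace (J (INR (S k) / INR n) - J 0) with ((J (INR (S k) / INR n) - J (INR k / INR n)) + (J (INR k / INR n) - J 0)) by ring.
      eapply Rle_trans. apply Rabs_triang. rewrite (S_INR k), Rmult_plus_distr_r, Rmult_1_l. rewrite <- (S_INR k). lra. }
  apply Rminus_diag_uniq. apply NNPP. intros Hn.
  assert (Hp : 0 < Rabs (J 1 - J 0)) by now apply Rabs_pos_lt.
  destruct (archimed_cor1 (Rabs (J 1 - J 0) / (K + 1))) as [n [Hn1 Hn2]].
  { apply Rdiv_lt_0_compat; lra. }
  specialize (S n Hn2 n (Nat.le_refl n)). assert (Pn : 0 < INR n) by now apply lt_0_INR.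
  replace (INR n / INR n) with 1 in S by (field; nz).
  replace (INR n * (K / INR n ^ 2)) with (K * / INR n) in S by (field; nz).
  assert (0 < / INR n) by now apply Rinv_0_lt_compat.
  assert (/ INR n * (K + 1) < Rabs (J 1 - J 0)).
  { replace (Rabs (J 1 - J 0)) with (Rabs (J 1 - J 0) / (K + 1) * (K + 1)) by (field; nz).
    apply Rmult_lt_compat_r; lra. }
  lra.
Qed.

Lemma hol1_Lip_circle f f' r : hol1 f f' -> 0 <= r <= 1 ->
  cont (fun t => fst (f (r * cis t)%C)) /\ cont (fun t => snd (f (r * cis t)%C)).
Proof.
  intros H Hr. split.
  - refine (cont_derive _ _ (fun t => proj1 (hol1_circle f f' r t H Hr))).
  - refine (cont_derive _ _ (fun t => proj2 (hol1_circle f f' r t H Hr))).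
Qed.
(** Adding the Taylor formulas based at [z] and at [z0] isolates [(f' z - f' z0) (z - z0)], of
    quadratic size; no second derivative has to exist. *)
Lemma hol1_deriv_Lip f f' : hol1 f f' -> exists B, 0 <= B /\ forall z z0, Cmod z <= 1 -> Cmod z0 <= 1 ->
  Cmod (f' z - f' z0)%C <= B * Cmod (z - z0)%C.
Proof.
  intros H. destruct (hol1_bound _ _ H) as [B [B0 HB]]. exists (2 * B). split; [lra|].
  intros z z0 Hz Hz0.
  destruct (HB _ _ Hz Hz0) as [_ [_ [_ A]]]. destruct (HB _ _ Hz0 Hz) as [_ [_ [_ A']]].
  rewrite (Cmod_minus_sym z0 z) in A'.
  destruct (Req_dec (Cmod (z - z0)%C) 0) as [E|E].
  - apply Cmod_eq_0 in E.
    assert (Ez : z = z0) by (transitivity ((z - z0) + z0)%C; [ring|rewrite E; apply Cplus_0_l]). subst z.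
    rewrite E, Cmod_0. replace (f' z0 - f' z0)%C with (RtoC 0) by ring. rewrite Cmod_0. lra.
  - pose proof (Cmod_ge_0 (z - z0)%C). set (h := Cmod (z - z0)) in *.
    apply Rmult_le_reg_r with h; [lra|]. unfold h at 1. rewrite <- Cmod_mult.
    replace ((f' z - f' z0) * (z - z0))%C with
      ((f z0 - f z - f' z * (z0 - z)) + (f z - f z0 - f' z0 * (z - z0)))%C by ring.
    eapply Rle_trans. apply Cmod_triangle. nra.
Qed.
Lemma hol1_deriv_cont_circle f f' r : hol1 f f' -> 0 <= r <= 1 ->
  cont (fun t => fst (f' (r * cis t)%C)) /\ cont (fun t => snd (f' (r * cis t)%C)).
Proof.
  intros H Hr. destruct (hol1_deriv_Lip _ _ H) as [B [B0 HB]].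
  assert (L : forall s t, Cmod (f' (r * cis s) - f' (r * cis t))%C <= B * (Rabs (cos s - cos t) + Rabs (sin s - sin t))).
  { intros s t. eapply Rle_trans. apply HB; now apply Cmod_scal_cis.
    apply Rmult_le_compat_l; auto. replace (r * cis s - r * cis t)%C with (r * (cis s - cis t))%C by ring.
    rewrite Cmod_mult, Cmod_R, Rabs_pos_eq by lra.
    pose proof (Cmod_le_abs (cis s - cis t)%C) as Q. simpl in Q. pose proof (Cmod_ge_0 (cis s - cis t)%C).
    unfold Rminus. nra. }
  assert (Gen : forall p : C -> R, (forall a b, Rabs (p a - p b) <= Cmod (a - b)%C) -> cont (fun t => p (f' (r * cis t)%C))).
  { intros p Hp t. apply filterlim_locally. intros eps.
    assert (CC : cont (fun s => B * (Rabs (cos s - cos t) + Rabs (sin s - sin t)))) by auto 12 with cont.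
    destruct (cont_near _ t eps CC (cond_pos eps)) as [d [Hd Hn]].
    exists (mkposreal _ Hd). intros s Hs. specialize (Hn s Hs). ballR.
    rewrite !Rminus_diag, Rabs_R0, Rplus_0_r, Rmult_0_r, Rminus_0_r in Hn.
    eapply Rle_lt_trans. apply Hp. eapply Rle_lt_trans. apply L.
    eapply Rle_lt_trans. apply RRle_abs. exact Hn. }
  split; apply Gen; intros a b.
  - apply (fst_le_Cmod (a - b)%C).
  - apply (snd_le_Cmod (a - b)%C).
Qed.

(** The mean over the circle of radius [r] has vanishing first variation, so its increments are
    quadratic in [r - r0] and [quadratic_const] makes it constant from radius 0 to 1. *)
Lemma mean_value f f' : hol1 f f' -> I (fun t => fst (f (cis t))) = 2 * PI * fst (f 0).
Proof.
  intros H. destruct (hol1_bound _ _ H) as [B [B0 HB]].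
  set (J := fun r : R => I (fun t => fst (f (r * cis t)%C))).
  assert (E1 : J 1 = I (fun t => fst (f (cis t)))).
  { unfold J. apply I_ext. intros t. now rewrite Cmult_1_l. }
  assert (E0 : J 0 = 2 * PI * fst (f 0)).
  { unfold J. rewrite <- I_const. apply I_ext. intros t. now rewrite Cmult_0_l. }
  rewrite <- E1, <- E0. apply quadratic_const with (2 * PI * B).
  intros r r0 Hr Hr0.
  (* the first variation is, up to the factor r0, the theta-derivative of Im f *)
  assert (Z : I (fun t => fst (f' (r0 * cis t) * cis t)%C) = 0).
  { destruct (Req_dec r0 0) as [->|Hn].
    - rewrite (I_ext _ (fun t => fst (f' 0) * e 2 t - snd (f' 0) * e 3 t)).
      + rewrite I_minus, !I_scal by auto with cont.
        assert (I (e 2) = 0 /\ I (e 3) = 0) as [-> ->]; [|ring].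
        split.
        * rewrite (I_ext _ (fun t => cos (IZR 1 * t))). apply I_cos_Z; lia.
          intros t. now rewrite (e_even 1).
        * rewrite (I_ext _ (fun t => sin (IZR 1 * t))). apply I_sin_Z.
          intros t. now rewrite (e_odd 1).
      + intros t. rewrite (e_even 1), (e_odd 1), Cmult_0_l. simpl. rewrite !Rmult_1_l. ring.
    - apply Rmult_eq_reg_l with r0; auto. rewrite Rmult_0_r.
      destruct (hol1_deriv_cont_circle _ _ _ H Hr0) as [C1 C2].
      assert (CC : cont (fun t => fst (f' (r0 * cis t) * cis t)%C)).
      { apply cont_ext with (fun t => fst (f' (r0 * cis t)%C) * cos t - snd (f' (r0 * cis t)%C) * sin t).
        intros t; simpl; ring. auto with cont. }
      rewrite <- I_scal by auto.
      apply I_derive_periodic with (fun t => snd (f (r0 * cis t)%C)); auto with cont.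
      + intros t. unfold cis. rewrite cos_plus, sin_plus, cos_2PI, sin_2PI.
        do 3 f_equal. apply C_eq; simpl; ring.
      + intros t. destruct (hol1_circle _ _ _ t H Hr0) as [_ D].
        replace (r0 * fst (f' (r0 * cis t) * cis t)%C) with (snd (f' (r0 * cis t) * (r0 * (Ci * cis t)))%C); auto.
        simpl. ring. }
  destruct (hol1_Lip_circle _ _ r H Hr) as [K1 _]. destruct (hol1_Lip_circle _ _ r0 H Hr0) as [K2 _].
  destruct (hol1_deriv_cont_circle _ _ _ H Hr0) as [C1 C2].
  assert (CC : cont (fun t => fst (f' (r0 * cis t) * cis t)%C)).
  { apply cont_ext with (fun t => fst (f' (r0 * cis t)%C) * cos t - snd (f' (r0 * cis t)%C) * sin t).
    intros t; simpl; ring. auto with cont. }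
  unfold J.
  replace (I (fun t => fst (f (r * cis t)%C)) - I (fun t => fst (f (r0 * cis t)%C))) with
    (I (fun t => fst (f (r * cis t)%C) - fst (f (r0 * cis t)%C) - (r - r0) * fst (f' (r0 * cis t) * cis t)%C)).
  2:{ rewrite !I_minus, I_scal, Z; auto with cont. ring. }
  rewrite Rmult_assoc. apply I_bound; auto with cont. intros t.
  destruct (HB (r * cis t)%C (r0 * cis t)%C) as [_ [_ [_ Q]]]; try (now apply Cmod_scal_cis).
  replace (r * cis t - r0 * cis t)%C with (RtoC (r - r0) * cis t)%C in Q by (rewrite RtoC_minus; ring).
  rewrite Cmod_mult, Cmod_R, Cmod_cis, Rmult_1_r, pow2_abs in Q.
  eapply Rle_trans; [|exact Q]. eapply Rle_trans; [|apply fst_le_Cmod].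
  right. f_equal. simpl. ring.
Qed.

(** * The complex exponential *)

Definition Cexp (w : C) : C := (exp (fst w) * cos (snd w), exp (fst w) * sin (snd w)).

Lemma Cexp_cis w : Cexp w = (exp (fst w) * cis (snd w))%C.
Proof. apply C_eq; simpl; ring. Qed.
Lemma Cmod_Cexp w : Cmod (Cexp w) = exp (fst w).
Proof.
  rewrite Cexp_cis, Cmod_mult, Cmod_cis, Cmod_R, Rabs_pos_eq, Rmult_1_r; auto.
  left; apply exp_pos.
Qed.

Lemma taylor2 (g g1 g2 : R -> R) K : (forall t : R, is_derive g t (g1 t)) ->
  (forall t : R, is_derive g1 t (g2 t)) -> (forall t, 0 <= t <= 1 -> Rabs (g2 t) <= K) ->
  Rabs (g 1 - g 0 - g1 0) <= K.
Proof.
  intros H1 H2 HK.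
  destruct (MVT_gen g 0 1 g1) as [c [Hc E]].
  { intros; apply H1. }
  { intros x _. apply continuity_pt_filterlim. apply (cont_derive _ _ H1). }
  rewrite Rmin_left, Rmax_right in Hc by lra.
  destruct (MVT_gen g1 0 c g2) as [d [Hd E']].
  { intros; apply H2. }
  { intros x _. apply continuity_pt_filterlim. apply (cont_derive _ _ H2). }
  rewrite Rmin_left, Rmax_right in Hd by lra.
  replace (g 1 - g 0 - g1 0) with (g2 d * (c - 0)) by lra.
  rewrite Rabs_mult. assert (Hd1 : 0 <= d <= 1) by lra. specialize (HK d Hd1). pose proof (Rabs_pos (g2 d)).
  rewrite (Rabs_pos_eq (c - 0)) by lra. nra.
Qed.

(** Second-order Taylor expansion along the segment from [w0] to [w], for the real and the imaginary
    part separately. Only the real parts need a bound, because they alone govern the modulus. *)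
Lemma Cexp_taylor M w w0 : Rabs (fst w) <= M -> Rabs (fst w0) <= M ->
  Cmod (Cexp w - Cexp w0 - Cexp w0 * (w - w0))%C <= 8 * exp M * Cmod (w - w0)%C ^ 2.
Proof.
  intros Hw Hw0.
  set (x := fst w - fst w0). set (y := snd w - snd w0). set (a := fst w0). set (b := snd w0).
  assert (Hxy : Cmod (w - w0)%C ^ 2 = x ^ 2 + y ^ 2) by (rewrite Cmod_sqr; reflexivity).
  rewrite Hxy.
  assert (Bd : forall t u v, 0 <= t <= 1 -> Rabs u <= 2 * (x ^ 2 + y ^ 2) -> Rabs v <= 2 * (x^2+y^2) ->
    Rabs (exp (a + t * x) * (u * cos (b + t * y) + v * sin (b + t * y))) <= 4 * exp M * (x ^ 2 + y ^ 2)).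
  { intros t u v Ht Hu Hv. rewrite Rabs_mult, (Rabs_pos_eq (exp _)) by (left; apply exp_pos).
    assert (exp (a + t * x) <= exp M).
    { assert (a + t * x <= M) as [L|L].
      { apply Rabs_le_between in Hw, Hw0. unfold a, x. nra. }
      left; now apply exp_increasing. rewrite L; lra. }
    assert (Rabs (u * cos (b + t * y) + v * sin (b + t * y)) <= 4 * (x ^ 2 + y ^ 2)).
    { eapply Rle_trans. apply Rabs_triang. rewrite !Rabs_mult.
      assert (Rabs (cos (b + t * y)) <= 1) by (apply Rabs_le, COS_bound).
      assert (Rabs (sin (b + t * y)) <= 1) by (apply Rabs_le, SIN_bound).
      pose proof (Rabs_pos u). pose proof (Rabs_pos v). nra. }
    pose proof (exp_pos (a + t * x)). pose proof (exp_pos M).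
    pose proof (Rabs_pos (u * cos (b + t * y) + v * sin (b + t * y))).
    replace (4 * exp M * (x ^ 2 + y ^ 2)) with (exp M * (4 * (x ^ 2 + y ^ 2))) by ring.
    apply Rmult_le_compat; lra. }
  assert (Q1 : Rabs (x ^ 2 - y ^ 2) <= 2 * (x ^ 2 + y ^ 2)) by (apply Rabs_le; nra).
  assert (Q2 : Rabs (2 * x * y) <= 2 * (x ^ 2 + y ^ 2)) by (apply Rabs_le; nra).
  assert (Q3 : Rabs (- (2 * x * y)) <= 2 * (x ^ 2 + y ^ 2)) by (rewrite Rabs_Ropp; auto).
  pose proof (taylor2 (fun t => exp (a + t * x) * cos (b + t * y))
    (fun t => exp (a + t * x) * (x * cos (b + t * y) - y * sin (b + t * y)))
    (fun t => exp (a + t * x) * ((x ^ 2 - y ^ 2) * cos (b + t * y) + - (2 * x * y) * sin (b + t * y)))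
    (4 * exp M * (x ^ 2 + y ^ 2))) as T1.
  pose proof (taylor2 (fun t => exp (a + t * x) * sin (b + t * y))
    (fun t => exp (a + t * x) * (y * cos (b + t * y) + x * sin (b + t * y)))
    (fun t => exp (a + t * x) * ((2 * x * y) * cos (b + t * y) + (x ^ 2 - y ^ 2) * sin (b + t * y)))
    (4 * exp M * (x ^ 2 + y ^ 2))) as T2.
  assert (E1 : a + 1 * x = fst w) by (unfold a, x; ring).
  assert (E2 : b + 1 * y = snd w) by (unfold b, y; ring).
  cbv beta in T1, T2. rewrite E1, E2 in T1, T2. rewrite !Rmult_0_l, !Rplus_0_r in T1, T2.
  eapply Rle_trans. apply Cmod_le_abs.
  replace (fst (Cexp w - Cexp w0 - Cexp w0 * (w - w0))%C) with
    (exp (fst w) * cos (snd w) - exp a * cos b - exp a * (x * cos b - y * sin b)) by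
    (unfold a, b, x, y; simpl; ring).
  replace (snd (Cexp w - Cexp w0 - Cexp w0 * (w - w0))%C) with
    (exp (fst w) * sin (snd w) - exp a * sin b - exp a * (y * cos b + x * sin b)) by
    (unfold a, b, x, y; simpl; ring).
  replace (8 * exp M * (x ^ 2 + y ^ 2)) with (4 * exp M * (x ^ 2 + y ^ 2) + 4 * exp M * (x ^ 2 + y ^ 2)) by ring.
  apply Rplus_le_compat.
  - apply T1; auto; intros t; auto_derive; auto; ring.
  - apply T2; auto; intros t; auto_derive; auto; ring.
Qed.

Lemma hol1_exp f f' : hol1 f f' -> hol1 (fun z => Cexp (f z)) (fun z => Cexp (f z) * f' z)%C.
Proof.
  intros H. destruct (hol1_bound _ _ H) as [B [B0 HB]].
  pose proof (exp_pos B) as EB.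
  exists (exp B + exp B * B + 8 * exp B * (B * B)).
  assert (BB : 0 <= B * B) by nra.
  intros z z0 Hz Hz0.
  destruct (HB _ _ Hz Hz0) as [A1 [A2 [A3 A4]]]. destruct (HB _ _ Hz0 Hz) as [A1' [A2' _]].
  assert (R1 : Rabs (fst (f z)) <= B) by (eapply Rle_trans; [apply fst_le_Cmod|auto]).
  assert (R2 : Rabs (fst (f z0)) <= B) by (eapply Rle_trans; [apply fst_le_Cmod|auto]).
  assert (X1 : exp (fst (f z)) <= exp B).
  { apply Rabs_le_between in R1. destruct R1 as [_ [L|L]]. left; now apply exp_increasing. rewrite L; lra. }
  assert (X2 : exp (fst (f z0)) <= exp B).
  { apply Rabs_le_between in R2. destruct R2 as [_ [L|L]]. left; now apply exp_increasing. rewrite L; lra. }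
  assert (0 <= exp B * B) by (apply Rmult_le_pos; lra).
  assert (0 <= 8 * exp B * (B * B)) by (apply Rmult_le_pos; lra).
  pose proof (exp_pos (fst (f z))). pose proof (exp_pos (fst (f z0))).
  repeat split.
  - rewrite Cmod_Cexp. lra.
  - rewrite Cmod_mult, Cmod_Cexp.
    assert (exp (fst (f z)) * Cmod (f' z) <= exp B * B) by (apply mult_le_compat4; auto using Cmod_ge_0; lra). lra.
  - replace (Cexp (f z) - Cexp (f z0) - Cexp (f z0) * f' z0 * (z - z0))%C with
     ((Cexp (f z) - Cexp (f z0) - Cexp (f z0) * (f z - f z0)) + Cexp (f z0) * (f z - f z0 - f' z0 * (z - z0)))%C by ring.
    eapply Rle_trans. apply Cmod_triangle. rewrite Cmod_mult, Cmod_Cexp.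
    pose proof (Cexp_taylor B (f z) (f z0) R1 R2) as Q.
    set (h := Cmod (z - z0)) in *. assert (0 <= h) by apply Cmod_ge_0.
    assert (0 <= h ^ 2) by (apply pow_le; auto).
    assert (Cmod (f z - f z0) ^ 2 <= (B * h) ^ 2) by (apply pow_incr; split; auto using Cmod_ge_0).
    assert (8 * exp B * Cmod (f z - f z0) ^ 2 <= 8 * exp B * (B * h) ^ 2) by (apply Rmult_le_compat_l; lra).
    assert (exp (fst (f z0)) * Cmod (f z - f z0 - f' z0 * (z - z0)) <= exp B * (B * h ^ 2))
      by (apply mult_le_compat4; auto using Cmod_ge_0; lra).
    replace ((exp B + exp B * B + 8 * exp B * (B * B)) * h ^ 2) with
      (exp B * h ^ 2 + exp B * (B * h ^ 2) + 8 * exp B * (B * h) ^ 2) by ring.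
    assert (0 <= exp B * h ^ 2) by (apply Rmult_le_pos; lra). lra.
Qed.

(** * From trigonometric series to power series *)

Lemma Series_pairs y : summable y -> Series y = Series (fun k => y (2 * k)%nat + y (2 * k + 1)%nat).
Proof.
  intros H. symmetry. apply is_series_unique.
  assert (Hs := Series_correct _ (summable_ex _ H)). unfold is_series in *.
  apply filterlim_ext with (fun N => sum_n y (2 * N + 1)).
  - intros N. induction N.
    + simpl. rewrite sum_Sn, !sum_O. reflexivity.
    + rewrite sum_Sn, <- IHN. replace (2 * S N + 1)%nat with (S (S (2 * N + 1))) by lia.
      rewrite !sum_Sn. replace (S (2 * N + 1)) with (2 * S N)%nat by lia.
      replace (S (2 * S N)) with (2 * S N + 1)%nat by lia.
      toR. apply Rplus_assoc.
  - eapply filterlim_comp; [|exact Hs]. apply eventually_subseq_loc. exists O. intros n _. lia.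
Qed.

(** The sign makes the real part of [coefC x k] times [cis (k t)] equal to
    [x (2k) cos (k t) + x (2k + 1) sin (k t)]. *)
Definition coefC (x : nat -> R) (k : nat) : C := (x (2 * k)%nat, - x (2 * k + 1)%nat).

Lemma rapidC_coefC x : rapid x -> rapidC (coefC x).
Proof.
  intros H q. destruct (H q) as [C HC]. exists (C + C). intros k.
  rewrite Rabs_pos_eq by apply Cmod_ge_0.
  assert (L : Cmod (coefC x k) <= Rabs (x (2 * k)%nat) + Rabs (x (2 * k + 1)%nat)).
  { eapply Rle_trans. apply Cmod_le_abs. unfold coefC, fst, snd. rewrite Rabs_Ropp. lra. }
  pose proof (HC (2 * k)%nat) as A. pose proof (HC (2 * k + 1)%nat) as B.
  assert (W : forall j, (k <= j)%nat -> (1 + INR k) ^ q <= (1 + INR j) ^ q).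
  { intros j Hj. apply pow_incr. pose proof (pos_INR k). apply le_INR in Hj. lra. }
  pose proof (W (2 * k)%nat ltac:(lia)). pose proof (W (2 * k + 1)%nat ltac:(lia)).
  pose proof (Rabs_pos (x (2 * k)%nat)). pose proof (Rabs_pos (x (2 * k + 1)%nat)).
  pose proof (weight_pos k q).
  apply Rle_trans with ((Rabs (x (2 * k)%nat) + Rabs (x (2 * k + 1)%nat)) * (1 + INR k) ^ q).
  - apply Rmult_le_compat_r; lra.
  - rewrite Rmult_plus_distr_r. apply Rplus_le_compat.
    + eapply Rle_trans; [apply Rmult_le_compat_l; [assumption|exact (W (2 * k)%nat ltac:(lia))]|assumption].
    + eapply Rle_trans; [apply Rmult_le_compat_l; [assumption|exact (W (2 * k + 1)%nat ltac:(lia))]|assumption].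
Qed.

Lemma ps_cis x t : rapid x -> fst (ps (coefC x) (cis t)) = T x t.
Proof.
  intros H. unfold T. rewrite Series_pairs by now apply summable_e, rapid_summable.
  change (fst (ps (coefC x) (cis t))) with (Series (fun n => fst (coefC x n * cis t ^ n)%C)).
  apply Series_ext. intros k. rewrite cis_pow, e_even, e_odd. unfold coefC, cis, Cmult, fst, snd. ring.
Qed.

Lemma dc_mult_z c z : rapidC c -> Cmod z <= 1 ->
  (z * ps (dc c) z)%C = ps (fun n => RtoC (INR n) * c n)%C z.
Proof.
  intros H Hz. unfold ps. rewrite <- CS_scal by (apply csum_ps; auto; now apply rapidC_dc).
  symmetry. rewrite CS_incr.
  - change (INR 0) with 0. rewrite !Cmult_0_l, Cplus_0_l. apply CS_ext. intros n. unfold dc. rewrite Cpow_S. ring.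
  - apply (csum_ps (fun n => RtoC (INR n) * c n)%C z); auto.
    apply rapid_poly with (fun n => Cmod (c n)) 1 1%nat; auto.
    intros n. rewrite Cmod_mult, Cmod_R, !Rabs_mult, !Rabs_Rabsolu, (Rabs_pos_eq (INR n)) by apply pos_INR.
    rewrite (Rabs_pos_eq (Cmod _)) by apply Cmod_ge_0. pose proof (Cmod_ge_0 (c n)). simpl. nra.
Qed.

(** The left side is the radial derivative of the real part, since [z f'(z)] is the derivative of
    [f] along the radius on the circle. The Dirichlet-to-Neumann map is thus diagonal in the Fourier
    basis. *)
Lemma ps_radial_cis x t : rapid x ->
  fst (cis t * ps (dc (coefC x)) (cis t))%C = T (fun n => freq n * x n) t.
Proof.
  intros H. rewrite dc_mult_z by (first [now apply rapidC_coefC | rewrite Cmod_cis; lra]).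
  rewrite <- ps_cis by now apply rapid_freq. f_equal. apply CS_ext. intros k. f_equal.
  unfold coefC. rewrite freq_even, freq_odd. apply C_eq; unfold RtoC, Cmult, fst, snd; ring.
Qed.

Lemma ps_0 c : rapidC c -> ps c 0 = c O.
Proof.
  intros H. unfold ps. rewrite CS_incr.
  - rewrite (CS_ext _ (fun n => RtoC 0 * c n)%C).
    + rewrite CS_scal by now apply rapidC_csum. simpl. ring.
    + intros n. rewrite Cpow_S. ring.
  - apply (csum_ps c 0); auto. rewrite Cmod_0; lra.
Qed.

(** * Division by a linear factor *)

(** The coefficients of [(f z - f a) / (z - a)], obtained by collecting powers of [z] in the
    quotients [(z ^ n - a ^ n) / (z - a)]. *)
Definition divdiff (c : nat -> C) (a : C) (k : nat) : C := ps (fun j => c (k + 1 + j)%nat) a.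

Lemma rapid_shift_n x k : rapid x -> rapid (fun n => x (k + n)%nat).
Proof.
  intros H. induction k; auto.
  apply rapid_shift in IHk.
  intros q. destruct (IHk q) as [C HC]. exists C. intros n. specialize (HC n).
  replace (k + S n)%nat with (S k + n)%nat in HC by lia. exact HC.
Qed.

(** The weight of index [k + 1 + j] dominates both that of [k] and that of [j]: of [q + 2] powers,
    [q] are kept for [k] and two make the sum over [j] converge. *)
Lemma rapidC_divdiff c a : rapidC c -> Cmod a <= 1 -> rapidC (divdiff c a).
Proof.
  intros H Ha q. destruct (rapid_nonneg_const _ (q + 2) H) as [C [C0 HC]].
  exists (2 * (C * norm1 (fun n => / (1 + INR n) ^ 2))). intros k.
  rewrite Rabs_pos_eq by apply Cmod_ge_0.
  pose proof (weight_pos k q) as Wk.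
  apply Rmult_le_reg_r with (/ (1 + INR k) ^ q). now apply Rinv_0_lt_compat.
  rewrite Rmult_assoc, Rinv_r, Rmult_1_r by lra.
  replace (2 * (C * norm1 (fun n => / (1 + INR n) ^ 2)) * / (1 + INR k) ^ q) with
    (2 * norm1 (fun n => (C * / (1 + INR k) ^ q) * / (1 + INR n) ^ 2)).
  - apply CS_bound. apply summable_scal, summable_inv_sq.
    intros j. rewrite Cmod_mult. pose proof (Cmod_pow_le1 a j Ha).
    specialize (HC (k + 1 + j)%nat). rewrite Rabs_pos_eq in HC by apply Cmod_ge_0.
    set (m := Cmod (c (k + 1 + j)%nat)) in *. assert (0 <= m) by apply Cmod_ge_0.
    apply Rle_trans with m. pose proof (Cmod_ge_0 (a ^ j)); nra.
    pose proof (weight_pos j 2) as Wj.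
    apply Rmult_le_reg_r with ((1 + INR k) ^ q * (1 + INR j) ^ 2). now apply Rmult_lt_0_compat.
    replace (C * / (1 + INR k) ^ q * / (1 + INR j) ^ 2 * ((1 + INR k) ^ q * (1 + INR j) ^ 2)) with C
      by (field; pose proof (pos_INR j); split; lra).
    eapply Rle_trans; [|exact HC]. apply Rmult_le_compat_l; auto. rewrite pow_add.
    apply Rmult_le_compat; try lra; apply pow_incr; rewrite !plus_INR; simpl; pose proof (pos_INR k); pose proof (pos_INR j); lra.
  - unfold norm1. rewrite (Series_ext _ (fun n => (C * / (1 + INR k) ^ q) * Rabs (/ (1 + INR n) ^ 2))).
    + rewrite Series_scal_l. ring.
    + intros n. rewrite Rabs_mult, (Rabs_pos_eq (C * _)); auto. apply Rmult_le_pos; auto.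
      left; now apply Rinv_0_lt_compat.
Qed.

(** The quotient coefficients satisfy [d k = c (k + 1) + a d (k + 1)]. Summing this against [z ^ k],
    and comparing with the splitting off of the term [k = 0], gives two expressions of the same
    series that combine to the identity. *)
Lemma divdiff_eq c a z : rapidC c -> Cmod a <= 1 -> Cmod z <= 1 ->
  (ps c z - ps c a)%C = ((z - a) * ps (divdiff c a) z)%C.
Proof.
  intros H Ha Hz. pose proof (rapidC_divdiff c a H Ha) as HD.
  assert (Sk : forall k, rapidC (fun j => c (k + j)%nat)) by (intros k; now apply (rapid_shift_n (fun n => Cmod (c n)))).
  assert (Rec : forall k, divdiff c a k = (c (k + 1)%nat + a * divdiff c a (k + 1))%C).
  { intros k. unfold divdiff at 1, ps. rewrite CS_incr by (apply (csum_ps (fun j => c (k+1+j)%nat)); auto).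
    unfold divdiff, ps. rewrite <- CS_scal by (apply (csum_ps (fun j => c (k+1+1+j)%nat)); auto).
    simpl Cpow. rewrite Nat.add_0_r, Cmult_1_r. f_equal. apply CS_ext. intros n.
    replace (k + 1 + S n)%nat with (k + 1 + 1 + n)%nat by lia. ring. }
  assert (A0 : ps c a = (c O + a * divdiff c a 0)%C).
  { unfold ps at 1. rewrite CS_incr by now apply csum_ps. simpl Cpow. rewrite Cmult_1_r. f_equal.
    unfold divdiff, ps. rewrite <- CS_scal by (apply (csum_ps (fun j => c (0+1+j)%nat)); auto).
    apply CS_ext. intros n. simpl. ring. }
  assert (Z0 : ps c z = (c O + z * ps (fun j => c (S j)) z)%C).
  { unfold ps at 1. rewrite CS_incr by now apply csum_ps. simpl Cpow. rewrite Cmult_1_r. f_equal.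
    unfold ps. rewrite <- CS_scal by (apply (csum_ps (fun j => c (S j))); auto; apply (Sk 1%nat)).
    apply CS_ext. intros n. rewrite ?Cpow_S; ring. }
  assert (P1 : ps (divdiff c a) z = (ps (fun j => c (S j)) z + a * ps (fun k => divdiff c a (S k)) z)%C).
  { unfold ps. rewrite <- CS_scal.
    - rewrite <- CS_plus.
      + apply CS_ext. intros n. rewrite Rec. rewrite Nat.add_1_r. ring.
      + apply (csum_ps (fun j => c (S j))); auto. apply (Sk 1%nat).
      + apply csum_scal. apply (csum_ps (fun k => divdiff c a (S k))); auto. now apply (rapid_shift (fun n => Cmod (divdiff c a n))).
    - apply (csum_ps (fun k => divdiff c a (S k))); auto. now apply (rapid_shift (fun n => Cmod (divdiff c a n))). }
  assert (P2 : ps (divdiff c a) z = (divdiff c a 0 + z * ps (fun k => divdiff c a (S k)) z)%C).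
  { unfold ps at 1. rewrite CS_incr by now apply csum_ps. simpl Cpow. rewrite Cmult_1_r. f_equal.
    unfold ps. rewrite <- CS_scal.
    2:{ apply (csum_ps (fun k => divdiff c a (S k))); auto. now apply (rapid_shift (fun n => Cmod (divdiff c a n))). }
    apply CS_ext. intros n. rewrite ?Cpow_S; ring. }
  rewrite Z0, A0.
  replace ((z - a) * ps (divdiff c a) z)%C with (z * ps (divdiff c a) z - a * ps (divdiff c a) z)%C by ring.
  rewrite P1 at 1. rewrite P2. ring.
Qed.

(** * Compactness *)

(** Compactness of a product of intervals, in a form without subsequences: each initial block of
    coordinates is approximated infinitely often. Coordinates are fixed one after the other by
    Bolzano-Weierstrass, each choice preserving the earlier ones, and the diagonal is taken. *)
Lemma cluster (X : nat -> nat -> R) (B : nat -> R) : (forall m k, Rabs (X m k) <= B k) ->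
  exists x : nat -> R, forall K eps M, 0 < eps ->
    exists m, (M <= m)%nat /\ forall k, (k < K)%nat -> Rabs (X m k - x k) < eps.
Proof.
  intros HB.
  set (Good := fun (K : nat) (x : nat -> R) => forall eps M, 0 < eps ->
    exists m, (M <= m)%nat /\ forall k, (k < K)%nat -> Rabs (X m k - x k) < eps).
  assert (Step : forall K x, Good K x -> exists y, Good (S K) y /\ forall k, (k < K)%nat -> y k = x k).
  { intros K x HG.
    assert (Hm : forall i : nat, exists m, (i <= m)%nat /\ forall k, (k < K)%nat -> Rabs (X m k - x k) < / (INR i + 1)).
    { intros i. apply HG. apply Rinv_0_lt_compat. pose proof (pos_INR i). lra. }
    apply choice in Hm. destruct Hm as [mm Hmm].
    destruct (Bolzano_Weierstrass (fun i => X (mm i) K) (fun r => - B K <= r <= B K) (compact_P3 _ _)) as [l Hl].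
    { intros n. apply Rabs_le_between, HB. }
    exists (fun k => if Nat.eq_dec k K then l else x k). split.
    - intros eps M He.
      destruct (archimed_cor1 eps He) as [N [HN HN0]].
      destruct (Hl (fun r => Rabs (r - l) < eps) (Nat.max M N)) as [p [Hp1 Hp2]].
      { exists (mkposreal _ He). intros r Hr. exact Hr. }
      exists (mm p). destruct (Hmm p) as [A1 A2]. split; [lia|].
      intros k Hk. destruct (Nat.eq_dec k K) as [->|Hne]; auto.
      eapply Rlt_trans. apply A2; lia. eapply Rle_lt_trans; [|exact HN].
      apply Rinv_le_contravar. now apply lt_0_INR.
      assert (N <= p)%nat by lia. apply le_INR in H. lra.
    - intros k Hk. destruct (Nat.eq_dec k K); auto; lia. }
  assert (G0 : Good 0%nat (fun _ => 0)).
  { intros eps M _. exists M. split; auto. intros k Hk; lia. }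
  (* Dependent choice: the approximation property of the first [K] coordinates travels with the
     sequence, because the next choice requires it. *)
  set (F := fix F (K : nat) : {x | Good K x} :=
    match K with
    | O => exist _ _ G0
    | S J => let s := F J in
       let t := constructive_indefinite_description _ (Step J (proj1_sig s) (proj2_sig s)) in
       exist _ (proj1_sig t) (proj1 (proj2_sig t))
    end).
  assert (Coh : forall K J, (J <= K)%nat -> forall k, (k < J)%nat -> proj1_sig (F K) k = proj1_sig (F J) k).
  { induction 1; auto. intros k Hk. rewrite <- IHle by auto. simpl.
    destruct (constructive_indefinite_description _ _) as [y [Hy1 Hy2]]. simpl. apply Hy2. lia. }
  exists (fun k => proj1_sig (F (S k)) k). intros K eps M He.
  destruct (proj2_sig (F K) eps M He) as [m [Hm1 Hm2]]. exists m. split; auto.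
  intros k Hk. rewrite <- (Coh K (S k)) by lia. auto.
Qed.

Lemma fst_diff_le (q p : C) : Rabs (fst q - fst p) <= Cmod (q - p)%C.
Proof. exact (fst_le_Cmod (q - p)%C). Qed.
Lemma snd_diff_le (q p : C) : Rabs (snd q - snd p) <= Cmod (q - p)%C.
Proof. exact (snd_le_Cmod (q - p)%C). Qed.
Lemma Cmod_diff_le (q p : C) : Cmod (q - p)%C <= Rabs (fst q - fst p) + Rabs (snd q - snd p).
Proof. exact (Cmod_le_abs (q - p)%C). Qed.

Definition compact2 (K : C -> Prop) : Prop :=
  forall u : nat -> C, (forall n, K (u n)) ->
  exists p, K p /\ forall eps M, 0 < eps -> exists m, (M <= m)%nat /\ Cmod (u m - p)%C < eps.

Definition cont_on (K : C -> Prop) (f : C -> R) : Prop :=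
  forall p, K p -> forall eps, 0 < eps -> exists d, 0 < d /\
    forall q, K q -> Cmod (q - p)%C < d -> Rabs (f q - f p) < eps.

Lemma Cmod_rev_triangle a b : Cmod a - Cmod b <= Cmod (a - b)%C.
Proof.
  assert (Cmod a <= Cmod (a - b)%C + Cmod b); [|lra].
  replace a with ((a - b) + b)%C at 1 by ring. apply Cmod_triangle.
Qed.

Lemma annulus_compact r : compact2 (fun p => r <= Cmod p <= 1).
Proof.
  intros u Hu.
  destruct (cluster (fun m k => match k with O => fst (u m) | _ => snd (u m) end) (fun _ => 1)) as [x Hx].
  { intros m k. destruct (Hu m). destruct k.
    - eapply Rle_trans; [apply fst_le_Cmod|auto].
    - eapply Rle_trans; [apply snd_le_Cmod|auto]. }
  set (p := (x O, x 1%nat) : C).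
  assert (Cl : forall eps M, 0 < eps -> exists m, (M <= m)%nat /\ Cmod (u m - p)%C < eps).
  { intros eps M He. destruct (Hx 2%nat (eps / 2) M) as [m [Hm1 Hm2]]; [lra|]. exists m. split; auto.
    eapply Rle_lt_trans. apply Cmod_diff_le.
    pose proof (Hm2 O ltac:(lia)) as A. pose proof (Hm2 1%nat ltac:(lia)) as B. simpl in *. lra. }
  exists p. split; auto. split.
  - apply Rnot_lt_le. intros L. destruct (Cl (r - Cmod p) O) as [m [_ Hm]]; [lra|].
    destruct (Hu m). pose proof (Cmod_rev_triangle (u m) p). lra.
  - apply Rnot_lt_le. intros L. destruct (Cl (Cmod p - 1) O) as [m [_ Hm]]; [lra|].
    destruct (Hu m). pose proof (Cmod_rev_triangle p (u m)). rewrite Cmod_minus_sym in H1. lra.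
Qed.
Lemma disk_compact : compact2 (fun p => Cmod p <= 1).
Proof.
  intros u Hu. destruct (annulus_compact 0 u) as [p [[_ H1] H2]].
  - intros n; split; auto. apply Cmod_ge_0.
  - exists p; auto.
Qed.

Lemma extreme_value K f : compact2 K -> cont_on K f -> (exists p, K p) ->
  exists p, K p /\ forall q, K q -> f q <= f p.
Proof.
  intros HK Hf [p0 Hp0].
  (* Composition with [atan] makes the set of values bounded before [f] is known to be bounded. *)
  destruct (completeness (fun y => exists p, K p /\ y = atan (f p))) as [M [HM1 HM2]].
  { exists (PI / 2). intros y [p [_ ->]]. pose proof (atan_bound (f p)). lra. }
  { exists (atan (f p0)); eauto. }
  assert (Hu : forall n : nat, exists p, K p /\ M - / (INR n + 1) < atan (f p)).
  { intros n. apply NNPP. intros Hn. assert (Pn : 0 < / (INR n + 1)).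
    { apply Rinv_0_lt_compat. pose proof (pos_INR n); lra. }
    assert (M <= M - / (INR n + 1)); [|lra]. apply HM2. intros y [p [Hp ->]].
    apply Rnot_lt_le. intros L. apply Hn. eauto. }
  apply choice in Hu. destruct Hu as [u Hu].
  destruct (HK u) as [p [Hp Hcl]]. { intros n; apply Hu. }
  exists p. split; auto.
  assert (HMp : M <= atan (f p)).
  { apply Rnot_lt_le. intros L. set (eps := (M - atan (f p)) / 2).
    assert (He : 0 < eps) by (unfold eps; lra).
    assert (CA : cont atan) by (intros x; apply continuous_atan).
    destruct (cont_near atan (f p) eps CA He) as [d [Hd HA]].
    destruct (Hf p Hp d Hd) as [d' [Hd' HF]].
    destruct (archimed_cor1 eps He) as [N [HN HN0]].
    destruct (Hcl d' N Hd') as [m [Hm1 Hm2]].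
    destruct (Hu m) as [U1 U2].
    specialize (HA _ (HF _ U1 Hm2)). apply Rabs_def2 in HA.
    assert (/ (INR m + 1) <= / INR N).
    { apply Rinv_le_contravar. now apply lt_0_INR. apply le_INR in Hm1. lra. }
    unfold eps in *. lra. }
  intros q Hq. apply Rnot_lt_le. intros L.
  apply atan_increasing in L. assert (atan (f q) <= M) by (apply HM1; eauto). lra.
Qed.

(** * The maximum principle *)

Lemma locally_Cmod (p : C) (P : C -> Prop) :
  @locally (prod_UniformSpace R_UniformSpace R_UniformSpace) p P <-> exists d, 0 < d /\ forall q, Cmod (q - p)%C < d -> P q.
Proof.
  split.
  - intros [d Hd]. exists d. split. apply cond_pos. intros q Hq. apply Hd.
    pose proof (fst_diff_le q p) as A. pose proof (snd_diff_le q p) as B.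
    split. eapply Rle_lt_trans; [exact A|exact Hq]. eapply Rle_lt_trans; [exact B|exact Hq].
  - intros [d [Hd H]]. assert (Hd2 : 0 < d / 2) by lra. exists (mkposreal _ Hd2).
    refine (fun (q : C) Hq => H q _). destruct Hq as [A B].
    assert (A' : Rabs (fst q - fst p) < d / 2) by exact A.
    assert (B' : Rabs (snd q - snd p) < d / 2) by exact B.
    eapply Rle_lt_trans. apply Cmod_diff_le. lra.
Qed.

(** A pointwise Laplacian asking only for second derivatives along the two axis lines through [p],
    which is what the second derivative test at a maximum uses. *)
Definition lap_at (f : C -> R) (p : C) (L : R) : Prop :=
  exists (gx gy : R -> R) (a b : R),
   locally (fst p) (fun t : R => is_derive (fun s => f (s, snd p)) t (gx t)) /\
   locally (snd p) (fun t : R => is_derive (fun s => f (fst p, s)) t (gy t)) /\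
   is_derive gx (fst p) a /\ is_derive gy (snd p) b /\ a + b = L.

Lemma second_derivative_test (g g1 : R -> R) (t a d : R) : 0 < d ->
  (forall s : R, Rabs (s - t) < d -> is_derive g s (g1 s)) -> is_derive g1 t a ->
  (forall s, Rabs (s - t) < d -> g s <= g t) -> a <= 0.
Proof.
  intros Hd Hg Hg1 Hmax.
  assert (D0 : forall s, Rabs (s - t) < d -> derivable_pt_lim g s (g1 s)) by (intros s Hs; now apply is_derive_Reals, Hg).
  assert (T0 : Rabs (t - t) < d) by (rewrite Rminus_diag, Rabs_R0; auto).
  assert (Z : g1 t = 0).
  { set (pr := exist _ (g1 t) (D0 t T0) : derivable_pt g t).
    change (derive_pt g t pr = 0).
    apply deriv_maximum with (t - d) (t + d); try lra.
    intros x H1 H2. apply Hmax. apply Rabs_def1; lra. }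
  apply Rnot_lt_le. intros Ha.
  apply is_derive_Reals in Hg1. destruct (Hg1 (a / 2)) as [d1 Hd1]; [lra|].
  set (h := Rmin d d1 / 2).
  assert (Hm : 0 < Rmin d d1) by (apply Rmin_glb_lt; auto; apply cond_pos).
  assert (Rmin d d1 <= d) by apply Rmin_l. assert (Rmin d d1 <= d1) by apply Rmin_r.
  destruct (MVT_gen g t (t + h) g1) as [c [Hc E]].
  - intros x Hx. rewrite Rmin_left, Rmax_right in Hx by (unfold h; lra). apply Hg. apply Rabs_def1; unfold h in *; lra.
  - intros x Hx. rewrite Rmin_left, Rmax_right in Hx by (unfold h; lra).
    apply derivable_continuous_pt. exists (g1 x). apply D0. apply Rabs_def1; unfold h in *; lra.
  - rewrite Rmin_left, Rmax_right in Hc by (unfold h; lra).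
    assert (Hle : g (t + h) <= g t) by (apply Hmax; apply Rabs_def1; unfold h in *; lra).
    replace (t + h - t) with h in E by ring.
    assert (Hh : 0 < h) by (unfold h; lra).
    destruct (MVT_gen g t c g1) as [c' [Hc' E']].
    { intros x Hx. rewrite Rmin_left, Rmax_right in Hx by lra. apply Hg. apply Rabs_def1; unfold h in *; lra. }
    { intros x Hx. rewrite Rmin_left, Rmax_right in Hx by lra.
      apply derivable_continuous_pt. exists (g1 x). apply D0. apply Rabs_def1; unfold h in *; lra. }
    (* The mean value point is only known to lie in the closed interval, so it may be [t] itself,
       where the derivative vanishes. *)
    destruct (Req_dec c t) as [->|Hct].
    + (* then g (t+h) = g t; compare with the midpoint *)
      clear E' Hc'. rewrite Z, Rmult_0_l in E.
      destruct (MVT_gen g (t + h / 2) (t + h) g1) as [c2 [Hc2 E2]].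
      { intros x Hx. rewrite Rmin_left, Rmax_right in Hx by lra. apply Hg. apply Rabs_def1; unfold h in *; lra. }
      { intros x Hx. rewrite Rmin_left, Rmax_right in Hx by lra.
        apply derivable_continuous_pt. exists (g1 x). apply D0. apply Rabs_def1; unfold h in *; lra. }
      rewrite Rmin_left, Rmax_right in Hc2 by lra.
      assert (g (t + h / 2) <= g t) by (apply Hmax; apply Rabs_def1; unfold h in *; lra).
      assert (P2 : 0 < g1 c2).
      { specialize (Hd1 (c2 - t) ltac:(lra)). rewrite Z in Hd1. replace (t + (c2 - t)) with c2 in Hd1 by ring.
        assert (Hs : Rabs (c2 - t) < d1) by (apply Rabs_def1; unfold h in *; lra).
        specialize (Hd1 Hs). apply Rabs_def2 in Hd1.
        replace (g1 c2) with ((g1 c2 - 0) / (c2 - t) * (c2 - t)) by (field; lra).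
        apply Rmult_lt_0_compat; lra. }
      destruct (MVT_gen g t (t + h/2) g1) as [c3 [Hc3 E3]].
      { intros x Hx. rewrite Rmin_left, Rmax_right in Hx by lra. apply Hg. apply Rabs_def1; unfold h in *; lra. }
      { intros x Hx. rewrite Rmin_left, Rmax_right in Hx by lra.
        apply derivable_continuous_pt. exists (g1 x). apply D0. apply Rabs_def1; unfold h in *; lra. }
      rewrite Rmin_left, Rmax_right in Hc3 by lra.
      assert (0 <= g1 c3).
      { destruct (Req_dec c3 t) as [->|Hn]; [lra|].
        specialize (Hd1 (c3 - t) ltac:(lra)). rewrite Z in Hd1. replace (t + (c3 - t)) with c3 in Hd1 by ring.
        assert (Hs : Rabs (c3 - t) < d1) by (apply Rabs_def1; unfold h in *; lra).
        specialize (Hd1 Hs). apply Rabs_def2 in Hd1.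
        replace (g1 c3) with ((g1 c3 - 0) / (c3 - t) * (c3 - t)) by (field; lra).
        apply Rmult_le_pos; lra. }
      nra.
    + assert (P2 : 0 < g1 c).
      { specialize (Hd1 (c - t) ltac:(lra)). rewrite Z in Hd1. replace (t + (c - t)) with c in Hd1 by ring.
        assert (Hs : Rabs (c - t) < d1) by (apply Rabs_def1; unfold h in *; lra).
        specialize (Hd1 Hs). apply Rabs_def2 in Hd1.
        replace (g1 c) with ((g1 c - 0) / (c - t) * (c - t)) by (field; lra).
        apply Rmult_lt_0_compat; lra. }
      nra.
Qed.

(** At a positive maximum both axis second derivatives are nonpositive, against [L > 0]. Boundary
    and interior points are separated by the disjunction, so the same lemma serves the disk and an
    annulus. *)
Lemma max_principle K f : compact2 K -> cont_on K f ->
  (forall p, K p -> f p <= 0 \/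
     (locally p K /\ exists L, 0 < L /\ lap_at f p L)) ->
  forall p, K p -> f p <= 0.
Proof.
  intros HK Hf H p Hp. apply Rnot_lt_le. intros Hpos.
  destruct (extreme_value K f HK Hf) as [m [Hm Hmax]]; [eauto|].
  specialize (Hmax p Hp) as Hmp.
  destruct (H m Hm) as [Hneg|[Hloc [L [HL [gx [gy [a [b [Gx [Gy [Ax [By E]]]]]]]]]]]]; [lra|].
  apply locally_Cmod in Hloc. destruct Hloc as [d [Hd HKd]].
  destruct Gx as [dx0 Gx]. destruct Gy as [dy0 Gy].
  set (r := Rmin d (Rmin dx0 dy0)).
  assert (Hr : 0 < r) by (unfold r; repeat apply Rmin_glb_lt; auto; apply cond_pos).
  assert (r <= d) by apply Rmin_l.
  assert (r <= dx0) by (eapply Rle_trans; [apply Rmin_r|apply Rmin_l]).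
  assert (r <= dy0) by (eapply Rle_trans; [apply Rmin_r|apply Rmin_r]).
  assert (a <= 0).
  { apply (second_derivative_test (fun s => f (s, snd m)) gx (fst m) a r Hr); auto.
    - intros s Hs. apply Gx. ballR. lra.
    - intros s Hs. destruct m as [m1 m2]. simpl in *. apply Hmax, HKd.
      eapply Rle_lt_trans. apply Cmod_diff_le. simpl. rewrite Rminus_diag, Rabs_R0. lra. }
  assert (b <= 0).
  { apply (second_derivative_test (fun s => f (fst m, s)) gy (snd m) b r Hr); auto.
    - intros s Hs. apply Gy. ballR. lra.
    - intros s Hs. destruct m as [m1 m2]. simpl in *. apply Hmax, HKd.
      eapply Rle_lt_trans. apply Cmod_diff_le. simpl. rewrite Rminus_diag, Rabs_R0. lra. }
  lra.
Qed.

Lemma lap_at_lin f g p L M c d : lap_at f p L -> lap_at g p M ->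
  lap_at (fun q => c * f q + d * g q) p (c * L + d * M).
Proof.
  intros [fx [fy [a [b [F1 [F2 [F3 [F4 F5]]]]]]]] [gx [gy [a' [b' [G1 [G2 [G3 [G4 G5]]]]]]]].
  assert (Lin : forall (u v : R -> R) (t u' v' : R), is_derive u t u' -> is_derive v t v' ->
     is_derive (fun s => c * u s + d * v s) t (c * u' + d * v')).
  { intros u v t u' v' Hu Hv. apply (is_derive_plus (fun s => c * u s) (fun s => d * v s)).
    apply (is_derive_scal u); auto. apply (is_derive_scal v); auto. }
  exists (fun t => c * fx t + d * gx t), (fun t => c * fy t + d * gy t), (c * a + d * a'), (c * b + d * b').
  refine (conj _ (conj _ (conj _ (conj _ _)))).
  - generalize (filter_and _ _ F1 G1). apply filter_imp. intros t [A B].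
    apply (Lin (fun s => f (s, snd p)) (fun s => g (s, snd p))); auto.
  - generalize (filter_and _ _ F2 G2). apply filter_imp. intros t [A B].
    apply (Lin (fun s => f (fst p, s)) (fun s => g (fst p, s))); auto.
  - apply Lin; auto.
  - apply Lin; auto.
  - rewrite <- F5, <- G5. ring.
Qed.
Lemma lap_at_eq f p L M : lap_at f p L -> L = M -> lap_at f p M.
Proof. now intros H <-. Qed.
Lemma lap_at_const c p : lap_at (fun _ => c) p 0.
Proof.
  exists (fun _ => 0), (fun _ => 0), 0, 0. refine (conj _ (conj _ (conj _ (conj _ _)))).
  - apply filter_forall. intros t. auto_derive; auto.
  - apply filter_forall. intros t. auto_derive; auto.
  - auto_derive; auto.
  - auto_derive; auto.
  - ring.
Qed.
Lemma lap_at_sqr p : lap_at (fun q => fst q ^ 2 + snd q ^ 2) p 4.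
Proof.
  exists (fun t => 2 * t), (fun t => 2 * t), 2, 2. refine (conj _ (conj _ (conj _ (conj _ _)))).
  - apply filter_forall. intros t. simpl. auto_derive; auto. ring.
  - apply filter_forall. intros t. simpl. auto_derive; auto. ring.
  - auto_derive; auto; ring.
  - auto_derive; auto; ring.
  - ring.
Qed.
(** In the plane the function [|x|^-2] is strictly subharmonic off the origin; it is the barrier
    from which the Hopf lemma is derived. *)
Lemma lap_at_inv_sqr p : 0 < fst p ^ 2 + snd p ^ 2 ->
  lap_at (fun q => / (fst q ^ 2 + snd q ^ 2)) p (4 / (fst p ^ 2 + snd p ^ 2) ^ 2).
Proof.
  intros Hp. destruct p as [x y]. simpl fst in *. simpl snd in *.
  assert (Nx : locally x (fun t : R => 0 < t ^ 2 + y ^ 2)).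
  { assert (Cx : cont (fun t => t ^ 2 + y ^ 2)) by auto with cont.
    destruct (cont_near _ x _ Cx Hp) as [d [Hd Hn]]. exists (mkposreal _ Hd). intros t Ht.
    specialize (Hn t Ht). apply Rabs_def2 in Hn. lra. }
  assert (Ny : locally y (fun t : R => 0 < x ^ 2 + t ^ 2)).
  { assert (Cx : cont (fun t => x ^ 2 + t ^ 2)) by auto with cont.
    destruct (cont_near _ y _ Cx Hp) as [d [Hd Hn]]. exists (mkposreal _ Hd). intros t Ht.
    specialize (Hn t Ht). apply Rabs_def2 in Hn. lra. }
  exists (fun t => - (2 * t) / (t ^ 2 + y ^ 2) ^ 2), (fun t => - (2 * t) / (x ^ 2 + t ^ 2) ^ 2).
  eexists. eexists. refine (conj _ (conj _ (conj _ (conj _ _)))).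
  - revert Nx. apply filter_imp. intros t Ht. simpl in Ht |- *. auto_derive. lra. field. lra.
  - revert Ny. apply filter_imp. intros t Ht. simpl in Ht |- *. auto_derive. lra. field. lra.
  - simpl fst. auto_derive; [apply Rgt_not_eq; simpl in Hp |- *; nra|reflexivity].
  - simpl snd. auto_derive; [apply Rgt_not_eq; simpl in Hp |- *; nra|reflexivity].
  - simpl fst. simpl snd. field. lra.
Qed.

(** * Regularity up to the boundary *)

Definition od (p : C) : Prop := Cmod p < 1.
Definition cd (p : C) : Prop := Cmod p <= 1.

Lemma dot_Cmod (p : C) : dot p p = Cmod p ^ 2.
Proof. rewrite Cmod_sqr. unfold dot. ring. Qed.
Lemma open_disk_od p : open_disk p <-> od p.
Proof.
  unfold open_disk, od. rewrite dot_Cmod. pose proof (Cmod_ge_0 p). split; intros; nra.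
Qed.
Lemma closed_disk_cd p : closed_disk p <-> cd p.
Proof.
  unfold closed_disk, cd. rewrite dot_Cmod. pose proof (Cmod_ge_0 p). split; intros; nra.
Qed.
Lemma circle_Cmod p : circle p <-> Cmod p = 1.
Proof.
  unfold circle. rewrite dot_Cmod. pose proof (Cmod_ge_0 p). split; intros H1; [nra|rewrite H1; ring].
Qed.
Lemma circle_cis p : circle p <-> exists t, p = cis t.
Proof.
  rewrite circle_Cmod. split.
  - intros H. assert (E : fst p ^ 2 + snd p ^ 2 = 1) by (rewrite <- Cmod_sqr, H; ring).
    assert (B : -1 <= fst p <= 1) by nra.
    destruct (Rle_lt_dec 0 (snd p)).
    + exists (acos (fst p)). apply C_eq; simpl. now rewrite cos_acos.
      rewrite sin_acos by auto. replace (1 - (fst p)²) with ((snd p)²) by (unfold Rsqr; lra).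
      now rewrite sqrt_Rsqr.
    + exists (- acos (fst p)). apply C_eq; simpl. now rewrite cos_neg, cos_acos.
      rewrite sin_neg, sin_acos by auto. replace (1 - (fst p)²) with ((- snd p)²) by (unfold Rsqr; lra).
      rewrite sqrt_Rsqr; lra.
  - intros [t ->]. apply Cmod_cis.
Qed.
Lemma od_open p : od p -> exists d, 0 < d /\ forall q, Cmod (q - p)%C < d -> od q.
Proof.
  intros H. exists (1 - Cmod p). split. unfold od in H; lra.
  intros q Hq. pose proof (Cmod_rev_triangle q p). unfold od in *. lra.
Qed.
Lemma interior_open_disk p : Defs.interior open_disk p <-> od p.
Proof.
  unfold Defs.interior. split.
  - intros H0. destruct (proj1 (locally_Cmod p _) H0) as [d [Hd H]]. apply open_disk_od, H. replace (p - p)%C with (RtoC 0) by ring. now rewrite Cmod_0.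
  - intros H. apply (proj2 (locally_Cmod p _)). destruct (od_open p H) as [d [Hd H1]]. exists d. split; auto. intros q Hq. now apply open_disk_od, H1.
Qed.
Lemma interior_closed_disk p : Defs.interior closed_disk p <-> od p.
Proof.
  unfold Defs.interior. split.
  - intros H0. destruct (proj1 (locally_Cmod p _) H0) as [d [Hd H]]. unfold od. apply Rnot_le_lt. intros L.
    assert (A : cd (RtoC (1 + d / 2 / Cmod p) * p)%C).
    { apply closed_disk_cd, H. replace (RtoC (1 + d / 2 / Cmod p) * p - p)%C with (RtoC (d / 2 / Cmod p) * p)%C
        by (rewrite RtoC_plus; ring).
      rewrite Cmod_mult, Cmod_R, Rabs_pos_eq. field_simplify; lra.
      apply Rmult_le_pos; [lra|]. left; apply Rinv_0_lt_compat; lra. }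
    unfold cd in A. rewrite Cmod_mult, Cmod_R, Rabs_pos_eq in A.
    + replace ((1 + d / 2 / Cmod p) * Cmod p) with (Cmod p + d / 2) in A by (field; nz). lra.
    + assert (0 <= d / 2 / Cmod p); [|lra]. apply Rmult_le_pos; [lra|]. left; apply Rinv_0_lt_compat; lra.
  - intros H. apply (proj2 (locally_Cmod p _)). destruct (od_open p H) as [d [Hd H1]]. exists d. split; auto. intros q Hq.
    apply closed_disk_cd. left. now apply H1.
Qed.

Definition Lim2 (D : C -> Prop) (f : C -> R) (p : C) (l : R) : Prop :=
  forall eps, 0 < eps -> exists d, 0 < d /\ forall q, D q -> Cmod (q - p)%C < d -> Rabs (f q - l) < eps.

Lemma filterlim_Lim2 (D D' : C -> Prop) (f : C -> R) (p : C) (l : R) : (forall q, D q <-> D' q) ->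
  filterlim f (within D (@locally (prod_UniformSpace R_UniformSpace R_UniformSpace) p)) (locally l) <-> Lim2 D' f p l.
Proof.
  intros HD. rewrite filterlim_locally. split.
  - intros H eps He. specialize (H (mkposreal _ He)). unfold within in H.
    apply locally_Cmod in H. destruct H as [d [Hd H]]. exists d. split; auto.
    intros q Hq Hqd. apply (H q Hqd), HD, Hq.
  - intros H eps. destruct (H eps (cond_pos eps)) as [d [Hd H1]]. unfold within.
    apply locally_Cmod. exists d. split; auto. intros q Hq HDq. apply H1; auto. now apply HD.
Qed.

Lemma Lim2_unique (D : C -> Prop) f p l l' : (forall d, 0 < d -> exists q, D q /\ Cmod (q - p)%C < d) ->
  Lim2 D f p l -> Lim2 D f p l' -> l = l'.
Proof.
  intros HD H H'. apply Rminus_diag_uniq. apply NNPP. intros Hn.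
  assert (He : 0 < Rabs (l - l') / 2) by (apply Rabs_pos_lt in Hn; lra).
  destruct (H _ He) as [d [Hd H1]]. destruct (H' _ He) as [d' [Hd' H2]].
  destruct (HD (Rmin d d')) as [q [Hq1 Hq2]]. now apply Rmin_glb_lt.
  assert (A := H1 q Hq1 (Rlt_le_trans _ _ _ Hq2 (Rmin_l _ _))).
  assert (B := H2 q Hq1 (Rlt_le_trans _ _ _ Hq2 (Rmin_r _ _))).
  rewrite (Rabs_minus_sym (f q)) in A. pose proof (Rabs_triang (l - f q) (f q - l')).
  replace (l - f q + (f q - l')) with (l - l') in H0 by ring. lra.
Qed.
Lemma Lim2_subset (D D' : C -> Prop) f p l : (forall q, D q -> D' q) -> Lim2 D' f p l -> Lim2 D f p l.
Proof.
  intros HD H eps He. destruct (H eps He) as [d [Hd H1]]. exists d. split; auto.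
Qed.
Lemma Lim2_ext (D : C -> Prop) f g p l : (forall q, D q -> f q = g q) -> Lim2 D f p l -> Lim2 D g p l.
Proof.
  intros HD H eps He. destruct (H eps He) as [d [Hd H1]]. exists d. split; auto.
  intros q Hq Hqd. rewrite <- HD; auto.
Qed.
Lemma Lim2_plus D f g p l m : Lim2 D f p l -> Lim2 D g p m -> Lim2 D (fun q => f q + g q) p (l + m).
Proof.
  intros H K eps He. destruct (H (eps/2)) as [d [Hd H1]]; [lra|]. destruct (K (eps/2)) as [d' [Hd' K1]]; [lra|].
  exists (Rmin d d'). split. now apply Rmin_glb_lt. intros q Hq Hqd.
  assert (A := H1 q Hq (Rlt_le_trans _ _ _ Hqd (Rmin_l _ _))).
  assert (B := K1 q Hq (Rlt_le_trans _ _ _ Hqd (Rmin_r _ _))).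
  apply Rabs_def2 in A, B. apply Rabs_def1; lra.
Qed.
Lemma Lim2_mult D f g p l m : Lim2 D f p l -> Lim2 D g p m -> Lim2 D (fun q => f q * g q) p (l * m).
Proof.
  intros H K eps He.
  set (B := Rabs l + Rabs m + 1). assert (HB : 0 < B) by (unfold B; pose proof (Rabs_pos l); pose proof (Rabs_pos m); lra).
  set (e1 := Rmin 1 (eps / (2 * B))).
  assert (He1 : 0 < e1). { apply Rmin_glb_lt. lra. apply Rdiv_lt_0_compat; lra. }
  destruct (H e1 He1) as [d [Hd H1]]. destruct (K e1 He1) as [d' [Hd' K1]].
  exists (Rmin d d'). split. now apply Rmin_glb_lt. intros q Hq Hqd.
  assert (A := H1 q Hq (Rlt_le_trans _ _ _ Hqd (Rmin_l _ _))).
  assert (A' := K1 q Hq (Rlt_le_trans _ _ _ Hqd (Rmin_r _ _))).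
  replace (f q * g q - l * m) with ((f q - l) * (g q - m) + ((f q - l) * m + l * (g q - m))) by ring.
  eapply Rle_lt_trans. apply Rabs_triang. rewrite Rabs_mult.
  eapply Rle_lt_trans. apply Rplus_le_compat_l. apply Rabs_triang. rewrite !Rabs_mult.
  assert (e1 <= 1) by apply Rmin_l. assert (e1 <= eps / (2 * B)) by apply Rmin_r.
  pose proof (Rabs_pos (f q - l)). pose proof (Rabs_pos (g q - m)). pose proof (Rabs_pos l). pose proof (Rabs_pos m).
  assert (E : eps / (2 * B) * (2 * B) = eps) by (field; nz).
  assert (e1 * B <= eps / 2) by nra.
  assert (Rabs (f q - l) * Rabs (g q - m) <= e1 * 1) by nra.
  assert (Rabs (f q - l) * Rabs m <= e1 * Rabs m) by nra.
  assert (Rabs l * Rabs (g q - m) <= Rabs l * e1) by nra.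
  unfold B in *. nra.
Qed.
Lemma Lim2_const D c p : Lim2 D (fun _ => c) p c.
Proof. intros eps He. exists 1. split; [lra|]. intros. now rewrite Rminus_diag, Rabs_R0. Qed.
Lemma Lim2_fst D p : Lim2 D (fun q => fst q) p (fst p).
Proof. intros eps He. exists eps. split; auto. intros q _ Hq. eapply Rle_lt_trans; [apply fst_diff_le|auto]. Qed.
Lemma Lim2_snd D p : Lim2 D (fun q => snd q) p (snd p).
Proof. intros eps He. exists eps. split; auto. intros q _ Hq. eapply Rle_lt_trans; [apply snd_diff_le|auto]. Qed.
Lemma Lim2_opp D f p l : Lim2 D f p l -> Lim2 D (fun q => - f q) p (- l).
Proof.
  intros H. replace (- l) with ((-1) * l) by ring.
  apply Lim2_ext with (fun q => (-1) * f q). intros; ring.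
  apply Lim2_mult; auto using Lim2_const.
Qed.
Lemma Lim2_minus D f g p l m : Lim2 D f p l -> Lim2 D g p m -> Lim2 D (fun q => f q - g q) p (l - m).
Proof. intros H K. apply Lim2_plus; auto using Lim2_opp. Qed.
Lemma Lim2_cont (u : R -> R) D f p l : Lim2 D f p l -> continuous u l -> Lim2 D (fun q => u (f q)) p (u l).
Proof.
  intros H Hu eps He.
  destruct (proj1 (filterlim_locally _ _) Hu (mkposreal _ He)) as [d1 Hd1].
  destruct (H d1 (cond_pos d1)) as [d [Hd H1]]. exists d. split; auto.
  intros q Hq Hqd. exact (Hd1 _ (H1 q Hq Hqd)).
Qed.
Lemma Lim2_inv D f p l : l <> 0 -> Lim2 D f p l -> Lim2 D (fun q => / f q) p (/ l).
Proof. intros Hl H. apply Lim2_cont; auto. now apply continuous_Rinv. Qed.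

Lemma od_dense p : cd p -> forall d, 0 < d -> exists q, od q /\ Cmod (q - p)%C < d.
Proof.
  intros Hp d Hd. set (r := Rmin (d / 2) (1 / 2)).
  assert (0 < r) by (apply Rmin_glb_lt; lra). assert (r <= d / 2) by apply Rmin_l. assert (r <= 1/2) by apply Rmin_r.
  exists (RtoC (1 - r) * p)%C. unfold od, cd in *. pose proof (Cmod_ge_0 p). split.
  - rewrite Cmod_mult, Cmod_R, Rabs_pos_eq; nra.
  - replace (RtoC (1 - r) * p - p)%C with (RtoC (- r) * p)%C by (rewrite RtoC_minus, RtoC_opp; ring).
    rewrite Cmod_mult, Cmod_R, Rabs_Ropp, Rabs_pos_eq; nra.
Qed.

Definition grad_on (D : C -> Prop) (g gx gy : C -> R) : Prop :=
  (forall p, D p -> is_derive (fun t => g (t, snd p)) (fst p) (gx p)) /\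
  (forall p, D p -> is_derive (fun t => g (fst p, t)) (snd p) (gy p)) /\
  cont_on D gx /\ cont_on D gy.

Lemma between_abs a b x : Rmin a b <= x <= Rmax a b -> Rabs (x - a) <= Rabs (b - a).
Proof.
  intros [H1 H2]. unfold Rmin, Rmax in *. destruct (Rle_dec a b).
  - rewrite !Rabs_pos_eq; lra.
  - rewrite !Rabs_left1; lra.
Qed.

Lemma mvt_abs (g g' : R -> R) (a b : R) : (forall x : R, Rmin a b <= x <= Rmax a b -> is_derive g x (g' x)) ->
  exists c, Rabs (c - a) <= Rabs (b - a) /\ g b - g a = g' c * (b - a).
Proof.
  intros H. destruct (MVT_gen g a b g') as [c [Hc E]].
  - intros x Hx. apply H. lra.
  - intros x Hx. apply derivable_continuous_pt. exists (g' x). now apply is_derive_Reals, H.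
  - exists c. split; auto. now apply between_abs.
Qed.

(** Continuous partial derivatives give total differentiability, by the mean value theorem along a
    horizontal and then a vertical segment. *)
Lemma grad_differentiable D g gx gy p : (forall q, D q -> exists d, 0 < d /\ forall r, Cmod (r - q)%C < d -> D r) ->
  grad_on D g gx gy -> D p -> differentiable_pt_lim (fun x y => g (x, y)) (fst p) (snd p) (gx p) (gy p).
Proof.
  intros HD [Hx [Hy [Cx Cy]]] Hp eps.
  destruct (HD p Hp) as [d0 [Hd0 HD0]].
  destruct (Cx p Hp (eps / 2)) as [d1 [Hd1 H1]]. pose proof (cond_pos eps); lra.
  destruct (Cy p Hp (eps / 2)) as [d2 [Hd2 H2]]. pose proof (cond_pos eps); lra.
  set (d := Rmin d0 (Rmin d1 d2)).
  assert (Hd : 0 < d) by (unfold d; repeat apply Rmin_glb_lt; auto).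
  assert (d <= d0) by apply Rmin_l.
  assert (d <= d1) by (eapply Rle_trans; [apply Rmin_r|apply Rmin_l]).
  assert (d <= d2) by (eapply Rle_trans; [apply Rmin_r|apply Rmin_r]).
  assert (Hdd : 0 < d / 2) by lra. exists (mkposreal _ Hdd). simpl. intros u v Hu Hv.
  destruct p as [x y]. simpl in *.
  assert (Near : forall s t, Rabs (s - x) <= Rabs (u - x) -> Rabs (t - y) <= Rabs (v - y) -> Cmod ((s, t) - (x, y))%C < d).
  { intros s t Hs Ht. eapply Rle_lt_trans. apply (Cmod_diff_le (s,t) (x,y)). simpl. lra. }
  destruct (mvt_abs (fun s => g (s, v)) (fun s => gx (s, v)) x u) as [c1 [Hc1 E1]].
  { intros s Hs. apply (Hx (s, v)). apply HD0. eapply Rlt_le_trans; [apply Near|]; auto. now apply between_abs. lra. }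
  destruct (mvt_abs (fun s => g (x, s)) (fun s => gy (x, s)) y v) as [c2 [Hc2 E2]].
  { intros s Hs. apply (Hy (x, s)). apply HD0. eapply Rlt_le_trans; [apply Near|]; auto.
    rewrite Rminus_diag, Rabs_R0; apply Rabs_pos. now apply between_abs. }
  replace (g (u, v) - g (x, y) - (gx (x, y) * (u - x) + gy (x, y) * (v - y))) with
    ((gx (c1, v) - gx (x, y)) * (u - x) + (gy (x, c2) - gy (x, y)) * (v - y)) by lra.
  eapply Rle_trans. apply Rabs_triang. rewrite !Rabs_mult.
  assert (N1 : Cmod ((c1, v) - (x, y))%C < d) by (apply Near; auto; lra).
  assert (N2 : Cmod ((x, c2) - (x, y))%C < d).
  { apply Near; auto. rewrite Rminus_diag, Rabs_R0; apply Rabs_pos. }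
  assert (A1 : Rabs (gx (c1, v) - gx (x, y)) < eps / 2) by (apply H1; [apply HD0|]; lra).
  assert (A2 : Rabs (gy (x, c2) - gy (x, y)) < eps / 2) by (apply H2; [apply HD0|]; lra).
  assert (M1 := Rmax_l (Rabs (u - x)) (Rabs (v - y))). assert (M2 := Rmax_r (Rabs (u - x)) (Rabs (v - y))).
  pose proof (Rabs_pos (u - x)). pose proof (Rabs_pos (v - y)).
  pose proof (Rabs_pos (gx (c1, v) - gx (x, y))). pose proof (Rabs_pos (gy (x, c2) - gy (x, y))).
  set (m := Rmax _ _) in *. nra.
Qed.

Lemma grad_curve D g gx gy (c1 c2 : R -> R) (t c1' c2' : R) :
  (forall q, D q -> exists d, 0 < d /\ forall r, Cmod (r - q)%C < d -> D r) ->
  grad_on D g gx gy -> D (c1 t, c2 t) -> is_derive c1 t c1' -> is_derive c2 t c2' ->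
  is_derive (fun s => g (c1 s, c2 s)) t (gx (c1 t, c2 t) * c1' + gy (c1 t, c2 t) * c2').
Proof.
  intros HD HG Hp H1 H2. apply is_derive_Reals. apply is_derive_Reals in H1, H2.
  apply (derivable_pt_lim_comp_2d (fun x y => g (x, y))); auto.
  apply (grad_differentiable D g gx gy (c1 t, c2 t)); auto.
Qed.

Lemma cis_Lip s t : Cmod (cis s - cis t)%C <= 2 * Rabs (s - t).
Proof.
  eapply Rle_trans. apply Cmod_diff_le. simpl.
  destruct (mvt_abs cos (fun x => - sin x) t s) as [c [_ ->]]. { intros; apply is_derive_cos. }
  destruct (mvt_abs sin cos t s) as [c' [_ ->]]. { intros; apply is_derive_sin. }
  rewrite !Rabs_mult, Rabs_Ropp.
  assert (Rabs (sin c) <= 1) by (apply Rabs_le, SIN_bound).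
  assert (Rabs (cos c') <= 1) by (apply Rabs_le, COS_bound).
  pose proof (Rabs_pos (s - t)). nra.
Qed.
Lemma Cmod_rcis r t : 0 <= r -> Cmod (RtoC r * cis t)%C = r.
Proof. intros H. rewrite Cmod_mult, Cmod_R, Cmod_cis, Rabs_pos_eq; lra. Qed.
Lemma rcis_pair r t : (RtoC r * cis t)%C = (r * cos t, r * sin t).
Proof. apply C_eq; simpl; ring. Qed.

Lemma Lim2_radial g t l : Lim2 od g (cis t) l -> forall eta d0, 0 < eta -> 0 < d0 ->
  exists d, 0 < d /\ d <= d0 /\ d <= 1 /\ forall r, 1 - d < r < 1 -> Rabs (g (RtoC r * cis t)%C - l) < eta.
Proof.
  intros H eta d0 He Hd0. destruct (H eta He) as [d [Hd H1]].
  set (d' := Rmin d (Rmin d0 1)).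
  assert (0 < d') by (unfold d'; repeat apply Rmin_glb_lt; lra).
  assert (d' <= d) by apply Rmin_l.
  assert (d' <= d0) by (eapply Rle_trans; [apply Rmin_r|apply Rmin_l]).
  assert (d' <= 1) by (eapply Rle_trans; [apply Rmin_r|apply Rmin_r]).
  exists d'. repeat split; auto. intros r Hr.
  apply H1. unfold od. rewrite Cmod_rcis; lra.
  replace (RtoC r * cis t - cis t)%C with (RtoC (r - 1) * cis t)%C by (rewrite RtoC_minus; ring).
  rewrite Cmod_mult, Cmod_R, Cmod_cis, Rabs_left1; lra.
Qed.

(** The mean value theorem is applied on a circle of radius [r < 1], where the function is of class
    C^1, and then [r] tends to 1 with the angular step fixed. The gradient limit at [cis t] controls
    all points involved at once. *)
Lemma boundary_derive g gx gy (G : R -> R) (t lx ly : R) : grad_on od g gx gy ->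
  (forall s, Lim2 od g (cis s) (G s)) -> Lim2 od gx (cis t) lx -> Lim2 od gy (cis t) ly ->
  is_derive G t (- sin t * lx + cos t * ly).
Proof.
  intros HG HL Hx Hy. set (D := - sin t * lx + cos t * ly).
  assert (HK : Lim2 od (fun q => - snd q * gx q + fst q * gy q) (cis t) D).
  { unfold D. apply Lim2_plus; apply Lim2_mult; auto.
    apply Lim2_opp. apply (Lim2_snd od (cis t)). apply (Lim2_fst od (cis t)). }
  apply is_derive_Reals. intros eps He.
  destruct (HK (eps / 2)) as [d [Hd H1]]; [lra|].
  assert (Hd4 : 0 < d / 4) by lra. exists (mkposreal _ Hd4). simpl. intros h Hh0 Hh.
  (* The slack [eta] pays for replacing the two boundary values by values at radius [r]; it is
     removed once the bound holds for every [eta]. *)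
  assert (Main : forall eta, 0 < eta -> Rabs (G (t + h) - G t - D * h) <= eps / 2 * Rabs h + eta).
  { intros eta Heta.
    destruct (Lim2_radial g t (G t) (HL t) (eta / 2) (d / 2)) as [d1 [Hd1 [Hd1' [Hd1'' R1]]]]; try lra.
    destruct (Lim2_radial g (t + h) (G (t + h)) (HL (t + h)) (eta / 2) (d / 2)) as [d2 [Hd2 [Hd2' [Hd2'' R2]]]]; try lra.
    set (r := 1 - Rmin d1 d2 / 2).
    assert (0 < Rmin d1 d2) by now apply Rmin_glb_lt.
    assert (Rmin d1 d2 <= d1) by apply Rmin_l. assert (Rmin d1 d2 <= d2) by apply Rmin_r.
    assert (Hr : 0 < r < 1) by (unfold r; lra).
    destruct (mvt_abs (fun s => g (RtoC r * cis s)%C) (fun s => - snd (RtoC r * cis s)%C * gx (RtoC r * cis s)%C + fst (RtoC r * cis s)%C * gy (RtoC r * cis s)%C) t (t + h)) as [c [Hc E]].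
    { intros s _. apply is_derive_ext with (fun s => g (r * cos s, r * sin s)). intros; now rewrite rcis_pair.
      rewrite !rcis_pair. simpl.
      assert (X : is_derive (fun s => g (r * cos s, r * sin s)) s (gx (r * cos s, r * sin s) * (- (r * sin s)) + gy (r * cos s, r * sin s) * (r * cos s))).
      { apply (grad_curve od g gx gy (fun s => r * cos s) (fun s => r * sin s)); auto using od_open.
        - rewrite <- rcis_pair. unfold od. rewrite Cmod_rcis; lra.
        - auto_derive; auto; ring.
        - auto_derive; auto; ring. }
      replace (- (r * sin s) * gx (r * cos s, r * sin s) + r * cos s * gy (r * cos s, r * sin s)) with
       (gx (r * cos s, r * sin s) * (- (r * sin s)) + gy (r * cos s, r * sin s) * (r * cos s)) by ring. exact X. }
    replace (t + h - t) with h in * by ring.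
    assert (Nc : Rabs (- snd (RtoC r * cis c)%C * gx (RtoC r * cis c)%C + fst (RtoC r * cis c)%C * gy (RtoC r * cis c)%C - D) < eps / 2).
    { apply (H1 (RtoC r * cis c)%C). unfold od. rewrite Cmod_rcis; lra.
      replace (RtoC r * cis c - cis t)%C with (RtoC (r - 1) * cis c + (cis c - cis t))%C by (rewrite RtoC_minus; ring).
      eapply Rle_lt_trans. apply Cmod_triangle. rewrite Cmod_mult, Cmod_R, Cmod_cis, Rabs_left1 by lra.
      pose proof (cis_Lip c t). unfold r. lra. }
    assert (A1 := R1 r ltac:(unfold r; lra)). assert (A2 := R2 r ltac:(unfold r; lra)).
    set (k := - snd (RtoC r * cis c)%C * gx (RtoC r * cis c)%C + fst (RtoC r * cis c)%C * gy (RtoC r * cis c)%C) in *.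
    replace (G (t + h) - G t - D * h) with
      ((k - D) * h + ((G (t + h) - g (RtoC r * cis (t + h))%C) + (g (RtoC r * cis t)%C - G t))) by lra.
    eapply Rle_trans. apply Rabs_triang. rewrite Rabs_mult.
    apply Rplus_le_compat. apply Rmult_le_compat_r. apply Rabs_pos. lra.
    eapply Rle_trans. apply Rabs_triang. rewrite (Rabs_minus_sym (G (t + h))). lra. }
  assert (Main' : Rabs (G (t + h) - G t - D * h) <= eps / 2 * Rabs h).
  { apply Rnot_lt_le. intros L. set (eta := (Rabs (G (t + h) - G t - D * h) - eps / 2 * Rabs h) / 2).
    specialize (Main eta ltac:(unfold eta; lra)). unfold eta in Main. lra. }
  replace ((G (t + h) - G t) / h - D) with ((G (t + h) - G t - D * h) / h) by (field; auto).
  unfold Rdiv. rewrite Rabs_mult, Rabs_inv. assert (0 < Rabs h) by now apply Rabs_pos_lt.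
  apply Rmult_lt_reg_r with (Rabs h); auto. rewrite Rmult_assoc, Rinv_l by lra. nra.
Qed.

(** The same comparison along a radius: differentiability holds only inside, so the segment is
    stopped at a radius [r < 1] chosen so close to 1 that the remaining piece costs less than
    [eta]. *)
Lemma boundary_radial g gx gy (t lx ly : R) : grad_on od g gx gy ->
  Lim2 od g (cis t) (g (cis t)) -> Lim2 od gx (cis t) lx -> Lim2 od gy (cis t) ly ->
  is_radial_derive g (cis t) (cos t * lx + sin t * ly).
Proof.
  intros HG HL Hx Hy. set (D := cos t * lx + sin t * ly).
  assert (HK : Lim2 od (fun q => gx q * cos t + gy q * sin t) (cis t) D).
  { unfold D. rewrite (Rmult_comm (cos t)), (Rmult_comm (sin t)).
    apply Lim2_plus; apply Lim2_mult; auto using Lim2_const. }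
  apply filterlim_locally. intros eps. pose proof (cond_pos eps) as He.
  destruct (HK (eps / 2)) as [d [Hd H1]]; [lra|].
  assert (Hm : 0 < Rmin d 1) by (apply Rmin_glb_lt; lra).
  assert (Rmin d 1 <= d) by apply Rmin_l. assert (Rmin d 1 <= 1) by apply Rmin_r.
  exists (mkposreal _ Hm). refine (fun (s : R) (Hs : Rabs (s - 1) < Rmin d 1) (Hs1 : s < 1) => _).
  apply Rabs_def2 in Hs.
  assert (Der : forall r : R, s <= r < 1 -> is_derive (fun r => g (RtoC r * cis t)%C) r
     (gx (RtoC r * cis t)%C * cos t + gy (RtoC r * cis t)%C * sin t)).
  { intros r Hr. apply is_derive_ext with (fun r => g (r * cos t, r * sin t)). intros; now rewrite rcis_pair.
    rewrite !rcis_pair.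
    apply (grad_curve od g gx gy (fun r => r * cos t) (fun r => r * sin t)); auto using od_open.
    - rewrite <- rcis_pair. unfold od. rewrite Cmod_rcis; lra.
    - auto_derive; auto; ring.
    - auto_derive; auto; ring. }
  assert (Main : forall eta, 0 < eta -> Rabs (g (RtoC s * cis t)%C - g (cis t) - D * (s - 1)) <= eps / 2 * Rabs (s - 1) + eta).
  { intros eta Heta. pose proof (Rabs_pos D) as PD.
    destruct (Lim2_radial g t _ HL (eta / 2) (Rmin (1 - s) (eta / 2 / (Rabs D + 1)))) as [d1 [Hd1 [Hd1' [Hd1'' R1]]]]; try lra.
    { apply Rmin_glb_lt. lra. apply Rdiv_lt_0_compat; lra. }
    assert (d1 <= 1 - s) by (eapply Rle_trans; [exact Hd1'|apply Rmin_l]).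
    assert (Hd1e : d1 <= eta / 2 / (Rabs D + 1)) by (eapply Rle_trans; [exact Hd1'|apply Rmin_r]).
    set (r := 1 - d1 / 2).
    assert (Hr : s < r < 1) by (unfold r; lra).
    destruct (mvt_abs (fun r => g (RtoC r * cis t)%C) (fun r => gx (RtoC r * cis t)%C * cos t + gy (RtoC r * cis t)%C * sin t) r s) as [c [Hc E]].
    { intros x Hx0. rewrite Rmin_right, Rmax_left in Hx0 by lra. apply Der. lra. }
    rewrite (Rabs_left1 (s - r)) in Hc by lra.
    assert (Hc2 : s <= c \/ c < s) by lra.
    assert (Hcs : Rabs (c - r) <= r - s) by lra. apply Rabs_le_between in Hcs.
    destruct (MVT_gen (fun r => g (RtoC r * cis t)%C) s r (fun r => gx (RtoC r * cis t)%C * cos t + gy (RtoC r * cis t)%C * sin t)) as [c' [Hc' E']].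
    { intros x Hx0. rewrite Rmin_left, Rmax_right in Hx0 by lra. apply Der. lra. }
    { intros x Hx0. rewrite Rmin_left, Rmax_right in Hx0 by lra. apply derivable_continuous_pt.
      eexists. apply is_derive_Reals. apply Der. lra. }
    rewrite Rmin_left, Rmax_right in Hc' by lra.
    assert (Nc : Rabs (gx (RtoC c' * cis t)%C * cos t + gy (RtoC c' * cis t)%C * sin t - D) < eps / 2).
    { apply (H1 (RtoC c' * cis t)%C). unfold od. rewrite Cmod_rcis; lra.
      replace (RtoC c' * cis t - cis t)%C with (RtoC (c' - 1) * cis t)%C by (rewrite RtoC_minus; ring).
      rewrite Cmod_mult, Cmod_R, Cmod_cis, Rabs_left1; lra. }
    assert (A1 := R1 r ltac:(unfold r; lra)).
    set (k := gx (RtoC c' * cis t)%C * cos t + gy (RtoC c' * cis t)%C * sin t) in *.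
    replace (g (RtoC s * cis t)%C - g (cis t) - D * (s - 1)) with
      ((k - D) * (s - r) + ((g (RtoC r * cis t)%C - g (cis t)) + D * (1 - r))) by lra.
    eapply Rle_trans. apply Rabs_triang. rewrite Rabs_mult.
    assert (Rabs (D * (1 - r)) <= eta / 2).
    { rewrite Rabs_mult, (Rabs_pos_eq (1 - r)) by lra. unfold r.
      assert (eta / 2 / (Rabs D + 1) * (Rabs D + 1) = eta / 2) by (field; nz). nra. }
    apply Rplus_le_compat.
    - apply Rmult_le_compat; try apply Rabs_pos. lra. rewrite !Rabs_left1; lra.
    - eapply Rle_trans. apply Rabs_triang. lra. }
  assert (Main' : Rabs (g (RtoC s * cis t)%C - g (cis t) - D * (s - 1)) <= eps / 2 * Rabs (s - 1)).
  { apply Rnot_lt_le. intros L. set (eta := (Rabs (g (RtoC s * cis t)%C - g (cis t) - D * (s - 1)) - eps / 2 * Rabs (s - 1)) / 2).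
    specialize (Main eta ltac:(unfold eta; lra)). unfold eta in Main. lra. }
  ballR. replace (s * fst (cis t), s * snd (cis t)) with (RtoC s * cis t)%C by (apply C_eq; simpl; ring).
  replace ((g (RtoC s * cis t)%C - g (cis t)) / (s - 1) - D) with ((g (RtoC s * cis t)%C - g (cis t) - D * (s - 1)) / (s - 1)) by (field; lra).
  unfold Rdiv. rewrite Rabs_mult, Rabs_inv. assert (0 < Rabs (s - 1)) by (apply Rabs_pos_lt; lra).
  apply Rmult_lt_reg_r with (Rabs (s - 1)); auto. rewrite Rmult_assoc, Rinv_l by lra. nra.
Qed.

Lemma radial_derive_unique g p l : is_radial_derive g p l -> radial_derive g p = l.
Proof.
  intros H. apply (iota_filterlim_locally (V := R_CompleteNormedModule)
    (fun t => (g (t * fst p, t * snd p) - g p) / (t - 1)) l H).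
Qed.

(** * Iterated partial derivatives and smoothness of power series *)

Lemma interior_along (K : C -> Prop) (p : C) a : Defs.interior K p ->
  locally (coord a p) (fun t : R => Defs.interior K (match a with AxisX => (t, snd p) | AxisY => (fst p, t) end)).
Proof.
  intros H. unfold Defs.interior in H. apply locally_locally in H. destruct H as [d Hd].
  exists d. intros t Ht. destruct a; apply Hd; split; simpl; auto; apply ball_center.
Qed.

Lemma along_at a f p t : along a f p t = f (match a with AxisX => (t, snd p) | AxisY => (fst p, t) end).
Proof. destruct a; reflexivity. Qed.

Lemma partial_ext_interior K f g a p : (forall q, Defs.interior K q -> f q = g q) -> Defs.interior K p ->
  partial a f p = partial a g p.
Proof.
  intros H Hp. apply Derive_ext_loc. generalize (interior_along K p a Hp). apply filter_imp.
  intros t Ht. rewrite !along_at. now apply H.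
Qed.
Lemma ex_partial_ext_interior K f g a p : (forall q, Defs.interior K q -> f q = g q) -> Defs.interior K p ->
  ex_partial a f p -> ex_partial a g p.
Proof.
  intros H Hp. apply ex_derive_ext_loc. generalize (interior_along K p a Hp). apply filter_imp.
  intros t Ht. rewrite !along_at. now apply H.
Qed.

(** A class of functions stable under first partial derivatives, whose members have limits at all
    points of [K], contains all iterated derivatives of each member; no formula for derivatives of
    high order is needed. It serves the power series and, later, the inverse map. *)
Lemma smooth_of_class (K : C -> Prop) (Cl : (C -> R) -> Prop) :
  (forall g, Cl g -> forall a, exists g', Cl g' /\
     forall p, Defs.interior K p -> is_derive (along a g p) (coord a p) (g' p)) ->
  (forall g, Cl g -> forall p, K p -> exists l, filterlim g (within (Defs.interior K) (locally p)) (locally l)) ->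
  forall g, Cl g -> (forall p, K p -> filterlim g (within K (locally p)) (locally (g p))) -> smooth_on K g.
Proof.
  intros Hd Hl g Hg Hc.
  assert (W : forall w, exists h, Cl h /\ forall p, Defs.interior K p -> partials w g p = h p).
  { induction w as [|a w [h [Hh E]]].
    - exists g. auto.
    - destruct (Hd h Hh a) as [h' [Hh' D]]. exists h'. split; auto. intros p Hp. simpl.
      rewrite (partial_ext_interior K _ h a p E Hp). apply is_derive_unique, D, Hp. }
  intros n. split; [|split]; auto.
  - intros w a p _ Hp. destruct (W w) as [h [Hh E]]. destruct (Hd h Hh a) as [h' [_ D]].
    apply (ex_partial_ext_interior K h); auto. intros q Hq; now rewrite E. exists (h' p). now apply D.
  - intros w p _ Hp. destruct (W w) as [h [Hh E]]. destruct (Hl h Hh p Hp) as [l Hlim]. exists l.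
    apply filterlim_within_ext with h; auto. intros q Hq. now rewrite E.
Qed.

Lemma hol1_partials f f' (p : C) : hol1 f f' -> od p ->
  is_derive (fun t => fst (f (t, snd p))) (fst p) (fst (f' p)) /\
  is_derive (fun t => fst (f (fst p, t))) (snd p) (- snd (f' p)) /\
  is_derive (fun t => snd (f (t, snd p))) (fst p) (snd (f' p)) /\
  is_derive (fun t => snd (f (fst p, t))) (snd p) (fst (f' p)).
Proof.
  intros H Hp. destruct p as [x y]. simpl fst. simpl snd.
  assert (L : locally ((x, y) : C_UniformSpace) (fun q : C => Cmod q <= 1)).
  { apply (proj2 (locally_Cmod (x,y) _)). destruct (od_open _ Hp) as [d [Hd Hq]]. exists d. split; auto.
    intros q Hqd. left. now apply Hq. }
  destruct L as [d L].
  assert (Lx : locally x (fun t : R => Cmod (t, y) <= 1)).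
  { exists d. intros t Ht. apply L. split; auto. apply ball_center. }
  assert (Ly : locally y (fun t : R => Cmod (x, t) <= 1)).
  { exists d. intros t Ht. apply L. split; auto. apply ball_center. }
  destruct (hol1_curve f f' (fun t => (t, y)) x (RtoC 1) H Lx) as [A B].
  { simpl. auto_derive; auto. }
  { simpl. auto_derive; auto. }
  destruct (hol1_curve f f' (fun t => (x, t)) y Ci H Ly) as [A' B'].
  { simpl. auto_derive; auto. }
  { simpl. auto_derive; auto. }
  rewrite Cmult_1_r in A, B.
  replace (fst (f' (x, y) * Ci)%C) with (- snd (f' (x, y))) in A' by (simpl; ring).
  replace (snd (f' (x, y) * Ci)%C) with (fst (f' (x, y))) in B' by (simpl; ring).
  auto.
Qed.

Lemma hol1_Lim2 f f' p : hol1 f f' -> cd p ->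
  Lim2 cd (fun q => fst (f q)) p (fst (f p)) /\ Lim2 cd (fun q => snd (f q)) p (snd (f p)).
Proof.
  intros H Hp. destruct (hol1_bound _ _ H) as [B [B0 HB]].
  assert (G : forall pr : C -> R, (forall a b, Rabs (pr a - pr b) <= Cmod (a - b)%C) ->
     Lim2 cd (fun q => pr (f q)) p (pr (f p))).
  { intros pr Hpr eps He. exists (eps / (B + 1)). split. apply Rdiv_lt_0_compat; lra.
    intros q Hq Hqd. eapply Rle_lt_trans. apply Hpr. destruct (HB q p Hq Hp) as [_ [_ [A _]]].
    eapply Rle_lt_trans. exact A. pose proof (Cmod_ge_0 (q - p)%C).
    replace eps with (eps / (B + 1) * (B + 1)) by (field; nz). nra. }
  split; apply G. exact fst_diff_le. exact snd_diff_le.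
Qed.

Lemma hol1_grad f f' f'' : hol1 f f' -> hol1 f' f'' ->
  grad_on od (fun p => fst (f p)) (fun p => fst (f' p)) (fun p => - snd (f' p)) /\
  grad_on od (fun p => snd (f p)) (fun p => snd (f' p)) (fun p => fst (f' p)).
Proof.
  intros H H'.
  assert (Cc : cont_on od (fun p => fst (f' p)) /\ cont_on od (fun p => - snd (f' p)) /\ cont_on od (fun p => snd (f' p))).
  { assert (S : forall q, od q -> cd q) by (intros q Hq; left; auto).
    split; [|split]; intros p Hp; pose proof (hol1_Lim2 _ _ p H' (S p Hp)) as [A B].
    - exact (Lim2_subset od cd _ p _ S A).
    - exact (Lim2_opp _ _ _ _ (Lim2_subset od cd _ p _ S B)).
    - exact (Lim2_subset od cd _ p _ S B). }
  destruct Cc as [C1 [C2 C3]].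
  split; (split; [|split; [|split]]); auto; intros p Hp; destruct (hol1_partials f f' p H Hp) as [A1 [A2 [A3 A4]]]; auto.
Qed.

Lemma ps_scal k c z : rapidC c -> cd z -> ps (fun n => k * c n)%C z = (k * ps c z)%C.
Proof.
  intros H Hz. unfold ps. rewrite <- CS_scal by now apply csum_ps. apply CS_ext. intros; ring.
Qed.
Lemma rapidC_scal k c : rapidC c -> rapidC (fun n => k * c n)%C.
Proof.
  intros H. apply rapid_poly with (fun n => Cmod (c n)) (Cmod k) O; auto.
  intros n. rewrite Cmod_mult, Rabs_mult, (Rabs_pos_eq (Cmod k)) by apply Cmod_ge_0. simpl. lra.
Qed.

(** The stable class consists of real parts of power series: the x-derivative replaces the
    coefficients by [dc b], the y-derivative by [i] times these. *)
Lemma ps_smooth_on (K : C -> Prop) c : (forall q, K q -> cd q) -> (forall q, Defs.interior K q <-> od q) ->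
  rapidC c -> smooth_on K (fun p => fst (ps c p)).
Proof.
  intros HK HI Hc.
  assert (HI' : forall q, Defs.interior K q -> cd q) by (intros q Hq; left; now apply HI).
  apply smooth_of_class with (fun g => exists c, rapidC c /\ g = fun p => fst (ps c p)).
  - intros g [b [Hb ->]] [|].
    + exists (fun p => fst (ps (dc b) p)). split. exists (dc b). split; auto using rapidC_dc.
      intros p Hp. apply HI in Hp. apply (hol1_partials _ _ p (ps_hol1 b Hb) Hp).
    + exists (fun p => fst (ps (fun n => Ci * dc b n)%C p)). split.
      * exists (fun n => Ci * dc b n)%C. split; auto using rapidC_scal, rapidC_dc.
      * intros p Hp. rewrite ps_scal; auto using rapidC_dc.
        apply HI in Hp. destruct (hol1_partials _ _ p (ps_hol1 b Hb) Hp) as [_ [A _]].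
        replace (fst (Ci * ps (dc b) p)%C) with (- snd (ps (dc b) p)) by (simpl; ring). exact A.
  - intros g [b [Hb ->]] p Hp. exists (fst (ps b p)).
    apply (filterlim_Lim2 _ (Defs.interior K)); [tauto|].
    apply Lim2_subset with cd; auto. apply (hol1_Lim2 _ _ p (ps_hol1 b Hb)); auto.
  - exists c; auto.
  - intros p Hp. apply (filterlim_Lim2 _ K); [tauto|].
    apply Lim2_subset with cd; auto. apply (hol1_Lim2 _ _ p (ps_hol1 c Hc)); auto.
Qed.

Lemma ps_harmonic c : rapidC c -> harmonic (fun p => fst (ps c p)).
Proof.
  intros H. pose proof (rapidC_dc c H) as H'. split.
  - apply ps_smooth_on; auto.
    + intros q Hq. left. now apply open_disk_od.
    + apply interior_open_disk.
  - intros p Hp. apply open_disk_od in Hp. pose proof (proj2 (interior_open_disk p) Hp) as HI. unfold laplacian.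
    rewrite (partial_ext_interior open_disk (partial AxisX _) (fun p => fst (ps (dc c) p)) AxisX p); auto.
    2:{ intros q Hq. apply is_derive_unique. apply interior_open_disk in Hq. apply (hol1_partials _ _ q (ps_hol1 c H) Hq). }
    rewrite (partial_ext_interior open_disk (partial AxisY _) (fun p => - snd (ps (dc c) p)) AxisY p); auto.
    2:{ intros q Hq. apply is_derive_unique. apply interior_open_disk in Hq. apply (hol1_partials _ _ q (ps_hol1 c H) Hq). }
    destruct (hol1_partials _ _ p (ps_hol1 _ H') Hp) as [A1 [A2 [A3 A4]]].
    assert (P1 : partial AxisX (fun p => fst (ps (dc c) p)) p = fst (ps (dc (dc c)) p))
      by exact (is_derive_unique _ _ _ A1).
    assert (P2 : partial AxisY (fun p => - snd (ps (dc c) p)) p = - fst (ps (dc (dc c)) p)).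
    { apply is_derive_unique. apply (is_derive_opp (fun t : R => snd (ps (dc c) (fst p, t)))). exact A4. }
    rewrite P1, P2. ring.
Qed.

Lemma ps_radial c t : rapidC c -> radial_derive (fun p => fst (ps c p)) (cis t) = fst (cis t * ps (dc c) (cis t))%C.
Proof.
  intros H. pose proof (rapidC_dc c H) as H'. apply radial_derive_unique.
  replace (fst (cis t * ps (dc c) (cis t))%C) with (cos t * fst (ps (dc c) (cis t)) + sin t * - snd (ps (dc c) (cis t)))
    by (simpl; ring).
  assert (Hc : cd (cis t)) by (unfold cd; rewrite Cmod_cis; lra).
  assert (S : forall q, od q -> cd q) by (intros q Hq; left; auto).
  destruct (hol1_Lim2 _ _ _ (ps_hol1 c H) Hc) as [A _].
  destruct (hol1_Lim2 _ _ _ (ps_hol1 _ H') Hc) as [B1 B2].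
  apply (boundary_radial _ (fun p => fst (ps (dc c) p)) (fun p => - snd (ps (dc c) p))).
  - apply (hol1_grad _ _ _ (ps_hol1 c H) (ps_hol1 _ H')).
  - exact (Lim2_subset od cd _ _ _ S A).
  - exact (Lim2_subset od cd _ _ _ S B1).
  - apply (Lim2_opp od (fun q => snd (ps (dc c) q))). exact (Lim2_subset od cd _ _ _ S B2).
Qed.

(** * Boundary values of functions smooth up to the boundary *)

(** The continuous extension of a partial derivative to the closed disk. On the circle [partials]
    itself is meaningless, since it would involve values of [h] outside the disk. *)
Definition bval (h : C -> R) (w : list axis) (p : C) : R := epsilon (inhabits 0) (Lim2 od (partials w h) p).

Lemma bval_spec h w p : smooth_on closed_disk h -> cd p -> Lim2 od (partials w h) p (bval h w p).
Proof.
  intros H Hp. unfold bval. apply epsilon_spec.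
  destruct (H (length w)) as [_ [H2 _]]. destruct (H2 w p) as [l Hl]; auto. now apply closed_disk_cd.
  exists l. revert Hl. apply filterlim_Lim2. apply interior_closed_disk.
Qed.
Lemma smooth_on_cont h p : smooth_on closed_disk h -> cd p -> Lim2 cd h p (h p).
Proof.
  intros H Hp. destruct (H O) as [_ [_ H3]]. specialize (H3 p (proj2 (closed_disk_cd p) Hp)).
  revert H3. apply filterlim_Lim2. apply closed_disk_cd.
Qed.
Lemma bval_nil h p : smooth_on closed_disk h -> cd p -> bval h nil p = h p.
Proof.
  intros H Hp. apply (Lim2_unique od h p).
  - now apply od_dense.
  - exact (bval_spec h nil p H Hp).
  - apply Lim2_subset with cd. intros q Hq; left; auto. now apply smooth_on_cont.
Qed.
Lemma bval_inside h w p : smooth_on closed_disk h -> od p -> bval h w p = partials w h p.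
Proof.
  intros H Hp. assert (Hc : cd p) by (left; auto).
  pose proof (bval_spec h w p H Hc) as L. symmetry. apply Rminus_diag_uniq. apply NNPP. intros Hn.
  apply Rabs_pos_lt in Hn. destruct (L _ Hn) as [d [Hd H1]].
  assert (A : Cmod (p - p)%C < d) by (replace (p - p)%C with (RtoC 0) by ring; rewrite Cmod_0; auto).
  specialize (H1 p Hp A). lra.
Qed.
Lemma partials_grad h w : smooth_on closed_disk h ->
  grad_on od (partials w h) (partials (AxisX :: w) h) (partials (AxisY :: w) h).
Proof.
  intros H.
  assert (D : forall a p, od p -> ex_partial a (partials w h) p).
  { intros a p Hp. destruct (H (S (length w))) as [H1 _]. apply H1. lia. now apply interior_closed_disk. }
  assert (Cc : forall v, cont_on od (partials v h)).
  { intros v p Hp. rewrite <- (bval_inside h v p H Hp). apply bval_spec; auto. left; auto. }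
  split; [|split; [|split]]; auto; intros p Hp.
  - apply (Derive_correct (fun t => partials w h (t, snd p)) (fst p)). exact (D AxisX p Hp).
  - apply (Derive_correct (fun t => partials w h (fst p, t)) (snd p)). exact (D AxisY p Hp).
Qed.
Lemma cd_cis t : cd (cis t).
Proof. unfold cd. rewrite Cmod_cis. lra. Qed.

Lemma bval_derive h w (t : R) : smooth_on closed_disk h ->
  is_derive (fun s => bval h w (cis s)) t
    (- sin t * bval h (AxisX :: w) (cis t) + cos t * bval h (AxisY :: w) (cis t)).
Proof.
  intros H. apply boundary_derive with (partials w h) (partials (AxisX :: w) h) (partials (AxisY :: w) h).
  - now apply partials_grad.
  - intros s. apply bval_spec; auto using cd_cis.
  - apply bval_spec; auto using cd_cis.
  - apply bval_spec; auto using cd_cis.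
Qed.
Lemma bval_smooth h w : smooth_on closed_disk h -> smooth (fun t => bval h w (cis t)).
Proof.
  intros H n. revert w. induction n; intros w.
  - simpl. apply (cont_derive _ _ (fun t => bval_derive h w t H)).
  - exists (fun t => - sin t * bval h (AxisX :: w) (cis t) + cos t * bval h (AxisY :: w) (cis t)).
    split. intros t; now apply bval_derive.
    apply Cn_plus; apply Cn_mult; auto.
    + apply Cn_opp. apply Cn_sincos, Cn_id.
    + apply Cn_sincos, Cn_id.
Qed.
Lemma trace_smooth h : smooth_on closed_disk h -> smooth (fun t => h (cis t)).
Proof.
  intros H n. apply Cn_ext with (fun t => bval h nil (cis t)).
  - intros t. apply bval_nil; auto using cd_cis.
  - now apply bval_smooth.
Qed.
Lemma periodic_cis (g : C -> R) : periodic (fun t => g (cis t)).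
Proof.
  intros t. unfold cis. rewrite cos_plus, sin_plus, cos_2PI, sin_2PI. f_equal. apply C_eq; simpl; ring.
Qed.
Lemma smooth_on_radial h t : smooth_on closed_disk h ->
  radial_derive h (cis t) = cos t * bval h (AxisX :: nil) (cis t) + sin t * bval h (AxisY :: nil) (cis t).
Proof.
  intros H. apply radial_derive_unique.
  apply (boundary_radial h (partials (AxisX :: nil) h) (partials (AxisY :: nil) h)).
  - exact (partials_grad h nil H).
  - apply Lim2_subset with cd. intros q Hq; left; auto. apply smooth_on_cont; auto using cd_cis.
  - apply bval_spec; auto using cd_cis.
  - apply bval_spec; auto using cd_cis.
Qed.

(** * Uniqueness for the Dirichlet problem and the power series of a harmonic function *)

Lemma harmonic_lap f p : harmonic f -> od p -> lap_at f p 0.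
Proof.
  intros [[H1 _] HL] Hp. pose proof (proj2 (interior_open_disk p) Hp) as HI.
  assert (D1 : forall a q, od q -> ex_partial a f q).
  { intros a q Hq. apply (H1 nil a q). simpl; lia. now apply interior_open_disk. }
  assert (D2 : forall a, ex_partial a (partial a f) p).
  { intros a. apply (H1 (a :: nil) a p). simpl; lia. auto. }
  exists (fun t => partial AxisX f (t, snd p)), (fun t => partial AxisY f (fst p, t)),
    (partial AxisX (partial AxisX f) p), (partial AxisY (partial AxisY f) p).
  refine (conj _ (conj _ (conj _ (conj _ _)))).
  - generalize (interior_along _ _ AxisX HI). apply filter_imp. intros t Ht. apply interior_open_disk in Ht.
    apply (Derive_correct (fun s => f (s, snd p)) t). exact (D1 AxisX _ Ht).
  - generalize (interior_along _ _ AxisY HI). apply filter_imp. intros t Ht. apply interior_open_disk in Ht.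
    apply (Derive_correct (fun s => f (fst p, s)) t). exact (D1 AxisY _ Ht).
  - apply (Derive_correct (fun t => partial AxisX f (t, snd p))). exact (D2 AxisX).
  - apply (Derive_correct (fun t => partial AxisY f (fst p, t))). exact (D2 AxisY).
  - apply HL. now apply open_disk_od.
Qed.

Lemma cont_on_lin K f g c d : cont_on K f -> cont_on K g -> cont_on K (fun q => c * f q + d * g q).
Proof.
  intros Hf Hg p Hp. apply (Lim2_plus K (fun q => c * f q) (fun q => d * g q)).
  - apply (Lim2_mult K (fun _ => c) f); [apply Lim2_const|exact (Hf p Hp)].
  - apply (Lim2_mult K (fun _ => d) g); [apply Lim2_const|exact (Hg p Hp)].
Qed.

(** Weak maximum principle: [f + eps (|x|^2 - 1)] is strictly subharmonic. *)
Lemma harmonic_le f : cont_on cd f -> (forall p, od p -> lap_at f p 0) ->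
  (forall t, f (cis t) <= 0) -> forall p, cd p -> f p <= 0.
Proof.
  intros Hf Hlap Hb p Hp.
  assert (M : forall eps, 0 < eps -> f p <= eps).
  { intros eps He.
    set (g := fun q : C => 1 * f q + eps * (1 * (fst q ^ 2 + snd q ^ 2) + (-1) * 1)).
    assert (Cg : cont_on cd g).
    { apply cont_on_lin; auto. apply (cont_on_lin cd (fun q => fst q ^ 2 + snd q ^ 2) (fun _ => 1)).
      - intros q Hq. simpl. apply (Lim2_plus cd (fun q => fst q * (fst q * 1)) (fun q => snd q * (snd q * 1)));
          repeat apply Lim2_mult; try apply Lim2_const; try apply Lim2_fst; try apply Lim2_snd.
      - intros q Hq. apply Lim2_const. }
    assert (G : g p <= 0).
    { apply (max_principle cd g disk_compact Cg); auto. intros q Hq.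
      destruct (Rle_lt_or_eq_dec _ _ Hq) as [L|E].
      - right. split.
        + apply (proj2 (locally_Cmod q _)). destruct (od_open q L) as [d [Hd Hr]]. exists d. split; auto.
          intros r Hrd. left. now apply Hr.
        + exists (1 * 0 + eps * (1 * 4 + (-1) * 0)). split; [lra|].
          apply lap_at_lin. now apply Hlap. apply (lap_at_lin (fun q => fst q ^ 2 + snd q ^ 2) (fun _ => 1)).
          apply lap_at_sqr. apply lap_at_const.
      - left. unfold g. rewrite <- Cmod_sqr, E.
        destruct (proj1 (circle_cis q) (proj2 (circle_Cmod q) E)) as [t ->]. specialize (Hb t). lra. }
    unfold g in G. rewrite <- Cmod_sqr in G. unfold cd in Hp. pose proof (Cmod_ge_0 p).
    assert (Cmod p ^ 2 <= 1) by nra. assert (0 <= Cmod p ^ 2) by nra. nra. }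
  apply Rnot_lt_le. intros L. specialize (M (f p / 2) ltac:(lra)). lra.
Qed.

Lemma harmonic_unique f g : cont_on cd f -> cont_on cd g -> (forall p, od p -> lap_at f p 0) ->
  (forall p, od p -> lap_at g p 0) -> (forall t, f (cis t) = g (cis t)) -> forall p, cd p -> f p = g p.
Proof.
  intros Cf Cg Lf Lg Hb p Hp. apply Rle_antisym.
  - enough (1 * f p + (-1) * g p <= 0) by lra.
    apply (harmonic_le (fun q => 1 * f q + (-1) * g q)); auto.
    + now apply cont_on_lin.
    + intros q Hq. eapply lap_at_eq. apply lap_at_lin; eauto. ring.
    + intros t. rewrite Hb. lra.
  - enough (1 * g p + (-1) * f p <= 0) by lra.
    apply (harmonic_le (fun q => 1 * g q + (-1) * f q)); auto.
    + now apply cont_on_lin.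
    + intros q Hq. eapply lap_at_eq. apply lap_at_lin; eauto. ring.
    + intros t. rewrite Hb. lra.
Qed.

Lemma ps_cont_on c : rapidC c -> cont_on cd (fun p => fst (ps c p)).
Proof. intros H p Hp. apply (hol1_Lim2 _ _ p (ps_hol1 c H) Hp). Qed.

(** The series built from the boundary Fourier coefficients has the trace of [h] by [fourier_eq];
    uniqueness of the harmonic extension does the rest. *)
Lemma harmonic_series h : smooth_on closed_disk h -> harmonic h ->
  forall p, cd p -> h p = fst (ps (coefC (fc (fun t => h (cis t)))) p).
Proof.
  intros Hs Hh. set (X := fun t => h (cis t)).
  assert (HX : rapid (fc X)) by (apply fc_rapid; [now apply trace_smooth|apply periodic_cis]).
  pose proof (rapidC_coefC _ HX) as HC.
  apply harmonic_unique.
  - intros p Hp. now apply smooth_on_cont.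
  - now apply ps_cont_on.
  - intros p Hp. now apply harmonic_lap.
  - intros p Hp. apply harmonic_lap; auto. now apply ps_harmonic.
  - intros t. rewrite ps_cis by auto. change (h (cis t)) with (X t). apply fourier_eq.
    now apply trace_smooth. apply periodic_cis.
Qed.

(** * The boundary behaviour of the immersion *)

Lemma is_derive_pair (f g : R -> R) (x a b : R) : is_derive f x a -> is_derive g x b ->
  @is_derive R_AbsRing (prod_NormedModule R_AbsRing R_NormedModule R_NormedModule) (fun t => (f t, g t)) x (a, b).
Proof.
  intros Hf Hg. unfold is_derive.
  apply (filterdiff_ext_lin (U := R_NormedModule) (V := prod_NormedModule R_AbsRing R_NormedModule R_NormedModule) _ (fun y : R => (y * a, y * b))); [|reflexivity].
  apply (filterdiff_comp'_2 (T := R_NormedModule) f g (fun u v => (u, v) : prod_NormedModule R_AbsRing R_NormedModule R_NormedModule) x (fun y : R => y * a) (fun y : R => y * b) (fun u v => (u, v)) Hf Hg).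
  apply filterdiff_ext with (fun t => t). { now intros []. }
  apply filterdiff_ext_lin with (fun t => t). { apply filterdiff_id. } now intros [].
Qed.

(** In the coordinates [(a x, b y)] the ellipse is the unit circle, and the curve is the rotation by
    [a b u]; this angular speed makes the velocity free of square roots. *)
Lemma ellipse_tangent s1 s2 q : 0 < s1 -> 0 < s2 -> ellipse s1 s2 q ->
  tangent (ellipse s1 s2) q (- s2 * snd q, s1 * fst q).
Proof.
  intros H1 H2 Hq. destruct q as [x y]. unfold ellipse in *. simpl fst in *. simpl snd in *.
  set (a := sqrt s1). set (b := sqrt s2).
  assert (Ha : 0 < a) by now apply sqrt_lt_R0. assert (Hb : 0 < b) by now apply sqrt_lt_R0.
  assert (Ea : s1 = a * a) by (unfold a; rewrite sqrt_sqrt; lra).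
  assert (Eb : s2 = b * b) by (unfold b; rewrite sqrt_sqrt; lra).
  exists (fun u => (x * cos (a * b * u) - b / a * y * sin (a * b * u), y * cos (a * b * u) + a / b * x * sin (a * b * u))).
  split; [|split].
  - intros u. simpl fst. simpl snd. rewrite Ea, Eb in *.
    set (c := cos (a * b * u)). set (s := sin (a * b * u)).
    assert (E : s ^ 2 + c ^ 2 = 1) by (rewrite <- !Rsqr_pow2; apply sin2_cos2).
    transitivity ((a * a * x ^ 2 + b * b * y ^ 2) * (s ^ 2 + c ^ 2)). field; split; lra. rewrite Hq, E. ring.
  - rewrite Rmult_0_r, cos_0, sin_0. f_equal; ring.
  - apply is_derive_pair; auto_derive; auto; rewrite Rmult_0_r, cos_0, sin_0, ?Ea, ?Eb; field; lra.
Qed.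

(** The angle is the primitive of the angular velocity [U W' - W U']. Then [U cos tau + W sin tau]
    has derivative zero and starts at 1, and two unit vectors with scalar product 1 coincide. *)
Lemma lifting (U W dU dW : R -> R) : (forall t : R, is_derive U t (dU t)) -> (forall t : R, is_derive W t (dW t)) ->
  (forall t, U t ^ 2 + W t ^ 2 = 1) -> smooth dU -> smooth dW ->
  exists tau, smooth tau /\ (forall t : R, is_derive tau t (U t * dW t - W t * dU t)) /\
    forall t, U t = cos (tau t) /\ W t = sin (tau t).
Proof.
  intros HU HW E SU SW.
  pose proof (smooth_primitive _ _ HU SU) as SU0. pose proof (smooth_primitive _ _ HW SW) as SW0.
  destruct (proj1 (circle_cis (U 0, W 0))) as [t0 Ht0].
  { unfold circle, dot. simpl. specialize (E 0). lra. }
  unfold cis in Ht0. injection Ht0 as EU EW.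
  set (dt := fun t => U t * dW t - W t * dU t).
  assert (Sdt : smooth dt) by (unfold dt; auto with cont).
  set (tau := fun t => t0 + RInt dt 0 t).
  assert (Dtau : forall t : R, is_derive tau t (dt t)).
  { intros t. unfold tau. replace (dt t) with (0 + dt t) by ring.
    apply (is_derive_plus (fun _ => t0) (RInt dt 0)). apply (is_derive_const (V := R_NormedModule)).
    apply (is_derive_RInt dt (RInt dt 0) 0 t).
    - apply filter_forall. intros s. apply (RInt_correct (V := R_CompleteNormedModule)). auto with cont.
    - apply (smooth_cont _ Sdt). }
  exists tau. split; [now apply smooth_primitive with dt|]. split; [exact Dtau|].
  assert (Diff : forall t, U t * dU t + W t * dW t = 0).
  { intros t.
    assert (D : is_derive (fun t => U t ^ 2 + W t ^ 2) t (2 * (U t * dU t + W t * dW t))).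
    { auto_derive. repeat split; eexists; eauto.
      rewrite (is_derive_unique (fun x : R => U x) _ _ (HU t)), (is_derive_unique (fun x : R => W x) _ _ (HW t)). ring. }
    apply is_derive_unique in D. rewrite (Derive_ext _ (fun _ => 1)), Derive_const in D by auto. lra. }
  assert (HdU : forall t, dU t = - dt t * W t).
  { intros t. unfold dt. specialize (E t). specialize (Diff t).
    transitivity (dU t * (U t ^ 2 + W t ^ 2)). rewrite E; ring.
    replace (dU t * (U t ^ 2 + W t ^ 2)) with ((U t * dU t) * U t + dU t * W t ^ 2) by ring.
    replace (U t * dU t) with (- (W t * dW t)) by lra. ring. }
  assert (HdW : forall t, dW t = dt t * U t).
  { intros t. unfold dt. specialize (E t). specialize (Diff t).
    transitivity (dW t * (U t ^ 2 + W t ^ 2)). rewrite E; ring.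
    replace (dW t * (U t ^ 2 + W t ^ 2)) with ((W t * dW t) * W t + dW t * U t ^ 2) by ring.
    replace (W t * dW t) with (- (U t * dU t)) by lra. ring. }
  set (P := fun t => U t * cos (tau t) + W t * sin (tau t)).
  assert (DP : forall t : R, is_derive P t 0).
  { intros t. unfold P. auto_derive. repeat split; eexists; eauto.
    rewrite (is_derive_unique (fun x : R => U x) _ _ (HU t)), (is_derive_unique (fun x : R => W x) _ _ (HW t)),
      (is_derive_unique (fun x : R => tau x) _ _ (Dtau t)), HdU, HdW. ring. }
  assert (P1 : forall t, P t = 1).
  { intros t. assert (P0 : P 0 = 1).
    { unfold P, tau. rewrite RInt_point. change (@zero R_AbelianMonoid) with 0. change (@zero _) with 0.
      rewrite Rplus_0_r, <- EU, <- EW. specialize (E 0). lra. }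
    rewrite <- P0. destruct (mvt_abs P (fun _ => 0) 0 t) as [c [_ Ec]]. intros; apply DP. lra. }
  intros t. specialize (P1 t). specialize (E t). unfold P in P1.
  assert (S1 : sin (tau t) ^ 2 + cos (tau t) ^ 2 = 1) by (rewrite <- !Rsqr_pow2; apply sin2_cos2).
  set (c := cos (tau t)) in *. set (s := sin (tau t)) in *.
  assert (Q : (U t - c) ^ 2 + (W t - s) ^ 2 = 0) by nra.
  rewrite <- !Rsqr_pow2 in Q. apply Rplus_sqr_eq_0 in Q. lra.
Qed.

Lemma sum_sqr_zero a b x y : 0 < a -> 0 < b -> a * x ^ 2 + b * y ^ 2 = 0 -> x = 0 /\ y = 0.
Proof.
  intros Ha Hb H. pose proof (pow2_ge_0 x). pose proof (pow2_ge_0 y).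
  assert (x ^ 2 = 0) by nra. assert (y ^ 2 = 0) by nra.
  split; apply Rsqr_0_uniq; now rewrite Rsqr_pow2.
Qed.

Lemma bval_ps h c p : smooth_on closed_disk h -> rapidC c -> (forall q, cd q -> h q = fst (ps c q)) -> cd p ->
  bval h (AxisX :: nil) p = fst (ps (dc c) p) /\ bval h (AxisY :: nil) p = - snd (ps (dc c) p).
Proof.
  intros Hs Hc E Hp. pose proof (rapidC_dc c Hc) as Hc'.
  assert (S : forall q, od q -> cd q) by (intros q Hq; left; auto).
  destruct (hol1_Lim2 _ _ p (ps_hol1 _ Hc') Hp) as [L1 L2].
  assert (EI : forall q, Defs.interior closed_disk q -> h q = fst (ps c q)).
  { intros q Hq. apply E, S, interior_closed_disk, Hq. }
  split; apply (Lim2_unique od _ p _ _ (od_dense p Hp) (bval_spec h _ p Hs Hp)).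
  - apply Lim2_ext with (fun q => fst (ps (dc c) q)); [|exact (Lim2_subset od cd _ _ _ S L1)].
    intros q Hq. simpl. rewrite (partial_ext_interior closed_disk _ _ AxisX q EI) by now apply interior_closed_disk.
    symmetry. apply is_derive_unique. apply (hol1_partials _ _ q (ps_hol1 c Hc) Hq).
  - apply Lim2_ext with (fun q => - snd (ps (dc c) q)).
    + intros q Hq. simpl. rewrite (partial_ext_interior closed_disk _ _ AxisY q EI) by now apply interior_closed_disk.
      symmetry. apply is_derive_unique. apply (hol1_partials _ _ q (ps_hol1 c Hc) Hq).
    + apply (Lim2_opp od (fun q => snd (ps (dc c) q))). exact (Lim2_subset od cd _ _ _ S L2).
Qed.

Section Immersion.
Variables (s1 s2 : R) (Phi : R * R -> R * R).
Hypotheses (H1 : 0 < s1) (H12 : s1 <= s2) (HF : fb_minimal_immersion (ellipse s1 s2) Phi).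

Let f1 (p : C) : R := fst (Phi p).
Let f2 (p : C) : R := snd (Phi p).
Let X (t : R) : R := f1 (cis t).
Let Y (t : R) : R := f2 (cis t).
(** On the circle, [A] and [B] are the x- and y-derivatives of the coordinates, [R] and [T] the
    radial and tangential ones. *)
Let A1 t := bval f1 (AxisX :: nil) (cis t).
Let B1 t := bval f1 (AxisY :: nil) (cis t).
Let A2 t := bval f2 (AxisX :: nil) (cis t).
Let B2 t := bval f2 (AxisY :: nil) (cis t).
Let R1 t := cos t * A1 t + sin t * B1 t.
Let R2 t := cos t * A2 t + sin t * B2 t.
Let T1 t := - sin t * A1 t + cos t * B1 t.
Let T2 t := - sin t * A2 t + cos t * B2 t.

Let Sm1 : smooth_on closed_disk f1.
Proof. apply HF. Qed.
Let Sm2 : smooth_on closed_disk f2.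
Proof. apply HF. Qed.
Let s2_pos : 0 < s2.
Proof. lra. Qed.

Lemma imm_boundary t : s1 * X t ^ 2 + s2 * Y t ^ 2 = 1.
Proof. apply (fbmi_boundary _ _ HF (cis t)). apply circle_cis. eauto. Qed.

Lemma imm_conformal t : A1 t ^ 2 + A2 t ^ 2 = B1 t ^ 2 + B2 t ^ 2 /\ A1 t * B1 t + A2 t * B2 t = 0.
Proof.
  pose proof (bval_spec f1 (AxisX :: nil) (cis t) Sm1 (cd_cis t)) as LA1.
  pose proof (bval_spec f1 (AxisY :: nil) (cis t) Sm1 (cd_cis t)) as LB1.
  pose proof (bval_spec f2 (AxisX :: nil) (cis t) Sm2 (cd_cis t)) as LA2.
  pose proof (bval_spec f2 (AxisY :: nil) (cis t) Sm2 (cd_cis t)) as LB2.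
  set (a1 := partials (AxisX :: nil) f1) in *. set (b1 := partials (AxisY :: nil) f1) in *.
  set (a2 := partials (AxisX :: nil) f2) in *. set (b2 := partials (AxisY :: nil) f2) in *.
  assert (Cf : forall p, od p -> a1 p * a1 p + a2 p * a2 p - (b1 p * b1 p + b2 p * b2 p) = 0 /\ a1 p * b1 p + a2 p * b2 p = 0).
  { intros p Hp. apply open_disk_od in Hp. destruct (fbmi_conformal _ _ HF p Hp) as [E1 E2].
    split; [|exact E2]. unfold enorm in E1. apply sqrt_inj in E1.
    - change (a1 p * a1 p + a2 p * a2 p = b1 p * b1 p + b2 p * b2 p) in E1. lra.
    - unfold dot. nra.
    - unfold dot. nra. }
  assert (Dn := od_dense (cis t) (cd_cis t)).
  split.
  - enough (A1 t * A1 t + A2 t * A2 t - (B1 t * B1 t + B2 t * B2 t) = 0) by lra.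
    apply (Lim2_unique od (fun p => a1 p * a1 p + a2 p * a2 p - (b1 p * b1 p + b2 p * b2 p)) (cis t)); auto.
    + apply Lim2_minus; apply Lim2_plus; apply Lim2_mult; auto.
    + apply Lim2_ext with (fun _ => 0); [|apply Lim2_const]. intros q Hq. now rewrite (proj1 (Cf q Hq)).
  - apply (Lim2_unique od (fun p => a1 p * b1 p + a2 p * b2 p) (cis t)); auto.
    + apply Lim2_plus; apply Lim2_mult; auto.
    + apply Lim2_ext with (fun _ => 0); [|apply Lim2_const]. intros q Hq. now rewrite (proj2 (Cf q Hq)).
Qed.

(** The conformality relations are invariant under rotation of the orthonormal frame. *)
Lemma imm_polar t : R1 t ^ 2 + R2 t ^ 2 = T1 t ^ 2 + T2 t ^ 2 /\ R1 t * T1 t + R2 t * T2 t = 0.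
Proof.
  destruct (imm_conformal t) as [E1 E2].
  assert (S : sin t ^ 2 + cos t ^ 2 = 1) by (rewrite <- !Rsqr_pow2; apply sin2_cos2).
  unfold R1, R2, T1, T2. set (c := cos t) in *. set (s := sin t) in *.
  split.
  - enough ((c ^ 2 - s ^ 2) * ((A1 t ^ 2 + A2 t ^ 2) - (B1 t ^ 2 + B2 t ^ 2)) + 4 * c * s * (A1 t * B1 t + A2 t * B2 t) = 0) by lra.
    rewrite E2, E1. ring.
  - replace ((c * A1 t + s * B1 t) * (- s * A1 t + c * B1 t) + (c * A2 t + s * B2 t) * (- s * A2 t + c * B2 t)) with
     (c * s * (B1 t ^ 2 + B2 t ^ 2 - (A1 t ^ 2 + A2 t ^ 2)) + (c ^ 2 - s ^ 2) * (A1 t * B1 t + A2 t * B2 t)) by ring.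
    rewrite E2, E1. ring.
Qed.

Lemma imm_tangential t : is_derive X t (T1 t) /\ is_derive Y t (T2 t).
Proof.
  split.
  - apply is_derive_ext with (fun s => bval f1 nil (cis s)).
    intros s; apply bval_nil; auto using cd_cis. apply bval_derive; auto.
  - apply is_derive_ext with (fun s => bval f2 nil (cis s)).
    intros s; apply bval_nil; auto using cd_cis. apply bval_derive; auto.
Qed.

Lemma imm_radial t : dr Phi (cis t) = (R1 t, R2 t).
Proof. unfold dr. f_equal. apply (smooth_on_radial f1 t Sm1). apply (smooth_on_radial f2 t Sm2). Qed.

(** [imm_kappa] is the factor of the radial derivative along the normal [(s1 X, s2 Y)], and [imm_mu]
    that of the tangential derivative along the rotated normal. Pairing with the position isolates
    them because [s1 X^2 + s2 Y^2 = 1]. *)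
Definition imm_kappa t : R := X t * R1 t + Y t * R2 t.
Definition imm_mu t : R := X t * T2 t - Y t * T1 t.

Lemma imm_normal t : R1 t = imm_kappa t * (s1 * X t) /\ R2 t = imm_kappa t * (s2 * Y t).
Proof.
  assert (O : dot (dr Phi (cis t)) (- s2 * Y t, s1 * X t) = 0).
  { apply (fbmi_orthogonal _ _ HF). apply circle_cis; eauto.
    apply ellipse_tangent; auto. apply imm_boundary. }
  rewrite imm_radial in O. unfold dot in O. simpl in O.
  pose proof (imm_boundary t) as E. unfold imm_kappa. split.
  - transitivity (R1 t * (s1 * X t ^ 2 + s2 * Y t ^ 2)). rewrite E; ring.
    replace (R1 t * (s1 * X t ^ 2 + s2 * Y t ^ 2)) with (s1 * X t ^ 2 * R1 t + Y t * (s2 * Y t * R1 t)) by ring.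
    replace (s2 * Y t * R1 t) with (s1 * X t * R2 t) by lra. ring.
  - transitivity (R2 t * (s1 * X t ^ 2 + s2 * Y t ^ 2)). rewrite E; ring.
    replace (R2 t * (s1 * X t ^ 2 + s2 * Y t ^ 2)) with (s2 * Y t ^ 2 * R2 t + X t * (s1 * X t * R2 t)) by ring.
    replace (s1 * X t * R2 t) with (s2 * Y t * R1 t) by lra. ring.
Qed.

Lemma imm_tangent t : T1 t = - imm_mu t * (s2 * Y t) /\ T2 t = imm_mu t * (s1 * X t).
Proof.
  destruct (imm_tangential t) as [DX DY].
  assert (O : s1 * X t * T1 t + s2 * Y t * T2 t = 0).
  { assert (D : is_derive (fun t => s1 * X t ^ 2 + s2 * Y t ^ 2) t (2 * (s1 * X t * T1 t + s2 * Y t * T2 t))).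
    { auto_derive. repeat split; eexists; eauto.
      rewrite (is_derive_unique (fun x : R => X x) _ _ DX), (is_derive_unique (fun x : R => Y x) _ _ DY). ring. }
    apply is_derive_unique in D. rewrite (Derive_ext _ (fun _ => 1)), Derive_const in D by (intros; apply imm_boundary). lra. }
  pose proof (imm_boundary t) as E. unfold imm_mu. split.
  - transitivity (T1 t * (s1 * X t ^ 2 + s2 * Y t ^ 2)). rewrite E; ring.
    replace (T1 t * (s1 * X t ^ 2 + s2 * Y t ^ 2)) with (X t * (s1 * X t * T1 t) + s2 * Y t ^ 2 * T1 t) by ring.
    replace (s1 * X t * T1 t) with (- (s2 * Y t * T2 t)) by lra. ring.
  - transitivity (T2 t * (s1 * X t ^ 2 + s2 * Y t ^ 2)). rewrite E; ring.
    replace (T2 t * (s1 * X t ^ 2 + s2 * Y t ^ 2)) with (s1 * X t ^ 2 * T2 t + Y t * (s2 * Y t * T2 t)) by ring.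
    replace (s2 * Y t * T2 t) with (- (s1 * X t * T1 t)) by lra. ring.
Qed.

Lemma imm_normal_pos t : 0 < s1 ^ 2 * X t ^ 2 + s2 ^ 2 * Y t ^ 2.
Proof.
  pose proof (imm_boundary t) as E.
  assert (s1 * (s1 * X t ^ 2 + s2 * Y t ^ 2) <= s1 ^ 2 * X t ^ 2 + s2 ^ 2 * Y t ^ 2).
  { assert (0 <= (s2 - s1) * (s2 * Y t ^ 2)); [|nra]. apply Rmult_le_pos; nra. }
  rewrite E in H. lra.
Qed.

Lemma imm_kappa_mu t : imm_kappa t ^ 2 = imm_mu t ^ 2.
Proof.
  destruct (imm_polar t) as [E _]. destruct (imm_normal t) as [N1 N2]. destruct (imm_tangent t) as [M1 M2].
  rewrite N1, N2, M1, M2 in E. pose proof (imm_normal_pos t) as P.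
  apply Rmult_eq_reg_r with (s1 ^ 2 * X t ^ 2 + s2 ^ 2 * Y t ^ 2); [|lra].
  set (k := imm_kappa t) in *. set (m := imm_mu t) in *. nra.
Qed.

Lemma imm_lap1 p : od p -> lap_at f1 p 0.
Proof. intros Hp. apply harmonic_lap; auto. apply HF. Qed.
Lemma imm_lap2 p : od p -> lap_at f2 p 0.
Proof. intros Hp. apply harmonic_lap; auto. apply HF. Qed.
Lemma imm_cont1 : cont_on cd f1.
Proof. intros p Hp. now apply smooth_on_cont. Qed.
Lemma imm_cont2 : cont_on cd f2.
Proof. intros p Hp. now apply smooth_on_cont. Qed.
Lemma imm_smoothX : smooth X.
Proof. now apply (trace_smooth f1). Qed.
Lemma imm_smoothY : smooth Y.
Proof. now apply (trace_smooth f2). Qed.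

(** For [q] on the ellipse this is an affine function of [Phi p] vanishing on the tangent line at
    [q]; it is harmonic in [p], and convexity of the ellipse gives its sign on the circle. *)
Let ell (q p : C) : R := 1 - (s1 * fst q * f1 p + s2 * snd q * f2 p).

Lemma ell_cont q : cont_on cd (ell q).
Proof.
  intros p Hp. apply Lim2_minus. apply Lim2_const.
  apply Lim2_plus; apply (Lim2_mult cd (fun _ => _)); try apply Lim2_const.
  exact (imm_cont1 p Hp). exact (imm_cont2 p Hp).
Qed.
Lemma ell_lap q p : od p -> lap_at (ell q) p 0.
Proof.
  intros Hp. apply lap_at_eq with (1 * 0 + (-1) * (s1 * fst q * 0 + s2 * snd q * 0)); [|ring].
  replace (ell q) with (fun p => 1 * 1 + (-1) * (s1 * fst q * f1 p + s2 * snd q * f2 p)).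
  - apply (lap_at_lin (fun _ => 1) (fun p => s1 * fst q * f1 p + s2 * snd q * f2 p)). apply lap_at_const.
    apply lap_at_lin. now apply imm_lap1. now apply imm_lap2.
  - apply functional_extensionality. intros z. unfold ell. ring.
Qed.
(** For two points of the ellipse, [2 ell] is the sum of the weighted squares of the coordinate
    differences. *)
Lemma ell_boundary q t : ellipse s1 s2 q -> 0 <= ell q (cis t).
Proof.
  intros Hq. unfold ellipse in Hq. pose proof (imm_boundary t) as E. unfold ell. change (f1 (cis t)) with (X t). change (f2 (cis t)) with (Y t).
  assert (0 <= s1 * (fst q - X t) ^ 2) by (apply Rmult_le_pos; [lra|apply pow2_ge_0]).
  assert (0 <= s2 * (snd q - Y t) ^ 2) by (apply Rmult_le_pos; [lra|apply pow2_ge_0]). nra.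
Qed.
(** The value at 0 is the mean over the circle. If that mean were zero, the boundary values would
    all be the point [q] and [Phi] would be constant. *)
Lemma ell_center_pos q : ellipse s1 s2 q -> 0 < ell q 0.
Proof.
  intros Hq.
  assert (Z0 : forall h : C -> R, smooth_on closed_disk h -> harmonic h -> h (RtoC 0) = I (fun t => h (cis t)) / (2 * PI)).
  { intros h Sh Hh. rewrite (harmonic_series h Sh Hh) by (unfold cd; rewrite Cmod_0; lra).
    rewrite ps_0. simpl. unfold fc. f_equal. apply I_ext. intros t. rewrite e0. ring.
    apply rapidC_coefC, fc_rapid. now apply trace_smooth. apply periodic_cis. }
  assert (E0 : ell q 0 = I (fun t => ell q (cis t)) / (2 * PI)).
  { unfold ell.
    assert (CX : cont (fun t => f1 (cis t))) by exact (smooth_cont _ imm_smoothX).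
    assert (CY : cont (fun t => f2 (cis t))) by exact (smooth_cont _ imm_smoothY).
    rewrite I_minus, I_plus, !I_scal, I_const by auto with cont.
    rewrite (Z0 f1), (Z0 f2); auto; try apply HF. field. apply PI_neq0. }
  rewrite E0. apply Rdiv_lt_0_compat; [|pose proof PI_RGT_0; lra].
  assert (Cl : cont (fun t => ell q (cis t))).
  { apply cont_minus; auto with cont. apply cont_plus; (apply cont_mult; [auto with cont|]). apply (smooth_cont _ imm_smoothX). apply (smooth_cont _ imm_smoothY). }
  destruct (classic (exists t, 0 < ell q (cis t))) as [[t Ht]|Hn].
  { apply I_pos_point with t; auto. apply (periodic_cis (ell q)). intros x; now apply ell_boundary. }
  exfalso.
  assert (K : forall t, X t = fst q /\ Y t = snd q).
  { intros t. assert (Z : ell q (cis t) = 0).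
    { apply Rle_antisym. apply Rnot_lt_le. intros L. apply Hn. eauto. now apply ell_boundary. }
    unfold ell in Z. change (f1 (cis t)) with (X t) in Z. change (f2 (cis t)) with (Y t) in Z. unfold ellipse in Hq. pose proof (imm_boundary t) as E.
    assert (0 <= s1 * (fst q - X t) ^ 2) by (apply Rmult_le_pos; [lra|apply pow2_ge_0]).
    assert (0 <= s2 * (snd q - Y t) ^ 2) by (apply Rmult_le_pos; [lra|apply pow2_ge_0]).
    assert (H3 : s1 * (fst q - X t) ^ 2 + s2 * (snd q - Y t) ^ 2 = 0) by nra.
    apply sum_sqr_zero in H3; auto; lra. }
  destruct (fbmi_nonconstant _ _ HF) as [p [p' [Hp [Hp' Hne]]]]. apply Hne.
  assert (Cst : forall r, cd r -> f1 r = fst q /\ f2 r = snd q).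
  { intros r Hr. split.
    - apply (harmonic_unique f1 (fun _ => fst q)); auto using imm_cont1, imm_lap1, lap_at_const.
      intros z Hz; apply Lim2_const. intros t; apply K.
    - apply (harmonic_unique f2 (fun _ => snd q)); auto using imm_cont2, imm_lap2, lap_at_const.
      intros z Hz; apply Lim2_const. intros t; apply K. }
  apply closed_disk_cd in Hp, Hp'. destruct (Cst p Hp), (Cst p' Hp'). unfold f1, f2 in *.
  apply C_eq; congruence.
Qed.

(** Comparison of [ell q] with the subharmonic barrier [|x|^-2 - 1]. *)
Lemma ell_barrier q : ellipse s1 s2 q -> exists d eps, 0 < eps /\ 0 < d < 1 /\
  (forall p, Cmod p <= d -> 0 < ell q p) /\
  (forall p, d <= Cmod p <= 1 -> eps * (/ (Cmod p ^ 2) - 1) <= ell q p).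
Proof.
  intros Hq. pose proof (ell_center_pos q Hq) as Hc. set (c := ell q 0 / 2).
  assert (H0 : cd 0) by (unfold cd; rewrite Cmod_0; lra).
  destruct (ell_cont q 0 H0 c) as [d0 [Hd0 Hn]]; [unfold c; lra|].
  set (d := Rmin (d0 / 2) (1 / 2)).
  assert (Hd : 0 < d) by (apply Rmin_glb_lt; lra). assert (d <= d0/2) by apply Rmin_l. assert (d <= 1/2) by apply Rmin_r.
  assert (Low : forall p, Cmod p <= d -> c < ell q p).
  { intros p Hp. assert (A : cd p) by (unfold cd; lra). specialize (Hn p A).
    replace (p - 0)%C with p in Hn by ring. specialize (Hn ltac:(lra)). apply Rabs_def2 in Hn. unfold c in *. lra. }
  exists d, (c * d ^ 2). assert (Pc : 0 < c) by (unfold c; lra).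
  assert (Pe : 0 < c * d ^ 2) by (apply Rmult_lt_0_compat; auto; apply pow_lt; auto).
  split; auto. split; [lra|]. split. { intros p Hp. specialize (Low p Hp). lra. }
  intros p Hp.
  set (K := fun p : C => d <= Cmod p <= 1).
  assert (Sq : forall z, K z -> 0 < fst z ^ 2 + snd z ^ 2).
  { intros z [Hz _]. rewrite <- Cmod_sqr. apply pow_lt. lra. }
  set (g := fun z : C => c * d ^ 2 * (1 * / (fst z ^ 2 + snd z ^ 2) + (-1) * 1) + (-1) * ell q z).
  assert (G : g p <= 0).
  { apply (max_principle K g (annulus_compact d)); auto.
    - apply (cont_on_lin K (fun z => 1 * / (fst z ^ 2 + snd z ^ 2) + (-1) * 1) (ell q)).
      + apply (cont_on_lin K (fun z => / (fst z ^ 2 + snd z ^ 2)) (fun _ => 1)).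
        * intros z Hz. apply (Lim2_inv K (fun z => fst z ^ 2 + snd z ^ 2)).
          specialize (Sq z Hz); lra.
          simpl. apply (Lim2_plus K (fun q => fst q * (fst q * 1)) (fun q => snd q * (snd q * 1)));
          repeat apply Lim2_mult; try apply Lim2_const; try apply Lim2_fst; try apply Lim2_snd.
        * intros z Hz. apply Lim2_const.
      + intros z Hz. apply Lim2_subset with cd. intros r [_ Hr]; exact Hr. exact (ell_cont q z (proj2 Hz)).
    - intros z Hz. pose proof (Sq z Hz) as Pz.
      destruct (proj2 Hz) as [Lt|E1].
      + destruct (proj1 Hz) as [Gt|E2].
        * right. split.
          -- apply (proj2 (locally_Cmod z _)). exists (Rmin (Cmod z - d) (1 - Cmod z)).
             split. apply Rmin_glb_lt; lra. intros r Hr.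
             assert (Rmin (Cmod z - d) (1 - Cmod z) <= Cmod z - d) by apply Rmin_l.
             assert (Rmin (Cmod z - d) (1 - Cmod z) <= 1 - Cmod z) by apply Rmin_r.
             pose proof (Cmod_rev_triangle r z). pose proof (Cmod_rev_triangle z r).
             rewrite (Cmod_minus_sym z r) in H6. split; lra.
          -- exists (c * d ^ 2 * (1 * (4 / (fst z ^ 2 + snd z ^ 2) ^ 2) + (-1) * 0) + (-1) * 0). split.
             ++ assert (0 < 4 / (fst z ^ 2 + snd z ^ 2) ^ 2) by (apply Rdiv_lt_0_compat; [lra|now apply pow_lt]). nra.
             ++ apply (lap_at_lin (fun z => 1 * / (fst z ^ 2 + snd z ^ 2) + (-1) * 1) (ell q)).
                apply (lap_at_lin (fun z => / (fst z ^ 2 + snd z ^ 2)) (fun _ => 1)).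
                now apply lap_at_inv_sqr. apply lap_at_const. now apply ell_lap.
        * left. unfold g. rewrite <- Cmod_sqr, <- E2. specialize (Low z ltac:(lra)).
          replace (c * d ^ 2 * (1 * / d ^ 2 + -1 * 1)) with (c - c * d ^ 2) by (field; lra). lra.
      + left. unfold g. rewrite <- Cmod_sqr, E1.
        destruct (proj1 (circle_cis z) (proj2 (circle_Cmod z) E1)) as [t ->]. pose proof (ell_boundary q t Hq).
        replace (1 ^ 2) with 1 by ring. rewrite Rinv_1. lra. }
  unfold g in G. rewrite <- Cmod_sqr in G. lra.
Qed.

Lemma ell_pos q p : ellipse s1 s2 q -> od p -> 0 < ell q p.
Proof.
  intros Hq Hp. destruct (ell_barrier q Hq) as [d [eps [He [Hd [A B]]]]].
  destruct (Rle_lt_dec (Cmod p) d) as [L|L]; auto.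
  unfold od in Hp. specialize (B p ltac:(lra)). eapply Rlt_le_trans; [|exact B].
  apply Rmult_lt_0_compat; auto. assert (1 < / Cmod p ^ 2); [|lra].
  rewrite <- Rinv_1. assert (0 < Cmod p ^ 2) by (apply pow_lt; lra). apply Rinv_lt_contravar; nra.
Qed.

(** With [r] the root of the quadratic form at [Phi p], the tangent line is taken at [Phi p / r],
    where the ray through [Phi p] meets the ellipse; there [ell] equals [1 - r]. *)
Lemma imm_inside p : od p -> s1 * f1 p ^ 2 + s2 * f2 p ^ 2 < 1.
Proof.
  intros Hp. set (m := s1 * f1 p ^ 2 + s2 * f2 p ^ 2).
  assert (0 <= m) by (unfold m; apply Rplus_le_le_0_compat; apply Rmult_le_pos; nra).
  destruct (Req_dec m 0); [lra|]. assert (Hm : 0 < sqrt m) by (apply sqrt_lt_R0; lra).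
  assert (Em : sqrt m * sqrt m = m) by (apply sqrt_sqrt; lra).
  set (r := sqrt m) in *.
  assert (Hq : ellipse s1 s2 (f1 p / r, f2 p / r)).
  { unfold ellipse. simpl fst. simpl snd. transitivity (m / (r * r)). unfold m; field; lra. rewrite Em. field; auto. }
  pose proof (ell_pos _ p Hq Hp) as L. unfold ell in L. simpl fst in L. simpl snd in L.
  replace (s1 * (f1 p / r) * f1 p + s2 * (f2 p / r) * f2 p) with (m / r) in L by (unfold m; field; lra).
  replace (m / r) with r in L by (rewrite <- Em; field; lra). nra.
Qed.

(** Hopf lemma: for [q = Phi (cis t)] the function [ell q] vanishes at [cis t] and dominates the
    barrier, whose decay towards the circle is at least linear. Its difference quotients therefore
    bound [s1 X R1 + s2 Y R2], a positive multiple of [imm_kappa], from below by [eps]. *)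
Lemma imm_kappa_pos t : 0 < imm_kappa t.
Proof.
  set (q := (X t, Y t) : C).
  assert (Hq : ellipse s1 s2 q) by apply imm_boundary.
  destruct (ell_barrier q Hq) as [d [eps [He [Hd [_ B]]]]].
  assert (L1 := boundary_radial f1 _ _ t _ _ (partials_grad f1 nil Sm1)
    (Lim2_subset od cd _ _ _ (fun z Hz => or_introl Hz) (smooth_on_cont f1 _ Sm1 (cd_cis t)))
    (bval_spec f1 (AxisX :: nil) (cis t) Sm1 (cd_cis t)) (bval_spec f1 (AxisY :: nil) (cis t) Sm1 (cd_cis t))).
  assert (L2 := boundary_radial f2 _ _ t _ _ (partials_grad f2 nil Sm2)
    (Lim2_subset od cd _ _ _ (fun z Hz => or_introl Hz) (smooth_on_cont f2 _ Sm2 (cd_cis t)))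
    (bval_spec f2 (AxisX :: nil) (cis t) Sm2 (cd_cis t)) (bval_spec f2 (AxisY :: nil) (cis t) Sm2 (cd_cis t))).
  fold (A1 t) (B1 t) in L1. fold (A2 t) (B2 t) in L2. fold (R1 t) in L1. fold (R2 t) in L2.
  assert (M : eps <= s1 * X t * R1 t + s2 * Y t * R2 t).
  { apply Rnot_lt_le. intros Lt. set (v := s1 * X t * R1 t + s2 * Y t * R2 t) in *.
    set (b := Rabs (s1 * X t) + Rabs (s2 * Y t) + 1).
    assert (Hb : 0 < b) by (unfold b; pose proof (Rabs_pos (s1 * X t)); pose proof (Rabs_pos (s2 * Y t)); lra).
    assert (Heta : 0 < (eps - v) / b) by (apply Rdiv_lt_0_compat; lra).
    destruct (proj1 (filterlim_locally _ _) L1 (mkposreal _ Heta)) as [d1 Q1].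
    destruct (proj1 (filterlim_locally _ _) L2 (mkposreal _ Heta)) as [d2 Q2].
    set (m := Rmin (Rmin d1 d2) (1 - d)).
    assert (Hm : 0 < m) by (unfold m; repeat apply Rmin_glb_lt; try apply cond_pos; lra).
    assert (m <= d1) by (eapply Rle_trans; [apply Rmin_l|apply Rmin_l]).
    assert (m <= d2) by (eapply Rle_trans; [apply Rmin_l|apply Rmin_r]).
    assert (m <= 1 - d) by apply Rmin_r.
    set (r := 1 - m / 2).
    assert (Nr : Rabs (r - 1) < m) by (apply Rabs_def1; unfold r; lra).
    assert (Lr : r < 1) by (unfold r; lra). assert (Gr : d < r) by (unfold r; lra).
    assert (W1 := Q1 r (Rlt_le_trans _ _ _ Nr H) Lr). assert (W2 := Q2 r (Rlt_le_trans _ _ _ Nr H0) Lr).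
    change (Rabs ((f1 (r * fst (cis t), r * snd (cis t)) - f1 (cis t)) / (r - 1) - R1 t) < (eps - v) / b) in W1.
    change (Rabs ((f2 (r * fst (cis t), r * snd (cis t)) - f2 (cis t)) / (r - 1) - R2 t) < (eps - v) / b) in W2.
    set (z := (r * fst (cis t), r * snd (cis t)) : C) in *.
    assert (Hz : Cmod z = r).
    { replace z with (RtoC r * cis t)%C by (apply C_eq; simpl; ring). apply Cmod_rcis. lra. }
    specialize (B z ltac:(rewrite Hz; lra)). rewrite Hz in B. unfold ell in B. simpl fst in B. simpl snd in B.
    set (D1 := (f1 z - f1 (cis t)) / (r - 1)) in *. set (D2 := (f2 z - f2 (cis t)) / (r - 1)) in *.
    assert (E1 : f1 z = X t + D1 * (r - 1)) by (unfold D1, X; field; lra).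
    assert (E2 : f2 z = Y t + D2 * (r - 1)) by (unfold D2, Y; field; lra).
    rewrite E1, E2 in B. pose proof (imm_boundary t) as Eb.
    assert (B' : eps * (/ r ^ 2 - 1) <= (1 - r) * (s1 * X t * D1 + s2 * Y t * D2)) by nra.
    assert (eps * (1 - r) <= eps * (/ r ^ 2 - 1)).
    { apply Rmult_le_compat_l; [lra|]. assert (r ^ 2 < 1) by nra. assert (0 < r ^ 2) by (apply pow_lt; lra).
      assert (1 <= / r ^ 2 * r) ; [|].
      { replace (/ r ^ 2 * r) with (/ r) by (field; lra). rewrite <- Rinv_1. apply Rinv_le_contravar; lra. }
      assert (0 < / r ^ 2) by now apply Rinv_0_lt_compat. nra. }
    assert (Low : eps <= s1 * X t * D1 + s2 * Y t * D2) by nra.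
    assert (Up : s1 * X t * D1 + s2 * Y t * D2 - v <= (Rabs (s1 * X t) + Rabs (s2 * Y t)) * ((eps - v) / b)).
    { replace (s1 * X t * D1 + s2 * Y t * D2 - v) with (s1 * X t * (D1 - R1 t) + s2 * Y t * (D2 - R2 t)) by (unfold v; ring).
      eapply Rle_trans. apply RRle_abs. eapply Rle_trans. apply Rabs_triang. rewrite !Rabs_mult, Rmult_plus_distr_r.
      rewrite <- !Rabs_mult. rewrite (Rabs_mult (s1 * X t)), (Rabs_mult (s2 * Y t)).
      apply Rplus_le_compat; apply Rmult_le_compat_l; try apply Rabs_pos; lra. }
    assert ((eps - v) / b * b = eps - v) by (field; lra). unfold b in *. nra. }
  destruct (imm_normal t) as [N1 N2]. rewrite N1, N2 in M. pose proof (imm_normal_pos t) as P.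
  assert (E : imm_kappa t * (s1 ^ 2 * X t ^ 2 + s2 ^ 2 * Y t ^ 2) = s1 * X t * (imm_kappa t * (s1 * X t)) + s2 * Y t * (imm_kappa t * (s2 * Y t))) by ring.
  nra.
Qed.

Lemma imm_weight t : ellipse_weight s1 s2 Phi (cis t) = imm_kappa t.
Proof.
  unfold ellipse_weight. rewrite imm_radial. destruct (imm_normal t) as [-> ->].
  pose proof (imm_kappa_pos t) as K. pose proof (imm_normal_pos t) as P.
  unfold enorm, dot. simpl fst. simpl snd.
  replace (imm_kappa t * (s1 * X t) * (imm_kappa t * (s1 * X t)) + imm_kappa t * (s2 * Y t) * (imm_kappa t * (s2 * Y t)))
    with (imm_kappa t ^ 2 * (s1 ^ 2 * X t ^ 2 + s2 ^ 2 * Y t ^ 2)) by ring.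
  rewrite sqrt_mult by (try apply pow2_ge_0; lra). rewrite sqrt_pow2 by lra.
  change (fst (Phi (cis t))) with (X t). change (snd (Phi (cis t))) with (Y t).
  field. apply Rgt_not_eq. now apply sqrt_lt_R0.
Qed.

Lemma imm_smooth_data : smooth A1 /\ smooth B1 /\ smooth A2 /\ smooth B2.
Proof. repeat split; now apply bval_smooth. Qed.
Lemma imm_smooth_kappa : smooth imm_kappa.
Proof.
  destruct imm_smooth_data as [SA1 [SB1 [SA2 SB2]]]. pose proof imm_smoothX. pose proof imm_smoothY.
  unfold imm_kappa, R1, R2. auto 12 with cont.
Qed.
Lemma imm_smoothT : smooth T1 /\ smooth T2.
Proof. destruct imm_smooth_data as [SA1 [SB1 [SA2 SB2]]]. unfold T1, T2. split; auto 12 with cont. Qed.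

(** The two factors agree up to sign and never vanish; by continuity the sign cannot change along
    the circle. *)
Lemma imm_orientation : exists sg, (sg = 1 \/ sg = -1) /\ forall t, imm_mu t = sg * imm_kappa t.
Proof.
  assert (Cm : cont imm_mu).
  { destruct imm_smoothT. pose proof imm_smoothX. pose proof imm_smoothY. unfold imm_mu. auto 12 with cont. }
  assert (Nz : forall t, imm_mu t <> 0).
  { intros t E. pose proof (imm_kappa_mu t) as K. rewrite E in K. pose proof (imm_kappa_pos t). nra. }
  assert (Sgn : forall a b, imm_mu a < 0 -> 0 < imm_mu b -> False).
  { intros a b Ha Hb. destruct (IVT_gen imm_mu a b 0) as [c [_ Hc]].
    - intros x. apply continuity_pt_filterlim, Cm.
    - rewrite Rmin_left, Rmax_right; lra.
    - now apply (Nz c). }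
  assert (Sq : forall t, imm_mu t = imm_kappa t \/ imm_mu t = - imm_kappa t).
  { intros t. pose proof (imm_kappa_mu t). destruct (Rmult_integral (imm_mu t - imm_kappa t) (imm_mu t + imm_kappa t)); [nra|left; lra|right; lra]. }
  destruct (Sq 0) as [E|E]; pose proof (imm_kappa_pos 0).
  - exists 1. split; auto. intros t. pose proof (imm_kappa_pos t). destruct (Sq t); [lra|].
    exfalso. apply (Sgn t 0); lra.
  - exists (-1). split; auto. intros t. pose proof (imm_kappa_pos t). destruct (Sq t); [|lra].
    exfalso. apply (Sgn 0 t); lra.
Qed.

Let c1 := coefC (fc X).

Lemma imm_c1_rapid : rapidC c1.
Proof. apply rapidC_coefC, fc_rapid. apply imm_smoothX. apply (periodic_cis f1). Qed.
Lemma imm_series1 p : cd p -> f1 p = fst (ps c1 p).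
Proof. intros Hp. apply (harmonic_series f1); auto. apply HF. Qed.
Lemma imm_AB1 t : A1 t = fst (ps (dc c1) (cis t)) /\ B1 t = - snd (ps (dc c1) (cis t)).
Proof. apply bval_ps; auto using imm_c1_rapid, cd_cis. exact imm_series1. Qed.
Lemma imm_R1 t : R1 t = fst (cis t * ps (dc c1) (cis t))%C.
Proof. unfold R1. destruct (imm_AB1 t) as [-> ->]. simpl. ring. Qed.
Lemma imm_eigen t : T (fun n => freq n * fc X n) t = imm_kappa t * (s1 * X t).
Proof.
  rewrite <- (proj1 (imm_normal t)), imm_R1. symmetry. apply ps_radial_cis.
  apply fc_rapid. apply imm_smoothX. apply (periodic_cis f1).
Qed.

(** The Cauchy-Riemann equations hold along the circle, with a constant
    orientation, so [sg * phi_2] is a harmonic conjugate of [phi_1]. *)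
Lemma imm_conjugate sg : (sg = 1 \/ sg = -1) -> (forall t, imm_mu t = sg * imm_kappa t) ->
  exists k, forall p, cd p -> sg * f2 p = snd (ps c1 p) + k.
Proof.
  intros Hsg Hmu. pose proof imm_c1_rapid as Hc.
  set (V := fun p => snd (ps c1 p)).
  assert (DV : forall t : R, is_derive (fun t => V (cis t)) t (R1 t)).
  { intros t. destruct (hol1_circle _ _ 1 t (ps_hol1 c1 Hc)) as [_ D]; [lra|].
    apply is_derive_ext with (fun s => snd (ps c1 (1 * cis s)%C)).
    { intros s. unfold V. now rewrite Cmult_1_l. }
    replace (R1 t) with (snd (ps (dc c1) (1 * cis t) * (1 * (Ci * cis t)))%C); auto.
    rewrite imm_R1, !Cmult_1_l. simpl. ring. }
  set (k := sg * Y 0 - V (cis 0)). exists k.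
  assert (Eb : forall t, sg * Y t = V (cis t) + k).
  { intros t. set (D := fun t => sg * Y t - V (cis t)).
    assert (HD : forall t : R, is_derive D t 0).
    (* Cauchy-Riemann on the circle: [sg * T2] is [sg * imm_mu * (s1 X)], and
       [sg * imm_mu = imm_kappa] because [sg] is its own inverse. *)
    { intros s. replace 0 with (sg * T2 s - R1 s).
      - apply (is_derive_minus (fun t => sg * Y t) (fun t => V (cis t))); auto.
        apply (is_derive_scal Y). apply imm_tangential.
      - rewrite (proj2 (imm_tangent s)), (proj1 (imm_normal s)), Hmu. destruct Hsg as [-> | ->]; ring. }
    destruct (mvt_abs D (fun _ => 0) 0 t) as [c [_ E]]. { intros; apply HD. }
    unfold D in E. fold k in E. lra. }
  assert (Vh : forall p, od p -> lap_at V p 0).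
  { intros p Hp.
    destruct (hol1_grad _ _ _ (ps_hol1 c1 Hc) (ps_hol1 _ (rapidC_dc _ Hc))) as [_ [Gx [Gy _]]].
    pose proof (hol1_partials _ _ p (ps_hol1 _ (rapidC_dc _ Hc)) Hp) as [P1 [P2 [P3 P4]]].
    pose proof (proj2 (interior_open_disk p) Hp) as HI.
    exists (fun t => snd (ps (dc c1) (t, snd p))), (fun t => fst (ps (dc c1) (fst p, t))),
      (snd (ps (dc (dc c1)) p)), (- snd (ps (dc (dc c1)) p)).
    refine (conj _ (conj _ (conj P3 (conj P2 _)))); [| |ring].
    - generalize (interior_along _ _ AxisX HI). apply filter_imp. intros t Ht. apply interior_open_disk in Ht. exact (Gx _ Ht).
    - generalize (interior_along _ _ AxisY HI). apply filter_imp. intros t Ht. apply interior_open_disk in Ht. exact (Gy _ Ht). }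
  intros p Hp.
  enough (1 * (sg * f2 p) + 0 * 0 = 1 * V p + k * 1) by (unfold V in *; lra).
  apply (harmonic_unique (fun p => 1 * (sg * f2 p) + 0 * 0) (fun p => 1 * V p + k * 1)); auto.
  - apply (cont_on_lin cd (fun p => sg * f2 p) (fun _ => 0)).
    + intros q Hq. apply (Lim2_mult cd (fun _ => sg) f2). apply Lim2_const. exact (imm_cont2 q Hq).
    + intros q Hq. apply Lim2_const.
  - apply (cont_on_lin cd V (fun _ => 1)).
    + intros q Hq. apply (hol1_Lim2 _ _ q (ps_hol1 c1 Hc) Hq).
    + intros q Hq. apply Lim2_const.
  - intros q Hq. apply lap_at_eq with (1 * (sg * 0 + 0 * 0) + 0 * 0); [|ring].
    apply (lap_at_lin (fun p => sg * f2 p) (fun _ => 0)).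
    + replace (fun p => sg * f2 p) with (fun p => sg * f2 p + 0 * 0) by (apply functional_extensionality; intros; ring).
      apply (lap_at_lin f2 (fun _ => 0)). now apply imm_lap2. apply lap_at_const.
    + apply lap_at_const.
  - intros q Hq. apply lap_at_eq with (1 * 0 + k * 0); [|ring].
    apply (lap_at_lin V (fun _ => 1)). now apply Vh. apply lap_at_const.
  - intros t. specialize (Eb t). unfold Y in Eb. lra.
Qed.

Lemma immersion_structure : exists (k tau : R -> R) (sg : R) (c : nat -> C),
  (sg = 1 \/ sg = -1) /\ smooth k /\ periodic k /\ (forall t, 0 < k t) /\
  (forall t, ellipse_weight s1 s2 Phi (cis t) = k t) /\
  smooth tau /\ (forall t : R, is_derive tau t (sqrt s1 * sqrt s2 * k t)) /\
  (forall t, sqrt s1 * fst (Phi (cis t)) = cos (tau t) /\ sqrt s2 * (sg * snd (Phi (cis t))) = sin (tau t)) /\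
  rapidC c /\
  (forall p, cd p -> fst (Phi p) = fst (ps c p) /\ sg * snd (Phi p) = snd (ps c p)) /\
  (forall t, radial_derive (fun p => fst (Phi p)) (cis t) = k t * (s1 * fst (Phi (cis t)))) /\
  (forall t, radial_derive (fun p => snd (Phi p)) (cis t) = k t * (s2 * snd (Phi (cis t)))) /\
  (forall p, od p -> s1 * fst (Phi p) ^ 2 + s2 * snd (Phi p) ^ 2 < 1) /\
  (forall t, ps (dc c) (cis t) <> 0) /\
  (forall t, T (fun n => freq n * fc (fun s => fst (Phi (cis s))) n) t = k t * (s1 * fst (Phi (cis t)))).
Proof.
  destruct imm_orientation as [sg [Hsg Hmu]].
  destruct (imm_conjugate sg Hsg Hmu) as [m Hm].
  set (a := sqrt s1). set (b := sqrt s2).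
  assert (Ha : 0 < a) by now apply sqrt_lt_R0. assert (Hb : 0 < b) by now apply sqrt_lt_R0.
  assert (Ea : s1 = a * a) by (unfold a; rewrite sqrt_sqrt; lra).
  assert (Eb : s2 = b * b) by (unfold b; rewrite sqrt_sqrt; lra).
  assert (Esg : sg * sg = 1) by (destruct Hsg as [-> | ->]; ring).
  destruct imm_smoothT as [ST1 ST2].
  destruct (lifting (fun t => a * X t) (fun t => b * (sg * Y t)) (fun t => a * T1 t) (fun t => b * (sg * T2 t))) as [tau [Stau [Dtau Etau]]].
  { intros t. apply (is_derive_scal X). apply imm_tangential. }
  { intros t. apply (is_derive_scal (fun t => sg * Y t)). apply (is_derive_scal Y). apply imm_tangential. }
  { intros t. pose proof (imm_boundary t) as E. rewrite Ea, Eb in E. rewrite <- E.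
    replace ((b * (sg * Y t)) ^ 2) with (b * b * (sg * sg) * Y t ^ 2) by ring. rewrite Esg. ring. }
  { auto with cont. } { auto with cont. }
  (* The free constant of the harmonic conjugate is absorbed into the imaginary part of the
     coefficient 0. *)
  set (cc := fun n => (c1 n + match n with O => (0, m) | _ => RtoC 0 end)%C).
  assert (Hd : rapidC (fun n => match n with O => (0, m) | _ => RtoC 0 end)).
  { apply (rapid_finite _ O). intros [|n] Hn; [lia|]. apply Cmod_0. }
  pose proof imm_c1_rapid as Hc1.
  assert (Hcc : rapidC cc).
  { apply rapid_poly with (fun n => Cmod (c1 n) + Cmod (match n with O => (0, m) | _ => RtoC 0 end)) 1 O.
    - now apply (rapid_plus (fun n => Cmod (c1 n))).
    - intros n. rewrite Rabs_pos_eq by apply Cmod_ge_0. simpl. rewrite Rmult_1_r, Rmult_1_l.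
      rewrite Rabs_pos_eq. apply Cmod_triangle. pose proof (Cmod_ge_0 (c1 n)).
      match goal with |- 0 <= _ + Cmod ?z => pose proof (Cmod_ge_0 z) end. lra. }
  assert (Ecc : forall p, cd p -> ps cc p = (ps c1 p + (0, m))%C).
  { intros p Hp. unfold ps, cc.
    rewrite (CS_ext _ (fun n => c1 n * p ^ n + (match n with O => (0, m) | _ => RtoC 0 end) * p ^ n)%C) by (intros; ring).
    rewrite CS_plus by (apply csum_ps; auto). f_equal.
    change (ps (fun n => match n with O => (0, m) | S _ => RtoC 0 end) p = (0, m)).
    unfold ps. rewrite CS_incr by (apply (csum_ps (fun n => match n with O => (0, m) | S _ => RtoC 0 end)); auto).
    rewrite (CS_ext _ (fun n => RtoC 0 * c1 n)%C) by (intros; ring).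
    rewrite CS_scal by now apply rapidC_csum. simpl Cpow. ring. }
  assert (Edc : forall p, ps (dc cc) p = ps (dc c1) p).
  { intros p. apply CS_ext. intros n. unfold dc, cc. ring. }
  exists imm_kappa, tau, sg, cc.
  split; auto. split. apply imm_smooth_kappa.
  split. { intros t. rewrite <- !imm_weight. apply (periodic_cis (ellipse_weight s1 s2 Phi)). }
  split. apply imm_kappa_pos. split. apply imm_weight. split; auto.
  split. { intros t. replace (a * b * imm_kappa t) with (a * X t * (b * (sg * T2 t)) - b * (sg * Y t) * (a * T1 t)); auto.
    transitivity (a * b * sg * imm_mu t). unfold imm_mu; ring. rewrite Hmu.
    transitivity (a * b * (sg * sg) * imm_kappa t); [ring|rewrite Esg; ring]. }
  split; auto. split; auto.
  split. { intros p Hp. rewrite (Ecc p Hp). split.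
    - change (f1 p = fst (ps c1 p) + 0). rewrite imm_series1; auto. ring.
    - change (sg * f2 p = snd (ps c1 p) + m). auto. }
  split. { intros t. transitivity (R1 t). apply (f_equal fst (imm_radial t)). apply (proj1 (imm_normal t)). }
  split. { intros t. transitivity (R2 t). apply (f_equal snd (imm_radial t)). apply (proj2 (imm_normal t)). }
  split. exact imm_inside.
  (* A zero of the derivative on the circle kills the gradient of [phi_1]; conformality then kills
     that of [phi_2], and [imm_kappa] would be zero. *)
  split. { intros t E. rewrite Edc in E. destruct (imm_AB1 t) as [E1 E2]. rewrite E in E1, E2. simpl in E1, E2.
    destruct (imm_conformal t) as [C1 C2]. pose proof (imm_kappa_pos t) as K.
    assert (E2' : B1 t = 0) by (rewrite E2; ring). rewrite E1, E2' in *.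
    assert (A2 t = 0 /\ B2 t = 0) as [Z1 Z2].
    { assert (A2 t * B2 t = 0) by lra. assert (Sq : A2 t * A2 t = B2 t * B2 t) by lra.
      destruct (Rmult_integral _ _ H) as [Z|Z]; rewrite Z in *.
      - split; auto. apply Rsqr_0_uniq. unfold Rsqr. lra.
      - split; auto. apply Rsqr_0_uniq. unfold Rsqr. lra. }
    unfold imm_kappa, R1, R2 in K. rewrite E1, E2', Z1, Z2 in K. lra. }
  exact imm_eigen.
Qed.

End Immersion.

(** * Galerkin approximation of the Steklov spectrum *)

(** Since [e 1 = 0], its coefficient is normalised to [0]. *)
Definition VN (N : nat) (x : nat -> R) : Prop := x 1%nat = 0 /\ forall n, (N < n)%nat -> x n = 0.

Lemma VN_summable N x : VN N x -> summable x.
Proof. intros [_ H]. now apply summable_finite with N. Qed.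
Lemma VN_lin N x y a : VN N x -> VN N y -> VN N (fun n => x n + a * y n).
Proof. intros [A B] [A' B']. split. rewrite A, A'; ring. intros n Hn. rewrite B, B' by auto. ring. Qed.
Lemma VN_scal N x a : VN N x -> VN N (fun n => a * x n).
Proof. intros [A B]. split. rewrite A; ring. intros n Hn. rewrite B by auto. ring. Qed.

Definition delta (k n : nat) : R := if Nat.eq_dec n k then 1 else 0.
Lemma VN_delta N k : (k <= N)%nat -> k <> 1%nat -> VN N (delta k).
Proof.
  intros H1 H2. unfold delta. split. destruct (Nat.eq_dec 1 k); auto; lia.
  intros n Hn. destruct (Nat.eq_dec n k); auto; lia.
Qed.
Lemma Series_delta k (f : nat -> R) : Series (fun n => delta k n * f n) = f k /\ is_series (fun n => delta k n * f n) (f k).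
Proof.
  assert (S : is_series (fun n => delta k n * f n) (f k)).
  { evar_last. apply (is_series_finite _ k). intros n Hn. unfold delta. destruct (Nat.eq_dec n k); [lia|ring].
    enough (forall N, sum_n (fun n => delta k n * f n) N = if le_dec k N then f k else 0).
    { rewrite H. destruct (le_dec k k); auto; lia. }
    induction N.
    - rewrite sum_O. toR. unfold delta. destruct (Nat.eq_dec 0 k), (le_dec k 0); try lia; subst; ring.
    - rewrite sum_Sn, IHN. toR. unfold delta.
      destruct (Nat.eq_dec (S N) k), (le_dec k N), (le_dec k (S N)); try (exfalso; lia); subst; ring. }
  split; auto. now apply is_series_unique.
Qed.
Lemma T_delta k t : T (delta k) t = e k t.
Proof. apply (Series_delta k (fun n => e n t)). Qed.

Lemma norm1_finite_le N x d : VN N x -> (forall n, (n <= N)%nat -> Rabs (x n) <= d) -> norm1 x <= (INR N + 1) * d.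
Proof.
  intros [_ H] Hd. unfold norm1.
  rewrite (is_series_unique _ _ (is_series_finite (fun n => Rabs (x n)) N
    (fun n Hn => eq_trans (f_equal Rabs (H n Hn)) Rabs_R0))).
  assert (G : forall K, (K <= N)%nat -> sum_n (fun n => Rabs (x n)) K <= (INR K + 1) * d).
  { induction K; intros HK.
    - rewrite sum_O. simpl. specialize (Hd O HK). lra.
    - rewrite sum_Sn. toR. specialize (IHK ltac:(lia)). specialize (Hd (S K) HK). rewrite S_INR.
      apply Rle_trans with ((INR K + 1) * d + d); [now apply Rplus_le_compat|lra]. }
  apply G; lia.
Qed.

(** A symmetric bilinear form on [VN N]. The bound in [norm1] is the form of continuity that suits
    coordinatewise convergence in finite dimension. *)
Record form (N : nat) (b : (nat -> R) -> (nat -> R) -> R) (K : R) : Prop := {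
  form_sym : forall x y, VN N x -> VN N y -> b x y = b y x;
  form_lin : forall x y z a, VN N x -> VN N y -> VN N z -> b (fun n => x n + a * y n) z = b x z + a * b y z;
  form_bound : forall x y, VN N x -> VN N y -> Rabs (b x y) <= K * norm1 x * norm1 y
}.

Lemma form_square N b K x y t : form N b K -> VN N x -> VN N y ->
  b (fun n => x n + t * y n) (fun n => x n + t * y n) = b x x + 2 * t * b x y + t * t * b y y.
Proof.
  intros F Hx Hy. pose proof (VN_lin N x y t Hx Hy) as Hz.
  rewrite (form_lin _ _ _ F), (form_sym _ _ _ F x), (form_sym _ _ _ F y), !(form_lin _ _ _ F) by auto.
  rewrite (form_sym _ _ _ F y x) by auto. ring.
Qed.
Lemma form_scal_square N b K x t : form N b K -> VN N x ->
  b (fun n => t * x n) (fun n => t * x n) = t * t * b x x.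
Proof.
  intros F Hx. pose proof (VN_scal N x t Hx) as Hz.
  assert (L : forall y z, VN N y -> VN N z -> b (fun n => t * y n) z = t * b y z).
  { intros y z Hy Hzz. pose proof (form_lin _ _ _ F (fun n => 0 * y n) y z t (VN_scal N y 0 Hy) Hy Hzz) as E1.
    pose proof (form_lin _ _ _ F (fun n => 0 * y n) y z 0 (VN_scal N y 0 Hy) Hy Hzz) as E2.
    cbv beta in E1, E2.
    replace (fun n => 0 * y n + t * y n) with (fun n => t * y n) in E1 by (apply functional_extensionality; intros; ring).
    replace (fun n => 0 * y n + 0 * y n) with (fun n => 0 * y n) in E2 by (apply functional_extensionality; intros; ring).
    assert (Z : b (fun n => 0 * y n) z = 0).
    { pose proof (form_lin _ _ _ F (fun n => 0 * y n) (fun n => 0 * y n) z 1 (VN_scal N y 0 Hy) (VN_scal N y 0 Hy) Hzz) as E3.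
      cbv beta in E3. replace (fun n => 0 * y n + 1 * (0 * y n)) with (fun n => 0 * y n) in E3 by (apply functional_extensionality; intros; ring).
      lra. }
    lra. }
  rewrite L, (form_sym _ _ _ F x), L by auto. ring.
Qed.
Lemma form_cont N b K x y C d : form N b K -> 0 <= K -> VN N x -> VN N y -> 0 <= C -> 0 <= d ->
  (forall n, (n <= N)%nat -> Rabs (x n) <= C) -> (forall n, (n <= N)%nat -> Rabs (y n) <= C) ->
  (forall n, (n <= N)%nat -> Rabs (x n - y n) <= d) ->
  Rabs (b x x - b y y) <= 2 * K * (INR N + 1) ^ 2 * C * d.
Proof.
  intros F HK Hx Hy HC Hd Bx By Bd.
  pose proof (VN_lin N x y (-1) Hx Hy) as Hz. set (z := fun n => x n + -1 * y n) in *.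
  assert (E : b x x - b y y = b z x + b z y).
  { unfold z. rewrite !(form_lin _ _ _ F), (form_sym _ _ _ F x y) by auto. ring. }
  rewrite E.
  assert (Nx := norm1_finite_le N x C Hx Bx). assert (Ny := norm1_finite_le N y C Hy By).
  assert (Nz : norm1 z <= (INR N + 1) * d).
  { apply norm1_finite_le; auto. intros n Hn. unfold z. replace (x n + -1 * y n) with (x n - y n) by ring. auto. }
  pose proof (norm1_ge0 x (VN_summable N x Hx)). pose proof (norm1_ge0 y (VN_summable N y Hy)).
  pose proof (norm1_ge0 z (VN_summable N z Hz)). pose proof (pos_INR N).
  assert (G : forall u, VN N u -> 0 <= norm1 u -> norm1 u <= (INR N + 1) * C -> Rabs (b z u) <= K * (INR N + 1) ^ 2 * C * d).
  { intros u Hu U0 Un. eapply Rle_trans. apply (form_bound _ _ _ F); auto.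
    rewrite Rmult_assoc. replace (K * (INR N + 1) ^ 2 * C * d) with (K * (((INR N + 1) * d) * ((INR N + 1) * C))) by ring.
    apply Rmult_le_compat_l; auto. apply Rmult_le_compat; auto. }
  eapply Rle_trans. apply Rabs_triang. pose proof (G x Hx H Nx). pose proof (G y Hy H0 Ny). lra.
Qed.

(** Minimisation of [Q] on the level set [M = 1]. Coercivity, with constant [c], keeps the
    coefficients of a minimising sequence bounded, and a cluster point is a minimiser by
    continuity. *)
Lemma min_eigen N (Q M : (nat -> R) -> (nat -> R) -> R) KQ KM c : 0 <= KQ -> 0 <= KM -> 0 < c ->
  form N Q KQ -> form N M KM -> (forall x, VN N x -> 0 <= Q x x) ->
  (forall x n, VN N x -> c * x n ^ 2 <= M x x) ->
  exists lam x, VN N x /\ M x x = 1 /\ (forall y, VN N y -> Q x y = lam * M x y) /\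
    (forall y, VN N y -> lam * M y y <= Q y y) /\ 0 <= lam.
Proof.
  intros HKQ HKM Hc FQ FM PQ PM.
  set (S := fun r => exists x, VN N x /\ M x x = 1 /\ r = - Q x x).
  assert (Nrm : forall y, VN N y -> 0 < M y y -> exists t, 0 < t /\ t * t * M y y = 1).
  { intros y Hy P. exists (/ sqrt (M y y)). assert (0 < sqrt (M y y)) by now apply sqrt_lt_R0.
    split. now apply Rinv_0_lt_compat.
    rewrite <- (sqrt_sqrt (M y y)) at 3 by lra. field. lra. }
  destruct (completeness S) as [L [HL1 HL2]].
  { exists 0. intros r [x [Hx [_ ->]]]. specialize (PQ x Hx). lra. }
  { assert (V0 : VN N (delta 0)) by (apply VN_delta; lia).
    assert (P0 : 0 < M (delta 0) (delta 0)).
    { specialize (PM (delta 0) O V0). unfold delta at 1 in PM. simpl in PM. lra. }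
    destruct (Nrm _ V0 P0) as [t [_ Ht]]. exists (- Q (fun n => t * delta 0 n) (fun n => t * delta 0 n)).
    exists (fun n => t * delta 0 n). split; [now apply VN_scal|]. split; auto. now rewrite (form_scal_square N M KM). }
  set (lam := - L).
  assert (Low : forall y, VN N y -> lam * M y y <= Q y y).
  { intros y Hy. destruct (Rle_lt_dec (M y y) 0) as [Z|P].
    - pose proof (PM y O Hy). assert (M y y = 0) by (pose proof (Rmult_le_pos c (y O ^ 2) (Rlt_le _ _ Hc) (pow2_ge_0 _)); lra). rewrite H0, Rmult_0_r. auto.
    - destruct (Nrm y Hy P) as [t [Ht E]].
      assert (A : - Q (fun n => t * y n) (fun n => t * y n) <= L).
      { apply HL1. exists (fun n => t * y n). split; [now apply VN_scal|]. split; auto. now rewrite (form_scal_square N M KM). }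
      rewrite (form_scal_square N Q KQ) in A by auto. unfold lam.
      apply Rmult_le_reg_l with (t * t); [nra|]. replace (t * t * (- L * M y y)) with (- L * (t * t * M y y)) by ring.
      rewrite E. lra. }
  assert (Hs : forall m : nat, exists x, VN N x /\ M x x = 1 /\ Q x x < lam + / (INR m + 1)).
  { intros m. apply NNPP. intros Hn. assert (Pm : 0 < / (INR m + 1)).
    { apply Rinv_0_lt_compat. pose proof (pos_INR m); lra. }
    assert (L <= L - / (INR m + 1)); [|lra]. apply HL2. intros r [x [Hx [Mx ->]]].
    apply Rnot_lt_le. intros Lt. apply Hn. exists x. split; [exact Hx|split; [exact Mx|unfold lam; lra]]. }
  apply choice in Hs. destruct Hs as [X HX].
  set (C := 1 + / c). assert (Hic : 0 < / c) by now apply Rinv_0_lt_compat.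
  assert (BX : forall x, VN N x -> M x x = 1 -> forall n, Rabs (x n) <= C).
  { intros x Hx E n. specialize (PM x n Hx). rewrite E in PM.
    assert (x n ^ 2 <= / c). { apply Rmult_le_reg_l with c; auto. rewrite Rinv_r; lra. }
    apply Rabs_le. unfold C. split; nra. }
  destruct (cluster X (fun _ => C)) as [x Hx].
  { intros m k. apply BX; apply HX. }
  assert (Vx : VN N x).
  { assert (Z : forall n, (forall m, X m n = 0) -> x n = 0).
    { intros n Hn. apply NNPP. intros Hne. apply Rabs_pos_lt in Hne.
      destruct (Hx (Datatypes.S n) _ O Hne) as [m [_ Hm]]. specialize (Hm n ltac:(lia)).
      rewrite Hn, Rminus_0_l, Rabs_Ropp in Hm. lra. }
    split; [apply Z; intros m; exact (proj1 (proj1 (HX m)))|].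
    intros n Hn. apply Z. intros m. exact (proj2 (proj1 (HX m)) n Hn). }
  assert (Bx : forall n, Rabs (x n) <= C).
  { intros n. apply Rnot_lt_le. intros Lt. destruct (Hx (Datatypes.S n) (Rabs (x n) - C) O) as [m [_ Hm]]; [lra|].
    specialize (Hm n ltac:(lia)). destruct (HX m) as [V [E _]]. pose proof (BX _ V E n).
    pose proof (Rabs_triang_inv (x n) (X m n)). rewrite Rabs_minus_sym in Hm. lra. }
  assert (App : forall eps, 0 < eps -> exists m, / (INR m + 1) < eps /\ Rabs (Q (X m) (X m) - Q x x) < eps /\ Rabs (M (X m) (X m) - M x x) < eps).
  { intros eps He. set (B := 2 * (KQ + KM) * (INR N + 1) ^ 2 * C + 1).
    pose proof (pos_INR N). assert (HN : 0 <= (INR N + 1) ^ 2) by apply pow2_ge_0.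
    assert (HC : 0 <= C) by (unfold C; lra).
    assert (B1 : 0 <= 2 * KQ * (INR N + 1) ^ 2 * C) by (repeat apply Rmult_le_pos; lra).
    assert (B2 : 0 <= 2 * KM * (INR N + 1) ^ 2 * C) by (repeat apply Rmult_le_pos; lra).
    assert (HB : 0 < B) by (unfold B; lra).
    destruct (archimed_cor1 eps He) as [P [HP HP0]].
    assert (Hd : 0 < eps / B) by now apply Rdiv_lt_0_compat.
    destruct (Hx (Datatypes.S N) (eps / B) P Hd) as [m [Hm1 Hm2]]. exists m.
    assert (Bd : forall n, (n <= N)%nat -> Rabs (X m n - x n) <= eps / B) by (intros n Hn; left; apply Hm2; lia).
    destruct (HX m) as [V [E _]].
    pose proof (form_cont N Q KQ (X m) x C (eps / B) FQ HKQ V Vx HC (Rlt_le _ _ Hd) (fun n _ => BX _ V E n) (fun n _ => Bx n) Bd).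
    pose proof (form_cont N M KM (X m) x C (eps / B) FM HKM V Vx HC (Rlt_le _ _ Hd) (fun n _ => BX _ V E n) (fun n _ => Bx n) Bd).
    assert (EB : eps / B * B = eps) by (field; lra).
    split; [|split].
    - eapply Rle_lt_trans; [|exact HP]. apply Rinv_le_contravar. now apply lt_0_INR. apply le_INR in Hm1. lra.
    - eapply Rle_lt_trans. exact H0. rewrite <- EB at 2. rewrite Rmult_comm. apply Rmult_lt_compat_l; auto. unfold B; lra.
    - eapply Rle_lt_trans. exact H1. rewrite <- EB at 2. rewrite Rmult_comm. apply Rmult_lt_compat_l; auto. unfold B; lra. }
  assert (Mx : M x x = 1).
  { apply Rminus_diag_uniq. apply NNPP. intros Hne. apply Rabs_pos_lt in Hne.
    destruct (App _ Hne) as [m [_ [_ A]]]. destruct (HX m) as [_ [E _]]. rewrite E, Rabs_minus_sym in A. lra. }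
  assert (Qx : Q x x = lam).
  { apply Rle_antisym.
    - apply Rnot_lt_le. intros Lt. destruct (App ((Q x x - lam) / 2)) as [m [A1 [A2 _]]]; [lra|].
      destruct (HX m) as [_ [_ B]]. apply Rabs_def2 in A2. lra.
    - specialize (Low x Vx). rewrite Mx in Low. lra. }
  exists lam, x. split; auto. split; auto. split; [|split; auto].
  - intros y Hy.
    (* Cauchy-Schwarz for the nonnegative form [Q - lam M], which vanishes at [x]: its polar form at
       [x] is then zero, which is the Euler equation. *)
    assert (Z : (Q x y - lam * M x y) * (Q x y - lam * M x y) <= (Q y y - lam * M y y) * 0).
    { apply nonneg_quadratic. intros t. pose proof (VN_lin N x y t Vx Hy) as Vt. pose proof (Low _ Vt) as A.
      rewrite (form_square N Q KQ x y t FQ Vx Hy), (form_square N M KM x y t FM Vx Hy), Mx, Qx in A. lra. }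
    rewrite Rmult_0_r in Z. apply Rminus_diag_uniq. apply Rsqr_0_uniq. unfold Rsqr.
    apply Rle_antisym; auto. apply Rle_0_sqr.
  - rewrite <- Qx. auto.
Qed.

(** * Weighted mass, linear functionals and Dirichlet energy in Fourier coefficients *)

Definition mass (w : R -> R) (x y : nat -> R) : R := I (fun t => w t * T x t * T y t).
Definition func (h : R -> R) (x : nat -> R) : R := I (fun t => h t * T x t).
(** The Dirichlet form of the harmonic extensions, computed as the boundary integral of one function
    against the radial derivative of the other. *)
Definition energy (x y : nat -> R) : R := Series (fun n => nu n * freq n * x n * y n).

Lemma term_le_norm1 x n : summable x -> Rabs (x n) <= norm1 x.
Proof.
  intros H. rewrite <- (proj1 (Series_delta n x)). apply Series_abs_le; auto.
  intros k. rewrite Rabs_mult. pose proof (Rabs_pos (x k)).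
  unfold delta. destruct (Nat.eq_dec k n); rewrite ?Rabs_R1, ?Rabs_R0; lra.
Qed.

Lemma func_lin h x y a : cont h -> summable x -> summable y ->
  func h (fun n => x n + a * y n) = func h x + a * func h y.
Proof.
  intros Hh Hx Hy. unfold func. rewrite <- I_scal, <- I_plus by auto 12 with cont. apply I_ext.
  intros t. rewrite T_plus, T_scal; auto using summable_scal. ring.
Qed.
Lemma func_bound h B x : cont h -> (forall t, Rabs (h t) <= B) -> summable x -> Rabs (func h x) <= 2 * PI * B * norm1 x.
Proof.
  intros Hh HB Hx. rewrite Rmult_assoc. apply I_bound; auto with cont. intros t. rewrite Rabs_mult.
  apply Rmult_le_compat; auto using Rabs_pos, T_abs.
Qed.
Lemma form_mass N w B : cont w -> (forall t, Rabs (w t) <= B) -> form N (mass w) (2 * PI * B).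
Proof.
  intros Hw HB. split.
  - intros x y _ _. apply I_ext. intros; ring.
  - intros x y z a Hx Hy Hz. apply VN_summable in Hx, Hy, Hz. unfold mass.
    rewrite <- I_scal, <- I_plus by auto 12 with cont. apply I_ext.
    intros t. rewrite T_plus, T_scal; auto using summable_scal. ring.
  - intros x y Hx Hy. apply VN_summable in Hx, Hy.
    replace (2 * PI * B * norm1 x * norm1 y) with (2 * PI * (B * norm1 x * norm1 y)) by ring.
    apply I_bound; auto with cont. intros t. rewrite !Rabs_mult.
    apply Rmult_le_compat; auto using T_abs, Rabs_pos. apply Rmult_le_pos; apply Rabs_pos.
    apply Rmult_le_compat; auto using T_abs, Rabs_pos.
Qed.
Lemma nufreq_ge0 n : 0 <= nu n * freq n.
Proof. apply Rmult_le_pos. left; apply nu_pos. apply freq_ge0. Qed.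

Lemma VN_series N x (f : nat -> R) : VN N x -> ex_series (fun n => f n * x n).
Proof.
  intros [_ H]. eexists. apply (is_series_finite _ N). intros n Hn. rewrite H by auto. ring.
Qed.
Lemma form_energy N : form N energy (2 * PI * INR N).
Proof.
  split.
  - intros x y _ _. apply Series_ext. intros; ring.
  - intros x y z a Hx Hy Hz. unfold energy. rewrite <- Series_scal_l, <- Series_plus.
    + apply Series_ext. intros; ring.
    + apply ex_series_ext with (fun n => (nu n * freq n * z n) * x n). intros; toR; ring. now apply (VN_series N x).
    + apply ex_series_ext with (fun n => (a * (nu n * freq n * z n)) * y n). intros; toR; ring. now apply (VN_series N y).
  - intros x y Hx Hy. pose proof (VN_summable _ _ Hx) as Sx. pose proof (VN_summable _ _ Hy) as Sy.
    pose proof (norm1_ge0 y Sy) as Ny. pose proof PI_RGT_0.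
    assert (Pc : 0 <= 2 * PI * INR N * norm1 y) by (pose proof (pos_INR N); apply Rmult_le_pos; [apply Rmult_le_pos|]; lra).
    eapply Rle_trans. apply (Series_abs_le _ (fun n => 2 * PI * INR N * norm1 y * x n)).
    + now apply summable_scal.
    + intros n. destruct (le_lt_dec n N) as [L|L].
      * replace (nu n * freq n * x n * y n) with ((nu n * freq n * y n) * x n) by ring.
        rewrite Rabs_mult. rewrite (Rabs_mult (2 * PI * INR N * norm1 y)), (Rabs_pos_eq (2 * PI * INR N * norm1 y)) by auto.
        apply Rmult_le_compat_r. apply Rabs_pos. rewrite Rabs_mult, (Rabs_pos_eq (nu n * freq n)) by apply nufreq_ge0.
        apply Rmult_le_compat; auto using nufreq_ge0, Rabs_pos, term_le_norm1.
        apply Rmult_le_compat. left; apply nu_pos. apply freq_ge0. destruct n; simpl; lra.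
        apply Rle_trans with (INR n). apply freq_bound. now apply le_INR.
      * destruct Hx as [_ Hx]. rewrite (Hx n L), !Rmult_0_r, Rmult_0_l. lra.
    + unfold norm1. rewrite (Series_ext _ (fun n => 2 * PI * INR N * norm1 y * Rabs (x n))).
      * rewrite Series_scal_l. fold (norm1 x). fold (norm1 y). right. ring.
      * intros n. fold (norm1 y). rewrite Rabs_mult, (Rabs_pos_eq _ Pc). reflexivity.
Qed.
Lemma form_func N h B : cont h -> (forall t, Rabs (h t) <= B) -> form N (fun x y => func h x * func h y) ((2 * PI * B) ^ 2).
Proof.
  intros Hh HB. split.
  - intros; ring.
  - intros x y z a Hx Hy Hz. rewrite func_lin; eauto using VN_summable. ring.
  - intros x y Hx Hy. apply VN_summable in Hx, Hy. rewrite Rabs_mult.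
    replace ((2 * PI * B) ^ 2 * norm1 x * norm1 y) with ((2 * PI * B * norm1 x) * (2 * PI * B * norm1 y)) by ring.
    apply Rmult_le_compat; auto using Rabs_pos, func_bound.
Qed.
Lemma form_add N b b' K K' k : form N b K -> form N b' K' -> form N (fun x y => b x y + k * b' x y) (K + Rabs k * K').
Proof.
  intros F F'. split.
  - intros x y Hx Hy. now rewrite (form_sym _ _ _ F), (form_sym _ _ _ F') by auto.
  - intros x y z a Hx Hy Hz. rewrite (form_lin _ _ _ F), (form_lin _ _ _ F') by auto. ring.
  - intros x y Hx Hy. eapply Rle_trans. apply Rabs_triang. rewrite Rabs_mult.
    replace ((K + Rabs k * K') * norm1 x * norm1 y) with (K * norm1 x * norm1 y + Rabs k * (K' * norm1 x * norm1 y)) by ring.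
    apply Rplus_le_compat. now apply (form_bound _ _ _ F). apply Rmult_le_compat_l. apply Rabs_pos. now apply (form_bound _ _ _ F').
Qed.

(** ** Uniform regularity of the Galerkin solutions *)

(** The bound is uniform in [n] and [N], so that convolution with an off-diagonally decaying matrix
    is bounded independently of the truncation. *)
Lemma conv_sum (n N : nat) : sum_n (fun m => / (1 + Rabs (INR m - INR n)) ^ 2) N <= 4.
Proof.
  (* telescoping against a potential increasing from 0 to 4 *)
  set (Psi := fun j : nat => if le_dec n j then 4 - 2 / (2 + (INR j - INR n)) else 2 / (1 + (INR n - INR j))).
  assert (B : forall d, 0 <= d -> / (1 + d) ^ 2 <= 2 / (1 + d) - 2 / (2 + d)).
  { intros d Hd. replace (2 / (1 + d) - 2 / (2 + d)) with (2 / ((1 + d) * (2 + d))) by (field; split; lra).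
    apply Rmult_le_reg_r with ((1 + d) ^ 2 * (2 + d)). apply Rmult_lt_0_compat. apply pow_lt; lra. lra.
    replace (/ (1 + d) ^ 2 * ((1 + d) ^ 2 * (2 + d))) with (2 + d) by (field; lra).
    replace (2 / ((1 + d) * (2 + d)) * ((1 + d) ^ 2 * (2 + d))) with (2 * (1 + d)) by (field; split; lra). lra. }
  assert (Main : sum_n (fun m => / (1 + Rabs (INR m - INR n)) ^ 2) N <= Psi N).
  { induction N.
    - rewrite sum_O. unfold Psi. destruct (le_dec n 0).
      + assert (n = O) by lia. subst. simpl INR. rewrite !Rminus_diag, Rabs_R0. lra.
      + simpl INR. assert (1 <= n)%nat by lia. apply le_INR in H. simpl in H.
        rewrite Rminus_0_l, Rabs_Ropp, Rabs_pos_eq, Rminus_0_r by lra.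
        pose proof (B (INR n) ltac:(lra)). assert (0 < 2 / (2 + INR n)) by (apply Rdiv_lt_0_compat; lra). lra.
    - rewrite sum_Sn. toR. eapply Rle_trans. apply Rplus_le_compat_r. exact IHN.
      unfold Psi. rewrite S_INR. destruct (le_dec n N) as [L|L], (le_dec n (S N)) as [L'|L']; try lia.
      + apply le_INR in L. rewrite Rabs_pos_eq by lra.
        replace (2 + (INR N + 1 - INR n)) with (2 + (1 + (INR N - INR n))) by ring.
        replace (1 + (INR N + 1 - INR n)) with (1 + (1 + (INR N - INR n))) by ring.
        pose proof (B (1 + (INR N - INR n)) ltac:(lra)).
        replace (1 + (1 + (INR N - INR n))) with (2 + (INR N - INR n)) in * by ring. lra.
      + assert (n = S N) by lia. subst. rewrite S_INR. rewrite !Rminus_diag, Rabs_R0.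
        replace (1 + (INR N + 1 - INR N)) with 2 by ring. lra.
      + assert (S N < n)%nat by lia. apply lt_INR in H. rewrite S_INR in H. rewrite Rabs_left1 by lra.
        pose proof (B (INR n - (INR N + 1)) ltac:(lra)).
        replace (- (INR N + 1 - INR n)) with (INR n - (INR N + 1)) by ring.
        replace (2 + (INR n - (INR N + 1))) with (1 + (INR n - INR N)) in H0 by ring. lra. }
  eapply Rle_trans. exact Main. unfold Psi. destruct (le_dec n N) as [L|L].
  - apply le_INR in L. assert (0 < 2 / (2 + (INR N - INR n))) by (apply Rdiv_lt_0_compat; lra). lra.
  - assert (N < n)%nat by lia. apply lt_INR in H.
    apply Rmult_le_reg_r with (1 + (INR n - INR N)); [lra|].
    unfold Rdiv. rewrite Rmult_assoc, Rinv_l by lra. lra.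
Qed.

Lemma fourier_weight w q : smooth w -> periodic w -> exists C, 0 <= C /\ forall k : nat,
  Rabs (I (fun t => w t * cos (INR k * t))) * (1 + INR k) ^ q <= C /\
  Rabs (I (fun t => w t * sin (INR k * t))) * (1 + INR k) ^ q <= C.
Proof.
  intros Hw P. destruct (fourier_decay q w (Hw q) P) as [C [C0 HC]].
  destruct (fourier_decay 0 w (Hw O) P) as [D [D0 HD]].
  assert (P2 : 1 <= 2 ^ q) by (apply pow_R1_Rle; lra).
  exists (2 ^ q * (C + D)). split. apply Rmult_le_pos; lra.
  intros k. destruct (HC k) as [A A'], (HD k) as [B B']. rewrite !pow_O, !Rmult_1_r in B, B'.
  assert (W : (1 + INR k) ^ q <= 2 ^ q * (INR k ^ q + 1)).
  { destruct k.
    - simpl INR. rewrite Rplus_0_r, pow1. assert (0 <= 0 ^ q) by (apply pow_le; lra). nra.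
    - assert (1 <= INR (S k)) by (rewrite S_INR; pose proof (pos_INR k); lra).
      apply Rle_trans with ((2 * INR (S k)) ^ q). apply pow_incr; lra. rewrite Rpow_mult_distr.
      assert (0 <= INR (S k) ^ q) by (apply pow_le; lra). nra. }
  assert (G : forall J, 0 <= J -> J * INR k ^ q <= C -> J <= D -> J * (1 + INR k) ^ q <= 2 ^ q * (C + D)).
  { intros J HJ H1 H2. apply Rle_trans with (J * (2 ^ q * (INR k ^ q + 1))). now apply Rmult_le_compat_l.
    replace (J * (2 ^ q * (INR k ^ q + 1))) with (2 ^ q * (J * INR k ^ q + J)) by ring. apply Rmult_le_compat_l; lra. }
  split; apply G; auto using Rabs_pos.
Qed.

(** With truncated subtraction, [(a - b) + (b - a)] is the distance of [a] and [b], a natural number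
    to which the decay of Fourier coefficients applies. *)
Lemma cos_dist a b t : cos ((INR a - INR b) * t) = cos (INR ((a - b) + (b - a)) * t).
Proof.
  rewrite plus_INR. destruct (le_dec b a).
  - rewrite minus_INR by auto. replace (b - a)%nat with O by lia. f_equal. simpl. ring.
  - rewrite (minus_INR b a) by lia. replace (a - b)%nat with O by lia. rewrite <- cos_neg. f_equal. simpl. ring.
Qed.
Lemma cos_sin_dist_sign a b : exists s, (s = 1 \/ s = -1) /\
  forall t, sin ((INR a - INR b) * t) = s * sin (INR ((a - b) + (b - a)) * t).
Proof.
  destruct (le_dec b a).
  - exists 1. split; auto. intros t. replace (INR a - INR b) with (INR ((a - b) + (b - a))). ring.
    rewrite plus_INR, minus_INR by auto. replace (b - a)%nat with O by lia. simpl; ring.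
  - exists (-1). split; auto. intros t. replace (INR a - INR b) with (- INR ((a - b) + (b - a))).
    + rewrite Ropp_mult_distr_l_reverse, sin_neg. ring.
    + rewrite plus_INR, (minus_INR b a) by lia. replace (a - b)%nat with O by lia. simpl; ring.
Qed.

(** Product formulas turn an entry into half the sum or difference of two Fourier coefficients of
    [w], at the distance and at the sum of the two frequencies; both indices are at least the
    distance. *)
Lemma matrix_decay w q : smooth w -> periodic w -> exists C, 0 <= C /\ forall m n : nat,
  Rabs (I (fun t => w t * e m t * e n t)) * (1 + Rabs (INR m - INR n)) ^ q <= C.
Proof.
  intros Hw P. destruct (fourier_weight w q Hw P) as [C [C0 HC]].
  assert (P2 : 1 <= 2 ^ q) by (apply pow_R1_Rle; lra).
  exists (2 ^ q * C). split. apply Rmult_le_pos; lra.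
  assert (Cw := smooth_cont _ Hw).
  assert (Hd : forall m n, (1 + Rabs (INR m - INR n)) <= 2 * (1 + Rabs (freq m - freq n))).
  { intros m n. destruct (nat_parity m) as [a [-> | ->]], (nat_parity n) as [b [-> | ->]];
      rewrite ?freq_even, ?freq_odd, ?plus_INR, ?mult_INR; simpl;
      unfold Rabs; repeat destruct (Rcase_abs _); lra. }
  assert (Hdist : forall a b, INR (a - b + (b - a)) = Rabs (INR a - INR b)).
  { intros a b. rewrite plus_INR. destruct (le_dec b a).
    - rewrite minus_INR by auto. replace (b - a)%nat with O by lia. apply le_INR in l. rewrite Rabs_pos_eq by lra. simpl; ring.
    - rewrite (minus_INR b a) by lia. replace (a - b)%nat with O by lia. assert (a <= b)%nat by lia. apply le_INR in H. rewrite Rabs_left1 by lra. simpl; ring. }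
  assert (Main : forall m n u v, Rabs (I (fun t => w t * e m t * e n t)) <= (u + v) / 2 ->
     u * (1 + Rabs (freq m - freq n)) ^ q <= C -> v * (1 + Rabs (freq m - freq n)) ^ q <= C ->
     Rabs (I (fun t => w t * e m t * e n t)) * (1 + Rabs (INR m - INR n)) ^ q <= 2 ^ q * C).
  { intros m n u v H1 H2 H3. pose proof (Rabs_pos (freq m - freq n)) as Pf. pose proof (Rabs_pos (INR m - INR n)).
    apply Rle_trans with (Rabs (I (fun t => w t * e m t * e n t)) * (2 * (1 + Rabs (freq m - freq n))) ^ q).
    - apply Rmult_le_compat_l. apply Rabs_pos. apply pow_incr. split; [lra|apply Hd].
    - rewrite Rpow_mult_distr. set (p := (1 + Rabs (freq m - freq n)) ^ q) in *.
      assert (0 <= p) by (apply pow_le; lra).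
      replace (Rabs (I (fun t => w t * e m t * e n t)) * (2 ^ q * p)) with (2 ^ q * (Rabs (I (fun t => w t * e m t * e n t)) * p)) by ring.
      apply Rmult_le_compat_l; [lra|]. nra. }
  assert (Mono : forall J a b, 0 <= J -> J * (1 + INR (a + b)) ^ q <= C -> J * (1 + Rabs (INR a - INR b)) ^ q <= C).
  { intros J a b HJ H. eapply Rle_trans; [|exact H]. apply Rmult_le_compat_l; auto. apply pow_incr.
    pose proof (Rabs_pos (INR a - INR b)). split; [lra|]. rewrite plus_INR.
    pose proof (pos_INR a). pose proof (pos_INR b). apply Rplus_le_compat_l. apply Rabs_le. lra. }
  assert (Mono' : forall J a b, J * (1 + INR (a - b + (b - a))) ^ q <= C -> J * (1 + Rabs (INR a - INR b)) ^ q <= C).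
  { intros J a b. now rewrite Hdist. }
  assert (Half : forall x y : R, Rabs (/ 2 * (x + y)) <= (Rabs x + Rabs y) / 2).
  { intros x y. rewrite Rabs_mult, Rabs_pos_eq by lra. pose proof (Rabs_triang x y). lra. }
  assert (Half' : forall x y : R, Rabs (/ 2 * (x - y)) <= (Rabs x + Rabs y) / 2).
  { intros x y. unfold Rminus. eapply Rle_trans. apply Half. rewrite Rabs_Ropp. lra. }
  intros m n.
  destruct (nat_parity m) as [a [Em|Em]], (nat_parity n) as [b [En|En]];
   pose proof (HC (a - b + (b - a))%nat) as [D1 D2]; pose proof (HC (a + b)%nat) as [S1 S2];
   apply Mono' in D1, D2; apply Mono in S1, S2; try apply Rabs_pos.
  - apply Main with (Rabs (I (fun t => w t * cos (INR (a - b + (b - a)) * t)))) (Rabs (I (fun t => w t * cos (INR (a + b) * t))));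
      rewrite Em, En, ?freq_even; [|exact D1|exact S1].
    rewrite (I_ext _ (fun t => / 2 * (w t * cos (INR (a - b + (b - a)) * t) + w t * cos (INR (a + b) * t)))).
    + rewrite I_scal, I_plus by auto 12 with cont. apply Half.
    + intros t. rewrite !e_even, Rmult_assoc, cos_cos, <- Rmult_minus_distr_r, <- Rmult_plus_distr_r.
      rewrite (cos_dist a b t), <- plus_INR. field.
  - destruct (cos_sin_dist_sign b a) as [s [Hs Es]].
    replace (b - a + (a - b))%nat with (a - b + (b - a))%nat in Es by lia.
    apply Main with (Rabs (I (fun t => w t * sin (INR (a + b) * t)))) (Rabs (I (fun t => w t * sin (INR (a - b + (b - a)) * t))));
      rewrite Em, En, ?freq_even, ?freq_odd; [|exact S2|exact D2].
    rewrite (I_ext _ (fun t => / 2 * (w t * sin (INR (a + b) * t) + s * (w t * sin (INR (a - b + (b - a)) * t))))).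
    + rewrite I_scal, I_plus, I_scal by auto 12 with cont. eapply Rle_trans. apply Half.
      rewrite Rabs_mult. destruct Hs as [-> | ->]; rewrite ?Rabs_m1, ?Rabs_R1; lra.
    + intros t. rewrite e_even, e_odd, Rmult_assoc, (Rmult_comm (cos _)), sin_cos_prod, <- Rmult_minus_distr_r, <- Rmult_plus_distr_r.
      rewrite Es, (Rplus_comm (INR b)), <- plus_INR. field.
  - destruct (cos_sin_dist_sign a b) as [s [Hs Es]].
    apply Main with (Rabs (I (fun t => w t * sin (INR (a + b) * t)))) (Rabs (I (fun t => w t * sin (INR (a - b + (b - a)) * t))));
      rewrite Em, En, ?freq_even, ?freq_odd; [|exact S2|exact D2].
    rewrite (I_ext _ (fun t => / 2 * (w t * sin (INR (a + b) * t) + s * (w t * sin (INR (a - b + (b - a)) * t))))).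
    + rewrite I_scal, I_plus, I_scal by auto 12 with cont. eapply Rle_trans. apply Half.
      rewrite Rabs_mult. destruct Hs as [-> | ->]; rewrite ?Rabs_m1, ?Rabs_R1; lra.
    + intros t. rewrite e_even, e_odd, Rmult_assoc, sin_cos_prod, <- Rmult_minus_distr_r, <- Rmult_plus_distr_r.
      rewrite Es, <- plus_INR. field.
  - apply Main with (Rabs (I (fun t => w t * cos (INR (a - b + (b - a)) * t)))) (Rabs (I (fun t => w t * cos (INR (a + b) * t))));
      rewrite Em, En, ?freq_odd; [|exact D1|exact S1].
    rewrite (I_ext _ (fun t => / 2 * (w t * cos (INR (a - b + (b - a)) * t) - w t * cos (INR (a + b) * t)))).
    + rewrite I_scal, I_minus by auto 12 with cont. apply Half'.
    + intros t. rewrite !e_odd, Rmult_assoc, sin_sin, <- Rmult_minus_distr_r, <- Rmult_plus_distr_r.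
      rewrite (cos_dist a b t), <- plus_INR. field.
Qed.

Lemma sum_n_le (f g : nat -> R) N : (forall n, (n <= N)%nat -> f n <= g n) -> sum_n f N <= sum_n g N.
Proof.
  induction N; intros H.
  - rewrite !sum_O. apply H; lia.
  - rewrite !sum_Sn. toR. apply Rplus_le_compat; auto.
Qed.
Lemma sum_n_abs (f : nat -> R) N : Rabs (sum_n f N) <= sum_n (fun n => Rabs (f n)) N.
Proof.
  induction N.
  - rewrite !sum_O. lra.
  - rewrite !sum_Sn. toR. eapply Rle_trans. apply Rabs_triang. now apply Rplus_le_compat_r.
Qed.
Lemma sum_n_scal c (f : nat -> R) N : sum_n (fun n => c * f n) N = c * sum_n f N.
Proof. apply (sum_n_mult_l (K := R_Ring) c). Qed.

(** Bootstrap on [q]. The matrix of [w] preserves a weighted bound of order [q], and dividing the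
    equation by the frequency gains one order. The constant is chosen before [N], which is what the
    limit needs. *)
Lemma galerkin_regular w h Lam : smooth w -> periodic w -> rapid h -> (forall n, 0 <= h n) -> 0 <= Lam ->
  forall C0 q, exists C, forall N x, VN N x -> (forall n, Rabs (x n) <= C0) ->
   (forall n, (n <= N)%nat -> nu n * freq n * Rabs (x n) <= Lam * Rabs (I (fun t => w t * T x t * e n t)) + h n) ->
   forall n, Rabs (x n) * (1 + INR n) ^ q <= C.
Proof.
  intros Hw P Hh Hh0 HL C0 q. induction q as [|q [C IH]].
  - exists C0. intros N x _ H _ n. rewrite pow_O, Rmult_1_r. auto.
  - destruct (matrix_decay w (q + 2) Hw P) as [D [D0 HD]].
    destruct (rapid_nonneg_const h q Hh) as [Hc [Hc0 HHc]].
    exists (4 / PI * (Lam * (4 * (Rabs C * D)) + Hc) + Rabs C0 * 2 ^ S q).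
    intros N x Hx Hb HEL n. specialize (IH N x Hx Hb HEL).
    pose proof PI_RGT_0 as Hpi. assert (Hip : 0 < / PI) by now apply Rinv_0_lt_compat.
    assert (PC : 0 <= Rabs C * D) by (apply Rmult_le_pos; auto; apply Rabs_pos).
    assert (Pa : 0 <= 4 / PI * (Lam * (4 * (Rabs C * D)) + Hc)).
    { apply Rmult_le_pos. unfold Rdiv; lra. assert (0 <= Lam * (4 * (Rabs C * D))) by (apply Rmult_le_pos; lra). lra. }
    assert (P2 : 0 < 2 ^ S q) by (apply pow_lt; lra).
    assert (Pb : 0 <= Rabs C0 * 2 ^ S q) by (apply Rmult_le_pos; [apply Rabs_pos|lra]).
    destruct (le_lt_dec n 1) as [Hn|Hn].
    { apply Rle_trans with (Rabs C0 * 2 ^ S q); [|lra]. apply Rmult_le_compat; auto using Rabs_pos.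
      left; apply weight_pos. eapply Rle_trans; [apply Hb|apply RRle_abs].
      apply pow_incr. pose proof (pos_INR n). apply le_INR in Hn. simpl in Hn. lra. }
    destruct (le_lt_dec n N) as [HnN|HnN].
    2:{ destruct Hx as [_ Hx]. rewrite Hx, Rabs_R0, Rmult_0_l by auto. lra. }
    specialize (HEL n HnN).
    assert (Hf : 1 <= freq n). { unfold freq. destruct n as [|[|n]]; try lia. simpl Nat.div2. rewrite S_INR. pose proof (pos_INR (Nat.div2 n)); lra. }
    assert (Hnu : nu n = PI) by (destruct n; [lia|reflexivity]). rewrite Hnu in HEL.
    destruct (freq_bound n) as [_ Fb].
    assert (Conv : Rabs (I (fun t => w t * T x t * e n t)) * (1 + INR n) ^ q <= 4 * (Rabs C * D)).
    { rewrite (I_ext _ (fun t => T x t * (w t * e n t))) by (intros; ring).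
      assert (Cw := smooth_cont _ Hw).
      rewrite <- (is_series_unique _ _ (I_T x (fun t => w t * e n t) (VN_summable _ _ Hx) ltac:(auto with cont))).
      rewrite (is_series_unique _ _ (is_series_finite (fun m => x m * I (fun t => e m t * (w t * e n t))) N
         (fun m Hm => eq_trans (f_equal (fun z => z * _) (proj2 Hx m Hm)) (Rmult_0_l _)))).
      rewrite Rmult_comm.
      apply Rle_trans with ((1 + INR n) ^ q * sum_n (fun m => Rabs (x m * I (fun t => e m t * (w t * e n t)))) N).
      { apply Rmult_le_compat_l. left; apply weight_pos. apply sum_n_abs. }
      rewrite <- sum_n_scal.
      apply Rle_trans with (sum_n (fun m => Rabs C * D * / (1 + Rabs (INR m - INR n)) ^ 2) N).
      2:{ rewrite sum_n_scal. rewrite (Rmult_comm 4). apply Rmult_le_compat_l; auto. apply conv_sum. }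
      apply sum_n_le. intros m Hm. rewrite Rabs_mult.
      rewrite (I_ext _ (fun t => w t * e m t * e n t)) by (intros; ring).
      specialize (HD m n). specialize (IH m). set (J := Rabs (I (fun t => w t * e m t * e n t))) in *.
      assert (HJ : 0 <= J) by apply Rabs_pos.
      set (u := 1 + Rabs (INR m - INR n)) in *. assert (Hu : 1 <= u) by (unfold u; pose proof (Rabs_pos (INR m - INR n)); lra).
      assert (Hu2 : 0 < u ^ 2) by (apply pow_lt; lra).
      apply Rmult_le_reg_r with (u ^ 2); auto. rewrite (Rmult_assoc (Rabs C * D)), Rinv_l, Rmult_1_r by lra.
      rewrite pow_add in HD.
      (* Peetre's inequality moves the weight from [n] to [m], at the price of [q] powers of the
         distance, which the decay of order [q + 2] pays. *)
      assert (Pee : (1 + INR n) ^ q <= (1 + INR m) ^ q * u ^ q).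
      { rewrite <- Rpow_mult_distr. apply pow_incr. pose proof (pos_INR n). pose proof (pos_INR m). split; [lra|].
        assert (INR n - INR m <= Rabs (INR m - INR n)) by (rewrite Rabs_minus_sym; apply RRle_abs). unfold u.
        pose proof (Rabs_pos (INR m - INR n)). nra. }
      assert (Px : 0 <= Rabs (x m)) by apply Rabs_pos.
      apply Rle_trans with (((1 + INR m) ^ q * u ^ q) * (Rabs (x m) * J) * u ^ 2).
      { apply Rmult_le_compat_r; [lra|]. apply Rmult_le_compat_r; auto. now apply Rmult_le_pos. }
      replace ((1 + INR m) ^ q * u ^ q * (Rabs (x m) * J) * u ^ 2) with ((Rabs (x m) * (1 + INR m) ^ q) * (J * (u ^ q * u ^ 2))) by ring.
      apply Rmult_le_compat; auto.
      - apply Rmult_le_pos; auto. left; apply weight_pos.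
      - apply Rmult_le_pos; auto. apply Rmult_le_pos; apply pow_le; lra.
      - eapply Rle_trans; [exact IH|apply RRle_abs]. }
    specialize (HHc n). rewrite Rabs_pos_eq in HHc by auto.
    assert (Pw := weight_pos n q).
    apply Rle_trans with (4 / PI * (Lam * (4 * (Rabs C * D)) + Hc)); [|lra].
    rewrite <- tech_pow_Rmult.
    assert (Px : 0 <= Rabs (x n)) by apply Rabs_pos.
    assert (S1 : PI * freq n * Rabs (x n) * (1 + INR n) ^ q <= Lam * (4 * (Rabs C * D)) + Hc).
    { apply Rle_trans with ((Lam * Rabs (I (fun t => w t * T x t * e n t)) + h n) * (1 + INR n) ^ q).
      apply Rmult_le_compat_r; lra. rewrite Rmult_plus_distr_r, Rmult_assoc. apply Rplus_le_compat; auto.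
      now apply Rmult_le_compat_l. }
    replace (4 / PI * (Lam * (4 * (Rabs C * D)) + Hc)) with (/ PI * (4 * (Lam * (4 * (Rabs C * D)) + Hc))) by (field; lra).
    apply Rmult_le_reg_l with PI; auto. rewrite <- (Rmult_assoc PI (/ PI)), Rinv_r, Rmult_1_l by lra.
    apply Rle_trans with (4 * (PI * freq n * Rabs (x n) * (1 + INR n) ^ q)); [|lra].
    replace (PI * (Rabs (x n) * ((1 + INR n) * (1 + INR n) ^ q))) with ((1 + INR n) * (PI * Rabs (x n) * (1 + INR n) ^ q)) by ring.
    replace (4 * (PI * freq n * Rabs (x n) * (1 + INR n) ^ q)) with (4 * freq n * (PI * Rabs (x n) * (1 + INR n) ^ q)) by ring.
    apply Rmult_le_compat_r; [|lra]. apply Rmult_le_pos; [apply Rmult_le_pos|]; lra.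
Qed.

(** * Limits of the Galerkin minimisers *)

Definition lim1 (X : nat -> nat -> R) (x : nat -> R) : Prop :=
  (forall j, summable (X j)) /\ summable x /\ is_lim_seq (fun j => norm1 (fun n => X j n - x n)) 0.

Lemma is_lim_seq_bound (u v : nat -> R) l : (forall j, Rabs (u j - l) <= v j) -> is_lim_seq v 0 -> is_lim_seq u l.
Proof.
  intros H Hv. apply is_lim_seq_spec. intros eps.
  apply is_lim_seq_spec in Hv. destruct (Hv eps) as [N HN]. exists N. intros n Hn. specialize (HN n Hn).
  eapply Rle_lt_trans. apply H. rewrite Rminus_0_r in HN. eapply Rle_lt_trans; [apply RRle_abs|exact HN].
Qed.

Lemma func_lim h B X x : cont h -> (forall t, Rabs (h t) <= B) -> lim1 X x -> is_lim_seq (fun j => func h (X j)) (func h x).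
Proof.
  intros Hh HB [SX [Sx HL]]. apply is_lim_seq_bound with (fun j => 2 * PI * B * norm1 (fun n => X j n - x n)).
  - intros j. replace (func h (X j) - func h x) with (func h (fun n => X j n + (-1) * x n)) by (rewrite func_lin; auto; ring).
    replace (fun n => X j n + -1 * x n) with (fun n => X j n - x n) by (apply functional_extensionality; intros; ring).
    apply func_bound; auto using summable_minus.
  - replace (Finite 0) with (Rbar_mult (2 * PI * B) 0) by (simpl; f_equal; ring). now apply is_lim_seq_scal_l.
Qed.
Lemma coef_lim X x n : lim1 X x -> is_lim_seq (fun j => X j n) (x n).
Proof.
  intros [SX [Sx HL]]. apply is_lim_seq_bound with (fun j => norm1 (fun n => X j n - x n)); auto.
  intros j. apply (term_le_norm1 (fun n => X j n - x n)). auto using summable_minus.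
Qed.
Lemma mass_lim w B X x : cont w -> (forall t, Rabs (w t) <= B) -> lim1 X x ->
  is_lim_seq (fun j => mass w (X j) (X j)) (mass w x x).
Proof.
  intros Hw HB [SX [Sx HL]].
  apply is_lim_seq_bound with (fun j => 2 * PI * B * (norm1 (fun n => X j n - x n) * (norm1 (fun n => X j n - x n) + 2 * norm1 x))).
  - intros j. set (d := fun n => X j n - x n). assert (Sd : summable d) by (apply summable_minus; auto).
    assert (Ed : forall t, T (X j) t = T x t + T d t).
    { intros t. unfold d. rewrite T_minus by auto. ring. }
    unfold mass. rewrite <- I_minus by auto with cont.
    rewrite Rmult_assoc. apply I_bound; auto 8 with cont. intros t. rewrite Ed.
    replace (w t * (T x t + T d t) * (T x t + T d t) - w t * T x t * T x t) with (w t * (T d t * (T d t + 2 * T x t))) by ring.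
    rewrite !Rabs_mult. apply Rmult_le_compat; auto using Rabs_pos. apply Rmult_le_pos; apply Rabs_pos.
    apply Rmult_le_compat; auto using Rabs_pos, T_abs. eapply Rle_trans. apply Rabs_triang.
    rewrite Rabs_mult, (Rabs_pos_eq 2) by lra. pose proof (T_abs d t Sd). pose proof (T_abs x t Sx). lra.
  - replace (Finite 0) with (Rbar_mult (2 * PI * B) (0 * (0 + 2 * norm1 x))) by (simpl; f_equal; ring).
    apply is_lim_seq_scal_l. apply is_lim_seq_mult'; auto. apply is_lim_seq_plus'; auto. apply is_lim_seq_const.
Qed.

Lemma norm1_le x y : summable y -> (forall n, Rabs (x n) <= Rabs (y n)) -> norm1 x <= norm1 y.
Proof. intros H K. apply Series_le; auto. intros n; split; auto. apply Rabs_pos. Qed.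
Lemma norm1_plus x y : summable x -> summable y -> norm1 (fun n => x n + y n) <= norm1 x + norm1 y.
Proof.
  intros H K. unfold norm1. rewrite <- Series_plus by auto. apply Series_le.
  - intros n; split; [apply Rabs_pos|apply Rabs_triang].
  - apply (ex_series_plus (fun n => Rabs (x n)) (fun n => Rabs (y n))); auto.
Qed.

(** The uniform bound with weight [(1 + n) ^ 2] makes the tails uniformly small, so coordinatewise
    approximation becomes convergence in [norm1], along indices common to [X] and [l]. *)
Lemma cluster_norm1 (X : nat -> nat -> R) (l : nat -> R) C L : (forall j n, Rabs (X j n) * (1 + INR n) ^ 2 <= C) ->
  (forall j, Rabs (l j) <= L) ->
  exists (x : nat -> R) (lam : R) (s : nat -> nat), (forall j, (j <= s j)%nat) /\ lim1 (fun j => X (s j)) x /\ is_lim_seq (fun j => l (s j)) lam.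
Proof.
  intros HC HL.
  assert (C0 : 0 <= C). { eapply Rle_trans; [|apply (HC O O)]. apply Rmult_le_pos. apply Rabs_pos. left; apply weight_pos. }
  assert (BX : forall j n, Rabs (X j n) <= C * / (1 + INR n) ^ 2).
  { intros j n. pose proof (weight_pos n 2). apply Rmult_le_reg_r with ((1 + INR n) ^ 2); auto.
    rewrite Rmult_assoc, Rinv_l, Rmult_1_r by lra. apply HC. }
  (* Coordinate 0 carries the level [l j], and the coefficients are shifted by one. *)
  destruct (cluster (fun j k => match k with O => l j | S n => X j n end)
     (fun k => match k with O => L | S n => C * / (1 + INR n) ^ 2 end)) as [z Hz].
  { intros m [|k]; auto. }
  set (x := fun n => z (S n)). set (lam := z O).
  assert (Bx : forall n, Rabs (x n) <= C * / (1 + INR n) ^ 2).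
  { intros n. apply Rnot_lt_le. intros Lt. destruct (Hz (S (S n)) (Rabs (x n) - C * / (1 + INR n) ^ 2) O) as [m [_ Hm]]; [lra|].
    specialize (Hm (S n) ltac:(lia)). change (Rabs (X m n - x n) < Rabs (x n) - C * / (1 + INR n) ^ 2) in Hm. pose proof (BX m n).
    pose proof (Rabs_triang_inv (x n) (X m n)). rewrite Rabs_minus_sym in Hm. lra. }
  assert (Sb : summable (fun n => C * / (1 + INR n) ^ 2)) by apply summable_scal, summable_inv_sq.
  assert (Pb : forall n, 0 <= C * / (1 + INR n) ^ 2).
  { intros n. apply Rmult_le_pos; auto. left. apply Rinv_0_lt_compat, weight_pos. }
  assert (SX : forall j, summable (X j)).
  { intros j. apply summable_le with (fun n => C * / (1 + INR n) ^ 2); auto. intros n. rewrite (Rabs_pos_eq (C * _)); auto. }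
  assert (Sx : summable x).
  { apply summable_le with (fun n => C * / (1 + INR n) ^ 2); auto. intros n. rewrite (Rabs_pos_eq (C * _)); auto. }
  assert (App : forall j : nat, exists m, (j <= m)%nat /\ norm1 (fun n => X m n - x n) <= / (INR j + 1) /\ Rabs (l m - lam) <= / (INR j + 1)).
  { intros j. set (eps := / (INR j + 1)). assert (He : 0 < eps) by (apply Rinv_0_lt_compat; pose proof (pos_INR j); lra).
    set (b := fun n => 2 * (C * / (1 + INR n) ^ 2)). assert (Sb2 : summable b) by now apply summable_scal.
    destruct (tail_small b (eps / 2) Sb2) as [K HK]; [lra|]. specialize (HK K (Nat.le_refl K)).
    set (dl := eps / (2 * (INR K + 1))). pose proof (pos_INR K).
    assert (Hdl : 0 < dl) by (unfold dl; apply Rdiv_lt_0_compat; lra).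
    assert (dl <= eps). { unfold dl. apply Rmult_le_reg_r with (2 * (INR K + 1)); [lra|].
      replace (eps / (2 * (INR K + 1)) * (2 * (INR K + 1))) with eps by (field; lra). nra. }
    destruct (Hz (S (S K)) dl j Hdl) as [m [Hm1 Hm2]]. exists m. split; auto. split.
    - set (cst := fun _ : nat => dl).
      assert (St : summable (trunc K cst)) by (apply (summable_finite _ K); intros n Hn; now apply trunc_out).
      assert (Stb : summable (fun n => b n - trunc K b n)) by (apply summable_minus; auto using summable_trunc).
      apply Rle_trans with (norm1 (fun n => trunc K cst n + (b n - trunc K b n))).
      + apply norm1_le. now apply summable_plus. intros n. destruct (le_lt_dec n K) as [Ln|Ln].
        * rewrite !trunc_in by auto. rewrite Rminus_diag, Rplus_0_r. unfold cst. rewrite (Rabs_pos_eq dl) by lra.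
          left. apply (Hm2 (S n)). lia.
        * rewrite !trunc_out by auto. rewrite Rminus_0_r, Rplus_0_l. unfold b. rewrite (Rabs_pos_eq (2 * _)).
          eapply Rle_trans. apply Rabs_triang. rewrite Rabs_Ropp. pose proof (BX m n). pose proof (Bx n). lra.
          specialize (Pb n). lra.
      + eapply Rle_trans. apply norm1_plus; auto.
        assert (norm1 (trunc K cst) <= (INR K + 1) * dl).
        { unfold norm1. rewrite (is_series_unique _ _ (is_series_finite (fun n => Rabs (trunc K cst n)) K
            (fun n Hn => eq_trans (f_equal Rabs (trunc_out K cst n Hn)) Rabs_R0))).
          rewrite (sum_n_ext_loc _ (fun _ => dl)). rewrite sum_n_const, S_INR. right; ring.
          intros n Hn. rewrite trunc_in by auto. unfold cst. apply Rabs_pos_eq. lra. }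
        replace ((INR K + 1) * dl) with (eps / 2) in H1 by (unfold dl; field; lra). lra.
    - left. eapply Rlt_le_trans. apply (Hm2 O). lia. auto. }
  apply choice in App. destruct App as [s Hs]. exists x, lam, s.
  assert (L0 : is_lim_seq (fun j => / (INR j + 1)) 0).
  { apply (is_lim_seq_inv (fun n => INR n + 1) p_infty); [|discriminate].
    eapply is_lim_seq_plus. apply is_lim_seq_INR. apply is_lim_seq_const. reflexivity. }
  split; [apply Hs|]. split; [split; [|split]|]; auto.
  - apply is_lim_seq_bound with (fun j => / (INR j + 1)); auto. intros j. rewrite Rminus_0_r, Rabs_pos_eq. apply Hs.
    apply norm1_ge0. apply summable_minus; auto.
  - apply is_lim_seq_bound with (fun j => / (INR j + 1)); auto. intros j. apply Hs.
Qed.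

Lemma trunc_lim x (s : nat -> nat) : summable x -> (forall j, (j <= s j)%nat) -> lim1 (fun j => trunc (s j) x) x.
Proof.
  intros Hx Hs. split; [|split]; auto using summable_trunc.
  apply is_lim_seq_spec. intros eps. destruct (tail_small x eps Hx (cond_pos eps)) as [N0 HN]. exists N0.
  intros n Hn. rewrite Rminus_0_r, Rabs_pos_eq.
  - replace (norm1 (fun n0 => trunc (s n) x n0 - x n0)) with (norm1 (fun n0 => x n0 - trunc (s n) x n0)).
    + apply HN. specialize (Hs n). lia.
    + apply Series_ext. intros k. apply Rabs_minus_sym.
  - apply norm1_ge0. apply summable_minus; auto using summable_trunc.
Qed.

Lemma rapid_energy v : rapid v -> ex_series (fun n => nu n * freq n * v n * v n).
Proof.
  intros Hv. destruct (rapid_nonneg_const v 0 Hv) as [C [C0 HC]].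
  assert (S : summable (fun n => v n * (1 + INR n) ^ 1)) by now apply rapid_weight.
  apply summable_ex. apply summable_le with (fun n => 2 * PI * C * (v n * (1 + INR n) ^ 1)).
  - now apply summable_scal.
  - intros n. specialize (HC n). rewrite pow_O, Rmult_1_r in HC. pose proof PI_RGT_0.
    rewrite !Rabs_mult, (Rabs_pos_eq (nu n)), (Rabs_pos_eq (freq n)), (Rabs_pos_eq 2), (Rabs_pos_eq PI), (Rabs_pos_eq C), (Rabs_pos_eq ((1 + INR n) ^ 1)); try lra.
    2: left; apply weight_pos. 2: apply freq_ge0. 2: left; apply nu_pos.
    replace (nu n * freq n * Rabs (v n) * Rabs (v n)) with ((nu n * Rabs (v n)) * (Rabs (v n) * freq n)) by ring.
    pose proof (nu_pos n). pose proof (freq_ge0 n). pose proof (Rabs_pos (v n)).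
    apply Rmult_le_compat.
    + apply Rmult_le_pos; lra.
    + apply Rmult_le_pos; lra.
    + apply Rmult_le_compat; try lra. destruct n; simpl; lra.
    + apply Rmult_le_compat_l; auto. destruct (freq_bound n). rewrite pow_1. lra.
Qed.

(** Lowest eigenpair of the energy plus two squared penalties, relative to the mass. The minimisers
    in [VN N] satisfy the Euler equation for [n <= N] and decay rapidly uniformly in [N]; each
    equation therefore survives in the limit, and so does minimality against rapidly decreasing
    [v]. *)
Lemma galerkin (w g : R -> R) K0 K1 : smooth w -> periodic w -> (forall t, 0 < w t) -> smooth g -> periodic g ->
  0 <= K0 -> 0 <= K1 ->
  let wg := fun t => w t * g t in
  exists lam x, 0 <= lam /\ rapid x /\ x 1%nat = 0 /\ mass w x x = 1 /\
   (forall n, nu n * freq n * x n + K0 * (func w x * I (fun t => w t * e n t)) + K1 * (func wg x * I (fun t => wg t * e n t))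
       = lam * I (fun t => w t * T x t * e n t)) /\
   (forall v, rapid v -> v 1%nat = 0 ->
      lam * mass w v v <= energy v v + K0 * (func w v * func w v) + K1 * (func wg v * func wg v)).
Proof.
  intros Sw Pw Pos Sg Pg HK0 HK1 wg.
  assert (Swg : smooth wg) by (unfold wg; auto with cont).
  assert (Pwg : periodic wg) by (intros t; unfold wg; now rewrite Pw, Pg).
  assert (Cw := smooth_cont _ Sw). assert (Cg := smooth_cont _ Sg). assert (Cwg := smooth_cont _ Swg).
  destruct (periodic_bounded w Cw Pw) as [Bw [Bw0 HBw]].
  destruct (periodic_bounded wg Cwg Pwg) as [Bg [Bg0 HBg]].
  pose proof two_PI_pos as Hpi.
  assert (Nw : forall t, w t <> 0) by (intros t; specialize (Pos t); lra).
  assert (Sinv : smooth (fun t => / w t)) by (apply smooth_inv; auto).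
  assert (Cinv := smooth_cont _ Sinv).
  set (Winv := I (fun t => / w t)).
  assert (HWinv : 0 < Winv).
  { apply (I_pos_point _ 0); auto. intros t; now rewrite Pw. intros t; left; apply Rinv_0_lt_compat, Pos. apply Rinv_0_lt_compat, Pos. }
  assert (HIw : 0 < I w) by (apply (I_pos_point _ 0); auto; intros t; left; auto).
  set (Q := fun x y => energy x y + K0 * (func w x * func w y) + K1 * (func wg x * func wg y)).
  assert (FQ : forall N, exists K, 0 <= K /\ form N Q K).
  { intros N. eexists. split; [|apply form_add; [apply form_add; [apply form_energy|apply form_func; eauto]|apply form_func; eauto]].
    pose proof (pos_INR N). pose proof (Rabs_pos K0). pose proof (Rabs_pos K1).
    assert (0 <= (2 * PI * Bw) ^ 2) by apply pow2_ge_0. assert (0 <= (2 * PI * Bg) ^ 2) by apply pow2_ge_0.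
    assert (0 <= 2 * PI * INR N) by (apply Rmult_le_pos; lra).
    assert (0 <= Rabs K0 * (2 * PI * Bw) ^ 2) by now apply Rmult_le_pos.
    assert (0 <= Rabs K1 * (2 * PI * Bg) ^ 2) by now apply Rmult_le_pos. lra. }
  assert (En0 : forall x, 0 <= energy x x \/ ~ ex_series (fun n => nu n * freq n * x n * x n)).
  { intros x. destruct (classic (ex_series (fun n => nu n * freq n * x n * x n))) as [H|H]; auto. left.
    unfold energy.
    replace 0 with (Series (fun _ : nat => 0)). apply Series_le; auto. intros n. split; [lra|].
    rewrite Rmult_assoc. apply Rmult_le_pos. apply nufreq_ge0. apply Rle_0_sqr.
    apply is_series_unique. evar_last. apply (is_series_finite (fun _ => 0) O). auto. now rewrite sum_O. }
  (* Coercivity of the mass: [x n * nu n] is the weighted product of [T x] with [e n / w], and the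
     weighted square of the latter integrates to at most the integral of [1 / w]. *)
  assert (Low : forall N x n, VN N x -> / Winv * x n ^ 2 <= mass w x x).
  { intros N x n Hx. pose proof (VN_summable _ _ Hx) as Sx.
    assert (M0 : 0 <= mass w x x).
    { apply I_ge0; auto with cont. intros t. rewrite Rmult_assoc. apply Rmult_le_pos. left; auto. apply Rle_0_sqr. }
    destruct (Nat.eq_dec n 1) as [->|Hn]. { rewrite (proj1 Hx). simpl. rewrite !Rmult_0_l, Rmult_0_r. auto. }
    pose proof (Cauchy_Schwarz_I w (T x) (fun t => e n t * / w t) Cw (cont_T x Sx) ltac:(auto with cont) (fun t => Rlt_le _ _ (Pos t))) as CS. cbv beta in CS.
    rewrite (I_ext (fun t => w t * T x t * (e n t * / w t)) (fun t => T x t * e n t)) in CS by (intros t; field; auto).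
    rewrite I_T_e in CS by auto. fold (mass w x x) in CS.
    assert (J : I (fun t => w t * (e n t * / w t) * (e n t * / w t)) <= Winv).
    { apply I_le; auto 8 with cont. intros t. replace (w t * (e n t * / w t) * (e n t * / w t)) with (/ w t * (e n t) ^ 2) by (field; auto).
      rewrite <- (Rmult_1_r (/ w t)) at 2. apply Rmult_le_compat_l. left; apply Rinv_0_lt_compat, Pos.
      rewrite <- (pow2_abs (e n t)). rewrite <- (pow1 2). apply pow_incr. split; [apply Rabs_pos|apply e_le1]. }
    assert (nu1 : 1 <= nu n). { pose proof PI2_1. destruct n; simpl; lra. }
    apply Rmult_le_reg_l with Winv; auto. rewrite <- Rmult_assoc, Rinv_r, Rmult_1_l by lra.
    assert (0 <= x n ^ 2) by apply pow2_ge_0.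
    apply Rle_trans with (x n ^ 2 * (nu n * nu n)).
    { rewrite <- (Rmult_1_r (x n ^ 2)) at 1. apply Rmult_le_compat_l; auto. nra. }
    replace (x n ^ 2 * (nu n * nu n)) with (x n * nu n * (x n * nu n)) by ring.
    eapply Rle_trans. exact CS.
    rewrite Rmult_comm. apply Rmult_le_compat_r; auto. }
  assert (Mins : forall N : nat, exists p : R * (nat -> R), VN N (snd p) /\ mass w (snd p) (snd p) = 1 /\
     (forall y, VN N y -> Q (snd p) y = fst p * mass w (snd p) y) /\ (forall y, VN N y -> fst p * mass w y y <= Q y y) /\ 0 <= fst p).
  { intros N. destruct (FQ N) as [K [HK FK]].
    assert (PQ : forall x, VN N x -> 0 <= Q x x).
    { intros x Hx. unfold Q. destruct (En0 x) as [E|E].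
      + assert (0 <= K0 * (func w x * func w x)) by (apply Rmult_le_pos; auto; apply Rle_0_sqr).
        assert (0 <= K1 * (func wg x * func wg x)) by (apply Rmult_le_pos; auto; apply Rle_0_sqr). lra.
      + exfalso. apply E. apply ex_series_ext with (fun n => (nu n * freq n * x n) * x n). intros; reflexivity. now apply (VN_series N). }
    assert (PB : 0 <= 2 * PI * Bw) by (apply Rmult_le_pos; lra).
    destruct (min_eigen N Q (mass w) K (2 * PI * Bw) (/ Winv) HK PB (Rinv_0_lt_compat _ HWinv) FK
      (form_mass N w Bw Cw HBw) PQ (Low N)) as [lam [x H]].
    now exists (lam, x). }
  apply choice in Mins. destruct Mins as [p Hp].
  set (X := fun N => snd (p N)). set (l := fun N => fst (p N)).
  assert (VX : forall N, VN N (X N)) by (intros; apply Hp).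
  assert (MX : forall N, mass w (X N) (X N) = 1) by (intros; apply Hp).
  assert (EL : forall N y, VN N y -> Q (X N) y = l N * mass w (X N) y) by (intros N; apply Hp).
  assert (Min : forall N y, VN N y -> l N * mass w y y <= Q y y) by (intros N; apply Hp).
  assert (l0 : forall N, 0 <= l N) by (intros; apply Hp).
  assert (SX : forall N, summable (X N)) by (intros N; now apply VN_summable with N).
  assert (Fdelta : forall h n, func h (delta n) = I (fun t => h t * e n t)).
  { intros h n. apply I_ext. intros t. now rewrite T_delta. }
  (* The quotient of the constant function, which has no energy, bounds every level independently of
     [N]. *)
  set (Lam := (K0 * (I w * I w) + K1 * (I wg * I wg)) / I w).
  assert (lL : forall N, l N <= Lam).
  { intros N. assert (V0 : VN N (delta 0)) by (apply VN_delta; lia).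
    pose proof (Min N _ V0) as H. unfold Q in H. rewrite !Fdelta in H.
    assert (E1 : mass w (delta 0) (delta 0) = I w).
    { apply I_ext. intros t. rewrite T_delta, e0. ring. }
    assert (E2 : energy (delta 0) (delta 0) = 0).
    { unfold energy. rewrite (Series_ext _ (fun n => delta 0 n * (nu n * freq n * delta 0 n))) by (intros; ring).
      rewrite (proj1 (Series_delta 0 (fun n => nu n * freq n * delta 0 n))). unfold freq. simpl. ring. }
    rewrite E1, E2 in H.
    rewrite !(I_ext (fun t => w t * e 0 t) w) in H by (intros; rewrite e0; ring).
    rewrite !(I_ext (fun t => wg t * e 0 t) wg) in H by (intros; rewrite e0; ring).
    unfold Lam. apply Rmult_le_reg_r with (I w); auto. unfold Rdiv. rewrite Rmult_assoc, Rinv_l by lra. lra. }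
  assert (HLam : 0 <= Lam) by (eapply Rle_trans; [apply (l0 O)|auto]).
  assert (BX : forall N n, Rabs (X N n) <= 1 + Winv).
  { intros N n. pose proof (Low N _ n (VX N)) as H. rewrite MX in H.
    assert (X N n ^ 2 <= Winv). { apply Rmult_le_reg_l with (/ Winv). now apply Rinv_0_lt_compat. rewrite Rinv_l; lra. }
    apply Rabs_le. split; nra. }
  assert (BF : forall N, Rabs (func w (X N)) <= 1 + I w).
  { intros N. pose proof (Cauchy_Schwarz_I w (T (X N)) (fun _ => 1) Cw (cont_T _ (SX N)) (cont_const 1) (fun t => Rlt_le _ _ (Pos t))) as CS. cbv beta in CS.
    fold (mass w (X N) (X N)) in CS. rewrite MX in CS.
    rewrite (I_ext (fun t => w t * T (X N) t * 1) (fun t => w t * T (X N) t)) in CS by (intros; ring). fold (func w (X N)) in CS.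
    rewrite (I_ext (fun t => w t * 1 * 1) w) in CS by (intros; ring). apply Rabs_le. split; nra. }
  set (G2 := I (fun t => w t * g t * g t)).
  assert (HG2 : 0 <= G2). { apply I_ge0; auto with cont. intros t. rewrite Rmult_assoc. apply Rmult_le_pos. left; auto. apply Rle_0_sqr. }
  assert (BG : forall N, Rabs (func wg (X N)) <= 1 + G2).
  { intros N. pose proof (Cauchy_Schwarz_I w (T (X N)) g Cw (cont_T _ (SX N)) Cg (fun t => Rlt_le _ _ (Pos t))) as CS. cbv beta in CS.
    fold (mass w (X N) (X N)) in CS. rewrite MX in CS.
    rewrite (I_ext (fun t => w t * T (X N) t * g t) (fun t => wg t * T (X N) t)) in CS by (intros; unfold wg; ring). fold (func wg (X N)) in CS.
    fold G2 in CS. apply Rabs_le. split; nra. }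
  set (R1 := fun n => I (fun t => w t * e n t)). set (R2 := fun n => I (fun t => wg t * e n t)).
  assert (ELn : forall N n, (n <= N)%nat -> nu n * freq n * X N n + K0 * (func w (X N) * R1 n) + K1 * (func wg (X N) * R2 n)
      = l N * I (fun t => w t * T (X N) t * e n t)).
  { intros N n Hn. destruct (Nat.eq_dec n 1) as [->|Hn1].
    - unfold R1, R2. rewrite !I_mult_e1. rewrite (proj1 (VX N)). ring.
    - pose proof (EL N (delta n) (VN_delta N n Hn Hn1)) as H. unfold Q in H. rewrite !Fdelta in H.
      assert (E1 : mass w (X N) (delta n) = I (fun t => w t * T (X N) t * e n t)).
      { apply I_ext. intros t. now rewrite T_delta. }
      assert (E2 : energy (X N) (delta n) = nu n * freq n * X N n).
      { unfold energy. rewrite (Series_ext _ (fun k => delta n k * (nu k * freq k * X N k))) by (intros; ring).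
        apply (proj1 (Series_delta n (fun k => nu k * freq k * X N k))). }
      rewrite E1, E2 in H. exact H. }
  assert (Rr : forall u, smooth u -> periodic u -> rapid (fun n => I (fun t => u t * e n t))).
  { intros u Su Pu. apply rapid_poly with (fc u) (2 * PI) O; [now apply fc_rapid|]. intros n. unfold fc.
    unfold Rdiv. rewrite Rabs_mult, Rabs_inv, (Rabs_pos_eq (nu n)) by (left; apply nu_pos). rewrite pow_O, Rmult_1_r.
    pose proof (nu_pos n). set (J := Rabs (I _)). assert (0 <= J) by apply Rabs_pos.
    apply Rmult_le_reg_r with (nu n); auto. replace (2 * PI * (J * / nu n) * nu n) with (J * (2 * PI)) by (field; lra).
    apply Rmult_le_compat_l; auto. pose proof PI_RGT_0. destruct n; simpl; lra. }
  (* The penalty terms of the Euler equation, bounded independently of [N], enter the regularity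
     estimate as a rapidly decreasing source. *)
  set (h := fun n => K0 * (1 + I w) * Rabs (R1 n) + K1 * (1 + G2) * Rabs (R2 n)).
  assert (Rh : rapid h).
  { apply rapid_plus; apply rapid_scal.
    - apply rapid_poly with R1 1 O. now apply Rr. intros n. rewrite Rabs_Rabsolu. simpl; lra.
    - apply rapid_poly with R2 1 O. now apply Rr. intros n. rewrite Rabs_Rabsolu. simpl; lra. }
  assert (h0 : forall n, 0 <= h n).
  { intros n. unfold h. apply Rplus_le_le_0_compat; (apply Rmult_le_pos; [apply Rmult_le_pos; lra|apply Rabs_pos]). }
  assert (Reg : forall q, exists C, forall N n, Rabs (X N n) * (1 + INR n) ^ q <= C).
  { intros q. destruct (galerkin_regular w h Lam Sw Pw Rh h0 HLam (1 + Winv) q) as [C HC]. exists C. intros N.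
    apply (HC N); auto. intros n Hn. pose proof (ELn N n Hn) as E.
    rewrite <- (Rabs_pos_eq (nu n * freq n)) by apply nufreq_ge0. rewrite <- Rabs_mult.
    replace (nu n * freq n * X N n) with (l N * I (fun t => w t * T (X N) t * e n t) + (- (K0 * (func w (X N) * R1 n)) + - (K1 * (func wg (X N) * R2 n)))) by lra.
    eapply Rle_trans. apply Rabs_triang. apply Rplus_le_compat.
    - rewrite Rabs_mult, (Rabs_pos_eq (l N)) by auto. apply Rmult_le_compat_r. apply Rabs_pos. auto.
    - eapply Rle_trans. apply Rabs_triang. rewrite !Rabs_Ropp, !Rabs_mult, (Rabs_pos_eq K0), (Rabs_pos_eq K1) by auto.
      unfold h. rewrite !Rmult_assoc. apply Rplus_le_compat; apply Rmult_le_compat_l; auto; apply Rmult_le_compat_r; auto using Rabs_pos. }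
  destruct (Reg 2%nat) as [C2 HC2].
  destruct (cluster_norm1 X l C2 Lam HC2) as [x [lam [s [Hs [HX Hl]]]]].
  { intros j. rewrite Rabs_pos_eq; auto. }
  assert (Hcoef : forall n, is_lim_seq (fun j => X (s j) n) (x n)) by (intros n; now apply (coef_lim (fun j => X (s j)))).
  assert (Hfw := func_lim w Bw _ x Cw HBw HX). assert (Hfg := func_lim wg Bg _ x Cwg HBg HX).
  exists lam, x. split; [|split; [|split; [|split; [|split]]]].
  - apply (is_lim_seq_le (fun _ => 0) (fun j => l (s j)) 0 lam); auto. apply is_lim_seq_const.
  - intros q. destruct (Reg q) as [C HC]. exists C. intros n.
    apply (is_lim_seq_le (fun j => Rabs (X (s j) n) * (1 + INR n) ^ q) (fun _ => C) (Rabs (x n) * (1 + INR n) ^ q) C); auto.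
    + apply is_lim_seq_mult'; [|apply is_lim_seq_const]. now apply (is_lim_seq_abs _ (x n)).
    + apply is_lim_seq_const.
  - pose proof (Hcoef 1%nat) as H. apply is_lim_seq_unique in H. rewrite (Lim_seq_ext _ (fun _ => 0)), Lim_seq_const in H.
    now injection H. intros j. apply (proj1 (VX (s j))).
  - pose proof (mass_lim w Bw _ x Cw HBw HX) as H. apply is_lim_seq_unique in H. rewrite (Lim_seq_ext _ (fun _ => 1)), Lim_seq_const in H.
    now injection H. intros j. apply MX.
  - intros n. fold (R1 n) (R2 n).
    assert (Cwe : cont (fun t => w t * e n t)) by auto with cont.
    assert (HBe : forall t, Rabs (w t * e n t) <= Bw).
    { intros t. rewrite Rabs_mult. pose proof (e_le1 n t). pose proof (Rabs_pos (w t)). specialize (HBw t). pose proof (Rabs_pos (e n t)). nra. }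
    assert (Hfe := func_lim _ Bw _ x Cwe HBe HX).
    assert (Ee : forall y, I (fun t => w t * T y t * e n t) = func (fun t => w t * e n t) y) by (intros y; apply I_ext; intros; ring).
    rewrite Ee.
    assert (L1 : is_lim_seq (fun j => nu n * freq n * X (s j) n + K0 * (func w (X (s j)) * R1 n) + K1 * (func wg (X (s j)) * R2 n))
       (nu n * freq n * x n + K0 * (func w x * R1 n) + K1 * (func wg x * R2 n))).
    { apply is_lim_seq_plus'; [apply is_lim_seq_plus'|].
      - apply is_lim_seq_mult'; [apply is_lim_seq_const|auto].
      - apply is_lim_seq_mult'; [apply is_lim_seq_const|]. apply is_lim_seq_mult'; [auto|apply is_lim_seq_const].
      - apply is_lim_seq_mult'; [apply is_lim_seq_const|]. apply is_lim_seq_mult'; [auto|apply is_lim_seq_const]. }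
    assert (L2 : is_lim_seq (fun j => l (s j) * func (fun t => w t * e n t) (X (s j))) (lam * func (fun t => w t * e n t) x))
      by (apply is_lim_seq_mult'; auto).
    apply is_lim_seq_unique in L1, L2.
    enough (Finite (nu n * freq n * x n + K0 * (func w x * R1 n) + K1 * (func wg x * R2 n)) = Finite (lam * func (fun t => w t * e n t) x)) by congruence.
    rewrite <- L1, <- L2. apply Lim_seq_ext_loc. exists n. intros j Hj. rewrite ELn. now rewrite Ee. specialize (Hs j). lia.
  (* Minimality is tested on truncations of [v]. Their energy is at most that of [v], so only the
     mass and the penalties require a limit. *)
  - intros v Rv v1. pose proof (rapid_summable _ Rv) as Sv. pose proof (trunc_lim v s Sv Hs) as HT.
    assert (VT : forall N, VN N (trunc N v)).
    { intros N. split. unfold trunc. destruct (Nat.leb 1 N); auto. intros n Hn. now apply trunc_out. }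
    apply (is_lim_seq_le (fun j => l (s j) * mass w (trunc (s j) v) (trunc (s j) v))
      (fun j => energy v v + K0 * (func w (trunc (s j) v) * func w (trunc (s j) v)) + K1 * (func wg (trunc (s j) v) * func wg (trunc (s j) v)))
      (lam * mass w v v) (energy v v + K0 * (func w v * func w v) + K1 * (func wg v * func wg v))).
    + intros j. eapply Rle_trans. apply Min, VT. unfold Q. do 2 apply Rplus_le_compat_r.
      apply Series_le.
      * intros n. split.
        -- rewrite Rmult_assoc. apply Rmult_le_pos. apply nufreq_ge0. apply Rle_0_sqr.
        -- rewrite !Rmult_assoc, <- (Rmult_assoc (nu n)), <- (Rmult_assoc (nu n) (freq n) (v n * v n)). apply Rmult_le_compat_l. apply nufreq_ge0.
           unfold trunc. destruct (Nat.leb n (s j)). lra. rewrite Rmult_0_r. apply Rle_0_sqr.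
      * now apply rapid_energy.
    + apply is_lim_seq_mult'; auto. now apply (mass_lim w Bw).
    + assert (F1 := func_lim w Bw _ v Cw HBw HT). assert (F2 := func_lim wg Bg _ v Cwg HBg HT).
      apply is_lim_seq_plus'; [apply is_lim_seq_plus'|].
      * apply is_lim_seq_const.
      * apply is_lim_seq_mult'; [apply is_lim_seq_const|]. apply is_lim_seq_mult'; auto.
      * apply is_lim_seq_mult'; [apply is_lim_seq_const|]. apply is_lim_seq_mult'; auto.
Qed.

(** * Steklov eigenfunctions and the inequality of Hersch, Payne and Schiffer *)

(** Both sides of the boundary condition are continuous and periodic with the same Fourier
    coefficients; hence the weak equation holds pointwise. *)
Lemma series_steklov (W : C -> R) w lam x : cont w -> (forall t, W (cis t) = w t) -> rapid x ->
  (forall n, nu n * freq n * x n = lam * I (fun t => w t * T x t * e n t)) ->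
  steklov_solution W lam (fun p => fst (ps (coefC x) p)).
Proof.
  intros Cw HW Hx E. pose proof (rapidC_coefC x Hx) as Hc. pose proof (rapid_summable _ Hx) as Sx.
  assert (Pw : periodic w) by (intros t; rewrite <- !HW; apply (periodic_cis W)).
  split; [now apply ps_harmonic|]. split.
  - apply ps_smooth_on; auto. intros q; apply closed_disk_cd. apply interior_closed_disk.
  - intros p Hp. apply circle_cis in Hp. destruct Hp as [t ->].
    rewrite ps_radial, ps_radial_cis, ps_cis, HW by auto.
    symmetry. apply (T_unique (fun t => lam * w t * T x t)).
    + auto with cont.
    + intros s. now rewrite Pw, periodic_T.
    + now apply rapid_summable, rapid_freq.
    + intros n Hn. rewrite (I_ext _ (fun t => lam * (w t * T x t * e n t))) by (intros; ring).
      rewrite I_scal by auto with cont. rewrite <- E. ring.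
Qed.

(** [b] tells whether orthogonality to the eigenfunction [g] is imposed. The test function [v] feels
    no penalty, so the penalised minimum satisfies [lam < mu]. Testing its equation with 1 gives
    [(mu - lam) func w x = 0] and, when [b] holds, testing with [g] gives
    [(s + mu - lam) func wg x = 0]: the penalty terms vanish and [x] solves the original problem. *)
Lemma eigen_below (b : bool) w g s mu v : smooth w -> periodic w -> (forall t, 0 < w t) ->
  smooth g -> periodic g -> 0 <= s -> 0 < mu ->
  (forall n, nu n * freq n * fc g n = s * I (fun t => w t * g t * e n t)) -> 0 < I (fun t => w t * g t * g t) ->
  I (fun t => w t * g t) = 0 ->
  rapid v -> v 1%nat = 0 -> func w v = 0 -> (b = true -> func (fun t => w t * g t) v = 0) ->
  energy v v < mu * mass w v v ->
  exists lam x, 0 < lam < mu /\ rapid x /\ mass w x x = 1 /\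
    (forall n, nu n * freq n * x n = lam * I (fun t => w t * T x t * e n t)) /\
    (b = true -> func (fun t => w t * g t) x = 0).
Proof.
  intros Sw Pw Pos Sg Pg Hs Hmu Eg Mg Ig Rv v1 Lv Bv Ev.
  set (wg := fun t => w t * g t) in *.
  assert (Cw := smooth_cont _ Sw). assert (Cg := smooth_cont _ Sg).
  assert (Cwg : cont wg) by (unfold wg; auto with cont).
  assert (HIw : 0 < I w) by (apply (I_pos_point _ 0); auto; intros t; left; auto).
  set (K0 := mu / I w). set (K1 := if b then mu / I (fun t => w t * g t * g t) else 0).
  assert (HK0 : 0 < K0) by now apply Rdiv_lt_0_compat.
  assert (HK1 : 0 <= K1). { unfold K1. destruct b; [left; now apply Rdiv_lt_0_compat|lra]. }
  destruct (galerkin w g K0 K1 Sw Pw Pos Sg Pg (Rlt_le _ _ HK0) HK1) as [lam [x [l0 [Rx [x1 [Mx [EL Min]]]]]]].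
  assert (EL0 : forall n, nu n * freq n * x n + K0 * (func w x * I (fun t => w t * e n t)) + K1 * (func wg x * I (fun t => wg t * e n t))
       = lam * I (fun t => w t * T x t * e n t)) by exact EL.
  assert (Min0 : forall v, rapid v -> v 1%nat = 0 ->
      lam * mass w v v <= energy v v + K0 * (func w v * func w v) + K1 * (func wg v * func wg v)) by exact Min.
  clear EL Min. rename EL0 into EL, Min0 into Min. pose proof (rapid_summable _ Rx) as Sx.
  assert (Mv : 0 < mass w v v).
  { assert (0 <= energy v v).
    { replace 0 with (Series (fun _ : nat => 0)).
      - apply Series_le; [|now apply rapid_energy]. intros n. split; [lra|].
        rewrite Rmult_assoc. apply Rmult_le_pos. apply nufreq_ge0. apply Rle_0_sqr.
      - apply is_series_unique. evar_last. apply (is_series_finite (fun _ => 0) O). auto. now rewrite sum_O. }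
    nra. }
  assert (Hlam : lam < mu).
  { specialize (Min v Rv v1). rewrite Lv in Min.
    assert (K1 * (func wg v * func wg v) = 0).
    { unfold K1. destruct b; [rewrite Bv by auto; ring|ring]. }
    assert (lam * mass w v v < mu * mass w v v) by lra. now apply Rmult_lt_reg_r with (mass w v v). }
  assert (c0 : func w x = 0).
  { pose proof (EL O) as E. rewrite (I_ext (fun t => w t * e 0 t) w) in E by (intros; rewrite e0; ring).
    rewrite (I_ext (fun t => wg t * e 0 t) wg) in E by (intros; rewrite e0; ring). fold wg in Ig. rewrite Ig in E.
    rewrite (I_ext (fun t => w t * T x t * e 0 t) (fun t => w t * T x t)) in E by (intros; rewrite e0; ring).
    fold (func w x) in E. unfold freq in E. simpl in E.
    assert (E' : (K0 * I w - lam) * func w x = 0) by lra.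
    assert (K0 * I w = mu) by (unfold K0; field; lra).
    apply Rmult_integral in E'. destruct E'; lra. }
  assert (EL' : forall n, nu n * freq n * x n + K1 * (func wg x * I (fun t => wg t * e n t)) = lam * I (fun t => w t * T x t * e n t)).
  { intros n. rewrite <- EL, c0. ring. }
  assert (c1 : K1 * func wg x = 0).
  { assert (Rg : rapid (fc g)) by now apply fc_rapid. pose proof (rapid_summable _ Rg) as Sgc.
    (* pairing the equation with the eigenvector g gives (s + mu - lam) * func wg x = 0 *)
    pose proof (I_T x wg Sx Cwg) as A1. pose proof (I_T (fc g) wg Sgc Cwg) as A2.
    pose proof (I_T (fc g) (fun t => w t * T x t) Sgc ltac:(auto with cont)) as A3. cbv beta in A3.
    rewrite (I_ext (fun t => T x t * wg t) (fun t => wg t * T x t)) in A1 by (intros; ring). fold (func wg x) in A1.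
    rewrite (I_ext (fun t => T (fc g) t * wg t) (fun t => w t * g t * g t)) in A2 by (intros t; rewrite <- fourier_eq by auto; unfold wg; ring).
    rewrite (I_ext (fun t => T (fc g) t * (w t * T x t)) (fun t => wg t * T x t)) in A3 by (intros t; rewrite <- fourier_eq by auto; unfold wg; ring).
    fold (func wg x) in A3.
    apply is_series_unique in A1, A2, A3.
    assert (Ex : forall h, cont h -> ex_series (fun n => fc g n * I (fun t => e n t * h t))) by (intros h Hh; eexists; now apply I_T).
    assert (S1 : Series (fun n => fc g n * (nu n * freq n * x n)) = s * func wg x).
    { rewrite <- A1, <- Series_scal_l. apply Series_ext. intros n.
      rewrite (I_ext (fun t => e n t * wg t) (fun t => w t * g t * e n t)) by (intros; unfold wg; ring).
      replace (fc g n * (nu n * freq n * x n)) with (nu n * freq n * fc g n * x n) by ring. rewrite Eg. ring. }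
    assert (S2 : Series (fun n => fc g n * (nu n * freq n * x n)) = lam * func wg x - K1 * func wg x * I (fun t => w t * g t * g t)).
    { rewrite <- A2 , <- A3 at 1. rewrite <- !Series_scal_l, <- Series_minus.
      - apply Series_ext. intros n. specialize (EL' n).
        rewrite (I_ext (fun t => e n t * wg t) (fun t => wg t * e n t)) by (intros; ring).
        rewrite (I_ext (fun t => e n t * (w t * T x t)) (fun t => w t * T x t * e n t)) by (intros; ring).
        replace (nu n * freq n * x n) with (lam * I (fun t => w t * T x t * e n t) - K1 * (func wg x * I (fun t => wg t * e n t))) by lra. ring.
      - apply (ex_series_scal lam (fun n => fc g n * I (fun t => e n t * (w t * T x t)))). apply Ex. auto with cont.
      - apply (ex_series_scal (K1 * func wg x) (fun n => fc g n * I (fun t => e n t * wg t))). apply Ex. auto. }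
    rewrite S1 in S2. unfold K1 in *. destruct b; [|ring].
    assert (E1 : mu / I (fun t => w t * g t * g t) * I (fun t => w t * g t * g t) = mu) by (field; lra).
    assert (E' : (s + mu - lam) * func wg x = 0) by (rewrite <- E1; lra).
    apply Rmult_integral in E'. destruct E' as [E'|E']; [lra|rewrite E'; ring]. }
  assert (EL2 : forall n, nu n * freq n * x n = lam * I (fun t => w t * T x t * e n t)).
  { intros n. rewrite <- EL'. rewrite <- Rmult_assoc, c1. ring. }
  exists lam, x. split; [split; [|auto]|split; [auto|split; [auto|split; [auto|]]]].
  (* At [lam = 0] all positive frequencies vanish, so [T x] is constant; orthogonality to 1 makes it
     zero, against mass 1. *)
  - destruct (Rle_lt_or_eq_dec 0 lam l0) as [|E]; auto. exfalso. subst lam.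
    assert (Z : forall n, n <> O -> x n = 0).
    { intros n Hn. destruct (Nat.eq_dec n 1) as [->|Hn1]; auto. specialize (EL2 n). rewrite Rmult_0_l in EL2.
      assert (0 < freq n). { unfold freq. destruct n as [|[|n]]; try lia. simpl Nat.div2. rewrite S_INR. pose proof (pos_INR (Nat.div2 n)); lra. }
      pose proof (nu_pos n). apply Rmult_integral in EL2. destruct EL2 as [E|E]; auto.
      apply Rmult_integral in E. lra. }
    assert (Tx : forall t, T x t = x O).
    { intros t. rewrite (T_finite x O) by (intros n Hn; apply Z; lia). rewrite sum_O, e0. ring. }
    assert (x0 : x O = 0).
    { unfold func in c0. rewrite (I_ext _ (fun t => x O * w t)) in c0 by (intros t; rewrite Tx; ring).
      rewrite I_scal in c0 by auto. apply Rmult_integral in c0. destruct c0; lra. }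
    unfold mass in Mx. rewrite (I_ext _ (fun _ => 0)) in Mx by (intros t; rewrite Tx, x0; ring). rewrite I_const in Mx. lra.
  - intros Hb. unfold K1 in c1. rewrite Hb in c1. apply Rmult_integral in c1. destruct c1 as [E|E]; auto.
    exfalso. assert (0 < mu / I (fun t => w t * g t * g t)) by now apply Rdiv_lt_0_compat. lra.
Qed.

(** * Use of the listed spectrum; harmonic conjugates in Fourier coefficients *)

Lemma lam_mono (lam : nat -> R) : (forall k : nat, lam k <= lam (S k)) -> forall j k, (j <= k)%nat -> lam j <= lam k.
Proof. intros H j k Hjk. induction Hjk; [lra|]. specialize (H m). lra. Qed.

Lemma spectrum_index W lam mu f : steklov_spectrum W lam -> steklov_solution W mu f ->
  (exists p, closed_disk p /\ f p <> 0) -> exists k, lam k = mu.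
Proof.
  intros [_ [_ [_ H]]] Hf [p [Hp Hn]]. destruct (H mu) as [ks [_ [Hks Hm]]].
  destruct ks as [|k ks].
  - exfalso. destruct Hm as [b [_ [_ Hspan]]]. destruct (Hspan f Hf) as [c Hc].
    rewrite (Hc p Hp), sum_n_m_zero in Hn by (simpl; lia). now apply Hn.
  - exists k. apply Hks. now left.
Qed.
(** A strict gap above [lam 1], together with [lam 0 = 0 < lam 1], leaves 1 as the only index of
    that value, so the eigenspace is a line. *)
Lemma spectrum_simple W lam f h : steklov_spectrum W lam -> lam 1%nat < lam 2%nat ->
  steklov_solution W (lam 1%nat) f -> steklov_solution W (lam 1%nat) h ->
  (exists p, closed_disk p /\ f p <> 0) -> exists c, forall p, closed_disk p -> h p = c * f p.
Proof.
  intros [H0 [H1 [Hm H]]] H12 Hf Hh [p0 [Hp0 Hn]]. destruct (H (lam 1%nat)) as [ks [Hnd [Hks Hmu]]].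
  assert (All : forall k, In k ks -> k = 1%nat).
  { intros k Hk. apply Hks in Hk. destruct k as [|[|k]]; auto.
    - lra.
    - exfalso. pose proof (lam_mono lam Hm 2 (S (S k)) ltac:(lia)). lra. }
  assert (L : length ks = 1%nat).
  { destruct ks as [|a [|b ks]]; auto.
    - exfalso. assert (In 1%nat nil) by now apply Hks. easy.
    - exfalso. assert (a = 1%nat) by (apply All; now left). assert (b = 1%nat) by (apply All; right; now left). subst.
      inversion Hnd; subst. apply H4. now left. }
  rewrite L in Hmu. destruct Hmu as [b [_ [_ Hspan]]].
  destruct (Hspan f Hf) as [c Hc]. destruct (Hspan h Hh) as [c' Hc'].
  assert (E1 : forall p, closed_disk p -> f p = c 1%nat * b 1%nat p) by (intros p Hp; rewrite (Hc p Hp), sum_n_n; auto).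
  assert (E2 : forall p, closed_disk p -> h p = c' 1%nat * b 1%nat p) by (intros p Hp; rewrite (Hc' p Hp), sum_n_n; auto).
  assert (c 1%nat <> 0). { intros Z. apply Hn. rewrite E1 by auto. rewrite Z. ring. }
  exists (c' 1%nat / c 1%nat). intros p Hp. rewrite E1, E2 by auto. field. auto.
Qed.

(** The harmonic conjugate of zero mean: [cos (k t)] goes to [sin (k t)] and [sin (k t)] to
    [- cos (k t)]. Slots 0 and 1 belong to frequency 0. *)
Definition conjT (x : nat -> R) (n : nat) : R :=
  match n with O | S O => 0 | _ => if Nat.odd n then x (n - 1)%nat else - x (n + 1)%nat end.

Lemma conjT_even k x : (0 < k)%nat -> conjT x (2 * k) = - x (2 * k + 1)%nat.
Proof.
  intros Hk. unfold conjT. rewrite Nat.odd_even. destruct (2 * k)%nat as [|[|n]] eqn:E; try lia. reflexivity.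
Qed.
Lemma conjT_odd k x : (0 < k)%nat -> conjT x (2 * k + 1) = x (2 * k)%nat.
Proof.
  intros Hk. unfold conjT. rewrite Nat.odd_odd. destruct (2 * k + 1)%nat as [|[|n]] eqn:E; try lia. f_equal. lia.
Qed.
Lemma rapid_conjT x : rapid x -> rapid (conjT x).
Proof.
  intros H q. destruct (rapid_nonneg_const x q H) as [C [C0 HC]]. exists (C * 2 ^ q). intros n.
  assert (P2 : 1 <= 2 ^ q) by (apply pow_R1_Rle; lra).
  assert (Z : forall m, 0 < (1 + INR m) ^ q) by (intros; apply weight_pos).
  destruct (nat_parity n) as [[|k] [-> | ->]].
  - simpl. rewrite Rabs_R0, Rmult_0_l. nra.
  - simpl. rewrite Rabs_R0, Rmult_0_l. nra.
  - rewrite conjT_even, Rabs_Ropp by lia. eapply Rle_trans; [|apply Rle_trans with (C * 1); [|apply Rmult_le_compat_l; lra]].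
    2: apply Rle_refl. rewrite Rmult_1_r. eapply Rle_trans; [|apply (HC (2 * S k + 1)%nat)].
    apply Rmult_le_compat_l. apply Rabs_pos. apply pow_incr. pose proof (pos_INR (2 * S k)). rewrite plus_INR. simpl (INR 1). lra.
  - rewrite conjT_odd by lia. specialize (HC (2 * S k)%nat).
    apply Rle_trans with (Rabs (x (2 * S k)%nat) * (2 ^ q * (1 + INR (2 * S k)) ^ q)).
    + apply Rmult_le_compat_l. apply Rabs_pos. rewrite <- Rpow_mult_distr. apply pow_incr.
      pose proof (pos_INR (2 * S k)). rewrite plus_INR. simpl (INR 1). lra.
    + replace (Rabs (x (2 * S k)%nat) * (2 ^ q * (1 + INR (2 * S k)) ^ q)) with (Rabs (x (2 * S k)%nat) * (1 + INR (2 * S k)) ^ q * 2 ^ q) by ring.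
      apply Rmult_le_compat_r; lra.
Qed.

Lemma energy_pairs x : rapid x -> energy x x = Series (fun k => PI * INR k * (x (2 * k)%nat ^ 2 + x (2 * k + 1)%nat ^ 2)).
Proof.
  intros Hx. unfold energy. rewrite Series_pairs.
  - apply Series_ext. intros k. rewrite freq_even, freq_odd. destruct k.
    + simpl. ring.
    + replace (nu (2 * S k)) with PI by (simpl; reflexivity). replace (nu (2 * S k + 1)) with PI by (simpl; reflexivity). ring.
  - pose proof (rapid_energy x Hx) as E. unfold summable.
    apply ex_series_ext with (fun n => nu n * freq n * x n * x n); auto.
    intros n. rewrite Rabs_pos_eq; auto. rewrite Rmult_assoc. apply Rmult_le_pos. apply nufreq_ge0. apply Rle_0_sqr.
Qed.

(** Conjugation swaps the two modes of each frequency, hence preserves energy. The second identity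
    is integration by parts, the radial derivative of [u] being the tangential derivative of its
    conjugate. The coefficient 0 of [y] stays free for an additive constant. *)
Lemma energy_conj x (y : nat -> R) u' : rapid x -> rapid y -> (forall n, (2 <= n)%nat -> y n = conjT x n) -> y 1%nat = 0 ->
  (forall t : R, is_derive (T x) t (u' t)) -> cont u' ->
  energy y y = energy x x /\ energy x x = - I (fun t => T y t * u' t).
Proof.
  intros Hx Hy Ey Y1 Du Cu. pose proof (rapid_summable _ Hy) as Sy. pose proof (rapid_summable _ Hx) as Sx.
  assert (Ev : forall k, y (2 * S k)%nat = - x (2 * S k + 1)%nat) by (intros k; rewrite Ey by lia; apply conjT_even; lia).
  assert (Od : forall k, y (2 * S k + 1)%nat = x (2 * S k)%nat) by (intros k; rewrite Ey by lia; apply conjT_odd; lia).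
  split.
  - rewrite !energy_pairs by auto. apply Series_ext. intros [|k].
    + simpl INR. ring.
    + rewrite Ev, Od. ring.
  - rewrite energy_pairs by auto.
    rewrite <- (is_series_unique _ _ (I_T y u' Sy Cu)).
    rewrite (Series_pairs (fun n => y n * I (fun t => e n t * u' t))).
    + match goal with |- _ = - ?S => replace (- S) with (-1 * S) by ring end. rewrite <- Series_scal_l.
      apply Series_ext. intros k.
      destruct (fourier_by_parts (T x) u' k (periodic_T x) Du Cu) as [P1 P2].
      rewrite (I_ext (fun t => e (2 * k) t * u' t) (fun t => u' t * cos (INR k * t))) by (intros; rewrite e_even; ring).
      rewrite (I_ext (fun t => e (2 * k + 1) t * u' t) (fun t => u' t * sin (INR k * t))) by (intros; rewrite e_odd; ring).
      rewrite <- P2. replace (I (fun t => u' t * sin (INR k * t))) with (- (I (fun t => T x t * cos (INR k * t)) * INR k)) by lra.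
      destruct k as [|k].
      * simpl INR. ring.
      * rewrite (I_ext (fun t => T x t * cos (INR (S k) * t)) (fun t => T x t * e (2 * S k) t)) by (intros; now rewrite e_even).
        rewrite (I_ext (fun t => T x t * sin (INR (S k) * t)) (fun t => T x t * e (2 * S k + 1) t)) by (intros; now rewrite e_odd).
        rewrite !I_T_e by (auto; lia).
        replace (nu (2 * S k)) with PI by (simpl; reflexivity). replace (nu (2 * S k + 1)) with PI by (simpl; reflexivity).
        rewrite Ev, Od. ring.
    + destruct (periodic_bounded u' Cu (derive_periodic _ _ (periodic_T x) Du)) as [B [B0 HB]].
      apply summable_mult with (2 * PI * B); auto. intros n. apply I_bound; auto with cont.
      intros t. rewrite Rabs_mult. pose proof (e_le1 n t). specialize (HB t). pose proof (Rabs_pos (e n t)). pose proof (Rabs_pos (u' t)). nra.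
Qed.

Lemma fc_1 g : fc g 1 = 0.
Proof. unfold fc. rewrite I_mult_e1. unfold Rdiv. ring. Qed.

(** Applied with [om = tau / d] and [k0 = sqrt (s1 s2) / d], where [d] is the boundary degree. *)
Lemma hersch_payne_schiffer s1 s2 w g om k0 : 0 < s1 -> 0 < s2 -> smooth w -> periodic w -> (forall t, 0 < w t) ->
  smooth g -> periodic g -> I (fun t => w t * g t) = 0 ->
  smooth om -> (forall t : R, is_derive om t (k0 * w t)) -> (forall t, om (t + 2 * PI) = om t + 2 * PI) ->
  0 < k0 -> k0 * k0 < s1 * s2 ->
  exists x y, rapid x /\ rapid y /\ x 1%nat = 0 /\ y 1%nat = 0 /\ func w x = 0 /\ func w y = 0 /\
    func (fun t => w t * g t) y = 0 /\ (energy x x < s1 * mass w x x \/ energy y y < s2 * mass w y y).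
Proof.
  intros Hs1 Hs2 Sw Pw Pos Sg Pg Ig Som Dom Pom Hk0 Hk.
  set (wg := fun t => w t * g t) in *.
  assert (Cw := smooth_cont _ Sw). assert (Cg := smooth_cont _ Sg).
  assert (Cwg : cont wg) by (unfold wg; auto with cont).
  assert (HIw : 0 < I w) by (apply (I_pos_point _ 0); auto; intros t; left; auto).
  set (cs := fun t => cos (om t)). set (sn := fun t => sin (om t)).
  assert (Sc : smooth cs) by (unfold cs; auto with cont). assert (Ss : smooth sn) by (unfold sn; auto with cont).
  assert (Pc : periodic cs) by (intros t; unfold cs; rewrite Pom, cos_plus, sin_2PI, cos_2PI; ring).
  assert (Ps : periodic sn) by (intros t; unfold sn; rewrite Pom, sin_plus, sin_2PI, cos_2PI; ring).
  assert (Dc : forall t : R, is_derive cs t (k0 * w t * - sn t)).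
  { intros t. unfold cs, sn. apply (is_derive_comp cos om t); [apply is_derive_cos|apply Dom]. }
  assert (Ds : forall t : R, is_derive sn t (k0 * w t * cs t)).
  { intros t. unfold cs, sn. apply (is_derive_comp sin om t); [apply is_derive_sin|apply Dom]. }
  assert (Cc := smooth_cont _ Sc). assert (Cs := smooth_cont _ Ss).
  set (a := fc cs). set (b := fc sn).
  assert (Ra : rapid a) by now apply fc_rapid. assert (Rb : rapid b) by now apply fc_rapid.
  assert (Sa := rapid_summable _ Ra). assert (Sb := rapid_summable _ Rb).
  assert (Sca : summable (conjT a)) by now apply rapid_summable, rapid_conjT.
  assert (Scb : summable (conjT b)) by now apply rapid_summable, rapid_conjT.
  set (al := func wg (conjT a)). set (be := func wg (conjT b)).
  (* Orthogonality of the conjugate to [g] is one linear condition on [(p, q)], so it has a nonzero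
     solution. *)
  assert (exists p q, 0 < p * p + q * q /\ p * al + q * be = 0) as [p [q [Hpq Epq]]].
  { destruct (Req_dec al 0) as [->|Hn].
    - exists 1, 0. split; [lra|ring].
    - exists be, (- al). split; [|ring]. assert (0 < al * al) by (apply Rsqr_pos_lt; auto). pose proof (Rle_0_sqr be). unfold Rsqr in *. lra. }
  set (x := fun n => p * a n + q * b n).
  assert (Rx : rapid x) by (apply rapid_plus; now apply rapid_scal). assert (Sx := rapid_summable _ Rx).
  assert (Tx : forall t, T x t = p * cs t + q * sn t).
  { intros t. unfold x. rewrite T_plus, !T_scal by auto using summable_scal. unfold a, b. now rewrite <- !fourier_eq. }
  set (y0 := conjT x). assert (Ry0 : rapid y0) by now apply rapid_conjT. assert (Sy0 := rapid_summable _ Ry0).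
  (* The constant that makes the conjugate orthogonal to 1; it does not disturb the orthogonality to
     [g], which is itself orthogonal to 1. *)
  set (c := - func w y0 / I w).
  set (y := fun n => y0 n + c * delta 0 n).
  assert (Rd : rapid (delta 0)) by (apply (rapid_finite _ O); intros n Hn; unfold delta; destruct (Nat.eq_dec n 0); auto; lia).
  assert (Sd := rapid_summable _ Rd).
  assert (Ry : rapid y) by (apply rapid_plus; auto; now apply rapid_scal). assert (Sy := rapid_summable _ Ry).
  assert (x1 : x 1%nat = 0) by (unfold x, a, b; rewrite !fc_1; ring).
  assert (y1 : y 1%nat = 0) by (unfold y, y0, delta; simpl; ring).
  assert (Fd : forall h, func h (delta 0) = I h).
  { intros h. apply I_ext. intros t. rewrite T_delta, e0. ring. }
  set (u' := fun t => k0 * (w t * (q * cs t - p * sn t))).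
  assert (Du : forall t : R, is_derive (T x) t (u' t)).
  { intros t. apply is_derive_ext with (fun t => p * cs t + q * sn t). intros; now rewrite Tx.
    replace (u' t) with (p * (k0 * w t * - sn t) + q * (k0 * w t * cs t)) by (unfold u'; ring).
    apply (is_derive_plus (fun t => p * cs t) (fun t => q * sn t)).
    apply (is_derive_scal cs); auto. apply (is_derive_scal sn); auto. }
  assert (Cu : cont u') by (unfold u'; auto 12 with cont).
  destruct (energy_conj x y u' Rx Ry) as [Ey Ex]; auto.
  { intros n Hn. unfold y, delta. destruct (Nat.eq_dec n 0); [lia|]. unfold y0. ring. }
  assert (Fx : func w x = 0).
  { unfold func. apply Rmult_eq_reg_l with k0; [|lra]. rewrite Rmult_0_r, <- I_scal by auto with cont.
    apply I_derive_periodic with (fun t => p * sn t - q * cs t); auto with cont.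
    - intros t. now rewrite Ps, Pc.
    - intros t. rewrite Tx. replace (k0 * (w t * (p * cs t + q * sn t))) with (p * (k0 * w t * cs t) - q * (k0 * w t * - sn t)) by ring.
      apply (is_derive_minus (fun t => p * sn t) (fun t => q * cs t)).
      apply (is_derive_scal sn); auto. apply (is_derive_scal cs); auto. }
  assert (Fy : func w y = 0).
  { unfold y. rewrite func_lin, Fd by auto. unfold c. field. lra. }
  assert (Fgy : func wg y = 0).
  { unfold y. rewrite func_lin, Fd, Ig, Rmult_0_r, Rplus_0_r by auto.
    replace y0 with (fun n => p * conjT a n + q * conjT b n).
    - rewrite func_lin by auto using summable_scal. fold be.
      assert (E : func wg (fun n => p * conjT a n) = p * al).
      { unfold al, func. rewrite <- I_scal by auto with cont. apply I_ext. intros t. rewrite T_scal. ring. }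
      rewrite E. exact Epq.
    - apply functional_extensionality. intros n. unfold y0, x, conjT. destruct n as [|[|n]]; try ring. destruct (Nat.odd _); ring. }
  set (D := I (fun t => w t * (q * cs t - p * sn t) * (q * cs t - p * sn t))).
  (* After division by [w], the difference of the integrands contains only the double angle [2 om];
     since [k0 w] is the derivative of [om], it integrates to zero over a period. Together with
     [Sum] this also shows that [D] is positive. *)
  assert (Mx : mass w x x = D).
  { unfold mass, D. rewrite (I_ext _ (fun t => w t * (p * cs t + q * sn t) * (p * cs t + q * sn t))) by (intros t; now rewrite Tx).
    apply Rminus_diag_uniq. rewrite <- I_minus by auto 12 with cont.
    apply Rmult_eq_reg_l with k0; [|lra]. rewrite Rmult_0_r, <- I_scal by auto 12 with cont.
    apply I_derive_periodic with (fun t => (p * p - q * q) * (sn t * cs t) + 2 * p * q * (sn t * sn t)).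
    - intros t. now rewrite Ps, Pc.
    - intros t. auto_derive. { repeat (split; [eexists; eauto|]). auto. }
      rewrite (is_derive_unique (fun x : R => sn x) _ _ (Ds t)), (is_derive_unique (fun x : R => cs x) _ _ (Dc t)). ring.
    - auto 12 with cont. }
  assert (Sum : mass w x x + D = (p * p + q * q) * I w).
  { unfold mass, D. rewrite <- I_plus, <- I_scal by auto 12 with cont. apply I_ext. intros t. rewrite Tx.
    assert (E : sn t * sn t + cs t * cs t = 1) by (pose proof (sin2_cos2 (om t)); unfold Rsqr in *; auto).
    transitivity (w t * (p * p + q * q) * (sn t * sn t + cs t * cs t)); [ring|rewrite E; ring]. }
  assert (HD : 0 < D) by nra.
  (* The tangential derivative of [T x] is [k0 w (q cos om - p sin om)], so Cauchy-Schwarz bounds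
     the energy by the mass of the conjugate and by [D]. *)
  assert (CS : energy x x * energy x x <= k0 * k0 * (D * mass w y y)).
  { assert (E : energy x x = - k0 * I (fun t => w t * T y t * (q * cs t - p * sn t))).
    { rewrite Ex, (I_ext _ (fun t => k0 * (w t * T y t * (q * cs t - p * sn t)))) by (intros t; unfold u'; ring).
      rewrite I_scal by auto 12 with cont. ring. }
    rewrite E.
    pose proof (Cauchy_Schwarz_I w (T y) (fun t => q * cs t - p * sn t) Cw (cont_T y Sy) ltac:(auto 12 with cont) (fun t => Rlt_le _ _ (Pos t))) as Q.
    cbv beta in Q. fold (mass w y y) D in Q. assert (0 <= k0 * k0) by nra. nra. }
  exists x, y. refine (conj Rx (conj Ry (conj x1 (conj y1 (conj Fx (conj Fy (conj Fgy _))))))).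
  rewrite Ey, Mx.
  assert (HMy : 0 <= mass w y y).
  { apply I_ge0; auto with cont. intros t. rewrite Rmult_assoc. apply Rmult_le_pos. left; auto. apply Rle_0_sqr. }
  destruct (Rlt_le_dec (energy x x) (s1 * D)) as [L1|L1]; auto.
  destruct (Rlt_le_dec (energy x x) (s2 * mass w y y)) as [L2|L2]; auto. exfalso.
  (* If both alternatives failed, then [s1 s2 D m <= E ^ 2 <= k0 ^ 2 D m], against [k0 ^ 2 < s1 s2];
     the case [m = 0] is apart, as it forces [E = 0] while [E >= s1 D > 0]. *)
  set (E := energy x x) in *. set (m := mass w y y) in *.
  assert (s1 * s2 * (D * m) <= E * E).
  { replace (s1 * s2 * (D * m)) with ((s1 * D) * (s2 * m)) by ring. apply Rmult_le_compat; auto; apply Rmult_le_pos; lra. }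
  assert (0 < s1 * D) by now apply Rmult_lt_0_compat.
  destruct (Req_dec m 0) as [Z|Z].
  - rewrite Z in CS. nra.
  - assert (0 < D * m) by (apply Rmult_lt_0_compat; lra). nra.
Qed.

(** * The boundary degree is one *)

Lemma cos_sin_period D t : cos (t + D) = cos t -> sin (t + D) = sin t -> exists k : Z, D = IZR k * (2 * PI).
Proof.
  intros Hc Hs. rewrite cos_plus in Hc. rewrite sin_plus in Hs.
  pose proof (sin2_cos2 t) as E. unfold Rsqr in E.
  assert (C1 : cos D = 1).
  { transitivity ((sin t * sin t + cos t * cos t) * cos D). rewrite E; ring.
    transitivity (cos t * (cos t * cos D - sin t * sin D) + sin t * (sin t * cos D + cos t * sin D)). ring.
    rewrite Hc, Hs. lra. }
  destruct (angle_reduce D) as [k Hk]. exists (- k)%Z. rewrite opp_IZR.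
  set (y := D + IZR k * (2 * PI)) in *.
  assert (Cy : cos y = 1) by (unfold y; now rewrite cos_Z).
  enough (y = 0) by (unfold y in *; lra).
  destruct (Rle_lt_or_eq_dec 0 y (proj1 Hk)) as [L|L]; auto. exfalso.
  assert (S0 : 0 < sin (y / 2)) by (apply sin_gt_0; lra).
  replace y with (2 * (y / 2)) in Cy by field. rewrite cos_2a_sin in Cy. nra.
Qed.

Lemma degree_one s1 s2 Phi lam : 0 < s1 -> s1 <= s2 ->
  fb_minimal_immersion (ellipse s1 s2) Phi ->
  steklov_spectrum (ellipse_weight s1 s2 Phi) lam ->
  steklov_eigenfunction (ellipse_weight s1 s2 Phi) (lam 1%nat) (fun p => fst (Phi p)) ->
  (steklov_eigenfunction (ellipse_weight s1 s2 Phi) (lam 1%nat) (fun p => snd (Phi p)) \/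
   steklov_eigenfunction (ellipse_weight s1 s2 Phi) (lam 2%nat) (fun p => snd (Phi p))) ->
  exists (tau : R -> R) (sg : R) (c : nat -> C),
  (sg = 1 \/ sg = -1) /\ smooth tau /\ (forall t, tau (t + 2 * PI) = tau t + 2 * PI) /\
  (forall a b, a < b -> tau a < tau b) /\
  (forall t, sqrt s1 * fst (Phi (cis t)) = cos (tau t) /\ sqrt s2 * (sg * snd (Phi (cis t))) = sin (tau t)) /\
  rapidC c /\
  (forall p, cd p -> fst (Phi p) = fst (ps c p) /\ sg * snd (Phi p) = snd (ps c p)) /\
  (forall p, od p -> s1 * fst (Phi p) ^ 2 + s2 * snd (Phi p) ^ 2 < 1) /\
  (forall t, ps (dc c) (cis t) <> 0).
Proof.
  intros H1 H12 HF HS HE1 HE2.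
  destruct (immersion_structure s1 s2 Phi H1 H12 HF) as
    [w [tau [sg [c [Hsg [Sw [Pw [Pos [HW [Stau [Dtau [Etau [Hc [EF [Rad1 [Rad2 [Ins [Nz Eig]]]]]]]]]]]]]]]]]].
  exists tau, sg, c.
  set (W := ellipse_weight s1 s2 Phi) in *.
  set (X := fun t => fst (Phi (cis t))).
  assert (s2p : 0 < s2) by lra.
  assert (Sm1 : smooth_on closed_disk (fun p => fst (Phi p))) by apply HF.
  assert (Sm2 : smooth_on closed_disk (fun p => snd (Phi p))) by apply HF.
  assert (SX : smooth X) by (apply (trace_smooth (fun p => fst (Phi p))); auto).
  assert (PX : periodic X) by apply (periodic_cis (fun p => fst (Phi p))).
  assert (Cw := smooth_cont _ Sw). assert (CX := smooth_cont _ SX).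
  set (ab := sqrt s1 * sqrt s2) in *.
  assert (Ha : 0 < sqrt s1) by now apply sqrt_lt_R0. assert (Hb : 0 < sqrt s2) by now apply sqrt_lt_R0.
  assert (Hab : 0 < ab) by (unfold ab; now apply Rmult_lt_0_compat).
  assert (Eab : ab * ab = s1 * s2).
  { unfold ab. replace (sqrt s1 * sqrt s2 * (sqrt s1 * sqrt s2)) with ((sqrt s1 * sqrt s1) * (sqrt s2 * sqrt s2)) by ring.
    rewrite !sqrt_sqrt; lra. }
  assert (Incr : forall a b, a < b -> tau a < tau b).
  { intros a b L. destruct (mvt_abs tau (fun t => ab * w t) a b) as [z [_ E]]; [intros; apply Dtau|].
    specialize (Pos z). assert (0 < ab * w z * (b - a)) by (repeat apply Rmult_lt_0_compat; lra). lra. }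
  assert (NZ : forall h, smooth_on closed_disk h -> harmonic h -> (exists p, closed_disk p /\ h p <> 0) -> exists t, h (cis t) <> 0).
  { intros h Sh Hh [p [Hp Hn]]. apply NNPP. intros Hall. apply Hn.
    apply (harmonic_unique h (fun _ => 0)); auto.
    - intros q Hq. now apply smooth_on_cont.
    - intros q Hq. apply Lim2_const.
    - intros q Hq. now apply harmonic_lap.
    - intros q Hq. apply lap_at_const.
    - intros t. apply NNPP. intros Hne. apply Hall. eauto.
    - now apply closed_disk_cd. }
  destruct (NZ (fun p => fst (Phi p)) Sm1 ltac:(apply HF) (proj2 HE1)) as [t1 Ht1]. fold (X t1) in Ht1.
  (* The two formulas for the radial derivative of [phi_1] are compared at a boundary point where it
     is nonzero; such a point exists by uniqueness for the Dirichlet problem. *)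
  assert (El1 : lam 1%nat = s1).
  { destruct HE1 as [[_ [_ HR]] _]. specialize (HR (cis t1) (proj2 (circle_cis _) (ex_intro _ t1 eq_refl))).
    rewrite Rad1, HW in HR. fold (X t1) in HR. specialize (Pos t1).
    apply Rmult_eq_reg_r with (w t1 * X t1). lra. apply Rmult_integral_contrapositive; split; lra. }
  assert (El2 : s2 = lam 1%nat \/ s2 = lam 2%nat).
  { assert (G : forall mu, steklov_eigenfunction W mu (fun p => snd (Phi p)) -> s2 = mu).
    { intros mu [[_ [_ HR]] Hn]. destruct (NZ (fun p => snd (Phi p)) Sm2 ltac:(apply HF) Hn) as [t2 Ht2].
      specialize (HR (cis t2) (proj2 (circle_cis _) (ex_intro _ t2 eq_refl))).
      rewrite Rad2, HW in HR. specialize (Pos t2).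
      apply Rmult_eq_reg_r with (w t2 * snd (Phi (cis t2))). lra. apply Rmult_integral_contrapositive; split; lra. }
    destruct HE2 as [HE2|HE2]; [left|right]; auto. }
  pose proof HS as [L0 [L1 [Lm _]]].
  assert (s2le : s2 <= lam 2%nat) by (pose proof (Lm 1%nat); destruct El2; lra).
  assert (RX : rapid (fc X)) by now apply fc_rapid.
  assert (EigN : forall n, nu n * freq n * fc X n = s1 * I (fun t => w t * X t * e n t)).
  { intros n. destruct (Nat.eq_dec n 1) as [->|Hn]. { rewrite I_mult_e1, fc_1. ring. }
    pose proof (I_T_e (fun n => freq n * fc X n) n (rapid_summable _ (rapid_freq _ RX)) Hn) as E.
    rewrite (I_ext _ (fun t => s1 * (w t * X t * e n t))) in E by (intros t; fold X in Eig; rewrite Eig; fold (X t); ring).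
    rewrite I_scal in E by auto with cont. lra. }
  assert (IX : I (fun t => w t * X t) = 0).
  { pose proof (EigN O) as E. rewrite (I_ext (fun t => w t * X t * e 0 t) (fun t => w t * X t)) in E by (intros; rewrite e0; ring).
    unfold freq in E. simpl in E. rewrite Rmult_0_r, Rmult_0_l in E. symmetry in E. apply Rmult_integral in E. destruct E; lra. }
  assert (MX : 0 < I (fun t => w t * X t * X t)).
  { apply (I_pos_point _ t1); auto with cont.
    - intros t. now rewrite Pw, PX.
    - intros t. rewrite Rmult_assoc. apply Rmult_le_pos. left; auto. apply Rle_0_sqr.
    - rewrite Rmult_assoc. apply Rmult_lt_0_compat; auto. apply Rsqr_pos_lt; auto. }
  assert (Nontriv : forall x, rapid x -> mass w x x = 1 -> exists p, closed_disk p /\ fst (ps (coefC x) p) <> 0).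
  { intros x Rx Mx. apply NNPP. intros Hall.
    assert (Tz : forall t, T x t = 0).
    { intros t. rewrite <- ps_cis by auto. apply NNPP. intros Hne. apply Hall. exists (cis t). split; auto. apply closed_disk_cd, cd_cis. }
    unfold mass in Mx. rewrite (I_ext _ (fun _ => 0)), I_const in Mx by (intros t; rewrite Tz; ring). lra. }
  (* The increment over a period is the same from every starting point, [w] being periodic, and is a
     positive multiple [k] of [2 PI]; this [k] is the boundary degree. *)
  set (D := tau (0 + 2 * PI) - tau 0).
  assert (ED : forall t, tau (t + 2 * PI) = tau t + D).
  { intros t. set (h := fun t => tau (t + 2 * PI) - tau t).
    assert (Dh : forall t : R, is_derive h t 0).
    { intros r. replace 0 with (1 * (ab * w (r + 2 * PI)) - ab * w r) by (rewrite Pw; ring).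
      apply (is_derive_minus (fun t => tau (t + 2 * PI)) tau); auto.
      apply (is_derive_comp tau (fun t => t + 2 * PI)); auto. auto_derive; auto. }
    destruct (mvt_abs h (fun _ => 0) 0 t) as [z [_ E]]; [intros; apply Dh|]. unfold h in E. unfold D. lra. }
  assert (DPos : 0 < D). { unfold D. pose proof two_PI_pos. pose proof (Incr 0 (0 + 2 * PI)). lra. }
  destruct (cos_sin_period D (tau 0)) as [k Hk].
  { rewrite <- ED. rewrite <- !(proj1 (Etau _)). now rewrite (periodic_cis (fun p => fst (Phi p)) 0). }
  { rewrite <- ED. rewrite <- !(proj2 (Etau _)). now rewrite (periodic_cis (fun p => snd (Phi p)) 0). }
  pose proof two_PI_pos as Hpi.
  assert (Kp : (0 < k)%Z). { apply lt_IZR. apply Rmult_lt_reg_r with (2 * PI); lra. }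
  destruct (Z.eq_dec k 1) as [->|Hk1].
  { refine (conj Hsg (conj Stau (conj _ (conj Incr (conj Etau (conj Hc (conj EF (conj Ins Nz)))))))).
    intros t. rewrite ED, Hk. ring. }
  exfalso.
  assert (Kd : 2 <= IZR k) by (apply IZR_le; lia).
  assert (Knz : IZR k <> 0) by nz.
  (* Dividing by the degree gives an angle winding exactly once, so its cosine and sine are
     periodic; [k >= 2] becomes the strict inequality [(ab / k) ^ 2 < s1 s2]. *)
  set (om := fun t => tau t / IZR k).
  destruct (hersch_payne_schiffer s1 s2 w X om (ab / IZR k)) as [x [y [Rx [Ry [x1 [y1 [Fx [Fy [Fgy Alt]]]]]]]]]; auto.
  { unfold om. auto with cont. }
  { intros t. unfold om. replace (ab / IZR k * w t) with (/ IZR k * (ab * w t)) by (field; auto).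
    apply is_derive_ext with (fun t => / IZR k * tau t). intros s; apply Rmult_comm. apply (is_derive_scal tau); auto. }
  { intros t. unfold om. rewrite ED, Hk. field. auto. }
  { apply Rdiv_lt_0_compat; lra. }
  { rewrite <- Eab. replace (ab / IZR k * (ab / IZR k)) with (ab * ab / (IZR k * IZR k)) by (field; auto).
    assert (0 < ab * ab) by nra. apply Rmult_lt_reg_r with (IZR k * IZR k); [nra|].
    replace (ab * ab / (IZR k * IZR k) * (IZR k * IZR k)) with (ab * ab) by (field; auto).
    assert (1 < IZR k * IZR k) by nra. rewrite <- (Rmult_1_r (ab * ab)) at 1. now apply Rmult_lt_compat_l. }
  destruct Alt as [Alt|Alt].
  (* An eigenvalue in [(0, s1)] has no place in the list: index 0 carries 0 and all later ones at
     least [lam 1 = s1]. *)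
  - destruct (eigen_below false w X s1 s1 x Sw Pw Pos SX PX (Rlt_le _ _ H1) H1 EigN MX IX Rx x1 Fx ltac:(discriminate) Alt)
      as [l [z [Hl [Rz [Mz [Ez _]]]]]].
    pose proof (series_steklov W w l z Cw HW Rz Ez) as St.
    destruct (spectrum_index W lam l _ HS St (Nontriv z Rz Mz)) as [j Hj].
    destruct j as [|j]; [lra|]. pose proof (lam_mono lam Lm 1 (S j) ltac:(lia)). lra.
  - destruct (eigen_below true w X s1 s2 y Sw Pw Pos SX PX (Rlt_le _ _ H1) s2p EigN MX IX Ry y1 Fy (fun _ => Fgy) Alt)
      as [l [z [Hl [Rz [Mz [Ez Oz]]]]]].
    pose proof (series_steklov W w l z Cw HW Rz Ez) as St.
    destruct (spectrum_index W lam l _ HS St (Nontriv z Rz Mz)) as [j Hj].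
    (* Only index 1 can carry a value in [(0, s2)]. Then [lam 1 < s2 <= lam 2], so the first
       eigenspace is spanned by [phi_1]; the new eigenfunction, orthogonal to [phi_1], would
       vanish. *)
    destruct j as [|[|j]]; [lra| |pose proof (lam_mono lam Lm 2 (S (S j)) ltac:(lia)); lra].
    rewrite <- Hj in St.
    destruct (spectrum_simple W lam (fun p => fst (Phi p)) _ HS ltac:(lra) (proj1 HE1) St (proj2 HE1)) as [m Hm].
    assert (Tz : forall t, T z t = m * X t).
    { intros t. rewrite <- ps_cis by auto. apply Hm. apply closed_disk_cd, cd_cis. }
    specialize (Oz eq_refl). unfold func in Oz.
    rewrite (I_ext _ (fun t => m * (w t * X t * X t))) in Oz by (intros t; rewrite Tz; ring).
    rewrite I_scal in Oz by auto with cont. apply Rmult_integral in Oz. destruct Oz as [m0|?]; [|lra].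
    unfold mass in Mz. rewrite (I_ext _ (fun _ => 0)), I_const in Mz by (intros t; rewrite Tz, m0; ring). lra.
Qed.

(** * Conformal bijectivity *)

Lemma half_plane_arg x y : 0 < x -> exists r, 0 < r /\ (x, y) = (RtoC r * cis (atan (y / x)))%C.
Proof.
  intros Hx. set (a := y / x). assert (Hs : 0 < sqrt (1 + a ^ 2)) by (apply sqrt_lt_R0; nra).
  exists (x * sqrt (1 + a ^ 2)). split; [now apply Rmult_lt_0_compat|].
  rewrite rcis_pair, cos_atan, sin_atan. unfold Rsqr. replace (a * a) with (a ^ 2) by ring.
  apply C_eq; unfold fst, snd; [field; nz|].
  transitivity (x * a). { unfold a; field; nz. } { field; nz. }
Qed.

(** The substitute for the argument principle: a zero at the centre forces zero mean on the circle,
    against positivity there. Both counting arguments below end with it. *)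
Lemma hol1_circle_pos N N' : hol1 N N' -> N 0 = 0 -> (forall t, 0 < fst (N (cis t))) -> False.
Proof.
  intros HN H0 Hp. pose proof (mean_value N N' HN) as M. rewrite H0 in M. simpl fst in M. rewrite Rmult_0_r in M.
  destruct (hol1_Lip_circle N N' 1 HN ltac:(lra)) as [C1 _].
  assert (E : cont (fun t => fst (N (cis t)))).
  { apply (cont_ext (fun t => fst (N (1 * cis t)%C))); auto. intros t. now rewrite Cmult_1_l. }
  assert (0 < I (fun t => fst (N (cis t)))).
  { apply (I_pos_point _ 0); auto. apply (periodic_cis (fun z => fst (N z))). intros t; left; auto. }
  lra.
Qed.

Lemma Cmod_cont_on f f' : hol1 f f' -> cont_on cd (fun z => Cmod (f z)).
Proof.
  intros Hf p Hp eps He. destruct (hol1_bound f f' Hf) as [B [B0 HB]].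
  exists (eps / (B + 1)). split; [apply Rdiv_lt_0_compat; lra|]. intros q Hq Hd.
  destruct (HB q p Hq Hp) as [_ [_ [L _]]].
  assert (Rabs (Cmod (f q) - Cmod (f p)) <= Cmod (f q - f p)%C).
  { apply Rabs_le. pose proof (Cmod_rev_triangle (f q) (f p)). pose proof (Cmod_rev_triangle (f p) (f q)) as R2.
    rewrite (Cmod_minus_sym (f p)) in R2. lra. }
  assert (Cmod (q - p)%C * (B + 1) < eps).
  { apply Rmult_lt_reg_r with (/ (B + 1)). apply Rinv_0_lt_compat; lra. rewrite Rmult_assoc, Rinv_r, Rmult_1_r by lra. exact Hd. }
  pose proof (Cmod_ge_0 (q - p)%C). nra.
Qed.

Lemma hol1_lower f f' : hol1 f f' -> (forall z, cd z -> f z <> 0) -> exists c, 0 < c /\ forall z, cd z -> c <= Cmod (f z).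
Proof.
  intros Hf Hn. destruct (extreme_value cd (fun z => - Cmod (f z))) as [p [Hp Hm]].
  - apply disk_compact.
  - intros p Hp eps He. destruct (Cmod_cont_on f f' Hf p Hp eps He) as [d [Hd H]]. exists d. split; auto.
    intros q Hq L. specialize (H q Hq L). replace (- Cmod (f q) - - Cmod (f p)) with (- (Cmod (f q) - Cmod (f p))) by ring.
    now rewrite Rabs_Ropp.
  - exists (cis 0). apply cd_cis.
  - exists (Cmod (f p)). split. apply Cmod_gt_0. now apply Hn. intros z Hz. specialize (Hm z Hz). lra.
Qed.

Lemma conj_cis t : Cconj (cis t) = cis (- t).
Proof. apply C_eq; unfold cis, Cconj, fst, snd. now rewrite cos_neg. now rewrite sin_neg. Qed.

Lemma cis_conj_1 t : (cis t * cis (- t))%C = 1.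
Proof. rewrite <- cis_plus, Rplus_opp_r. apply C_eq; simpl. apply cos_0. apply sin_0. Qed.

Lemma cis_nz t : cis t <> 0.
Proof. intros E. pose proof (Cmod_cis t) as H. rewrite E, Cmod_0 in H. lra. Qed.

Section Filling.
Variables (s1 s2 : R) (tau : R -> R) (c : nat -> C).
Hypotheses (s1_pos : 0 < s1) (s2_pos : 0 < s2) (Htau : smooth tau)
  (Hper : forall t, tau (t + 2 * PI) = tau t + 2 * PI) (Hincr : forall a b, a < b -> tau a < tau b)
  (Hc : rapidC c)
  (Hbd : forall t, sqrt s1 * fst (ps c (cis t)) = cos (tau t) /\ sqrt s2 * snd (ps c (cis t)) = sin (tau t))
  (Hin : forall p, od p -> s1 * fst (ps c p) ^ 2 + s2 * snd (ps c p) ^ 2 < 1).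

Definition filled (q : C) : R := s1 * fst q ^ 2 + s2 * snd q ^ 2.

Lemma root_pos : 0 < sqrt s1 /\ 0 < sqrt s2.
Proof. split; now apply sqrt_lt_R0. Qed.

Lemma filled_boundary t : filled (ps c (cis t)) = 1.
Proof.
  unfold filled. destruct (Hbd t) as [E1 E2]. pose proof (sin2_cos2 (tau t)) as E. unfold Rsqr in E.
  rewrite <- E1, <- E2 in E. rewrite <- (sqrt_sqrt s1), <- (sqrt_sqrt s2) by lra. lra.
Qed.

Lemma filled_le p : cd p -> filled (ps c p) <= 1.
Proof.
  intros Hp. destruct (Rle_lt_or_eq_dec _ _ Hp) as [L|E]. left; now apply Hin.
  apply circle_Cmod, circle_cis in E. destruct E as [t ->]. rewrite filled_boundary. lra.
Qed.

(** With [n] the normal of the ellipse at the boundary point [F], both [F - q]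
    and [cis tau] stay in the half plane directed by [n]; hence the argument of
    [F - q] differs from [tau] by two arctangents. *)
Lemma filled_arg q : filled q < 1 -> exists A rho, smooth A /\ periodic A /\
  forall t, 0 < rho t /\ (ps c (cis t) - q)%C = (RtoC (rho t) * cis (A t + t))%C.
Proof.
  intros Hq. destruct root_pos as [Ha Hb]. set (a := sqrt s1) in *. set (b := sqrt s2) in *.
  assert (Ea : a * a = s1) by (apply sqrt_sqrt; lra). assert (Eb : b * b = s2) by (apply sqrt_sqrt; lra).
  destruct q as [q1 q2]. unfold filled, fst, snd in Hq.
  (* With [n] the complex number [(a cos tau, b sin tau)], the pair [(x1, y1)] is [F - q] times the
     conjugate of [n], and [(x2, y2)] is [n] times the conjugate of [cis tau]. Their product with
     [cis tau] is [|n|^2 (F - q)]. *)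
  set (x1 := fun t => 1 - (a * q1 * cos (tau t) + b * q2 * sin (tau t))).
  set (y1 := fun t => (sin (tau t) / b - q2) * (a * cos (tau t)) - (cos (tau t) / a - q1) * (b * sin (tau t))).
  set (x2 := fun t => a * (cos (tau t) * cos (tau t)) + b * (sin (tau t) * sin (tau t))).
  set (y2 := fun t => b * sin (tau t) * cos (tau t) - a * cos (tau t) * sin (tau t)).
  assert (CS : forall t, sin (tau t) * sin (tau t) + cos (tau t) * cos (tau t) = 1).
  { intros t. pose proof (sin2_cos2 (tau t)) as E. unfold Rsqr in E. auto. }
  (* The vector [(a q1, b q2)] has norm below 1, while [(cos tau, sin tau)] is a unit vector. *)
  assert (X1 : forall t, 0 < x1 t).
  { intros t. unfold x1. specialize (CS t). set (C := cos (tau t)) in *. set (S := sin (tau t)) in *.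
    pose proof (Rle_0_sqr (a * q1 - C)). pose proof (Rle_0_sqr (b * q2 - S)). unfold Rsqr in *. nra. }
  assert (X2 : forall t, 0 < x2 t).
  { intros t. unfold x2. specialize (CS t). set (C := cos (tau t)) in *. set (S := sin (tau t)) in *.
    pose proof (Rle_0_sqr C). pose proof (Rle_0_sqr S). unfold Rsqr in *.
    destruct (Rle_lt_dec (C * C) 0); [assert (0 < S * S) by lra|]; nra. }
  assert (Sx1 : smooth x1) by (unfold x1; auto 12 with cont).
  assert (Sy1 : smooth y1) by (unfold y1; auto 12 with cont).
  assert (Sx2 : smooth x2) by (unfold x2; auto 12 with cont).
  assert (Sy2 : smooth y2) by (unfold y2; auto 12 with cont).
  assert (Pc : forall t, cos (tau (t + 2 * PI)) = cos (tau t)) by (intros t; rewrite Hper, cos_plus, cos_2PI, sin_2PI; ring).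
  assert (Ps : forall t, sin (tau (t + 2 * PI)) = sin (tau t)) by (intros t; rewrite Hper, sin_plus, cos_2PI, sin_2PI; ring).
  set (N2 := fun t => (a * cos (tau t)) ^ 2 + (b * sin (tau t)) ^ 2).
  assert (HN2 : forall t, 0 < N2 t).
  { intros t. unfold N2. specialize (CS t). set (C := cos (tau t)) in *. set (S := sin (tau t)) in *.
    pose proof (Rle_0_sqr (a * C)). pose proof (Rle_0_sqr (b * S)). unfold Rsqr in *.
    destruct (Req_dec C 0) as [Z|Z].
    - assert (0 < b * S * (b * S)). { apply Rsqr_pos_lt. apply Rmult_integral_contrapositive. split; [lra|]. intros Z'. rewrite Z, Z' in CS. lra. }
      simpl. lra.
    - assert (0 < a * C * (a * C)). { apply Rsqr_pos_lt. apply Rmult_integral_contrapositive. split; lra. }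
      simpl. lra. }
  assert (G : forall t, exists rho, 0 < rho /\
    (ps c (cis t) - (q1, q2))%C = (RtoC rho * cis (tau t - t + atan (y1 t / x1 t) + atan (y2 t / x2 t) + t))%C).
  { intros t. destruct (half_plane_arg (x1 t) (y1 t) (X1 t)) as [r1 [R1 E1]].
    destruct (half_plane_arg (x2 t) (y2 t) (X2 t)) as [r2 [R2 E2]].
    exists (r1 * r2 / N2 t). split. { apply Rdiv_lt_0_compat; auto. now apply Rmult_lt_0_compat. }
    replace (tau t - t + atan (y1 t / x1 t) + atan (y2 t / x2 t) + t) with (atan (y1 t / x1 t) + atan (y2 t / x2 t) + tau t) by ring.
    rewrite !cis_plus.
    transitivity (RtoC (/ N2 t) * ((x1 t, y1 t) * (x2 t, y2 t) * cis (tau t)))%C.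
    - specialize (HN2 t). specialize (CS t). destruct (Hbd t) as [B1 B2]. fold a in B1. fold b in B2.
      assert (F1 : fst (ps c (cis t)) = cos (tau t) / a) by (rewrite <- B1; field; lra).
      assert (F2 : snd (ps c (cis t)) = sin (tau t) / b) by (rewrite <- B2; field; lra).
      set (n := (a * cos (tau t), b * sin (tau t))). set (n' := (a * cos (tau t), - (b * sin (tau t)))).
      assert (E3 : (x1 t, y1 t) = ((ps c (cis t) - (q1, q2)) * n')%C).
      { apply C_eq; unfold n', Cmult, Cminus, Cplus, Copp; cbn [fst snd]; rewrite F1, F2; unfold x1, y1; [|field; lra].
        transitivity (sin (tau t) * sin (tau t) + cos (tau t) * cos (tau t) - (a * q1 * cos (tau t) + b * q2 * sin (tau t))).
        - rewrite CS; ring.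
        - field; lra. }
      assert (E4 : (x2 t, y2 t) = (n * cis (- tau t))%C).
      { apply C_eq; unfold n, Cmult, cis, x2, y2, fst, snd; rewrite cos_neg, sin_neg; ring. }
      assert (E5 : (n' * n)%C = RtoC (N2 t)).
      { apply C_eq; unfold n, n', Cmult, RtoC, N2, fst, snd; ring. }
      rewrite E3, E4.
      transitivity ((RtoC (/ N2 t) * RtoC (N2 t)) * (ps c (cis t) - (q1, q2)) * (cis (tau t) * cis (- tau t)))%C.
      { rewrite cis_conj_1, <- RtoC_mult, Rinv_l by lra. ring. }
      rewrite <- E5. ring.
    - rewrite E1, E2. replace (r1 * r2 / N2 t) with (/ N2 t * (r1 * r2)) by (unfold Rdiv; ring). rewrite !RtoC_mult. ring. }
  exists (fun t => tau t - t + atan (y1 t / x1 t) + atan (y2 t / x2 t)), (fun t => Cmod (ps c (cis t) - (q1, q2))%C).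
  assert (Sdiv : forall f g, smooth f -> smooth g -> (forall t, 0 < g t) -> smooth (fun t => f t / g t)).
  { intros f g Sf Sg Hg. unfold Rdiv. apply smooth_mult; auto. apply smooth_inv; auto. intros t. specialize (Hg t). lra. }
  split; [|split].
  - apply smooth_plus; [apply smooth_plus; [auto with cont|]|]; apply smooth_atan; auto.
  - intros t. unfold x1, y1, x2, y2. rewrite !Pc, !Ps, Hper. ring.
  - intros t. destruct (G t) as [rho [Hr E]].
    assert (Er : Cmod (ps c (cis t) - (q1, q2))%C = rho) by (rewrite E, Cmod_mult, Cmod_R, Cmod_cis, Rabs_pos_eq by lra; ring).
    rewrite Er. auto.
Qed.

(** The power series with real part [A] on the circle is multiplied by [i]. This is the logarithm
    that removes the periodic part of the argument without affecting zeros. *)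
Lemma arg_exponential A : smooth A -> periodic A -> exists H H', hol1 H H' /\ forall t, snd (H (cis t)) = A t.
Proof.
  intros SA PA. assert (RA : rapid (fc A)) by now apply fc_rapid. pose proof (rapidC_coefC _ RA) as RC.
  eexists. eexists. split. apply (hol1_mult _ _ _ _ (hol1_const Ci) (ps_hol1 _ RC)).
  intros t. cbv beta. rewrite (fourier_eq A SA PA), <- ps_cis by auto. unfold Ci, Cmult, fst, snd. ring.
Qed.

Lemma filled_surjective q : filled q < 1 -> exists p, cd p /\ ps c p = q.
Proof.
  intros Hq. apply NNPP. intros Hno.
  destruct (filled_arg q Hq) as [A [rho [SA [PA HA]]]]. destruct (arg_exponential A SA PA) as [H [H' [HH EH]]].
  pose proof (hol1_plus _ _ _ _ (ps_hol1 c Hc) (hol1_const (- q))) as HF. cbv beta in HF.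
  assert (Nz : forall z, cd z -> (ps c z + - q)%C <> 0).
  { intros z Hz E. apply Hno. exists z. split; auto. replace (ps c z) with (ps c z + - q + q)%C by ring. rewrite E. ring. }
  destruct (hol1_lower _ _ HF Nz) as [m [Hm Hl]].
  pose proof (hol1_inv _ _ m Hm Hl HF) as HI.
  pose proof (hol1_mult _ _ _ _ (hol1_mult _ _ _ _ hol1_id (hol1_exp _ _ HH)) HI) as HN. cbv beta in HN.
  apply (hol1_circle_pos _ _ HN).
  - ring.
  (* On the circle numerator and denominator both have argument [A t + t], so their quotient is
     [exp (Re H) / rho]. *)
  - intros t. destruct (HA t) as [Hr E].
    pose proof (cis_nz t) as N1. pose proof (cis_nz (A t)) as N2.
    assert (N3 : RtoC (rho t) <> 0) by (intros Z; apply (f_equal fst) in Z; simpl in Z; lra).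
    assert (E' : (cis t * Cexp (H (cis t)) * / (ps c (cis t) + - q))%C = RtoC (exp (fst (H (cis t))) / rho t)).
    { rewrite Cexp_cis, EH. change (ps c (cis t) + - q)%C with (ps c (cis t) - q)%C. rewrite E, cis_plus.
      unfold Rdiv. rewrite RtoC_mult, RtoC_inv by lra. field. auto. }
    rewrite E'. simpl. apply Rdiv_lt_0_compat; auto. apply exp_pos.
Qed.

(** On the circle [conj (cis t)] is [1 / cis t]. A zero inside the disk thus counts as one factor
    [cis t], up to the conjugate of a function without zeros on the circle. *)
Lemma blaschke_factor a t : od a -> (cis t - a)%C = (cis t * Cconj (1 - Cconj a * cis t))%C /\ (1 - Cconj a * cis t)%C <> 0.
Proof.
  intros Ha. split.
  - transitivity (cis t - a * (cis t * cis (- t)))%C. rewrite cis_conj_1; ring.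
    rewrite <- conj_cis. apply C_eq; unfold cis, Cconj, Cmult, Cminus, Cplus, Copp, RtoC, fst, snd; ring.
  - intros E. assert (Z : (Cconj a * cis t)%C = 1) by (transitivity (1 - (1 - Cconj a * cis t))%C; [ring|rewrite E; ring]).
    apply (f_equal Cmod) in Z. rewrite Cmod_mult, Cmod_conj, Cmod_cis, Cmod_1 in Z. unfold od in Ha. lra.
Qed.

Lemma hol1_blaschke a : od a -> exists f', hol1 (fun z => / (1 - Cconj a * z))%C f'.
Proof.
  intros Ha. assert (Hl : forall z, cd z -> 1 - Cmod a <= Cmod (1 + - Cconj a * z)%C).
  { intros z Hz. pose proof (Cmod_rev_triangle 1 (Cconj a * z)) as R. rewrite Cmod_1, Cmod_mult, Cmod_conj in R.
    replace (1 + - Cconj a * z)%C with (1 - Cconj a * z)%C by ring. unfold cd in Hz. pose proof (Cmod_ge_0 a). nra. }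
  pose proof (hol1_plus _ _ _ _ (hol1_const 1) (hol1_mult _ _ _ _ (hol1_const (- Cconj a)) hol1_id)) as H. cbv beta in H.
  pose proof (hol1_inv _ _ (1 - Cmod a) ltac:(unfold od in Ha; lra) Hl H) as HI.
  refine (ex_intro _ _ (hol1_ext _ _ _ _ _ (fun z _ => eq_refl) HI)). intros z _. f_equal. ring.
Qed.

(** Two zeros of [F - q] in the disk contradict the fact that [F - q] winds once. *)
Lemma filled_divdiff_nz a b : od a -> od b -> ps (divdiff c a) b <> 0.
Proof.
  intros Ha Hb Z. assert (Ha' : cd a) by (left; auto). assert (Hb' : cd b) by (left; auto).
  assert (Hd := rapidC_divdiff c a Hc Ha'). set (c1 := divdiff c a) in *.
  assert (Hd2 := rapidC_divdiff c1 b Hd Hb'). set (c2 := divdiff c1 b) in *.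
  destruct (filled_arg (ps c a) (Hin a Ha)) as [A [rho [SA [PA HA]]]]. destruct (arg_exponential A SA PA) as [H [H' [HH EH]]].
  destruct (hol1_blaschke a Ha) as [ba Hba]. destruct (hol1_blaschke b Hb) as [bb Hbb].
  pose proof (hol1_exp _ _ (hol1_mult _ _ _ _ (hol1_const (- (1))) HH)) as HE. cbv beta in HE.
  pose proof (hol1_mult _ _ _ _ (hol1_mult _ _ _ _ hol1_id (hol1_mult _ _ _ _ (ps_hol1 c2 Hd2) HE)) (hol1_mult _ _ _ _ Hba Hbb)) as HN.
  cbv beta in HN. apply (hol1_circle_pos _ _ HN).
  - ring.
  - intros t. destruct (HA t) as [Hr E].
    destruct (blaschke_factor a t Ha) as [Ea Na]. destruct (blaschke_factor b t Hb) as [Eb Nb].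
    set (u := (1 - Cconj a * cis t)%C) in *. set (v := (1 - Cconj b * cis t)%C) in *.
    rewrite (divdiff_eq c a (cis t)) in E by (auto; apply cd_cis). fold c1 in E.
    pose proof (divdiff_eq c1 b (cis t) Hd Hb' (cd_cis t)) as E1. rewrite Z in E1. fold c2 in E1.
    replace (ps c1 (cis t) - 0)%C with (ps c1 (cis t)) in E1 by ring. rewrite E1, Ea, Eb, cis_plus in E.
    assert (Nu : RtoC (Cmod u ^ 2) = (u * Cconj u)%C) by (apply C_eq; rewrite Cmod_sqr; unfold Cconj, Cmult, RtoC, fst, snd; ring).
    assert (Nv : RtoC (Cmod v ^ 2) = (v * Cconj v)%C) by (apply C_eq; rewrite Cmod_sqr; unfold Cconj, Cmult, RtoC, fst, snd; ring).
    assert (Hu : 0 < Cmod u) by now apply Cmod_gt_0. assert (Hv : 0 < Cmod v) by now apply Cmod_gt_0.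
    assert (Hu2 : 0 < Cmod u ^ 2) by now apply pow_lt. assert (Hv2 : 0 < Cmod v ^ 2) by now apply pow_lt.
    assert (Cu : Cconj u <> 0). { intros Y. rewrite Y, Cmult_0_r in Nu. apply (f_equal fst) in Nu. simpl fst in Nu. lra. }
    assert (Cv : Cconj v <> 0). { intros Y. rewrite Y, Cmult_0_r in Nv. apply (f_equal fst) in Nv. simpl fst in Nv. lra. }
    (* Since [1 / u] is [conj u / |u|^2], the denominators supply the conjugates split off from the
       two zeros. Of the two factors [cis t] so obtained, one cancels the winding of [F - q]; the
       other is the factor that vanishes at 0. *)
    assert (E' : (cis t * (ps c2 (cis t) * Cexp (- (1) * H (cis t))) * (/ u * / v))%C =
       RtoC (rho t * exp (fst (- (1) * H (cis t))%C) * / (Cmod u ^ 2 * Cmod v ^ 2))).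
    { rewrite Cexp_cis. replace (snd (- (1) * H (cis t))%C) with (- A t) by (rewrite <- EH; unfold Cmult, Copp, RtoC, fst, snd; ring).
      rewrite !RtoC_mult, RtoC_inv by (apply Rgt_not_eq; now apply Rmult_lt_0_compat). rewrite RtoC_mult, Nu, Nv.
      set (X := exp _).
      assert (E2 : (cis t * ps c2 (cis t) * Cconj u * Cconj v)%C = (RtoC (rho t) * cis (A t))%C).
      { transitivity (cis (- t) * (cis t * Cconj u * (cis t * Cconj v * ps c2 (cis t))))%C.
        - transitivity ((cis t * cis (- t)) * (cis t * ps c2 (cis t) * Cconj u * Cconj v))%C; [rewrite cis_conj_1; ring|ring].
        - rewrite E. transitivity ((cis t * cis (- t)) * (RtoC (rho t) * cis (A t)))%C; [ring|rewrite cis_conj_1; ring]. }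
      transitivity ((cis t * ps c2 (cis t) * Cconj u * Cconj v) * X * cis (- A t) / (u * Cconj u * (v * Cconj v)))%C.
      { field. auto. }
      rewrite E2. transitivity ((cis (A t) * cis (- A t)) * RtoC (rho t) * X / (u * Cconj u * (v * Cconj v)))%C.
      { field. auto. } rewrite cis_conj_1. field. auto. }
    rewrite E'. simpl fst. apply Rmult_lt_0_compat. apply Rmult_lt_0_compat; auto. apply exp_pos.
    apply Rinv_0_lt_compat. now apply Rmult_lt_0_compat.
Qed.

(** In the coordinates scaled to the unit circle the target is an angle; [tau] gains exactly [2 PI]
    over a period, so it takes some representative of that angle by the intermediate value
    theorem. *)
Lemma filled_boundary_onto q : filled q = 1 -> exists t, ps c (cis t) = q.
Proof.
  intros Hq. destruct root_pos as [Ha Hb].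
  assert (Hcirc : circle (sqrt s1 * fst q, sqrt s2 * snd q)).
  { unfold circle, dot. cbn [fst snd]. rewrite <- Hq. unfold filled.
    transitivity (sqrt s1 * sqrt s1 * fst q ^ 2 + sqrt s2 * sqrt s2 * snd q ^ 2); [ring|]. now rewrite !sqrt_sqrt by lra. }
  apply circle_cis in Hcirc. destruct Hcirc as [th Eth]. unfold cis in Eth. injection Eth as E1 E2.
  destruct (angle_reduce (th - tau 0)) as [k [K1 K2]]. set (y := th + IZR k * (2 * PI)).
  pose proof two_PI_pos. assert (Et : tau (2 * PI) = tau 0 + 2 * PI) by (rewrite <- Hper; f_equal; ring).
  assert (exists t, tau t = y) as [t Ht].
  { assert (Ct : forall x, continuity_pt (fun t => tau t - y) x).
    { intros x. apply continuity_pt_filterlim. apply (cont_minus tau (fun _ => y) (smooth_cont _ Htau) (cont_const y)). }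
    destruct (IVT_cor (fun t => tau t - y) 0 (2 * PI) Ct) as [t [_ Ez]]; [lra| |exists t; lra].
    assert (tau 0 <= y) by (unfold y; lra). assert (y <= tau (2 * PI)) by (unfold y; lra). nra. }
  exists t. destruct (Hbd t) as [B1 B2]. rewrite Ht in B1, B2. unfold y in B1, B2. rewrite cos_Z in B1. rewrite sin_Z in B2.
  apply C_eq; [apply Rmult_eq_reg_l with (sqrt s1)|apply Rmult_eq_reg_l with (sqrt s2)]; lra.
Qed.

Lemma filled_boundary_inj s t : ps c (cis s) = ps c (cis t) -> cis s = cis t.
Proof.
  intros E. destruct (Hbd s) as [A1 A2]. destruct (Hbd t) as [B1 B2]. rewrite E in A1, A2.
  destruct (cos_sin_period (tau s - tau t) (tau t)) as [k Hk].
  { replace (tau t + (tau s - tau t)) with (tau s) by ring. lra. }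
  { replace (tau t + (tau s - tau t)) with (tau s) by ring. lra. }
  assert (Pt : tau (t + IZR k * (2 * PI)) = tau t + IZR k * (2 * PI)).
  { pose proof (periodic_Z (fun t => tau t - t) ltac:(intros x; rewrite Hper; ring) k t) as Q. cbv beta in Q. lra. }
  assert (Es : s = t + IZR k * (2 * PI)).
  { destruct (Rtotal_order s (t + IZR k * (2 * PI))) as [L|[Eq|L]]; auto; apply Hincr in L; lra. }
  rewrite Es. unfold cis. now rewrite cos_Z, sin_Z.
Qed.

(** Interior and boundary points have images separated by [filled]. Two interior points with the
    same image give a zero of the divided difference; on the boundary [tau] is strictly
    increasing. *)
Lemma filled_injective p q : cd p -> cd q -> ps c p = ps c q -> p = q.
Proof.
  intros Hp Hq E.
  assert (Bd : forall z, Cmod z = 1 -> filled (ps c z) = 1).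
  { intros z Hz. apply circle_Cmod, circle_cis in Hz. destruct Hz as [t ->]. apply filled_boundary. }
  destruct (Rle_lt_or_eq_dec _ _ Hp) as [Lp|Ep]; destruct (Rle_lt_or_eq_dec _ _ Hq) as [Lq|Eq].
  - apply NNPP. intros Hne. apply (filled_divdiff_nz p q Lp Lq).
    pose proof (divdiff_eq c p q Hc Hp Hq) as D. rewrite E in D.
    assert (Nz : (q - p)%C <> 0) by (intros Z; apply Hne; transitivity (q - (q - p))%C; [ring|rewrite Z; ring]).
    transitivity (/ (q - p) * ((q - p) * ps (divdiff c p) q))%C; [field; auto|rewrite <- D; ring].
  - pose proof (Hin p Lp) as H. rewrite E in H. pose proof (Bd q Eq) as H'. unfold filled in H'. lra.
  - pose proof (Hin q Lq) as H. rewrite <- E in H. pose proof (Bd p Ep) as H'. unfold filled in H'. lra.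
  - apply circle_Cmod, circle_cis in Ep. apply circle_Cmod, circle_cis in Eq.
    destruct Ep as [s ->]. destruct Eq as [t ->]. now apply filled_boundary_inj.
Qed.

Lemma filled_onto q : filled q <= 1 -> exists p, cd p /\ ps c p = q.
Proof.
  intros [L|E]. now apply filled_surjective. destruct (filled_boundary_onto q E) as [t Ht]. exists (cis t). split; auto. apply cd_cis.
Qed.
End Filling.

(** * Smoothness of the inverse *)

Lemma convex_hull_ellipse s1 s2 q : 0 < s1 -> 0 < s2 -> convex_hull (ellipse s1 s2) q <-> filled s1 s2 q <= 1.
Proof.
  intros H1 H2. split.
  - intros H. apply (H (fun q => filled s1 s2 q <= 1)).
    + intros [p1 p2] [q1 q2] t Hp Hq Ht. unfold filled in *. cbn [fst snd] in *.
      assert (0 <= t * (1 - t) * (s1 * (p1 - q1) ^ 2 + s2 * (p2 - q2) ^ 2)).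
      { apply Rmult_le_pos; [nra|]. pose proof (pow2_ge_0 (p1 - q1)). pose proof (pow2_ge_0 (p2 - q2)). nra. }
      replace (s1 * ((1 - t) * p1 + t * q1) ^ 2 + s2 * ((1 - t) * p2 + t * q2) ^ 2) with
        ((1 - t) * (s1 * p1 ^ 2 + s2 * p2 ^ 2) + t * (s1 * q1 ^ 2 + s2 * q2 ^ 2) - t * (1 - t) * (s1 * (p1 - q1) ^ 2 + s2 * (p2 - q2) ^ 2)) by ring.
      nra.
    + intros p Hp. right. exact Hp.
  - intros H A HC HA. destruct q as [x y]. unfold filled in H. cbn [fst snd] in H.
    assert (Hz : 0 <= (1 - s1 * x ^ 2) / s2).
    { apply Rmult_le_reg_r with s2; auto. unfold Rdiv. rewrite Rmult_0_l, Rmult_assoc, Rinv_l by lra.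
      pose proof (pow2_ge_0 y). nra. }
    set (y0 := sqrt ((1 - s1 * x ^ 2) / s2)). assert (Hy0 : 0 <= y0) by apply sqrt_pos.
    assert (E0 : s2 * y0 ^ 2 = 1 - s1 * x ^ 2).
    { unfold y0. rewrite pow2_sqrt by auto. field. lra. }
    assert (Hy : y ^ 2 <= y0 ^ 2) by nra.
    assert (Hy' : - y0 <= y <= y0) by (split; nra).
    assert (A1 : A (x, - y0)). { apply HA. unfold ellipse, fst, snd. replace ((- y0) ^ 2) with (y0 ^ 2) by ring. lra. }
    assert (A2 : A (x, y0)). { apply HA. unfold ellipse, fst, snd. lra. }
    destruct (Req_dec y0 0) as [Z|Nz].
    + replace y with y0 by lra. exact A2.
    + assert (P : 0 < y0) by lra. assert (Hi : 0 < / (2 * y0)) by (apply Rinv_0_lt_compat; lra).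
      set (t := (y + y0) * / (2 * y0)).
      assert (Ht : 0 <= t <= 1).
      { unfold t. split; [apply Rmult_le_pos; lra|]. apply Rmult_le_reg_r with (2 * y0); [lra|].
        rewrite Rmult_assoc, Rinv_l by lra. lra. }
      pose proof (HC _ _ t A1 A2 Ht) as Q. cbn [fst snd] in Q.
      replace x with ((1 - t) * x + t * x) by ring. replace y with ((1 - t) * - y0 + t * y0) by (unfold t; field; lra). exact Q.
Qed.

Lemma hol1_unique f f' g : hol1 f f' -> hol1 f g -> forall p, od p -> f' p = g p.
Proof.
  intros H1 H2 p Hp. destruct (hol1_partials f f' p H1 Hp) as [A [_ [B _]]].
  destruct (hol1_partials f g p H2 Hp) as [A' [_ [B' _]]].
  apply is_derive_unique in A, B, A', B'. apply C_eq; congruence.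
Qed.

(** Differentiating [f z = f a + (z - a) d z] at [a]. It lets [filled_divdiff_nz], taken at two
    equal points, exclude critical points inside the disk. *)
Lemma divdiff_diag c a : rapidC c -> od a -> ps (divdiff c a) a = ps (dc c) a.
Proof.
  intros Hc Ha. assert (Ha' : cd a) by (left; auto). pose proof (rapidC_divdiff c a Hc Ha') as Hd.
  pose proof (hol1_plus _ _ _ _ (hol1_const (ps c a))
    (hol1_mult _ _ _ _ (hol1_plus _ _ _ _ hol1_id (hol1_const (- a))) (ps_hol1 _ Hd))) as H. cbv beta in H.
  assert (H' : hol1 (ps c) (fun z => 0 + ((1 + 0) * ps (divdiff c a) z + (z + - a) * ps (dc (divdiff c a)) z))%C).
  { refine (hol1_ext _ _ _ _ _ (fun _ _ => eq_refl) H). intros z Hz. cbv beta.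
    pose proof (divdiff_eq c a z Hc Ha' Hz) as E.
    transitivity (ps c a + (ps c z - ps c a))%C; [rewrite E; ring|ring]. }
  rewrite (hol1_unique _ _ _ (ps_hol1 c Hc) H' a Ha). ring.
Qed.

Section Inverse.
Variables (L : C -> Prop) (c : nat -> C) (sg : R).
Hypotheses (Hsg : sg = 1 \/ sg = -1) (Hc : rapidC c) (HD : forall z, cd z -> ps (dc c) z <> 0)
  (Hinj : forall p q, cd p -> cd q -> ps c p = ps c q -> p = q)
  (Honto : forall q, L q -> exists p, cd p /\ ps c p = (fst q, sg * snd q)).

(** The preimage is taken under the holomorphic map, after the reflection by [sg] has carried the
    target of [Phi] to that of [F]; this is the inverse of [Phi] itself. *)
Definition inverse (q : C) : C := epsilon (inhabits (RtoC 0)) (fun p => cd p /\ ps c p = (fst q, sg * snd q)).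

Lemma inverse_spec q : L q -> cd (inverse q) /\ ps c (inverse q) = (fst q, sg * snd q).
Proof. intros Hq. apply (epsilon_spec (inhabits (RtoC 0)) (fun p => cd p /\ ps c p = (fst q, sg * snd q))). auto. Qed.

Lemma reflection_isometry (p q : C) : Cmod ((fst p, (sg * snd p)%R) - (fst q, (sg * snd q)%R))%C = Cmod (p - q)%C.
Proof.
  unfold Cmod. f_equal. cbn [fst snd Cminus Cplus Copp]. destruct Hsg as [-> | ->]; ring.
Qed.

(** By compactness: otherwise the preimages of points tending to [q0] would cluster at a second
    preimage of [q0], against injectivity. *)
Lemma inverse_cont q0 : L q0 -> forall eps, 0 < eps -> exists d, 0 < d /\
  forall q, L q -> Cmod (q - q0)%C < d -> Cmod (inverse q - inverse q0)%C < eps.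
Proof.
  intros H0 eps He. apply NNPP. intros Hno.
  assert (Hs : forall n : nat, exists q, L q /\ Cmod (q - q0)%C < / (INR n + 1) /\ eps <= Cmod (inverse q - inverse q0)%C).
  { intros n. apply NNPP. intros Hn. apply Hno. exists (/ (INR n + 1)). split.
    - apply Rinv_0_lt_compat. pose proof (pos_INR n). lra.
    - intros q Hq Hd. apply Rnot_le_lt. intros Hle. apply Hn. eauto. }
  set (s := fun n => proj1_sig (constructive_indefinite_description _ (Hs n))).
  assert (Es : forall n, L (s n) /\ Cmod (s n - q0)%C < / (INR n + 1) /\ eps <= Cmod (inverse (s n) - inverse q0)%C).
  { intros n. apply (proj2_sig (constructive_indefinite_description _ (Hs n))). }
  destruct (inverse_spec q0 H0) as [I0 E0].
  destruct (disk_compact (fun n => inverse (s n))) as [p [Hp Hcl]].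
  { intros n. apply inverse_spec, Es. }
  destruct (hol1_bound _ _ (ps_hol1 c Hc)) as [B [B0 HB]].
  enough (Ep : p = inverse q0).
  { destruct (Hcl eps O He) as [m [_ Hm]]. destruct (Es m) as [_ [_ Hge]]. rewrite Ep in Hm. lra. }
  apply Hinj; auto. rewrite E0.
  assert (Z : Cmod (ps c p - (fst q0, (sg * snd q0)%R))%C = 0).
  { apply Rle_antisym; [|apply Cmod_ge_0]. apply Rnot_lt_le. intros Hpos. set (r := Cmod _) in Hpos.
    assert (He1 : 0 < r / (2 * (B + 1))) by (apply Rdiv_lt_0_compat; lra).
    destruct (INR_unbounded (2 / r)) as [M HM].
    destruct (Hcl _ M He1) as [m [HmM Hm]]. destruct (Es m) as [Ls [Hd _]].
    destruct (inverse_spec _ Ls) as [Is Ei].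
    destruct (HB (inverse (s m)) p Is Hp) as [_ [_ [Lip _]]].
    assert (D1 : Cmod (ps c (inverse (s m)) - (fst q0, (sg * snd q0)%R))%C < r / 2).
    { rewrite Ei, reflection_isometry. apply Rlt_trans with (1 := Hd).
      assert (2 / r < INR m + 1) by (apply le_INR in HmM; lra).
      assert (Q : 0 < 2 / r) by (apply Rdiv_lt_0_compat; lra).
      replace (r / 2) with (/ (2 / r)) by (field; lra). apply Rinv_lt_contravar; auto. apply Rmult_lt_0_compat; lra. }
    assert (D2 : Cmod (ps c (inverse (s m)) - ps c p)%C < r / 2).
    { apply Rle_lt_trans with (1 := Lip). apply Rle_lt_trans with (B * (r / (2 * (B + 1)))).
      - apply Rmult_le_compat_l; lra.
      - apply Rmult_lt_reg_r with (2 * (B + 1)); [lra|].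
        replace (B * (r / (2 * (B + 1))) * (2 * (B + 1))) with (B * r) by (field; lra).
        replace (r / 2 * (2 * (B + 1))) with ((B + 1) * r) by field. nra. }
    rewrite Cmod_minus_sym in D2.
    pose proof (Cmod_triangle (ps c p - ps c (inverse (s m))) (ps c (inverse (s m)) - (fst q0, (sg * snd q0)%R)))%C as Tr.
    replace (ps c p - ps c (inverse (s m)) + (ps c (inverse (s m)) - (fst q0, (sg * snd q0)%R)))%C with (ps c p - (fst q0, (sg * snd q0)%R))%C in Tr by ring.
    fold r in Tr. lra. }
  apply Cmod_eq_0 in Z. transitivity (ps c p - (fst q0, (sg * snd q0)%R) + (fst q0, (sg * snd q0)%R))%C; [ring|rewrite Z; ring].
Qed.

(** Divide the Taylor formula of [F] by its derivative. Continuity of the inverse makes the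
    remainder at most half of [|z - z0|], so it can be absorbed: [|z - z0|] is controlled linearly
    by the displacement of the image. The estimate holds at boundary points too. *)
Lemma inverse_quadratic q0 : L q0 -> exists K d, 0 <= K /\ 0 < d /\ forall q, L q -> Cmod (q - q0)%C < d ->
  Cmod (inverse q - inverse q0 - / ps (dc c) (inverse q0) * ((fst q, (sg * snd q)%R) - (fst q0, (sg * snd q0)%R)))%C <= K * Cmod (q - q0)%C ^ 2.
Proof.
  intros H0. destruct (inverse_spec q0 H0) as [I0 E0]. set (z0 := inverse q0) in *. pose proof (HD z0 I0) as Nz.
  set (j := (/ ps (dc c) z0)%C). set (J := Cmod j). assert (HJ : 0 <= J) by apply Cmod_ge_0.
  destruct (hol1_bound _ _ (ps_hol1 c Hc)) as [B [B0 HB]].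
  assert (BJ : 0 <= B * J) by now apply Rmult_le_pos.
  (* The radius is such that [B J |z - z0| <= 1/2], where [J] is the modulus of the inverse
     derivative; adding 1 keeps the denominator positive. *)
  destruct (inverse_cont q0 H0 (/ (2 * (B * J + 1)))) as [d [Hd HG]]. { apply Rinv_0_lt_compat. lra. }
  exists (B * J * (2 * J) ^ 2), d. split; [|split; auto].
  { apply Rmult_le_pos; auto. apply pow2_ge_0. }
  intros q Hq Hqd. destruct (inverse_spec q Hq) as [I1 E1]. specialize (HG q Hq Hqd). fold z0 in HG.
  set (z := inverse q) in *. destruct (HB z z0 I1 I0) as [_ [_ [_ Q]]]. rewrite E1, E0 in Q.
  rewrite <- (reflection_isometry q q0). set (w := ((fst q, (sg * snd q)%R) - (fst q0, (sg * snd q0)%R))%C) in *.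
  set (x := Cmod (z - z0)%C) in *. assert (Hx : 0 <= x) by apply Cmod_ge_0.
  assert (R : Cmod (z - z0 - j * w)%C <= B * J * x ^ 2).
  { replace (z - z0 - j * w)%C with (- j * (w - ps (dc c) z0 * (z - z0)))%C by (unfold j; field; auto).
    rewrite Cmod_mult, Cmod_opp. fold J. replace (B * J * x ^ 2) with (J * (B * x ^ 2)) by ring. now apply Rmult_le_compat_l. }
  assert (Hx1 : B * J * x <= / 2).
  { assert (x * (2 * (B * J + 1)) < 1).
    { apply Rmult_lt_reg_r with (/ (2 * (B * J + 1))). apply Rinv_0_lt_compat; lra.
      rewrite Rmult_assoc, Rinv_r, Rmult_1_r, Rmult_1_l by lra. exact HG. }
    nra. }
  assert (Tr : x <= J * Cmod w + B * J * x ^ 2).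
  { unfold x at 1. replace (z - z0)%C with (j * w + (z - z0 - j * w))%C by ring.
    eapply Rle_trans; [apply Cmod_triangle|]. rewrite Cmod_mult. fold J. lra. }
  assert (Hx2 : x <= 2 * J * Cmod w) by nra.
  apply Rle_trans with (1 := R). rewrite (Rmult_assoc (B * J)).
  replace ((2 * J) ^ 2 * Cmod w ^ 2) with ((2 * J * Cmod w) ^ 2) by ring.
  apply Rmult_le_compat_l; auto. apply pow_incr. lra.
Qed.

(** The reflected axis vectors: moving along an axis in the target of [Phi] displaces the argument
    of the holomorphic inverse in this direction. *)
Definition dir (a : axis) : C := match a with AxisX => 1%C | AxisY => (Ci * sg)%C end.

Lemma inverse_along a p : Defs.interior L p ->
  let v := (/ ps (dc c) (inverse p) * dir a)%C in
  is_derive (along a (fun q => fst (inverse q)) p) (coord a p) (fst v) /\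
  is_derive (along a (fun q => snd (inverse q)) p) (coord a p) (snd v).
Proof.
  intros Hp v. assert (Lp : L p) by now apply locally_singleton.
  destruct (inverse_quadratic p Lp) as [K [d [K0 [Hd Q]]]].
  set (ga := fun t => match a with AxisX => (t, snd p) | AxisY => (fst p, t) end : C).
  assert (Eg : ga (coord a p) = p) by (destruct a, p; reflexivity).
  assert (Hd' : forall t, Cmod (ga t - p)%C = Rabs (t - coord a p)).
  { intros t. unfold ga. destruct a; unfold Cmod, Cminus, Cplus, Copp, coord; cbn [fst snd]; rewrite <- sqrt_Rsqr_abs; f_equal; unfold Rsqr; ring. }
  assert (Hdir : forall t, ((fst (ga t), (sg * snd (ga t))%R) - (fst p, (sg * snd p)%R))%C = (dir a * RtoC (t - coord a p))%C).
  { intros t. unfold ga, dir, coord. destruct a; apply C_eq; unfold Cminus, Cplus, Copp, Cmult, Ci, RtoC; cbn [fst snd]; ring. }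
  assert (Loc : locally (coord a p) (fun t : R => Cmod (inverse (ga t) - inverse p - v * RtoC (t - coord a p))%C <= K * (t - coord a p) ^ 2)).
  { pose proof (interior_along L p a Hp) as HL. destruct HL as [e1 He1].
    exists (mkposreal (Rmin e1 d) (Rmin_pos _ _ (cond_pos e1) Hd)). intros t Ht.
    assert (Ht' : Rabs (t - coord a p) < Rmin e1 d) by exact Ht.
    assert (Lt : L (ga t)).
    { apply locally_singleton. apply He1. change (Rabs (t - coord a p) < e1). eapply Rlt_le_trans; [apply Ht'|apply Rmin_l]. }
    specialize (Q (ga t) Lt). rewrite Hd', Hdir in Q. rewrite pow2_abs in Q.
    unfold v. replace (/ ps (dc c) (inverse p) * dir a * RtoC (t - coord a p))%C with (/ ps (dc c) (inverse p) * (dir a * RtoC (t - coord a p)))%C by ring.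
    apply Q. eapply Rlt_le_trans; [apply Ht'|apply Rmin_r]. }
  assert (Al : forall (h : C -> R) t, along a h p t = h (ga t)) by (intros; apply along_at).
  split; apply derive_of_quadratic with K; destruct Loc as [e1 He1]; exists e1; intros t Ht; specialize (He1 t Ht);
    rewrite !Al, Eg; eapply Rle_trans; try apply He1.
  - eapply Rle_trans; [|apply fst_le_Cmod]. right. f_equal. unfold Cminus, Cplus, Copp, Cmult, RtoC; cbn [fst snd]. ring.
  - eapply Rle_trans; [|apply snd_le_Cmod]. right. f_equal. unfold Cminus, Cplus, Copp, Cmult, RtoC; cbn [fst snd]. ring.
Qed.

(** Closed under derivation, since [(1/F')' = - F'' / F'^2]; so the compositions
    of its members with the inverse of [F] are closed under partial derivatives. *)
Inductive hclass : (C -> C) -> Prop :=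
| hclass_id : hclass (fun z => z)
| hclass_const k : hclass (fun _ => k)
| hclass_ps d : rapidC d -> hclass (ps d)
| hclass_inv : hclass (fun z => / ps (dc c) z)%C
| hclass_plus f g : hclass f -> hclass g -> hclass (fun z => f z + g z)%C
| hclass_mult f g : hclass f -> hclass g -> hclass (fun z => f z * g z)%C.

Lemma hclass_hol f : hclass f -> exists f', hclass f' /\ hol1 f f'.
Proof.
  induction 1 as [|k|d Hd| |f g _ [f' [Cf Df]] _ [g' [Cg Dg]]|f g Hf [f' [Cf Df]] Hg [g' [Cg Dg]]].
  - eexists. split; [apply hclass_const|apply hol1_id].
  - eexists. split; [apply (hclass_const 0)|apply hol1_const].
  - exists (ps (dc d)). split; [apply hclass_ps; now apply rapidC_dc|now apply ps_hol1].
  - assert (H1 := rapidC_dc c Hc). destruct (hol1_lower _ _ (ps_hol1 _ H1) HD) as [m [Hm Hl]].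
    exists (fun z => (- (1)) * ps (dc (dc c)) z * (/ ps (dc c) z * / ps (dc c) z))%C. split.
    + repeat apply hclass_mult; try apply hclass_inv. apply hclass_const. apply hclass_ps. now apply rapidC_dc.
    + refine (hol1_ext _ _ _ _ (fun _ _ => eq_refl) _ (hol1_inv _ _ m Hm Hl (ps_hol1 _ H1))).
      intros z Hz. field. now apply HD.
  - exists (fun z => f' z + g' z)%C. split; [now apply hclass_plus|now apply hol1_plus].
  - exists (fun z => f' z * g z + f z * g' z)%C. split; [|now apply hol1_mult].
    apply hclass_plus; now apply hclass_mult.
Qed.

Definition hclass_inverse (g : C -> R) : Prop :=
  exists f, hclass f /\ (g = (fun q => fst (f (inverse q))) \/ g = (fun q => snd (f (inverse q)))).

Lemma inverse_Lim2 f f' p : hol1 f f' -> L p ->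
  Lim2 L (fun q => fst (f (inverse q))) p (fst (f (inverse p))) /\ Lim2 L (fun q => snd (f (inverse q))) p (snd (f (inverse p))).
Proof.
  intros Hf Hp. destruct (inverse_spec p Hp) as [Ip _]. destruct (hol1_Lim2 f f' (inverse p) Hf Ip) as [A B].
  split; intros eps He; [destruct (A eps He) as [d [Hd H]]|destruct (B eps He) as [d [Hd H]]];
    destruct (inverse_cont p Hp d Hd) as [d' [Hd' H']]; exists d'; split; auto; intros q Hq Hl; apply H; auto;
    now apply inverse_spec.
Qed.

Lemma inverse_smooth : smooth_map_on L inverse.
Proof.
  assert (SC : forall g, hclass_inverse g -> smooth_on L g).
  { assert (Lims : forall g p, hclass_inverse g -> L p -> Lim2 L g p (g p)).
    { intros g p [f [Hf Hg]] Hp. destruct (hclass_hol f Hf) as [f' [_ Df]].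
      destruct (inverse_Lim2 f f' p Df Hp). destruct Hg as [-> | ->]; auto. }
    intros g Hg. apply (smooth_of_class L hclass_inverse); auto.
    - clear g Hg. intros g [f [Hf Hg]] a. destruct (hclass_hol f Hf) as [f' [Hf' Df]].
      assert (Hk : hclass (fun z => f' z * (/ ps (dc c) z * dir a))%C).
      { repeat apply hclass_mult; auto. apply hclass_inv. apply hclass_const. }
      assert (Cu : forall p, Defs.interior L p ->
        is_derive (along a (fun q => fst (f (inverse q))) p) (coord a p) (fst (f' (inverse p) * (/ ps (dc c) (inverse p) * dir a))%C) /\
        is_derive (along a (fun q => snd (f (inverse q))) p) (coord a p) (snd (f' (inverse p) * (/ ps (dc c) (inverse p) * dir a))%C)).
      { intros p Hp. destruct (inverse_along a p Hp) as [D1 D2].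
        set (cu := fun t => inverse (match a with AxisX => (t, snd p) | AxisY => (fst p, t) end)).
        assert (Ec : cu (coord a p) = inverse p) by (unfold cu; destruct a, p; reflexivity).
        assert (Loc : locally (coord a p) (fun s : R => Cmod (cu s) <= 1)).
        { destruct (interior_along L p a Hp) as [e1 He1]. exists e1. intros t Ht. apply inverse_spec.
          apply locally_singleton. now apply He1. }
        destruct (hol1_curve f f' cu (coord a p) (/ ps (dc c) (inverse p) * dir a)%C Df Loc) as [R1 R2].
        - apply is_derive_ext with (2 := D1). intros t. now rewrite along_at.
        - apply is_derive_ext with (2 := D2). intros t. now rewrite along_at.
        - rewrite Ec in R1, R2. split; [apply is_derive_ext with (2 := R1)|apply is_derive_ext with (2 := R2)];
            intros t; now rewrite along_at. }
      destruct Hg as [-> | ->].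
      + exists (fun q => fst (f' (inverse q) * (/ ps (dc c) (inverse q) * dir a))%C). split.
        * exists (fun z => f' z * (/ ps (dc c) z * dir a))%C. auto.
        * intros p Hp. now apply Cu.
      + exists (fun q => snd (f' (inverse q) * (/ ps (dc c) (inverse q) * dir a))%C). split.
        * exists (fun z => f' z * (/ ps (dc c) z * dir a))%C. auto.
        * intros p Hp. now apply Cu.
    - intros h Hh p Hp. exists (h p). apply (filterlim_Lim2 _ _ _ _ _ (fun q => iff_refl _)).
      apply Lim2_subset with L; auto. intros q Hq. now apply locally_singleton.
    - intros p Hp. apply (filterlim_Lim2 _ _ _ _ _ (fun q => iff_refl _)). auto. }
  split; apply SC; exists (fun z => z); split; auto using hclass_id.
Qed.
End Inverse.

(** * Assembly of the diffeomorphism *)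

Theorem proposition1p2 (s1 s2 : R) (Phi : R * R -> R * R) (lam : nat -> R) :
  0 < s1 -> s1 <= s2 ->
  fb_minimal_immersion (ellipse s1 s2) Phi ->
  steklov_spectrum (ellipse_weight s1 s2 Phi) lam ->
  steklov_eigenfunction (ellipse_weight s1 s2 Phi) (lam 1%nat)
    (fun p => fst (Phi p)) ->
  (steklov_eigenfunction (ellipse_weight s1 s2 Phi) (lam 1%nat)
     (fun p => snd (Phi p)) \/
   steklov_eigenfunction (ellipse_weight s1 s2 Phi) (lam 2%nat)
     (fun p => snd (Phi p))) ->
  diffeomorphism closed_disk (convex_hull (ellipse s1 s2)) Phi.
Proof.
  intros H1 H12 HF HS HE1 HE2. assert (H2 : 0 < s2) by lra.
  destruct (degree_one s1 s2 Phi lam H1 H12 HF HS HE1 HE2) as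
    [tau [sg [c [Hsg [Stau [Per [Incr [Bd [Hc [EF [Ins Nz]]]]]]]]]]].
  assert (Bd' : forall t, sqrt s1 * fst (ps c (cis t)) = cos (tau t) /\ sqrt s2 * snd (ps c (cis t)) = sin (tau t)).
  { intros t. destruct (EF _ (cd_cis t)) as [<- <-]. apply Bd. }
  assert (Esg : sg * sg = 1) by (destruct Hsg as [-> | ->]; ring).
  assert (Ins' : forall p, od p -> s1 * fst (ps c p) ^ 2 + s2 * snd (ps c p) ^ 2 < 1).
  { intros p Hp. destruct (EF p (Rlt_le _ _ Hp)) as [<- <-].
    replace ((sg * snd (Phi p)) ^ 2) with (sg * sg * snd (Phi p) ^ 2) by ring. rewrite Esg, Rmult_1_l. now apply Ins. }
  assert (EP : forall p, cd p -> ps c p = (fst (Phi p), sg * snd (Phi p))).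
  { intros p Hp. destruct (EF p Hp) as [E1 E2]. apply C_eq; cbn [fst snd]; auto. }
  assert (Fsg : forall q, filled s1 s2 (fst q, sg * snd q) = filled s1 s2 q).
  { intros q. unfold filled. cbn [fst snd]. replace ((sg * snd q) ^ 2) with (sg * sg * snd q ^ 2) by ring. rewrite Esg. ring. }
  assert (Inj : forall p q, cd p -> cd q -> ps c p = ps c q -> p = q) by exact (filled_injective s1 s2 tau c H1 H2 Stau Per Incr Hc Bd' Ins').
  assert (Onto : forall q, convex_hull (ellipse s1 s2) q -> exists p, cd p /\ ps c p = (fst q, sg * snd q)).
  { intros q Hq. apply convex_hull_ellipse in Hq; auto. apply (filled_onto s1 s2 tau c H1 H2 Stau Per Hc Bd'). now rewrite Fsg. }
  (* Inside, a critical point would be a double preimage and is excluded by the divided difference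
     on the diagonal; on the circle the derivative is nonzero by the Hopf lemma. *)
  assert (HD : forall z, cd z -> ps (dc c) z <> 0).
  { intros z Hz. destruct (Rle_lt_or_eq_dec _ _ Hz) as [Lz|Ez].
    - rewrite <- divdiff_diag by auto. now apply (filled_divdiff_nz s1 s2 tau c H1 H2 Stau Per Hc Bd' Ins').
    - apply circle_Cmod, circle_cis in Ez. destruct Ez as [t ->]. apply Nz. }
  assert (Maps : forall p, closed_disk p -> convex_hull (ellipse s1 s2) (Phi p)).
  { intros p Hp. apply closed_disk_cd in Hp. apply convex_hull_ellipse; auto. rewrite <- Fsg, <- EP by auto.
    now apply (filled_le s1 s2 tau c H1 H2 Bd' Ins'). }
  split; [apply HF|split; auto]. exists (inverse c sg).
  assert (Spec := inverse_spec (convex_hull (ellipse s1 s2)) c sg Onto).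
  split; [now apply inverse_smooth|split; [|split]].
  - intros q Hq. apply closed_disk_cd. now apply Spec.
  - intros p Hp. destruct (Spec _ (Maps p Hp)) as [A B]. apply closed_disk_cd in Hp.
    rewrite <- EP in B by auto. now apply Inj.
  - intros q Hq. destruct (Spec q Hq) as [A B]. rewrite EP in B by auto. injection B as B1 B2.
    apply C_eq; auto. transitivity (sg * sg * snd (Phi (inverse c sg q))); [rewrite Esg; ring|].
    rewrite Rmult_assoc, B2, <- Rmult_assoc, Esg. ring.
Qed.
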